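(* The solution to $$\frac{\partial^{4/3}u}{\partial t^{4/3}}=-\frac{1}{2^2}\frac{\partial^4u}{\partial x^4},\qquad x\in\mathbb{R},\ t>0,$$ with $u(x,0)=\delta(x)$ and $u_t(x,0)=0$, has the form $$u_{4/3}(x,t)=\frac{3}{2^{3/2}\sqrt[3]{3t}}\left[e^{i\frac{\pi}{4}}Ai\left(\sqrt2\frac{|x|e^{i\frac{\pi}{4}}}{\sqrt[3]{3t}}\right)+e^{-i\frac{\pi}{4}}Ai\left(\sqrt2\frac{|x|e^{-i\frac{\pi}{4}}}{\sqrt[3]{3t}}\right)\right],$$ where $Ai$ is the Airy function.
   Context: The Airy function is $$Ai(x)=\frac1\pi\int_0^\infty\cos\left(\alpha x+\frac{\alpha^3}{3}\right)d\alpha=\frac{\sqrt x}{3}\left[I_{-\frac13}\left(\frac23x^{3/2}\right)-I_{\frac13}\left(\frac23x^{3/2}\right)\right]$$ (the second formula for $x>0$, $I_{\pm1/3}$ being modified Bessel functions of the first kind), extended to complex arguments as an entire function. The fractional time derivative is in the sense of Dzhrbashyan–Caputo: for $1<\alpha<2$, $$\frac{\partial^\alpha u}{\partial t^\alpha}(x,t)=\frac{1}{\Gamma(2-\alpha)}\int_0^t\frac{\frac{\partial^2u}{\partial t^2}(x,s)}{(t-s)^{\alpha-1}}\,ds.$$ $\delta$ is the Dirac delta; the problem and its initial data are understood in the sense of tempered distributions in $x$. *)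

(* Defs.v *)
From HB Require Import structures.
From mathcomp Require Import all_boot all_order all_algebra.
From mathcomp Require Import complex.
From mathcomp Require Import all_classical all_reals all_analysis.

Set Implicit Arguments.
Unset Strict Implicit.
Unset Printing Implicit Defensive.

Import Order.TTheory GRing.Theory Num.Theory.
Import numFieldNormedType.Exports.

Local Open Scope classical_set_scope.
Local Open Scope ring_scope.
Local Open Scope complex_scope.

Section ComplexValuedCalculus.
Context {R : realType}.
Implicit Types (f : R -> R[i]) (D : set R).

(* MathComp-Analysis has no normed R-module structure on R[i]; differentiation
   and integration of functions R -> R[i] are therefore componentwise. *)

Definition cderivable f (x : R) : Prop :=
  derivable (fun y => complex.Re (f y)) x 1 /\
  derivable (fun y => complex.Im (f y)) x 1.

Definition cderive f : R -> R[i] := fun x =>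
  derive1 (fun y => complex.Re (f y)) x +i*
  derive1 (fun y => complex.Im (f y)) x.

Definition cderiven (n : nat) f : R -> R[i] := iter n cderive f.

Definition cintegrable D f : Prop :=
  (@lebesgue_measure R).-integrable D (fun x => (complex.Re (f x))%:E) /\
  (@lebesgue_measure R).-integrable D (fun x => (complex.Im (f x))%:E).

Definition cintegral D f : R[i] :=
  (\int[@lebesgue_measure R]_(x in D) complex.Re (f x)) +i*
  (\int[@lebesgue_measure R]_(x in D) complex.Im (f x)).

Definition cis (theta : R) : R[i] := cos theta +i* sin theta.

End ComplexValuedCalculus.

Section TemperedDistributions.
Context {R : realType}.
Implicit Types (phi psi : R -> R[i]) (T : (R -> R[i]) -> R[i]).

Definition schwartz_term (m n : nat) phi (x : R) : R :=
  `|x| ^+ m * ComplexField.Normc.normc (cderiven n phi x).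

Definition schwartz phi : Prop :=
  (forall n x, cderivable (cderiven n phi) x) /\
  (forall m n, exists M : R, forall x, schwartz_term m n phi x <= M).

Definition schwartz_seminorm (m n : nat) phi : R :=
  sup (range (schwartz_term m n phi)).

(* A tempered distribution is given by a functional on all functions R -> R[i];
   only its values on Schwartz functions are meaningful. *)
Definition tempered_distribution T : Prop :=
  (forall (a : R[i]) phi psi, schwartz phi -> schwartz psi ->
     T (fun x => a * phi x + psi x) = a * T phi + T psi) /\
  (exists (K : R) (N : nat), forall phi, schwartz phi ->
     ComplexField.Normc.normc (T phi) <=
       K * \sum_(m < N.+1) \sum_(n < N.+1) schwartz_seminorm m n phi).

Definition dirac_distribution phi : R[i] := phi 0.

Definition distribution_derive (n : nat) T phi : R[i] :=
  (-1) ^+ n * T (cderiven n phi).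

Definition represented_by T (g : R -> R[i]) : Prop :=
  forall phi, schwartz phi ->
    cintegrable [set: R] (fun x => g x * phi x) /\
    T phi = cintegral [set: R] (fun x => g x * phi x).

End TemperedDistributions.

Section FractionalCauchyProblem.
Context {R : realType}.

Definition Gamma (a : R) : R :=
  \int[@lebesgue_measure R]_(x in `]0, +oo[) (x `^ (a - 1) * expR (- x)).

(* The Dzhrbashyan-Caputo derivative, for orders 1 < alpha < 2. *)
Definition caputo_integrand (alpha : R) (f : R -> R[i]) (t s : R) : R[i] :=
  cderiven 2 f s / ((t - s) `^ (alpha - 1))%:C.

Definition caputo (alpha : R) (f : R -> R[i]) (t : R) : R[i] :=
  ((Gamma (2 - alpha))^-1)%:C * cintegral `]0, t[ (caputo_integrand alpha f t).

(* d^alpha u/dt^alpha = - (1/2^2) d^4 u/dx^4 on R x ]0, +oo[, with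
   u(., 0) = delta and u_t(., 0) = 0, in the sense of tempered distributions
   in x: u t is the distribution u(., t), every time derivative is tested
   against Schwartz functions, and the initial data are limits at 0^'+. *)
Definition fractional_rod_solution (alpha : R)
    (u : R -> (R -> R[i]) -> R[i]) : Prop :=
  (forall t, 0 < t -> tempered_distribution (u t)) /\
  forall phi, schwartz phi ->
    let f := fun t : R => u t phi in
    [/\ forall t, 0 < t ->
          [/\ cderivable f t, cderivable (cderive f) t
            & {for t, continuous (cderiven 2 f : R -> R[i]^o)}],
        forall t, 0 < t -> cintegrable `]0, t[ (caputo_integrand alpha f t),
        forall t, 0 < t ->
          caputo alpha f t =
          - (1 / 2 ^+ 2) * distribution_derive 4 (u t) phi,
        (f : R -> R[i]^o) t @[t --> 0^'+] -->
          (dirac_distribution phi : R[i]^o)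
      & (cderive f : R -> R[i]^o) t @[t --> 0^'+] --> (0 : R[i]^o)].

End FractionalCauchyProblem.

Section AiryFunction.
Context {R : realType}.

Definition airy_real (x : R) : R :=
  pi^-1 * lim ((\int[@lebesgue_measure R]_(a in `[0, A])
                  cos (a * x + a ^+ 3 / 3)) @[A --> +oo]).

Definition entire (f : R[i] -> R[i]) : Prop :=
  forall z : R[i], derivable (f : R[i]^o -> R[i]^o) z 1.

(* The entire function extending airy_real, selected by description. *)
Definition Ai : R[i] -> R[i] :=
  xget (fun=> 0) [set f | entire f /\ forall x : R, f x%:C = (airy_real x)%:C].

Definition u43 (x t : R) : R[i] :=
  let r := (3 * t) `^ 3^-1 in
  (3 / (2 `^ (3 / 2) * r))%:C *
  (cis (pi / 4) * Ai ((Num.sqrt 2)%:C * (`|x|%:C * cis (pi / 4)) / r%:C) +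
   cis (- (pi / 4)) *
     Ai ((Num.sqrt 2)%:C * (`|x|%:C * cis (- (pi / 4))) / r%:C)).

End AiryFunction.

(* Main.v *)
From HB Require Import structures.
Require Import Defs.
From mathcomp Require Import all_boot all_order all_algebra.
From mathcomp Require Import complex.
From mathcomp Require Import all_classical all_reals all_analysis.
From mathcomp Require Import measurable_realfun.
From mathcomp Require Import ring lra.
Set Implicit Arguments.
Unset Strict Implicit.
Unset Printing Implicit Defensive.
Import Order.TTheory GRing.Theory Num.Theory.
Import numFieldNormedType.Exports.
Local Open Scope classical_set_scope.
Local Open Scope ring_scope.

(** Let phi be a Schwartz function, [w = 1 + i], [r = (3 t)^(1/3)], and let
    [A y = Re (w Ai (w y))]. The proposed solution is the real kernel
    [(3 / (2 r)) A (|x| / r)], so its pairing with phi is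
    [(3/2) \int_0^oo A(y) (phi(r y) + phi(- r y)) dy] ([u43E], [u43_pairing]).
    Everything about it follows from three facts on A.

    - The function [Ai] chosen by description is the contour integral
      [airyD 0] along two rays of the sector where [e^{i a^3/3}] decays:
      that integral is entire, it agrees with [airy_real] on the real line
      because the ray can be rotated onto the real axis, and an entire
      function is determined by its values on the real line ([Ai_airyD]).
    - [V y = w Ai (w y)] solves [V'' = w^3 y V] and decays on the half line
      faster than every exponential, since both rays may be moved upwards
      ([airyV_ode], [airyV_decay]).
    - The moments of V satisfy a three-term recursion from the differential
      equation; the zeroth one is computed from the Laplace transform of V,
      which solves a first order equation ([mom_rec], [mom0_value]).

    Existence. Since [A''] and its companion are tied by the equation, two
    integrations by parts give the first two time derivatives of the pairing
    ([sol_der], [sol1_der]). The Caputo equation at time t is then the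
    vanishing of a linear functional [defect t] of the test function. It kills
    every monomial: this is an identity between moments of V, Gamma values
    and the singular integrals [sing_moment]. By Taylor expansion it kills
    every function whose derivatives grow geometrically, and these, obtained
    by convolution with the square of the cosine transform of a bump, are
    dense in the Schwartz functions ([defect_sch]).

    Uniqueness. The difference W of two solutions has zero data. Inverting the
    Abel integral of order 1/3 turns the equation into
    [|W phi t| <= L \int_0^t sup |W phi^(4)|], and n iterations gain [1/n!]
    against 4n derivatives of phi ([pairing_iter]). A uniform-boundedness
    argument bounds [W phi^(8j) / j!] uniformly in j and in the time when the
    derivatives of phi grow geometrically ([pairing_equibounded]), so that
    W vanishes on such phi, hence, by density and continuity, everywhere
    ([null_solution_eq0]).

    A Schwartz function is handled through the sequences of derivatives of its
    real and imaginary parts: a function is carried by [F : nat -> R -> R],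
    where [F n] is its n-th derivative ([dseq], [sch]). *)

Notation Lint D f := (lebesgue_measure.-integrable D (EFin \o f)).
Notation Lmeas D := (measurable (D : set (measurableTypeR _))).
Notation Lmfun D f := (@measurable_fun _ _ (measurableTypeR _) _ D f).
Notation halfline := (`[0, +oo[%classic).

(** * Real calculus: mean value and Taylor bounds *)

Section RealCalculus.
Context {R : realType}.
Implicit Types (f g : R -> R) (D : set R) (x a b : R).

Lemma derive_cont f x (l : R) : is_derive x (1 : R) f l -> {for x, continuous f}.
Proof.
move=> df; apply: differentiable_continuous; apply/derivable1_diffP.
exact: (@ex_derive _ _ _ _ _ _ _ df).
Qed.

Lemma derive_contT (f f' : R -> R) : (forall x : R, is_derive x (1 : R) f (f' x)) -> continuous f.
Proof. by move=> df x; apply: derive_cont (df x). Qed.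

Lemma derive_within (f f' : R -> R) D :
  (forall x : R, D x -> is_derive x (1 : R) f (f' x)) -> {within D, continuous f}.
Proof.
move=> df; apply: continuous_in_subspaceT => x /set_mem Dx.
exact: derive_cont (df x Dx).
Qed.

(** Comparison of increments: both g - f and g + f have a nonnegative
    derivative. *)
Lemma mvt_le (f f' g g' : R -> R) a b : a <= b ->
  (forall x : R, a <= x <= b -> is_derive x (1 : R) f (f' x)) ->
  (forall x : R, a <= x <= b -> is_derive x (1 : R) g (g' x)) ->
  (forall x : R, a <= x <= b -> `|f' x| <= g' x) -> `|f b - f a| <= g b - g a.
Proof.
move=> ab df dg fg.
have key (h h' : R -> R) : (forall x : R, a <= x <= b -> is_derive x (1 : R) h (h' x)) ->
    (forall x : R, a <= x <= b -> 0 <= h' x) -> h a <= h b.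
  move=> dh h0; apply: (@ger0_derive1_ndecr R h a b) => //.
  - move=> x; rewrite in_itv/= => /andP[/ltW ax /ltW xb].
    have Hx : a <= x <= b by rewrite ax xb.
    exact: (@ex_derive _ _ _ _ _ _ _ (dh x Hx)).
  - move=> x; rewrite in_itv/= => /andP[/ltW ax /ltW xb].
    have Hx : a <= x <= b by rewrite ax xb.
    by rewrite derive1E (@derive_val _ _ _ _ _ _ _ (dh x Hx)) h0.
  - by apply: (@derive_within _ h') => x; rewrite /= in_itv/=; exact: dh.
have H1 : g a + f a <= g b + f b.
  apply: (key (fun x => g x + f x) (fun x => g' x + f' x)) => x Hx.
    exact: is_deriveD (dg x Hx) (df x Hx).
  by have := fg _ Hx; rewrite ler_norml => /andP[]; lra.
have H2 : g a - f a <= g b - f b.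
  apply: (key (fun x => g x - f x) (fun x => g' x - f' x)) => x Hx.
    exact: is_deriveB (dg x Hx) (df x Hx).
  by have := fg _ Hx; rewrite ler_norml => /andP[]; lra.
by rewrite ler_norml; apply/andP; split; lra.
Qed.

Lemma lipschitz_le (f f' : R -> R) a b (M : R) :
  (forall x : R, Num.min a b <= x <= Num.max a b -> is_derive x (1 : R) f (f' x)) ->
  (forall x : R, Num.min a b <= x <= Num.max a b -> `|f' x| <= M) ->
  `|f b - f a| <= M * `|b - a|.
Proof.
have dM (x : R) : is_derive x (1 : R) ( *%R M) M.
  by have := @is_deriveZ _ _ _ id M x 1 1 (is_derive_id _ _); rewrite /GRing.scale/= mulr1.
case: (leP a b) => ab df fM.
  rewrite (@ger0_norm _ (b - a)) ?subr_ge0// mulrBr; apply: (@mvt_le f f' _ (fun=> M)) => //.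
rewrite distrC (distrC b) (@ger0_norm _ (a - b)) ?subr_ge0 ?(ltW ab)// mulrBr; apply: (@mvt_le f f' _ (fun=> M)) => //; exact: ltW.
Qed.

(** The remainder is bounded through the second derivative; the constant is not
    optimal, which is harmless since only the order matters below. *)
Lemma taylor2 (f f' f'' : R -> R) a b (M : R) :
  (forall x : R, Num.min a b <= x <= Num.max a b -> is_derive x (1 : R) f (f' x)) ->
  (forall x : R, Num.min a b <= x <= Num.max a b -> is_derive x (1 : R) f' (f'' x)) ->
  (forall x : R, Num.min a b <= x <= Num.max a b -> `|f'' x| <= M) ->
  `|f b - f a - (b - a) * f' a| <= M * (b - a) ^+ 2.
Proof.
move=> df df' M''.
have H := @lipschitz_le (fun x => f x - x * f' a) (fun x => f' x - f' a) a b
  (M * `|b - a|).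
have -> : f b - f a - (b - a) * f' a = f b - b * f' a - (f a - a * f' a) by ring.
rewrite -normr_id -[X in _ <= _ * X]real_normK ?num_real// expr2 mulrA normr_id.
apply: H => x Hx.
  apply: is_deriveB; first exact: df.
  have := @is_deriveM _ _ id (cst (f' a)) x 1 1 0 (is_derive_id _ _) (is_derive_cst _ _ _).
  by rewrite /GRing.scale/= mulr0 add0r mulr1.
have ax : Num.min a x >= Num.min a b /\ Num.max a x <= Num.max a b.
  by move: Hx; case: (leP a b); case: (leP a x); lra.
have M0 : 0 <= M by apply: le_trans (M'' _ Hx).
apply: le_trans (_ : M * `|x - a| <= _).
  apply: (@lipschitz_le f' f'') => y Hy; [apply: df'|apply: M''];
   move: Hy ax => /andP[? ?] [? ?]; apply/andP; split; lra.
apply: ler_wpM2l => //.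
move: Hx; case: (leP a b) => ab Hx.
  by rewrite !ger0_norm; lra.
by rewrite !ler0_norm; lra.
Qed.

(** A quadratic error bound is how most derivatives are obtained: it passes
    under integrals and through limits without any dominated convergence. *)
Lemma is_derive_quad f x (l C d : R) : 0 < d ->
  (forall h, `|h| < d -> `|f (x + h) - f x - h * l| <= C * h ^+ 2) ->
  is_derive x (1 : R) f l.
Proof.
move=> d0 H.
suff cf : h^-1 *: ((f \o shift x) (h *: 1) - f x) @[h --> 0^'] --> l.
  by apply: DeriveDef; [apply/cvg_ex; exists l|exact/cvg_lim].
apply/cvgrPdist_le => e e0; near=> h.
have h0 : h != 0 by near: h; exact: nbhs_dnbhs_neq.
have hd : `|h| < d.
  near: h; apply: (@nbhs_dnbhs _ 0); exact: (@nbhs0_lt _ R).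
rewrite /= /GRing.scale/= mulr1 (addrC h).
rewrite -(mulKf h0 l) -mulrBr normrM normfV distrC.
rewrite ler_pdivrMl ?normr_gt0// mulrC.
rewrite (mulrC l); apply: le_trans (H _ hd) _.
have -> : h ^+ 2 = `|h| * `|h| by rewrite -normrM -expr2 ger0_norm ?sqr_ge0.
rewrite mulrA [X in _ <= X]mulrC; apply: ler_wpM2r => //.
have : `|h| <= e / (`|C| + 1).
  near: h; apply: (@nbhs_dnbhs _ 0); apply: (@nbhs0_le _ R).
  by rewrite divr_gt0// ltr_wpDl.
rewrite ler_pdivlMr; last by rewrite ltr_wpDl.
move=> he; apply: le_trans _ he.
rewrite mulrC; apply: ler_wpM2l => //.
by apply: le_trans (ler_norm C) _; rewrite lerDl.
Unshelve. all: by end_near. Qed.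

End RealCalculus.

(** * Lebesgue integrals on the line and the half line *)

Section RealIntegral.
Context {R : realType}.
Notation mu := (@lebesgue_measure R).
Implicit Types (f g : R -> R) (D : set R) (x a b : R).

Lemma measurable_halfline : Lmeas (halfline : set R).
Proof. exact: measurable_itv. Qed.
Hint Resolve measurable_halfline : core.

Lemma Lint_le D f g : Lmeas D -> Lmfun D f -> Lint D g ->
  (forall x, D x -> `|f x| <= g x) -> Lint D f.
Proof.
move=> mD mf ig fg; apply: (le_integrable mD _ _ ig).
  exact/measurable_EFinP.
move=> x Dx; rewrite /= lee_fin; apply: le_trans (fg x Dx) _; exact: ler_norm.
Qed.

Lemma cont_meas D f : Lmeas D -> continuous f -> Lmfun D f.
Proof.
move=> mD cf; exact: (measurable_funS measurableT (@subsetT _ D) (continuous_measurable_fun cf)).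
Qed.

Lemma LintD D f g : Lmeas D -> Lint D f -> Lint D g ->
  Lint D (fun x => f x + g x).
Proof. by move=> mD i1 i2; exact: (integrableD mD i1 i2). Qed.

Lemma LintZ D f (c : R) : Lmeas D -> Lint D f -> Lint D (fun x => c * f x).
Proof. by move=> mD i1; exact: (integrableZl mD c i1). Qed.

Lemma LintB D f g : Lmeas D -> Lint D f -> Lint D g ->
  Lint D (fun x => f x - g x).
Proof. by move=> mD i1 i2; exact: (integrableB mD i1 i2). Qed.

Lemma Lint_eq D f g : Lmeas D -> (forall x, D x -> f x = g x) ->
  Lint D f -> Lint D g.
Proof.
move=> mD fg; apply: eq_integrable => // x /set_mem Dx /=; congr EFin; exact: fg.
Qed.

Lemma int_eq D f g : (forall x, D x -> f x = g x) ->
  \int[mu]_(x in D) f x = \int[mu]_(x in D) g x.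
Proof. by move=> fg; apply: eq_Rintegral => x /set_mem; exact: fg. Qed.

Lemma Lint_meas D f : Lint D f -> Lmfun D f.
Proof. by move=> If; apply/measurable_EFinP; exact: (measurable_int _ If). Qed.

Lemma Lint_norm D f : Lmeas D -> Lint D f -> Lint D (fun x => `|f x|).
Proof. by move=> mD If; exact: (integrable_norm If). Qed.

Lemma norm_int_le D f g : Lmeas D -> Lint D f -> Lint D g ->
  (forall x, D x -> `|f x| <= g x) ->
  `|\int[mu]_(x in D) f x| <= \int[mu]_(x in D) g x.
Proof.
move=> mD i1 i2 fg; apply: le_trans (le_normr_Rintegral mD i1) _.
apply: le_Rintegral => //.
exact: Lint_norm.
Qed.

(** Differentiation under the integral sign, with a uniform integrable bound on
    the derivative. *)
Lemma derive_int D (f f' : R -> R -> R) (u v a : R) (G : R -> R) :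
  Lmeas D -> u < a < v ->
  (forall x, u < x < v -> Lint D (f x)) ->
  (forall x y, u < x < v -> D y -> is_derive x (1 : R) (f^~ y) (f' x y)) ->
  Lint D G -> (forall x y, u < x < v -> D y -> `|f' x y| <= G y) ->
  is_derive a (1 : R) (fun x => \int[mu]_(y in D) f x y)
    (\int[mu]_(y in D) f' a y).
Proof.
move=> mD auv If df IG fG.
have Ia : (`]u, v[%classic : set R) a by rewrite /= in_itv.
have I1 x : (`]u, v[%classic : set R) x -> Lint D (f x).
  by rewrite /= in_itv/=; exact: If.
have I2 x y : (`]u, v[%classic : set R) x -> D y -> derivable (f^~ y) x 1.
  rewrite /= in_itv/= => h1 h2; exact: (@ex_derive _ _ _ _ _ _ _ (df x y h1 h2)).
have I3 x y : (`]u, v[%classic : set R) x -> D y ->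
    `|partial1of2 f x y| <= `|G y|.
  rewrite /= in_itv/= => h1 h2.
  rewrite partial1of2E (@derive_val _ _ _ _ _ _ _ (df x y h1 h2)).
  by apply: le_trans (fG _ _ h1 h2) (ler_norm _).
have IG' : Lint D (fun y => `|G y|).
  exact: Lint_norm.
apply: DeriveDef.
  exact: (@derivable_under_integral R _ _ mu f D mD a u v Ia I1 I2
    (fun y => `|G y|) (fun y => normr_ge0 _) IG' I3).
rewrite -derive1E (@differentiation_under_integral R _ _ mu f D mD a u v Ia I1 I2
    (fun y => `|G y|) (fun y => normr_ge0 _) IG' I3).
apply: int_eq => y Dy; rewrite partial1of2E.
exact: (@derive_val _ _ _ _ _ _ _ (df a y auv Dy)).
Qed.

Lemma cvg_int_halfline f : Lint halfline f ->
  \int[mu]_(x in `[0, A]) f x @[A --> +oo] --> \int[mu]_(x in halfline) f x.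
Proof.
move=> If; apply/cvg_pinftyP => u u_oo.
have E n : \int[mu]_(x in `[0, u n]) f x =
    \int[mu]_(x in halfline) (f \_ `[0%R, u n]) x.
  rewrite -Rintegral_mkcondr; congr Rintegral.
  rewrite setIidr// => x /=; rewrite !in_itv/= andbT; by case/andP.
under eq_fun do rewrite E.
have mf := measurable_int _ If.
have H1 n : measurable_fun (halfline : set (measurableTypeR R))
    (fun x => ((f \_ `[0%R, u n]) x)%:E).
  apply/measurable_EFinP/(measurable_restrict f) => //.
  apply: measurable_funS (Lint_meas If) => //.
have H2 : {ae mu, forall x, halfline x ->
    ((f \_ `[0%R, u n]) x)%:E @[n --> \oo] --> (f x)%:E}.
  apply/aeW => x /=; rewrite in_itv/= andbT => x0.
  apply: cvg_near_cst; near=> n.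
  rewrite patchE ifT//; apply/mem_set; rewrite /= in_itv/= x0/=.
  by near: n; move/cvgryPge: u_oo; exact.
have H3 : {ae mu, forall x n, halfline x ->
    (`|((f \_ `[0%R, u n]) x)%:E| <= `|f x|%:E)%E}.
  apply/aeW => x n _ /=; rewrite lee_fin patchE; case: ifP => _ //.
  by rewrite normr0.
have [_ _ I3] := @dominated_convergence _ _ _ mu halfline measurable_halfline
  _ _ _ H1 mf H2 (Lint_norm measurable_halfline If) H3.
by apply/fine_cvg; rewrite fineK ?integrable_fin_num.
Unshelve. all: by end_near. Qed.

Lemma FTC_halfline f f' : (forall x, 0 <= x -> is_derive x (1 : R) f (f' x)) ->
  continuous f' -> Lint halfline f' -> f x @[x --> +oo] --> (0 : R) ->
  \int[mu]_(x in halfline) f' x = - f 0.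
Proof.
move=> df cf' If' f0.
apply: (cvg_unique (@norm_hausdorff _ R) (cvg_int_halfline If')).
have : f x - f 0 @[x --> +oo] --> 0 - f 0 by apply: cvgB => //; exact: cvg_cst.
rewrite sub0r => H; apply: cvg_trans H; apply: near_eq_cvg; near=> A.
have A0 : 0 < A by near: A; exact: nbhs_pinfty_gt.
rewrite /Rintegral (@continuous_FTC2 _ f' f 0 A) //.
- apply: continuous_in_subspaceT => x _; exact: cf'.
- have dfc x : 0 <= x -> {for x, continuous f}.
    by move=> x0; apply: derive_cont (df x x0).
  split.
  + move=> x; rewrite in_itv/= => /andP[/ltW x0 _].
    exact: (@ex_derive _ _ _ _ _ _ _ (df x x0)).
  + exact/cvg_at_right_filter/dfc.
  + exact/cvg_at_left_filter/dfc/ltW.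
- move=> x; rewrite in_itv/= => /andP[/ltW x0 _].
  by rewrite derive1E (@derive_val _ _ _ _ _ _ _ (df x x0)).
Unshelve. all: by end_near. Qed.

Lemma FTC_segment f f' a b : a <= b ->
  (forall x, a <= x <= b -> is_derive x (1 : R) f (f' x)) -> continuous f' ->
  \int[mu]_(x in `[a, b]) f' x = f b - f a.
Proof.
rewrite le_eqVlt => /predU1P[->|ab] df cf'.
  by rewrite set_itv1 Rintegral_set1 subrr.
rewrite /Rintegral (@continuous_FTC2 _ f' f a b) //.
- apply: continuous_in_subspaceT => x _; exact: cf'.
- have dfc x : a <= x <= b -> {for x, continuous f}.
    by move=> x0; apply: derive_cont (df x x0).
  split.
  + move=> x; rewrite in_itv/= => /andP[/ltW x0 /ltW x1].
    have Hx : a <= x <= b by rewrite x0 x1.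
    exact: (@ex_derive _ _ _ _ _ _ _ (df x Hx)).
  + by apply/cvg_at_right_filter/dfc; rewrite lexx ltW.
  + by apply/cvg_at_left_filter/dfc; rewrite lexx ltW.
- move=> x; rewrite in_itv/= => /andP[/ltW x0 /ltW x1].
  have Hx : a <= x <= b by rewrite x0 x1.
  by rewrite derive1E (@derive_val _ _ _ _ _ _ _ (df x Hx)).
Qed.

Lemma Lint_segment a b f : continuous f -> Lint `[a, b] f.
Proof.
move=> cf; apply: continuous_compact_integrable; first exact: segment_compact.
by apply: continuous_in_subspaceT => x _; exact: cf.
Qed.

Lemma is_derive_expRZ (c x : R) :
  is_derive x (1 : R) (fun y => expR (c * y)) (c * expR (c * x)).
Proof.
have H : is_derive x (1 : R) (fun y => c * y) c.
  by have := @is_deriveZ _ _ _ id c x 1 1 (is_derive_id _ _); rewrite /GRing.scale/= mulr1.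
have := @is_derive1_comp R expR (fun y => c * y) x _ _ (is_derive_expR _) H.
by rewrite mulrC.
Qed.

Lemma Lint_expR (c : R) : 0 < c -> Lint halfline (fun x => expR (- c * x)).
Proof.
move=> c0.
have dF x : is_derive x (1 : R) (fun x => - c^-1 * expR (- c * x)) (expR (- c * x)).
  have := @is_deriveZ _ _ _ _ (- c^-1) x 1 _ (is_derive_expRZ (- c) x).
  by rewrite /GRing.scale/= mulrA mulrNN mulVf ?gt_eqF// mul1r.
apply/integrableP; split.
  apply/measurable_EFinP; apply: cont_meas => //.
  exact: (@derive_contT _ _ (fun x => - c * expR (- c * x)) (is_derive_expRZ _)).
have -> : (\int[mu]_(x in halfline) `|(EFin \o (fun x => expR (- c * x))) x| =
  \int[mu]_(x in `[0%R, +oo[) (expR (- c * x))%:E)%E.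
  by apply: eq_integral => x _ /=; rewrite ger0_norm// expR_ge0.
rewrite (@ge0_continuous_FTC2y R _ (fun x => - c^-1 * expR (- c * x)) 0 0).
- by rewrite -EFinB ltry.
- by move=> x _; exact: expR_ge0.
- apply: continuous_in_subspaceT => x _.
  exact: (@derive_contT _ _ (fun x => - c * expR (- c * x)) (is_derive_expRZ _)).
- rewrite -(mulr0 (- c^-1)); apply: cvgM; first exact: cvg_cst.
  under eq_fun do rewrite mulNr.
  apply: (@cvg_comp _ _ _ (fun x => c * x) (fun x => expR (- x))) (@cvgr_expR R).
  by apply: gt0_cvgMry => //; exact: cvg_id.
- move=> x _; exact: (@ex_derive _ _ _ _ _ _ _ (dF x)).
- by apply/cvg_at_right_filter; exact: (derive_cont (dF 0)).
- move=> x _.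
  by rewrite derive1E (@derive_val _ _ _ _ _ _ _ (dF x)).
Qed.

Lemma Lint_expR_dom f (C : R) : Lmfun halfline f ->
  (forall x, 0 <= x -> `|f x| <= C * expR (- x)) -> Lint halfline f.
Proof.
move=> mf H; apply: (Lint_le _ mf (g := fun x => C * expR (- 1 * x))) => //.
- by apply: LintZ => //; exact: Lint_expR.
- by move=> x; rewrite /= in_itv/= andbT mulN1r; exact: H.
Qed.

(** A cubic decay absorbs polynomial factors and quadratic exponents, leaving a
    simple exponential as common dominating function of the Airy integrands. *)
Lemma cubic_decay (A e : R) (m : nat) : 0 < e -> exists C : R, 0 <= C /\
  forall s, 0 <= s ->
    (1 + s) ^+ m * expR (A * (1 + s + s ^+ 2) - e * s ^+ 3) <= C * expR (- s).
Proof.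
move=> e0; pose B := `|A| + 2; pose S := 3 * B / e + 1.
have B0 : 2 <= B by rewrite lerDr.
have S1 : 1 <= S by rewrite lerDr divr_ge0// ?mulr_ge0//; lra.
pose K := B * (1 + S + S ^+ 2).
exists (m`!%:R * expR K); split; first by rewrite mulr_ge0// expR_ge0.
move=> s s0.
have H1 : (1 + s) ^+ m <= m`!%:R * expR (1 + s).
  case: m => [|m].
    by rewrite expr0 mul1r; have := expR_ge1Dx (1 + s); lra.
  rewrite mulrC -ler_pdivrMr ?ltr0n ?fact_gt0//.
  have := @expR_ge1Dxn R (1 + s) m; lra.
have H2 : A * (1 + s + s ^+ 2) - e * s ^+ 3 + (1 + s) <= K - s.
  have s2 : 0 <= s ^+ 2 by exact: sqr_ge0.
  have AB : A * (1 + s + s ^+ 2) <= (B - 2) * (1 + s + s ^+ 2).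
    by rewrite ler_wpM2r /B ?addrK ?ler_norm//; lra.
  suff : B * (1 + s + s ^+ 2) - e * s ^+ 3 <= K by lra.
  have e3 : 0 <= e * s ^+ 3 by rewrite mulr_ge0 ?exprn_ge0// ltW.
  case: (leP s S) => sS.
    have : B * (1 + s + s ^+ 2) <= K.
      rewrite /K ler_wpM2l//; first lra.
      have : s ^+ 2 <= S ^+ 2 by rewrite ler_pXn2r// nnegrE; lra.
      lra.
    lra.
  have eS : 3 * B <= e * s.
    have : e * S = 3 * B + e by rewrite /S mulrDr mulrCA mulfV ?gt_eqF// !mulr1.
    have : e * S <= e * s by rewrite ler_wpM2l// ltW.
    lra.
  have H3 : 3 * B * s ^+ 2 <= e * s ^+ 3.
    have -> : e * s ^+ 3 = e * s * s ^+ 2 by ring.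
    exact: ler_wpM2r.
  have K0 : 0 <= K.
    by rewrite /K mulr_ge0//; have := sqr_ge0 S; lra.
  have s1 : s <= s ^+ 2 by rewrite expr2 ler_peMl//; lra.
  have H4 : B * (1 + s + s ^+ 2) <= B * (3 * s ^+ 2) by rewrite ler_wpM2l//; lra.
  lra.
apply: le_trans (ler_wpM2r (expR_ge0 _) H1) _.
by rewrite -!mulrA -!expRD ler_wpM2l// ler_expR; lra.
Qed.

End RealIntegral.

Notation cRe := complex.Re.
Notation cIm := complex.Im.
Notation nc := ComplexField.Normc.normc.
Local Open Scope complex_scope.

(** * Complex functions of a real variable *)

Section ComplexCalculus.
Context {R : realType}.
Notation mu := (@lebesgue_measure R).
Implicit Types (x y : R) (z w : R[i]) (f g : R -> R[i]) (D : set R).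

Lemma cReM z w : cRe (z * w) = cRe z * cRe w - cIm z * cIm w.
Proof. by case: z w => [a b] [c d]. Qed.

Lemma cImM z w : cIm (z * w) = cRe z * cIm w + cIm z * cRe w.
Proof. by case: z w => [a b] [c d]. Qed.

Lemma cReD z w : cRe (z + w) = cRe z + cRe w.
Proof. by case: z w => [a b] [c d]. Qed.

Lemma cImD z w : cIm (z + w) = cIm z + cIm w.
Proof. by case: z w => [a b] [c d]. Qed.

Lemma cReN z : cRe (- z) = - cRe z.
Proof. by case: z. Qed.

Lemma cImN z : cIm (- z) = - cIm z.
Proof. by case: z. Qed.

Lemma c_ext z w : cRe z = cRe w -> cIm z = cIm w -> z = w.
Proof. by case: z w => [a b] [c d] /= -> ->. Qed.

Lemma ncM z w : nc (z * w) = nc z * nc w.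
Proof. exact: ComplexField.Normc.normcM. Qed.

Lemma ncD z w : nc (z + w) <= nc z + nc w.
Proof. exact: le_normcD. Qed.

Lemma ncN z : nc (- z) = nc z.
Proof. by case: z => a b /=; rewrite !sqrrN. Qed.

Lemma ncB z w : nc (z - w) <= nc z + nc w.
Proof. by rewrite -(ncN w); exact: ncD. Qed.

Lemma nc_ge0 z : 0 <= nc z.
Proof. by case: z => a b; exact: sqrtr_ge0. Qed.

Lemma ncX z n : nc (z ^+ n) = nc z ^+ n.
Proof.
by elim: n => [|n IH]; rewrite ?expr0 ?ComplexField.Normc.normc1// !exprS ncM IH.
Qed.

Lemma nc_real x : nc x%:C = `|x|.
Proof. by rewrite /= expr0n/= addr0 sqrtr_sqr. Qed.

Lemma nc_Re z : `|cRe z| <= nc z.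
Proof.
case: z => a b /=; rewrite -sqrtr_sqr ler_wsqrtr// lerDl; exact: sqr_ge0.
Qed.

Lemma nc_Im z : `|cIm z| <= nc z.
Proof.
case: z => a b /=; rewrite -sqrtr_sqr ler_wsqrtr// lerDr; exact: sqr_ge0.
Qed.

Lemma nc_le z : nc z <= `|cRe z| + `|cIm z|.
Proof.
case: z => a b /=; rewrite -[leRHS]ger0_norm ?addr_ge0// -sqrtr_sqr ler_wsqrtr//.
rewrite sqrrD !real_normK ?num_real// lerD2r lerDl.
by rewrite mulrn_wge0// mulr_ge0.
Qed.

Definition cder f x z : Prop :=
  is_derive x (1 : R) (fun y => cRe (f y)) (cRe z) /\
  is_derive x (1 : R) (fun y => cIm (f y)) (cIm z).

Lemma cder_eq f x z w : z = w -> cder f x z -> cder f x w.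
Proof. by move->. Qed.

Lemma cder_cst z x : cder (fun=> z) x 0.
Proof. by split => /=; exact: is_derive_cst. Qed.

Lemma cderD f g x z w : cder f x z -> cder g x w ->
  cder (fun y => f y + g y) x (z + w).
Proof.
move=> [f1 f2] [g1 g2]; split.
  rewrite cReD (_ : (fun y => _) = (fun y => cRe (f y) + cRe (g y))).
    exact: is_deriveD.
  by apply/funext => y; rewrite cReD.
rewrite cImD (_ : (fun y => _) = (fun y => cIm (f y) + cIm (g y))).
  exact: is_deriveD.
by apply/funext => y; rewrite cImD.
Qed.

Lemma cderN f x z : cder f x z -> cder (fun y => - f y) x (- z).
Proof.
move=> [f1 f2]; split.
  rewrite cReN (_ : (fun y => _) = (fun y => - cRe (f y))).
    exact: is_deriveN.
  by apply/funext => y; rewrite cReN.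
rewrite cImN (_ : (fun y => _) = (fun y => - cIm (f y))).
  exact: is_deriveN.
by apply/funext => y; rewrite cImN.
Qed.

Lemma cderB f g x z w : cder f x z -> cder g x w ->
  cder (fun y => f y - g y) x (z - w).
Proof. by move=> fz gw; apply: cderD => //; exact: cderN. Qed.

Lemma cderM f g x z w : cder f x z -> cder g x w ->
  cder (fun y => f y * g y) x (z * g x + f x * w).
Proof.
move=> [f1 f2] [g1 g2]; split.
  rewrite (_ : (fun y => _) = (fun y => cRe (f y) * cRe (g y) - cIm (f y) * cIm (g y))).
    apply: is_derive_eq; rewrite cReD !cReM /GRing.scale/=; ring.
  by apply/funext => y; rewrite cReM.
rewrite (_ : (fun y => _) = (fun y => cRe (f y) * cIm (g y) + cIm (f y) * cRe (g y))).
  apply: is_derive_eq; rewrite cImD !cImM /GRing.scale/=; ring.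
by apply/funext => y; rewrite cImM.
Qed.

Lemma cderZ c f x z : cder f x z -> cder (fun y => c * f y) x (c * z).
Proof.
by move=> fz; apply: cder_eq (cderM (cder_cst c x) fz); rewrite mul0r add0r.
Qed.

Lemma cder_real (f : R -> R) x (l : R) : is_derive x (1 : R) f l ->
  cder (fun y => (f y)%:C) x l%:C.
Proof. by move=> df; split => //=; exact: is_derive_cst. Qed.

Lemma cder_id x : cder (fun y => y%:C) x 1.
Proof. exact: (@cder_real id x 1 (is_derive_id _ _)). Qed.

Definition cexp z : R[i] := (expR (cRe z))%:C * cis (cIm z).

Lemma cexpE z : cexp z = (expR (cRe z) * cos (cIm z)) +i* (expR (cRe z) * sin (cIm z)).
Proof. by rewrite /cexp /cis; simpc. Qed.

Lemma cexp0 : cexp 0 = 1.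
Proof. by rewrite cexpE /= expR0 cos0 sin0 mulr0 mulr1. Qed.

Lemma cexpD z w : cexp (z + w) = cexp z * cexp w.
Proof.
by rewrite !cexpE cReD cImD expRD cosD sinD; apply: c_ext => /=; ring.
Qed.

Lemma nc_cexp z : nc (cexp z) = expR (cRe z).
Proof.
by rewrite cexpE /= !exprMn -mulrDr cos2Dsin2 mulr1 sqrtr_sqr ger0_norm// expR_ge0.
Qed.

Lemma cder_cexp f x z : cder f x z -> cder (fun y => cexp (f y)) x (z * cexp (f x)).
Proof.
move=> [f1 f2].
have e1 := @is_derive1_comp R expR _ x _ _ (is_derive_expR _) f1.
have c1 := @is_derive1_comp R cos _ x _ _ (is_derive_cos _) f2.
have s1 := @is_derive1_comp R sin _ x _ _ (is_derive_sin _) f2.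
split.
  rewrite (_ : (fun y => _) = (fun y => expR (cRe (f y)) * cos (cIm (f y)))).
    apply: (is_derive_eq (is_deriveM e1 c1)).
    rewrite cexpE cReM /GRing.scale/=; ring.
  by apply/funext => y; rewrite cexpE.
rewrite (_ : (fun y => _) = (fun y => expR (cRe (f y)) * sin (cIm (f y)))).
  apply: (is_derive_eq (is_deriveM e1 s1)).
  rewrite cexpE cImM /GRing.scale/=; ring.
by apply/funext => y; rewrite cexpE.
Qed.

(** A holomorphic function with derivative g', through the chain rule along
    differentiable curves, which is the only way it is used here. *)
Definition hol (g g' : R[i] -> R[i]) : Prop :=
  forall (a : R -> R[i]) x l, cder a x l -> cder (fun y => g (a y)) x (l * g' (a x)).

Lemma hol_id : hol id (fun=> 1).
Proof. by move=> a x l; rewrite mulr1. Qed.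

Lemma hol_cst c : hol (fun=> c) (fun=> 0).
Proof. by move=> a x l _; rewrite mulr0; exact: cder_cst. Qed.

Lemma holD (g g' h h' : R[i] -> R[i]) : hol g g' -> hol h h' ->
  hol (fun z => g z + h z) (fun z => g' z + h' z).
Proof.
by move=> Hg Hh a x l da; rewrite mulrDr; exact: cderD (Hg _ _ _ da) (Hh _ _ _ da).
Qed.

Lemma holM (g g' h h' : R[i] -> R[i]) : hol g g' -> hol h h' ->
  hol (fun z => g z * h z) (fun z => g' z * h z + g z * h' z).
Proof.
move=> Hg Hh a x l da; apply: cder_eq (cderM (Hg _ _ _ da) (Hh _ _ _ da)); ring.
Qed.

Lemma holX n : hol (fun z => z ^+ n.+1) (fun z => n.+1%:R * z ^+ n).
Proof.
elim: n => [|n IH] a x l da.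
  by rewrite expr0 mulr1 mulr1; exact: da.
apply: cder_eq (cderM da (IH a x l da)); rewrite exprS (natrD _ 1 n.+1); ring.
Qed.

Lemma hol_cexp (g g' : R[i] -> R[i]) : hol g g' -> hol (fun z => cexp (g z)) (fun z => g' z * cexp (g z)).
Proof. by move=> Hg a x l da; rewrite mulrA; apply: cder_cexp; exact: Hg. Qed.

Lemma hol_eq (g h g' h' : R[i] -> R[i]) : hol g g' -> (forall z, g z = h z) ->
  (forall z, g' z = h' z) -> hol h h'.
Proof. by move=> Hg /funext <- /funext <-. Qed.

(** Componentwise, like every notion for functions from the reals to the complex
    numbers here. *)
Definition ccont f := continuous (fun y => cRe (f y)) /\ continuous (fun y => cIm (f y)).

Lemma cder_cont f f' : (forall x, cder f x (f' x)) -> ccont f.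
Proof.
move=> df; split.
  by apply: (@derive_contT _ _ (fun x => cRe (f' x))) => x; exact: (df x).1.
by apply: (@derive_contT _ _ (fun x => cIm (f' x))) => x; exact: (df x).2.
Qed.

Lemma Cint_dom D f (G : R -> R) : Lmeas D -> ccont f -> Lint D G ->
  (forall x, D x -> nc (f x) <= G x) -> cintegrable D f.
Proof.
move=> mD [c1 c2] IG fG; split.
  apply: (Lint_le mD (cont_meas mD c1) IG) => x Dx.
  exact: le_trans (nc_Re _) (fG x Dx).
apply: (Lint_le mD (cont_meas mD c2) IG) => x Dx.
exact: le_trans (nc_Im _) (fG x Dx).
Qed.

Lemma CintZ D c f : Lmeas D -> cintegrable D f -> cintegrable D (fun x => c * f x).
Proof.
move=> mD [f1 f2]; split.
  apply: (Lint_eq mD (f := fun x => cRe c * cRe (f x) - cIm c * cIm (f x))).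
    by move=> x _; rewrite cReM.
  by apply: LintB => //; apply: LintZ.
apply: (Lint_eq mD (f := fun x => cRe c * cIm (f x) + cIm c * cRe (f x))).
  by move=> x _; rewrite cImM.
by apply: LintD => //; apply: LintZ.
Qed.

Lemma cintZ D c f : Lmeas D -> cintegrable D f ->
  cintegral D (fun x => c * f x) = c * cintegral D f.
Proof.
move=> mD [f1 f2]; apply: c_ext; rewrite /cintegral /= ?cReM ?cImM /=.
  rewrite -!RintegralZl// -RintegralB//; [|exact: LintZ|exact: LintZ].
  by apply: int_eq => x _; rewrite cReM.
rewrite -!RintegralZl// -RintegralD//; [|exact: LintZ|exact: LintZ].
by apply: int_eq => x _; rewrite cImM.
Qed.

Lemma CintD D f g : Lmeas D -> cintegrable D f -> cintegrable D g ->
  cintegrable D (fun x => f x + g x).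
Proof.
move=> mD [f1 f2] [g1 g2]; split.
  apply: (Lint_eq mD (f := fun x => cRe (f x) + cRe (g x))).
    by move=> x _; rewrite cReD.
  exact: LintD.
apply: (Lint_eq mD (f := fun x => cIm (f x) + cIm (g x))).
  by move=> x _; rewrite cImD.
exact: LintD.
Qed.

Lemma cintD D f g : Lmeas D -> cintegrable D f -> cintegrable D g ->
  cintegral D (fun x => f x + g x) = cintegral D f + cintegral D g.
Proof.
move=> mD [f1 f2] [g1 g2]; apply: c_ext; rewrite /cintegral /=.
  by rewrite -RintegralD//; apply: int_eq => x _; rewrite cReD.
by rewrite -RintegralD//; apply: int_eq => x _; rewrite cImD.
Qed.

Lemma CintB D f g : Lmeas D -> cintegrable D f -> cintegrable D g ->
  cintegrable D (fun x => f x - g x).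
Proof.
move=> mD If Ig; apply: CintD => //.
have := CintZ (-1) mD Ig.
by rewrite (_ : (fun x => -1 * g x) = (fun x => - g x))//; apply/funext => x; rewrite mulN1r.
Qed.

Lemma cintB D f g : Lmeas D -> cintegrable D f -> cintegrable D g ->
  cintegral D (fun x => f x - g x) = cintegral D f - cintegral D g.
Proof.
move=> mD If Ig.
have E : (fun x => -1 * g x) = (fun x => - g x) by apply/funext => x; rewrite mulN1r.
have I2 := CintZ (-1) mD Ig; rewrite E in I2.
by rewrite cintD// -E cintZ// mulN1r.
Qed.

Lemma cint_eq D f g : (forall x, D x -> f x = g x) -> cintegral D f = cintegral D g.
Proof. by move=> fg; apply: c_ext => /=; apply: int_eq => x /fg ->. Qed.

Lemma Cint_eq D f g : Lmeas D -> (forall x, D x -> f x = g x) -> cintegrable D f ->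
  cintegrable D g.
Proof.
move=> mD fg [f1 f2]; split.
  by apply: (Lint_eq mD _ f1) => x /fg ->.
by apply: (Lint_eq mD _ f2) => x /fg ->.
Qed.

Lemma nc_cint D f (G : R -> R) : Lmeas D -> cintegrable D f -> Lint D G ->
  (forall x, D x -> nc (f x) <= G x) ->
  nc (cintegral D f) <= 2 * \int[mu]_(x in D) G x.
Proof.
move=> mD [f1 f2] IG fG; apply: le_trans (nc_le _) _ => /=.
rewrite mulr_natl mulr2n; apply: lerD; apply: norm_int_le => // x Dx.
  exact: le_trans (nc_Re _) (fG x Dx).
exact: le_trans (nc_Im _) (fG x Dx).
Qed.

Lemma cder_int D (f f' : R -> R -> R[i]) (u v a : R) (G : R -> R) :
  Lmeas D -> u < a < v ->
  (forall x, u < x < v -> cintegrable D (f x)) ->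
  (forall x y, u < x < v -> D y -> cder (f^~ y) x (f' x y)) ->
  Lint D G -> (forall x y, u < x < v -> D y -> nc (f' x y) <= G y) ->
  cder (fun x => cintegral D (f x)) a (cintegral D (f' a)).
Proof.
move=> mD auv If df IG fG; split => /=.
  apply: (@derive_int _ D (fun x y => cRe (f x y)) (fun x y => cRe (f' x y)) u v a G) => //.
  - by move=> x /If [].
  - by move=> x y h Dy; exact: (df x y h Dy).1.
  - by move=> x y h Dy; exact: le_trans (nc_Re _) (fG x y h Dy).
apply: (@derive_int _ D (fun x y => cIm (f x y)) (fun x y => cIm (f' x y)) u v a G) => //.
- by move=> x /If [].
- by move=> x y h Dy; exact: (df x y h Dy).2.
- by move=> x y h Dy; exact: le_trans (nc_Im _) (fG x y h Dy).
Qed.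

Definition cvgy0 f := forall e : R, 0 < e -> exists A : R, forall x, A <= x -> nc (f x) <= e.

Lemma cvgy0_real (g : R -> R) f : cvgy0 f -> (forall x, `|g x| <= nc (f x)) ->
  g x @[x --> +oo] --> (0 : R).
Proof.
move=> f0 gf; apply/cvgrPdist_le => e e0; have [A HA] := f0 _ e0.
near=> x; rewrite sub0r normrN; apply: le_trans (gf x) (HA x _).
by near: x; apply: nbhs_pinfty_ge; rewrite num_real.
Unshelve. all: by end_near. Qed.

Lemma expR_cvgy0 f (C : R) : (forall x, 0 <= x -> nc (f x) <= C * expR (- x)) -> cvgy0 f.
Proof.
move=> H e e0.
exists (`|C| / e) => x xA.
have x0 : 0 <= x by apply: le_trans xA; rewrite divr_ge0// ltW.
apply: le_trans (H x x0) _; rewrite expRN ler_pdivrMr ?expR_gt0//.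
apply: le_trans (ler_norm C) _.
move: xA; rewrite ler_pdivrMr// => xA.
by have := expR_ge1Dx x; nra.
Qed.

(** Used both for integrations by parts and for exact derivatives along contours. *)
Lemma cFTC_halfline f f' : (forall x, 0 <= x -> cder f x (f' x)) ->
  ccont f' -> cintegrable halfline f' -> cvgy0 f ->
  cintegral halfline f' = - f 0.
Proof.
move=> df [c1 c2] [i1 i2] f0; apply: c_ext => /=.
  rewrite cReN; apply: (@FTC_halfline _ (fun x => cRe (f x))) => //.
    by move=> x x0; exact: (df x x0).1.
  by apply: (cvgy0_real f0) => x; exact: nc_Re.
rewrite cImN; apply: (@FTC_halfline _ (fun x => cIm (f x))) => //.
  by move=> x x0; exact: (df x x0).2.
by apply: (cvgy0_real f0) => x; exact: nc_Im.
Qed.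

Lemma cFTC_segment f f' (a b : R) : a <= b ->
  (forall x, a <= x <= b -> cder f x (f' x)) -> ccont f' ->
  cintegral `[a, b] f' = f b - f a.
Proof.
move=> ab df [c1 c2]; apply: c_ext => /=.
  rewrite cReD cReN; apply: (@FTC_segment _ (fun x => cRe (f x))) => // x x0.
  exact: (df x x0).1.
rewrite cImD cImN; apply: (@FTC_segment _ (fun x => cIm (f x))) => // x x0.
exact: (df x x0).2.
Qed.

Lemma ccontM f g : ccont f -> ccont g -> ccont (fun x => f x * g x).
Proof.
move=> [f1 f2] [g1 g2]; split.
  rewrite (_ : (fun y => _) = (fun y => cRe (f y) * cRe (g y) - cIm (f y) * cIm (g y))).
    by move=> x; apply: cvgB; apply: cvgM; [exact: f1|exact: g1|exact: f2|exact: g2].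
  by apply/funext => y; rewrite cReM.
rewrite (_ : (fun y => _) = (fun y => cRe (f y) * cIm (g y) + cIm (f y) * cRe (g y))).
  by move=> x; apply: cvgD; apply: cvgM; [exact: f1|exact: g2|exact: f2|exact: g1].
by apply/funext => y; rewrite cImM.
Qed.

Lemma cder_0_cst f (a b : R) : (forall x, cder f x 0) -> f a = f b.
Proof.
move=> df; apply: c_ext.
  by apply: (@is_derive_0_is_cst _ (fun x => cRe (f x))) => x; exact: (df x).1.
by apply: (@is_derive_0_is_cst _ (fun x => cIm (f x))) => x; exact: (df x).2.
Qed.

End ComplexCalculus.

(** * Contour integrals of the Airy integrand *)

Section AiryContours.
Context {R : realType}.
Notation mu := (@lebesgue_measure R).
Implicit Types (x y s k : R) (z w a b : R[i]).

Definition ii : R[i] := 0 +i* 1.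

Lemma ii2 : ii * ii = -1.
Proof. by apply: c_ext => /=; ring. Qed.

Lemma cder_linear a b x : cder (fun s => a + b * s%:C) x b.
Proof.
apply: cder_eq (cderD (cder_cst a x) (cderZ b (cder_id x))).
by rewrite add0r mulr1.
Qed.

Section HomotopyOfLines.
Variables (g g' g'' : R[i] -> R[i]) (A0 A1 B0 B1 : R[i]).
Hypotheses (Hg : hol g g') (Hg' : hol g' g'').

(** The family of parametrized lines [s |-> k (A0 + A1 s) + (B0 + B1 s)]: shifts
    are [A1 = 0], rotations about the origin are [A0 = 0]. *)
Definition line k s : R[i] := k%:C * (A0 + A1 * s%:C) + (B0 + B1 * s%:C).
(** The pull-back of the 1-form [g dz] to the line with parameter k. *)
Definition line_form k s : R[i] := (k%:C * A1 + B1) * g (line k s).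
(** The variation field of the moving line contracted with [g dz]; its
    derivative in s is the derivative in k of the pull-back. *)
Definition line_pot k s : R[i] := (A0 + A1 * s%:C) * g (line k s).
Definition line_dform k s : R[i] :=
  A1 * g (line k s) + (k%:C * A1 + B1) * ((A0 + A1 * s%:C) * g' (line k s)).

Lemma lineE k s : line k s = (k%:C * A0 + B0) + (k%:C * A1 + B1) * s%:C.
Proof. rewrite /line; ring. Qed.

Lemma cder_line_k k s : cder (fun k => line k s) k (A0 + A1 * s%:C).
Proof.
have := cderD (cderM (cder_id k) (cder_cst (A0 + A1 * s%:C) k)) (cder_cst (B0 + B1 * s%:C) k).
by apply: cder_eq; ring.
Qed.

Lemma cder_line_s k s : cder (fun s => line k s) s (k%:C * A1 + B1).
Proof.
rewrite (_ : (fun s => line k s) = fun s => (k%:C * A0 + B0) + (k%:C * A1 + B1) * s%:C).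
  exact: cder_linear.
by apply/funext => t; rewrite lineE.
Qed.

Lemma cder_line_form k s : cder (fun k => line_form k s) k (line_dform k s).
Proof.
have h1 : cder (fun k => k%:C * A1 + B1) k A1.
  have := cderD (cderM (cder_id k) (cder_cst A1 k)) (cder_cst B1 k).
  by apply: cder_eq; ring.
apply: cder_eq (cderM h1 (Hg (cder_line_k k s))); rewrite /line_dform; ring.
Qed.

(** The 1-form g dz is closed, so that the variation of its pull-back along a
    moving line is an exact derivative. *)
Lemma cder_line_pot k s : cder (fun s => line_pot k s) s (line_dform k s).
Proof.
apply: cder_eq (cderM (cder_linear A0 A1 s) (Hg (cder_line_s k s))).
rewrite /line_dform; ring.
Qed.

Lemma line_form_cont k : ccont (line_form k).
Proof.
apply: (@cder_cont _ _ (fun s => (k%:C * A1 + B1) * ((k%:C * A1 + B1) * g' (line k s)))) => s.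
exact: cderZ (Hg (cder_line_s k s)).
Qed.

Lemma line_dform_cont k : ccont (line_dform k).
Proof.
apply: cder_cont => s; apply: cderD.
  exact: cderZ (Hg (cder_line_s k s)).
apply: cderZ; apply: cderM; first exact: cder_linear.
exact: Hg' (cder_line_s k s).
Qed.

(** The integral along a moving segment varies only through the end points. *)
Lemma homotopy_segment (u v L K : R) k : 0 <= L -> u < k < v ->
  (forall k s, u < k < v -> 0 <= s <= L -> nc (line_dform k s) <= K) ->
  cder (fun k => cintegral `[0, L] (line_form k)) k (line_pot k L - line_pot k 0).
Proof.
move=> L0 uv H.
have cst_int (c : R) : Lint `[0, L] (fun=> c) by apply: Lint_segment => x; exact: cvg_cst.
rewrite -(@cFTC_segment _ _ (line_dform k))//; last 2 first.
- by move=> s _; exact: cder_line_pot.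
- exact: line_dform_cont.
apply: (@cder_int _ _ _ _ u v k (fun=> K)) => //.
- move=> x _; have [c1 c2] := line_form_cont x.
  by split; exact: Lint_segment.
by move=> x s _ _; exact: cder_line_form.
Qed.

(** On a half line with exponential decay only the starting point contributes. *)
Lemma homotopy_halfline (u v K : R) k : u < k < v ->
  (forall k s, u < k < v -> 0 <= s ->
     (1 + s) * nc (g (line k s)) <= K * expR (- s) /\
     (1 + s) * nc (g' (line k s)) <= K * expR (- s)) ->
  cder (fun k => cintegral halfline (line_form k)) k
    (- (A0 * g (k%:C * A0 + B0))).
Proof.
move=> uv H; pose M := Num.max `|u| `|v|.
have kM x : u < x < v -> `|x| <= M.
  move=> /andP[ux xv]; rewrite ler_norml /M.
  have := ler_norm v; have := ler_norm (- u); rewrite normrN.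
  by case: (leP `|u| `|v|); lra.
have LK (c : R) : Lint halfline (fun s => c * expR (- s)).
  apply: LintZ => //.
  apply: (Lint_eq _ (f := fun x => expR (- 1 * x))) => //.
    by move=> x _; rewrite mulN1r.
  exact: Lint_expR.
pose N := 1 + nc A0 + nc A1 + (M * nc A1 + nc B1).
have M0 : 0 <= M by rewrite /M le_max normr_ge0.
have nA0 := nc_ge0 A0; have nA1 := nc_ge0 A1; have nB1 := nc_ge0 B1.
have MA : 0 <= M * nc A1 by exact: mulr_ge0.
have N1 : 1 <= N by rewrite /N; lra.
have bAs s : 0 <= s -> nc (A0 + A1 * s%:C) <= N * (1 + s).
  move=> s0; apply: le_trans (ncD _ _) _; rewrite ncM nc_real ger0_norm//.
  apply: (@le_trans _ _ ((nc A0 + nc A1) * (1 + s))); first by nra.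
  by rewrite ler_wpM2r// /N; lra.
have bk x : u < x < v -> nc (x%:C * A1 + B1) <= N.
  move=> /kM xM; apply: le_trans (ncD _ _) _; rewrite ncM nc_real.
  have : `|x| * nc A1 <= M * nc A1 by exact: ler_wpM2r.
  by rewrite /N; lra.
have gb x s : u < x < v -> 0 <= s -> nc (g (line x s)) <= K * expR (- s).
  move=> hx s0; apply: le_trans (H _ _ hx s0).1.
  by rewrite ler_peMl ?nc_ge0//; lra.
have e0 s := expR_ge0 (- s).
have dfb x s : u < x < v -> 0 <= s -> nc (line_dform x s) <= (N + N * N) * K * expR (- s).
  move=> hx s0; have [H1 H2] := H _ _ hx s0; rewrite mulrDl (mulrDl (N * K)).
  apply: le_trans (ncD _ _) _; rewrite !ncM; apply: lerD.
    rewrite -mulrA; apply: ler_pM; rewrite ?nc_ge0//; last exact: gb.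
    by rewrite /N; lra.
  rewrite -!mulrA; apply: ler_pM; rewrite ?mulr_ge0 ?nc_ge0//; first exact: bk.
  apply: (@le_trans _ _ (N * (1 + s) * nc (g' (line x s)))).
    by rewrite ler_wpM2r ?nc_ge0// bAs.
  by rewrite -mulrA ler_wpM2l//; lra.
have pot0 : cvgy0 (line_pot k).
  apply: (@expR_cvgy0 _ _ (N * K)) => s s0.
  rewrite ncM; apply: (@le_trans _ _ (N * (1 + s) * nc (g (line k s)))).
    by rewrite ler_wpM2r ?nc_ge0// bAs.
  by rewrite -!mulrA ler_wpM2l//; [lra|exact: (H _ _ uv s0).1].
have Idf : cintegrable halfline (line_dform k).
  apply: (Cint_dom _ (line_dform_cont k) (LK ((N + N * N) * K))) => // s.
  by rewrite /= in_itv/= andbT; exact: dfb.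
have -> : - (A0 * g (k%:C * A0 + B0)) = cintegral halfline (line_dform k).
  rewrite (@cFTC_halfline _ (line_pot k) (line_dform k))//.
  - by rewrite /line_pot /line !mulr0 !addr0.
  - by move=> s _; exact: cder_line_pot.
  - exact: line_dform_cont.
apply: (@cder_int _ _ _ _ u v k (fun s => (N + N * N) * K * expR (- s))) => //.
- move=> x hx.
  apply: (Cint_dom _ (line_form_cont x) (LK (N * K))) => // s.
  rewrite /= in_itv/= andbT => s0; rewrite ncM -mulrA.
  by apply: ler_pM; rewrite ?nc_ge0//; [exact: bk|exact: gb].
- by move=> x s _ _; exact: cder_line_form.
- by move=> x s hx; rewrite /= in_itv/= andbT; exact: dfb.
Qed.

End HomotopyOfLines.

(** For [m = 0] the integrand of the Airy function; the factor [a^m] comes from m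
    differentiations in z, up to a power of i. *)
Definition airyG m z a : R[i] := a ^+ m * cexp (ii * (a * z + a ^+ 3 / 3)).
Definition airyG' m z a : R[i] :=
  (m%:R * a ^+ m.-1 + a ^+ m * (ii * (z + a ^+ 2))) * cexp (ii * (a * z + a ^+ 3 / 3)).

Lemma hol_exponent z : hol (fun a => ii * (a * z + a ^+ 3 / 3)) (fun a => ii * (z + a ^+ 2)).
Proof.
apply: (hol_eq (holM (hol_cst ii) (holD (holM hol_id (hol_cst z))
   (holM (@holX _ 2) (hol_cst 3^-1))))) => a //=; field.
done.
Qed.

Lemma hol_pow m : hol (fun a : R[i] => a ^+ m) (fun a => m%:R * a ^+ m.-1).
Proof.
case: m => [|m]; last exact: holX.
by apply: (hol_eq (hol_cst 1)) => a; rewrite ?expr0 ?mul0r.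
Qed.

Lemma hol_airyG m z : hol (airyG m z) (airyG' m z).
Proof.
apply: (hol_eq (holM (hol_pow m) (hol_cexp (hol_exponent z)))) => a //.
by rewrite /airyG'; ring.
Qed.

Lemma hol_airyG' m z : exists g'', hol (airyG' m z) g''.
Proof.
eexists; apply: (hol_eq (holM (holD (holM (hol_cst m%:R) (hol_pow m.-1))
  (holM (hol_pow m) (holM (hol_cst ii) (holD (hol_cst z) (hol_pow 2)))))
  (hol_cexp (hol_exponent z)))) => a //.
Qed.

(** Where the real part of the exponent is dominated by a negative cubic, the
    integrand is exponentially small; all contours used below meet this bound. *)
Lemma airyG_decay m z (A e M : R) : 0 < e -> exists K : R, 0 <= K /\
  forall a s, 0 <= s -> nc a <= M * (1 + s) ->
    cRe (ii * (a * z + a ^+ 3 / 3)) <= A * (1 + s + s ^+ 2) - e * s ^+ 3 ->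
    (1 + s) * nc (airyG m z a) <= K * expR (- s) /\
    (1 + s) * nc (airyG' m z a) <= K * expR (- s).
Proof.
move=> e0; have [C [C0 HC]] := cubic_decay A (m.+3) e0.
pose N := 1 + `|M|.
have N1 : 1 <= N by rewrite lerDl.
pose P := N ^+ m.+2 * (m%:R + 1 + nc z).
have nz := nc_ge0 z; have m0 : 0 <= m%:R :> R by [].
exists (P * C); split.
  by rewrite mulr_ge0// /P mulr_ge0 ?exprn_ge0//; lra.
move=> a s s0 aM HA.
have aN : nc a <= N * (1 + s).
  apply: le_trans aM _; rewrite ler_wpM2r//; first lra.
  by have := ler_norm M; rewrite /N; lra.
have b1 : 1 <= N * (1 + s) by rewrite mulr_ege1//; lra.
have pw j : (j <= m.+2)%N -> nc a ^+ j <= N ^+ m.+2 * (1 + s) ^+ m.+2.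
  move=> jm; rewrite -exprMn; apply: le_trans (_ : (N * (1 + s)) ^+ j <= _).
    by rewrite lerXn2r ?nnegrE ?nc_ge0//; lra.
  by rewrite ler_weXn2l.
have E0 := expR_ge0 (cRe (ii * (a * z + a ^+ 3 / 3))).
have key c : nc c <= P * (1 + s) ^+ m.+2 ->
    (1 + s) * nc (c * cexp (ii * (a * z + a ^+ 3 / 3))) <= P * C * expR (- s).
  move=> cb; rewrite ncM nc_cexp -mulrA.
  have P0 : 0 <= P by rewrite /P mulr_ge0 ?exprn_ge0//; lra.
  apply: (@le_trans _ _ (P * ((1 + s) ^+ m.+3 *
     expR (A * (1 + s + s ^+ 2) - e * s ^+ 3)))); last first.
    by apply: ler_wpM2l => //; exact: HC.
  rewrite mulrCA.
  have -> : P * ((1 + s) ^+ m.+3 * expR (A * (1 + s + s ^+ 2) - e * s ^+ 3)) =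
    P * (1 + s) ^+ m.+2 * ((1 + s) * expR (A * (1 + s + s ^+ 2) - e * s ^+ 3)).
    by rewrite (exprS _ m.+2); ring.
  apply: ler_pM; rewrite ?nc_ge0 ?mulr_ge0//; first lra.
  by rewrite ler_wpM2l ?ler_expR//; lra.
split; apply: key.
  rewrite ncX; apply: le_trans (pw m _) _; first by rewrite -addn2 leq_addr.
  have -> : P * (1 + s) ^+ m.+2 = N ^+ m.+2 * (1 + s) ^+ m.+2 * (m%:R + 1 + nc z).
    by rewrite /P; ring.
  rewrite ler_peMr//; last lra.
  by rewrite mulr_ge0// exprn_ge0//; lra.
apply: le_trans (ncD _ _) _.
have nm : nc (m%:R : R[i]) = m%:R.
  by rewrite -(rmorph_nat (@real_complex R)) nc_real ger0_norm.
have nii : nc ii = 1 by rewrite /= expr0n/= add0r expr1n sqrtr1.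
rewrite !ncM nm nii mul1r !ncX.
have H1 := pw m.-1 (leq_trans (leq_pred m) (leq_trans (leqnSn m) (leqnSn _))).
have H2 := pw m (leq_trans (leqnSn m) (leqnSn _)).
have H3 := pw m.+2 (leqnn _).
have H4 : nc a ^+ m * nc (z + a ^+ 2) <= nc z * nc a ^+ m + nc a ^+ m.+2.
  apply: (@le_trans _ _ (nc a ^+ m * (nc z + nc (a ^+ 2)))).
    by rewrite ler_wpM2l ?exprn_ge0 ?nc_ge0// ncD.
  by rewrite ncX mulrDr -exprD addn2 [nc a ^+ m * _]mulrC.
set T := N ^+ m.+2 * (1 + s) ^+ m.+2 in H1 H2 H3.
apply: (@le_trans _ _ (m%:R * T + (nc z * T + T))).
  apply: lerD; first exact: ler_wpM2l.
  by apply: le_trans H4 _; apply: lerD => //; exact: ler_wpM2l.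
by rewrite /P -/T le_eqVlt; apply/orP; left; apply/eqP; rewrite /T; ring.
Qed.

Lemma Lint_expN (c : R) : Lint halfline (fun s => c * expR (- s)).
Proof.
apply: LintZ => //; apply: (Lint_eq _ (f := fun x => expR (- 1 * x))) => //.
  by move=> x _; rewrite mulN1r.
exact: Lint_expR.
Qed.

Lemma int_expN (c : R) : \int[mu]_(s in halfline) (c * expR (- s)) = c.
Proof.
have dF x : is_derive x (1 : R) (fun s => - c * expR (- 1 * s)) (c * expR (- x)).
  have := @is_deriveZ _ _ _ _ (- c) x 1 _ (is_derive_expRZ (- 1) x).
  by rewrite /GRing.scale/= !mulN1r mulrNN.
rewrite (@FTC_halfline R (fun s => - c * expR (- 1 * s))) ?mulr0 ?expR0 ?mulr1 ?opprK//.
- apply: (@derive_contT _ _ (fun x => c * (- 1 * expR (- 1 * x)))) => x.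
  have := @is_deriveZ _ _ _ _ c x 1 _ (is_derive_expRZ (- 1) x).
  by under eq_fun do rewrite mulN1r.
- exact: Lint_expN.
- apply: (@cvgy0_real _ _ (fun s => (c * expR (- s))%:C)).
    apply: (@expR_cvgy0 _ _ `|c|) => x x0.
    by rewrite nc_real normrM (ger0_norm (expR_ge0 _)).
  by move=> x; rewrite nc_real mulN1r !normrM normrN.
Qed.

(** Integral of the Airy integrand along the ray from 0 in the direction b. *)
Definition ray b m z : R[i] := cintegral halfline (fun s => b * airyG m z (b * s%:C)).

(** The pointwise form of complex differentiability of the exponential, uniform
    enough to be integrated along a ray. *)
Lemma cexp_quad w : nc (cexp w - 1 - w) <= 2 * (nc w ^+ 2 * expR (nc w)).
Proof.
pose f (t : R) := cexp (t%:C * w).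
have lin t : cder (fun t => t%:C * w) t w.
  by have := cderM (cder_id t) (cder_cst w t); apply: cder_eq; ring.
have df t : cder f t (w * f t) by exact: cder_cexp (lin t).
have df2 t : cder (fun t => w * f t) t (w * (w * f t)) by exact: cderZ (df t).
have f0 : f 0 = 1 by rewrite /f mul0r cexp0.
have f1 : f 1 = cexp w by rewrite /f mul1r.
have bd t : 0 <= t <= 1 -> nc (w * (w * f t)) <= nc w ^+ 2 * expR (nc w).
  move=> /andP[t0 t1]; rewrite (ncM w (w * f t)) (ncM w (f t)) mulrA -expr2 ler_wpM2l ?sqr_ge0//.
  rewrite /f nc_cexp ler_expR; apply: le_trans (ler_norm _) _.
  apply: le_trans (nc_Re _) _; rewrite ncM nc_real ger0_norm//.
  by rewrite ler_piMl ?nc_ge0.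
have m01 : Num.min (0 : R) 1 = 0 /\ Num.max (0 : R) 1 = 1.
  by rewrite /Order.min /Order.max ltr01.
apply: le_trans (nc_le _) _; rewrite mulr_natl mulr2n; apply: lerD.
  have := @taylor2 _ (fun t => cRe (f t)) (fun t => cRe (w * f t))
    (fun t => cRe (w * (w * f t))) 0 1 (nc w ^+ 2 * expR (nc w)).
  rewrite m01.1 m01.2 f0 f1 mulr1 (subr0 (1 : R)) mul1r expr1n mulr1 !cReD !cReN.
  apply=> x Hx; [exact: (df x).1|exact: (df2 x).1|].
  by apply: le_trans (nc_Re _) (bd x Hx).
have := @taylor2 _ (fun t => cIm (f t)) (fun t => cIm (w * f t))
  (fun t => cIm (w * (w * f t))) 0 1 (nc w ^+ 2 * expR (nc w)).
rewrite m01.1 m01.2 f0 f1 mulr1 (subr0 (1 : R)) mul1r expr1n mulr1 !cImD !cImN.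
apply=> x Hx; [exact: (df x).2|exact: (df2 x).2|].
by apply: le_trans (nc_Im _) (bd x Hx).
Qed.

Section Rays.
Variables (b : R[i]) (e : R).
Hypotheses (e0 : 0 < e) (be : cRe (ii * (b ^+ 3 / 3)) = - e).

Lemma ray_exponent z s : 0 <= s ->
  cRe (ii * (b * s%:C * z + (b * s%:C) ^+ 3 / 3)) <= nc b * nc z * s - e * s ^+ 3.
Proof.
move=> s0.
have -> : ii * (b * s%:C * z + (b * s%:C) ^+ 3 / 3) =
    ii * (b * z * s%:C) + ii * (b ^+ 3 / 3) * (s ^+ 3)%:C.
  by rewrite rmorphXn/=; ring.
rewrite cReD (cReM (_ * (b ^+ 3 / 3))) be /= mulr0 subr0 -mulNr lerD2r.
apply: le_trans (ler_norm _) _; apply: le_trans (nc_Re _) _.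
rewrite !ncM nc_real ger0_norm// [nc ii]/= expr0n/= add0r expr1n sqrtr1 mul1r.
by [].
Qed.

Lemma ray_integrand_cont m z : ccont (fun s => b * airyG m z (b * s%:C)).
Proof.
apply: (@cder_cont _ _ (fun s => b * (b * airyG' m z (0 + b * s%:C)))) => s.
apply: cderZ.
have := hol_airyG m z (cder_linear 0 b s).
by under eq_fun do rewrite add0r.
Qed.

Lemma ray_quad_pt m z : exists C : R, 0 <= C /\ forall h s, nc h <= 1 -> 0 <= s ->
  nc (b * airyG m (z + h) (b * s%:C)) <= C * expR (- s) /\
  nc (b * airyG m (z + h) (b * s%:C) - b * airyG m z (b * s%:C)
      - h * ii * (b * airyG m.+1 z (b * s%:C))) <= C * nc h ^+ 2 * expR (- s).
Proof.
have [C [C0 HC]] := cubic_decay (nc b * (nc z + 1)) (m.+2) e0.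
have nb := nc_ge0 b; have nz := nc_ge0 z.
have p j : 0 <= nc b ^+ j by exact: exprn_ge0.
exists ((nc b ^+ m.+1 + 2 * nc b ^+ m.+3) * C); split.
  by apply: mulr_ge0 => //; have := p m.+1; have := p m.+3; lra.
move=> h s h1 s0; have nh := nc_ge0 h.
have nas : nc (b * s%:C) = nc b * s by rewrite ncM nc_real ger0_norm.
have e1 := expR_ge0 (- s).
have bC : 0 <= nc b ^+ m.+1 * C * expR (- s).
  by apply: mulr_ge0 => //; exact: mulr_ge0.
have bC2 : 0 <= nc b ^+ m.+3 * C * expR (- s).
  by apply: mulr_ge0 => //; exact: mulr_ge0.
have bd w : nc w <= nc z + 1 -> expR (cRe (ii * (b * s%:C * w + (b * s%:C) ^+ 3 / 3))) <=
    expR (nc b * (nc z + 1) * (1 + s + s ^+ 2) - e * s ^+ 3).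
  move=> hw; rewrite ler_expR; apply: le_trans (ray_exponent _ s0) _.
  rewrite lerD2r; apply: ler_pM => //; rewrite ?mulr_ge0 ?nc_ge0//.
    by rewrite ler_wpM2l.
  by have := sqr_ge0 s; lra.
have s1 j (E : R) : (j <= m.+2)%N -> 0 <= E ->
    E <= expR (nc b * (nc z + 1) * (1 + s + s ^+ 2) - e * s ^+ 3) ->
    s ^+ j * E <= C * expR (- s).
  move=> jm E0 hE; apply: le_trans (HC s s0); apply: ler_pM; rewrite ?exprn_ge0//.
  apply: (@le_trans _ _ ((1 + s) ^+ j)); first by rewrite lerXn2r ?nnegrE; lra.
  by apply: ler_weXn2l => //; lra.
split.
  rewrite ncM [X in _ * X]ncM ncX nas nc_cexp.
  have := bd (z + h); set E1 := expR (cRe _) => bdE.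
  have {bdE}E1b : E1 <= expR (nc b * (nc z + 1) * (1 + s + s ^+ 2) - e * s ^+ 3).
    by apply: bdE; apply: le_trans (ncD _ _) _; lra.
  have -> : nc b * ((nc b * s) ^+ m * E1) = nc b ^+ m.+1 * (s ^+ m * E1).
    by rewrite exprMn (exprS _ m); ring.
  apply: (@le_trans _ _ (nc b ^+ m.+1 * (C * expR (- s)))).
    apply: ler_wpM2l => //; apply: s1 => //; last exact: expR_ge0.
    by rewrite -addn2 leq_addr.
  move: bC2; move: (nc b ^+ m.+1) (nc b ^+ m.+3) => X Y bC2.
  have -> : (X + 2 * Y) * C * expR (- s) = X * (C * expR (- s)) + 2 * (Y * C * expR (- s)) by ring.
  by rewrite lerDl mulr_ge0.
set a := b * s%:C.
have -> : b * airyG m (z + h) a - b * airyG m z a - h * ii * (b * airyG m.+1 z a) =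
    b * (airyG m z a * (cexp (ii * a * h) - 1 - ii * a * h)).
  have -> : airyG m (z + h) a = airyG m z a * cexp (ii * a * h).
    rewrite /airyG -mulrA -cexpD; congr (_ * cexp _); ring.
  rewrite /airyG (exprS a m); ring.
have nia : nc (ii * a * h) = nc b * s * nc h.
  by rewrite ncM (ncM ii) nas [nc ii]/= expr0n/= add0r expr1n sqrtr1 mul1r.
rewrite ncM [X in _ * X]ncM [nc (airyG _ _ _)]ncM ncX nas nc_cexp.
have := cexp_quad (ii * a * h); rewrite nia.
move: (nc (cexp _ - _ - _)) (nc_ge0 (cexp (ii * a * h) - 1 - ii * a * h)) => Q Q0 q.
have hE := ray_exponent z s0; rewrite -/a in hE.
move: hE; rewrite -ler_expR; set E1 := expR (cRe _) => hE.
have E10 : 0 <= E1 by exact: expR_ge0.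
set E2 := expR (nc b * nc z * s - e * s ^+ 3) in hE.
pose E3 := expR (nc b * (nc z + 1) * s - e * s ^+ 3).
have E3E : E3 = E2 * expR (nc b * s).
  by rewrite /E2 -expRD /E3; congr expR; ring.
have E3b : s ^+ m.+2 * E3 <= C * expR (- s).
  apply: s1 => //; first exact: expR_ge0.
  rewrite ler_expR lerD2r ler_wpM2l ?mulr_ge0//; first lra.
  by have := sqr_ge0 s; lra.
have q2 : Q <= 2 * ((nc b * s * nc h) ^+ 2 * expR (nc b * s)).
  apply: le_trans q _; rewrite ler_wpM2l// ler_wpM2l ?sqr_ge0// ler_expR.
  by rewrite ler_piMr// mulr_ge0.
apply: (@le_trans _ _ (nc b * ((nc b * s) ^+ m * E2 *
   (2 * ((nc b * s * nc h) ^+ 2 * expR (nc b * s)))))).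
  apply: ler_wpM2l => //; apply: ler_pM => //.
    by apply: mulr_ge0 => //; apply: exprn_ge0; exact: mulr_ge0.
  by apply: ler_wpM2l => //; apply: exprn_ge0; exact: mulr_ge0.
have -> : nc b * ((nc b * s) ^+ m * E2 *
   (2 * ((nc b * s * nc h) ^+ 2 * expR (nc b * s)))) =
   2 * nc b ^+ m.+3 * nc h ^+ 2 * (s ^+ m.+2 * E3).
  rewrite E3E exprMn (exprS (nc b) m.+2) (exprS (nc b) m.+1) (exprS (nc b) m).
  rewrite (exprS s m.+1) (exprS s m); move: (nc b ^+ m) (s ^+ m) => X Y; ring.
apply: (@le_trans _ _ (2 * nc b ^+ m.+3 * nc h ^+ 2 * (C * expR (- s)))).
  by apply: ler_wpM2l => //; apply: mulr_ge0; [exact: mulr_ge0|exact: sqr_ge0].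
have := mulr_ge0 bC (sqr_ge0 (nc h)).
move: (nc b ^+ m.+1) (nc b ^+ m.+3) (nc h ^+ 2) => X Y H bC3.
have -> : (X + 2 * Y) * C * H * expR (- s) =
  2 * Y * H * (C * expR (- s)) + X * C * expR (- s) * H by ring.
by rewrite lerDl.
Qed.

Lemma ray_integrable m z : cintegrable halfline (fun s => b * airyG m z (b * s%:C)).
Proof.
have [C [C0 HC]] := ray_quad_pt m z.
apply: (Cint_dom _ (ray_integrand_cont m z) (Lint_expN C)) => // s.
rewrite /= in_itv/= andbT => s0.
have := (HC 0 s _ s0).1; rewrite addr0; apply.
by rewrite ComplexField.Normc.normc0.
Qed.

(** The ray integral is complex differentiable in z, with an explicit quadratic
    error: the derivative raises the power of a by one. *)
Lemma ray_quad m z : exists C : R, forall h, nc h <= 1 ->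
  nc (ray b m (z + h) - ray b m z - h * (ii * ray b m.+1 z)) <= C * nc h ^+ 2.
Proof.
have [C [C0 HC]] := ray_quad_pt m z.
exists (2 * C) => h h1.
have I1 := ray_integrable m (z + h); have I2 := ray_integrable m z.
have I3 := CintZ (h * ii) (@measurable_halfline R) (ray_integrable m.+1 z).
rewrite /ray (mulrA h) -cintZ//; last exact: ray_integrable.
rewrite -!cintB//; last exact: CintB.
rewrite -mulrA -(int_expN (C * nc h ^+ 2)); apply: nc_cint => //.
- by apply: CintB => //; exact: CintB.
- exact: Lint_expN.
- by move=> s; rewrite /= in_itv/= andbT => s0; exact: (HC h s h1 s0).2.
Qed.

End Rays.
End AiryContours.

(** * Moving the contours: decay and the real Airy function *)

Section AiryDecay.
Context {R : realType}.
Notation mu := (@lebesgue_measure R).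
Implicit Types (x y s k : R) (z w a b : R[i]).

(** Direction of the right ray, at angle pi/4, where [i a^3/3] has real part
    [- 2 s^3/3]. The same number is the factor w of the kernel. *)
Definition bR : R[i] := 1 +i* 1.
(** Direction of the left ray, the mirror image of the right one. *)
Definition bL : R[i] := (-1) +i* 1.

Lemma c3V : (3 : R[i])^-1 = (3^-1 : R)%:C.
Proof. by rewrite fmorphV rmorph_nat. Qed.

Lemma bR_cubic : cRe (ii * (bR ^+ 3 / 3)) = - (2 / 3).
Proof. by rewrite c3V !exprS expr0 /=; field. Qed.

Lemma bL_cubic : cRe (ii * (bL ^+ 3 / 3)) = - (2 / 3).
Proof. by rewrite c3V !exprS expr0 /=; field. Qed.

Lemma e23 : 0 < 2 / 3 :> R. Proof. by []. Qed.

Lemma cubic_exponent_re (p q y : R) :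
  cRe (ii * ((p +i* q) * (bR * y%:C) + (p +i* q) ^+ 3 / 3)) =
  - y * (p + q) - (3 * p ^+ 2 * q - q ^+ 3) / 3.
Proof. by rewrite c3V !exprS expr0 /=; field. Qed.

Lemma nc_ii : nc ii = 1 :> R.
Proof. by rewrite /= expr0n/= add0r expr1n sqrtr1. Qed.

Lemma exprn_le_norm (x K : R) n : `|x| <= K -> x ^+ n <= K ^+ n.
Proof.
move=> xK; apply: le_trans (ler_norm _) _; rewrite normrX.
by rewrite lerXn2r ?nnegrE//; apply: le_trans xK.
Qed.

Section Shift.
Variables (c : R) (m : nat) (y : R).
Hypothesis c1 : c = 1 \/ c = -1.
Let b : R[i] := c +i* 1.

Lemma shift_line k s : line ii 0 0 b k s = (c * s) +i* (k + s).
Proof. by apply: c_ext => /=; ring. Qed.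

(** The term [- y k] is the gain: lifting the ray by [k i] multiplies the
    integrand by [e^{- k y}], at the price of lower order terms in s. *)
Lemma shift_exponent k s :
  cRe (ii * (line ii 0 0 b k s * (bR * y%:C) + line ii 0 0 b k s ^+ 3 / 3)) =
  - y * ((c + 1) * s + k) + k ^+ 3 / 3 + k ^+ 2 * s - 2 / 3 * s ^+ 3.
Proof.
rewrite shift_line cubic_exponent_re.
have cc : c ^+ 2 = 1 by case: c1 => ->; rewrite ?sqrrN expr1n.
by rewrite exprMn cc; field.
Qed.

Lemma shift_nc k s : 0 <= s -> nc (line ii 0 0 b k s) <= (`|k| + 2) * (1 + s).
Proof.
move=> s0; rewrite shift_line; apply: le_trans (nc_le _) _ => /=.
have -> : `|c * s| = s.
  by rewrite normrM (ger0_norm s0); case: c1 => ->; rewrite ?normrN normr1 mul1r.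
have := ler_normD k s; rewrite (ger0_norm s0).
by have := normr_ge0 k; nra.
Qed.

(** The derivative in k of the shifted ray is minus the value of the form at the
    starting point [k i], which does not depend on the direction of the ray. *)
Lemma shift_deriv k :
  cder (fun k => cintegral halfline (line_form (airyG m (bR * y%:C)) ii 0 0 b k)) k
    (- (ii * airyG m (bR * y%:C) (k%:C * ii + 0))).
Proof.
pose K := `|k| + 1.
have K1 : 1 <= K by rewrite lerDr.
have [g'' Hg''] := hol_airyG' m (bR * y%:C).
have [C [_ HC]] := @airyG_decay R m (bR * y%:C) (2 * `|y| * K + K ^+ 3) (2 / 3) (K + 2) e23.
apply: (@homotopy_halfline _ _ _ _ _ _ _ _ (hol_airyG m _) Hg'' (k - 1) (k + 1) C).
  by apply/andP; split; lra.
move=> k' s /andP[k1 k2] s0.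
have k'K : `|k'| <= K.
  rewrite ler_norml /K; have := ler_norm k; have := ler_norm (- k).
  by rewrite normrN => ? ?; apply/andP; split; lra.
apply: HC => //.
  apply: le_trans (shift_nc k' s0) _; rewrite ler_wpM2r//; lra.
rewrite shift_exponent lerD2r.
have h1 : - y * ((c + 1) * s + k') <= 2 * `|y| * K * (1 + s).
  apply: le_trans (ler_norm _) _; rewrite normrM normrN.
  apply: (@le_trans _ _ (`|y| * (2 * s + K))).
    apply: ler_wpM2l => //; apply: le_trans (ler_normD _ _) _; apply: lerD => //.
    by rewrite normrM (ger0_norm s0) ler_wpM2r//; case: c1 => ->; rewrite ger0_norm; lra.
  have := normr_ge0 y; move: `|y| => Y Y0.
  have : Y * (2 * s + K) <= Y * (2 * K * (1 + s)) by apply: ler_wpM2l => //; nra.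
  by lra.
have h2 : k' ^+ 3 / 3 + k' ^+ 2 * s <= K ^+ 3 * (1 + s).
  have kk : k' ^+ 2 <= K ^+ 2 by exact: exprn_le_norm.
  have k3 : k' ^+ 3 <= K ^+ 3 by exact: exprn_le_norm.
  have K23 : K ^+ 2 <= K ^+ 3 by rewrite (exprS K 2) ler_peMl ?sqr_ge0.
  have K30 : 0 <= K ^+ 3 by rewrite exprn_ge0; lra.
  have : k' ^+ 2 * s <= K ^+ 3 * s by apply: ler_wpM2r => //; lra.
  by lra.
have s2 := sqr_ge0 s.
have K30 : 0 <= 2 * `|y| * K + K ^+ 3.
  by apply: addr_ge0; rewrite ?exprn_ge0 ?mulr_ge0//; lra.
have : (2 * `|y| * K + K ^+ 3) * (1 + s) <= (2 * `|y| * K + K ^+ 3) * (1 + s + s ^+ 2).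
  by apply: ler_wpM2l => //; lra.
by lra.
Qed.

End Shift.

Lemma shift_bound (c : R) (m : nat) (eta : R) : (c = 1 \/ c = -1) ->
  exists C, forall y, 0 <= y ->
  nc (cintegral halfline (line_form (airyG m (bR * y%:C)) ii 0 0 (c +i* 1) eta)) <=
  C * expR (- eta * y).
Proof.
move=> c1; pose E := `|eta|.
have [C [C0 HC]] := @cubic_decay R (E ^+ 3 + E ^+ 2) (2 / 3) m e23.
have E0 : 0 <= E by exact: normr_ge0.
exists (2 * ((nc (c +i* 1)) * ((E + 2) ^+ m * C))) => y y0.
have pt s : 0 <= s -> nc (line_form (airyG m (bR * y%:C)) ii 0 0 (c +i* 1) eta s) <=
    nc (c +i* 1) * ((E + 2) ^+ m * C) * expR (- eta * y) * expR (- s).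
  move=> s0; rewrite ncM mulr0 add0r -!(mulrA (nc _)); apply: ler_wpM2l; first exact: nc_ge0.
  rewrite ncM ncX nc_cexp shift_exponent//.
  have H1 : nc (line ii 0 0 (c +i* 1) eta s) ^+ m <= (E + 2) ^+ m * (1 + s) ^+ m.
    rewrite -exprMn lerXn2r ?nnegrE ?nc_ge0//; last exact: shift_nc.
    by rewrite mulr_ge0//; lra.
  have H2 : expR (- y * ((c + 1) * s + eta) + eta ^+ 3 / 3 + eta ^+ 2 * s - 2 / 3 * s ^+ 3) <=
      expR (- eta * y) * expR ((E ^+ 3 + E ^+ 2) * (1 + s + s ^+ 2) - 2 / 3 * s ^+ 3).
    rewrite -expRD ler_expR addrA lerD2r.
    have h1 : - y * ((c + 1) * s + eta) <= - eta * y.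
      have : 0 <= y * ((c + 1) * s).
        by apply: mulr_ge0 => //; apply: mulr_ge0 => //; case: c1 => ->; lra.
      lra.
    have h2 : eta ^+ 3 <= E ^+ 3 by exact: exprn_le_norm.
    have h3 : eta ^+ 2 = E ^+ 2 by rewrite /E real_normK ?num_real.
    have E3 : 0 <= E ^+ 3 by exact: exprn_ge0.
    have E2 : 0 <= E ^+ 2 by exact: exprn_ge0.
    rewrite h3.
    have t1 : 0 <= E ^+ 3 * s by exact: mulr_ge0.
    have t2 : 0 <= (E ^+ 3 + E ^+ 2) * s ^+ 2 by rewrite mulr_ge0 ?sqr_ge0 ?addr_ge0.
    lra.
  apply: (le_trans (ler_pM _ _ H1 H2)); rewrite ?exprn_ge0 ?nc_ge0 ?expR_ge0//.
  have := ler_wpM2l (expR_ge0 (- eta * y)) (HC s s0).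
  have : 0 <= (E + 2) ^+ m by apply: exprn_ge0; lra.
  move: (expR (- eta * y)) (expR (- s)) (expR (_ - _)) ((E + 2) ^+ m) ((1 + s) ^+ m) => Z W U X Y X0 H.
  have -> : X * Y * (Z * U) = X * (Z * (Y * U)) by ring.
  have -> : X * C * Z * W = X * (Z * (C * W)) by ring.
  exact: ler_wpM2l.
have [g'' Hg''] := hol_airyG' m (bR * y%:C).
have cc := line_form_cont ii 0 0 (c +i* 1) (hol_airyG m (bR * y%:C)) eta.
have LI := Lint_expN (nc (c +i* 1) * ((E + 2) ^+ m * C) * expR (- eta * y)).
have I : cintegrable halfline (line_form (airyG m (bR * y%:C)) ii 0 0 (c +i* 1) eta).
  apply: (Cint_dom _ cc LI) => // s; rewrite /= in_itv/= andbT; exact: pt.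
rewrite -mulrA -[X in _ <= _ * X]int_expN; apply: nc_cint => // s.
by rewrite /= in_itv/= andbT; exact: pt.
Qed.

(** Moving both rays up by i eta leaves their difference unchanged, since they
    share their starting point; the factor e^{i a z} then gains e^{- eta y}. *)
Lemma ray_diff_decay (m : nat) (eta : R) : exists C : R, forall y, 0 <= y ->
  nc (ray bR m (bR * y%:C) - ray bL m (bR * y%:C)) <= C * expR (- eta * y).
Proof.
have r1 : (1 : R) = 1 \/ (1 : R) = -1 by left.
have l1 : (-1 : R) = 1 \/ (-1 : R) = -1 by right.
have [C1 H1] := shift_bound m eta r1.
have [C2 H2] := shift_bound m eta l1.
exists (C1 + C2) => y y0.
pose S c k := cintegral halfline (line_form (airyG m (bR * y%:C)) ii 0 0 (c +i* 1) k).
have S0 c : S c 0 = ray (c +i* 1) m (bR * y%:C).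
  apply: cint_eq => s _; rewrite /line_form /line !mul0r !add0r; congr (_ * airyG _ _ _).
have : S 1 0 - S (-1) 0 = S 1 eta - S (-1) eta.
  apply: (@cder_0_cst _ (fun k => S 1 k - S (-1) k)) => k.
  apply: cder_eq (cderB (shift_deriv m y r1 k) (shift_deriv m y l1 k)).
  by rewrite subrr.
rewrite !S0 -/bR -/bL => ->; apply: le_trans (ncB _ _) _; rewrite mulrDl.
by apply: lerD; [exact: H1|exact: H2].
Qed.

Lemma cder_0_seg (f : R -> R[i]) (p q : R) : p <= q ->
  (forall x, p <= x <= q -> cder f x 0) -> f q = f p.
Proof.
move=> pq df.
have key (h : R -> R) : (forall x, p <= x <= q -> is_derive x (1 : R) h 0) -> h q = h p.
  move=> dh; apply/eqP; rewrite -subr_eq0 -normr_le0.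
  have := @mvt_le _ h (fun=> 0) (fun=> 0) (fun=> 0) p q pq dh.
  by rewrite subr0; apply=> // x _; rewrite normr0.
by apply: c_ext; [apply: (key (fun t => cRe (f t)))|apply: (key (fun t => cIm (f t)))] => x /df [].
Qed.

Lemma fan_line j s : line 0 ii 0 1 j s = s +i* (j * s).
Proof. by apply: c_ext => /=; ring. Qed.

Lemma fan_exponent j s x :
  cRe (ii * (line 0 ii 0 1 j s * x%:C + line 0 ii 0 1 j s ^+ 3 / 3)) =
  - (j * s * x) - (3 * j - j ^+ 3) / 3 * s ^+ 3.
Proof. by rewrite fan_line c3V !exprS expr0 /=; field. Qed.

Lemma fan_nc j s : 0 <= s -> `|j| <= 2 -> nc (line 0 ii 0 1 j s) <= 3 * (1 + s).
Proof.
move=> s0 j2; rewrite fan_line; apply: le_trans (nc_le _) _ => /=.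
rewrite normrM (ger0_norm s0).
have : `|j| * s <= 2 * s by exact: ler_wpM2r.
lra.
Qed.

Lemma fan_ray m j z :
  ray (1 +i* j) m z = cintegral halfline (line_form (airyG m z) 0 ii 0 1 j).
Proof.
apply: cint_eq => s _; rewrite /line_form fan_line; congr (_ * airyG _ _ _).
  by apply: c_ext => /=; ring.
by apply: c_ext => /=; ring.
Qed.

(** The starting point is fixed, so rotating the ray inside the sector of decay
    does not change the integral. *)
Lemma ray_rotate m j : 1 / 2 < j <= 1 -> ray bR m 0 = ray (1 +i* j) m 0.
Proof.
move=> /andP[j0 j1]; rewrite /bR !fan_ray.
apply: (@cder_0_seg (fun j => cintegral halfline (line_form (airyG m 0) 0 ii 0 1 j))) => //.
move=> k /andP[k0 k1].
have [g'' Hg''] := hol_airyG' m (0 : R[i]).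
have e8 : 0 < 1 / 8 :> R by [].
have [C [_ HC]] := @airyG_decay R m 0 0 (1 / 8) 3 e8.
apply: cder_eq (@homotopy_halfline _ _ _ _ _ _ _ _ (hol_airyG m _) Hg'' (1 / 2) (3 / 2) C k _ _).
- by rewrite mul0r oppr0.
- by apply/andP; split; lra.
move=> k' s /andP[h1 h2] s0; apply: HC => //.
  by apply: fan_nc => //; rewrite ger0_norm; lra.
rewrite -[0 : R[i]]/((0 : R)%:C) fan_exponent mulr0 oppr0 add0r mul0r add0r -!mulNr.
apply: ler_wpM2r; first exact: exprn_ge0.
have : (1 / 2) * (3 / 4) <= k' * (3 - k' ^+ 2) by apply: ler_pM; nra.
by lra.
Qed.

(** On segments of length L the rotation from the real axis costs an arc, whose
    contribution tends to 0 with L. The oscillatory integral is only defined as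
    a limit, so the comparison is made before passing to the limit. *)
Lemma airy_rotate_segment (L x : R) : 0 < L -> 0 < 2 * L ^+ 3 / 3 - L * `|x| ->
  `|cRe (cintegral `[0, L] (line_form (airyG 0 x%:C) 0 ii 0 1 1)) -
    \int[mu]_(a in `[0, L]) cos (a * x + a ^+ 3 / 3)| <=
  L / (2 * L ^+ 3 / 3 - L * `|x|).
Proof.
set c := _ - _ => L0 c0.
have L0' := ltW L0.
pose S j := cintegral `[0, L] (line_form (airyG 0 x%:C) 0 ii 0 1 j).
have -> : \int[mu]_(a in `[0, L]) cos (a * x + a ^+ 3 / 3) = cRe (S 0).
  apply: int_eq => s _; rewrite /line_form fan_line mul0r.
  rewrite /airyG expr0 mul1r mul0r add0r mul1r cexpE -[_ +i* 0]/(s%:C).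
  have -> : ii * (s%:C * x%:C + s%:C ^+ 3 / 3) = 0 +i* (s * x + s ^+ 3 / 3).
    by rewrite c3V; apply: c_ext; rewrite !exprS expr0 /=; ring.
  by rewrite /= expR0 mul1r.
pose G j := - (L / c) * expR (- c * j).
have dG j : is_derive j (1 : R) G (L * expR (- c * j)).
  apply: (is_derive_eq (@is_deriveZ _ _ _ _ (- (L / c)) j 1 _ (is_derive_expRZ (- c) j))).
  by rewrite /GRing.scale/=; field; rewrite gt_eqF.
have [g'' Hg''] := hol_airyG' 0 (x%:C).
have [C [C0 HC]] := @airyG_decay R 0 x%:C (2 * L * `|x| + 6 * L ^+ 3) 1 3 ltr01.
have dS j : -1 < j < 2 -> cder S j (line_pot (airyG 0 x%:C) 0 ii 0 1 j L -
    line_pot (airyG 0 x%:C) 0 ii 0 1 j 0).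
  move=> jb; apply: (@homotopy_segment _ _ _ _ _ _ _ _ (hol_airyG 0 _) Hg'' (-1) 2 L
     (C + 3 * C)) => //.
  move=> k s /andP[k1 k2] /andP[s0 sL].
  have k2' : `|k| <= 2 by rewrite ler_norml; apply/andP; split; lra.
  have x0 := normr_ge0 x.
  have [] := HC (line 0 ii 0 1 k s) s s0.
  - exact: fan_nc.
  - rewrite fan_exponent mul1r.
    have a1 : - (k * s * x) <= 2 * L * `|x|.
      apply: le_trans (ler_norm _) _; rewrite normrN !normrM (ger0_norm s0).
      by apply: ler_wpM2r => //; apply: ler_pM.
    have s3 : s ^+ 3 <= L ^+ 3 by rewrite lerXn2r ?nnegrE.
    have s30 : 0 <= s ^+ 3 by exact: exprn_ge0.
    have a2 : - ((3 * k - k ^+ 3) / 3 * s ^+ 3) <= 5 * s ^+ 3.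
      rewrite -mulNr; apply: ler_wpM2r => //.
      have : k ^+ 3 <= 2 ^+ 3 by exact: exprn_le_norm.
      rewrite !exprS expr0; lra.
    have a3 : 0 <= (2 * L * `|x| + 6 * L ^+ 3) * (s + s ^+ 2).
      apply: mulr_ge0; last by rewrite addr_ge0 ?sqr_ge0.
      by apply: addr_ge0; apply: mulr_ge0; rewrite ?mulr_ge0 ?exprn_ge0.
    have L3 : 0 <= L ^+ 3 by exact: exprn_ge0.
    lra.
  have es : expR (- s) <= 1 by rewrite -expR0 ler_expR oppr_le0.
  have CC : C * expR (- s) <= C by rewrite ler_piMr.
  move=> H1 H2; apply: le_trans (ncD _ _) _.
  have nii := nc_ii.
  have n1 := nc_ge0 (airyG 0 x%:C (line 0 ii 0 1 k s)).
  have n2 := nc_ge0 (airyG' 0 x%:C (line 0 ii 0 1 k s)).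
  apply: lerD.
    by rewrite ncM nii mul1r; nra.
  rewrite ncM; apply: ler_pM; rewrite ?nc_ge0//.
    apply: le_trans (ncD _ _) _; rewrite ncM nc_real nii mulr1.
    by rewrite -[1 : R[i]]/((1 : R)%:C) nc_real normr1; lra.
  rewrite ncM add0r ncM nii mul1r nc_real (ger0_norm s0); nra.
rewrite -/(S 1); apply: le_trans (_ : G 1 - G 0 <= _).
  apply: (@mvt_le _ (fun j => cRe (S j)) (fun j => cRe (line_pot (airyG 0 x%:C) 0 ii 0 1 j L -
    line_pot (airyG 0 x%:C) 0 ii 0 1 j 0)) G (fun j => L * expR (- c * j))) => //.
    move=> j /andP[j0 j1]; apply: (dS j _).1; apply/andP; split; lra.
  move=> j /andP[j0 j1]; apply: le_trans (nc_Re _) _.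
  rewrite /line_pot mulr0 addr0 mul0r subr0 add0r ncM (ncM ii) nc_ii mul1r.
  rewrite nc_real (ger0_norm L0') /airyG expr0 mul1r nc_cexp fan_exponent.
  apply: ler_wpM2l => //; rewrite ler_expR.
  have a1 : - (j * L * x) <= j * L * `|x|.
    apply: le_trans (ler_norm _) _; rewrite normrN normrM (ger0_norm _)//.
    exact: mulr_ge0.
  have a2 : 2 * j * L ^+ 3 <= (3 * j - j ^+ 3) * L ^+ 3.
    apply: ler_wpM2r; first exact: exprn_ge0.
    have : j * j ^+ 2 <= j * 1.
      by apply: ler_wpM2l => //; rewrite expr_le1.
    by rewrite -exprS; lra.
  have -> : - c * j = j * L * `|x| - (2 * j * L ^+ 3) / 3 by rewrite /c; field.
  lra.
rewrite /G mulr0 expR0 !mulr1.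
have := expR_ge0 (- c).
have : 0 <= L / c by rewrite divr_ge0// ltW.
move: (L / c) (expR _) => X Y; nra.
Qed.

(** The improper integral defining the Airy function converges, and equals the
    real part of an absolutely convergent ray integral. *)
Lemma airy_real_ray (x : R) : airy_real x = pi^-1 * cRe (ray bR 0 x%:C).
Proof.
congr (_ * _); apply: cvg_lim; first exact: norm_hausdorff.
have I : cintegrable halfline (line_form (airyG 0 x%:C) 0 ii 0 1 1).
  apply: (Cint_eq _ _ (ray_integrable e23 bR_cubic 0 x%:C)) => // s _.
  rewrite /line_form fan_line; congr (_ * airyG _ _ _).
    by apply: c_ext => /=; ring.
  by apply: c_ext => /=; ring.
have c1 : cRe (cintegral `[0, L] (line_form (airyG 0 x%:C) 0 ii 0 1 1)) @[L --> +oo] -->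
    cRe (ray bR 0 x%:C).
  by rewrite fan_ray; exact: (cvg_int_halfline I.1).
apply/cvgrPdist_le => e e0.
move/cvgrPdist_le: c1 => /(_ (e / 2)); rewrite divr_gt0// => /(_ isT) c1.
near=> L.
have H1 : `|cRe (ray bR 0 x%:C) -
  cRe (cintegral `[0, L] (line_form (airyG 0 x%:C) 0 ii 0 1 1))| <= e / 2.
  by near: L.
have L1 : 1 + 3 * `|x| + 6 / e <= L by near: L; apply: nbhs_pinfty_ge; rewrite num_real.
have x0 := normr_ge0 x.
have e6 : 0 < 6 / e by rewrite divr_gt0.
have L0 : 0 < L by lra.
have LL : L <= L ^+ 2 by rewrite expr2 ler_peMl; lra.
have L3 : 2 * L ^+ 3 / 3 - L * `|x| = L * (2 / 3 * L ^+ 2 - `|x|) by field.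
have D0 : 2 / e <= 2 / 3 * L ^+ 2 - `|x|.
  have -> : 2 / e = 6 / e / 3 by field; rewrite gt_eqF.
  lra.
have D1 : 0 < 2 / 3 * L ^+ 2 - `|x| by apply: lt_le_trans D0; rewrite divr_gt0.
have := @airy_rotate_segment L x L0; rewrite L3 mulr_gt0// => /(_ isT) H2.
have H3 : L / (L * (2 / 3 * L ^+ 2 - `|x|)) <= e / 2.
  rewrite invfM mulrA divff ?gt_eqF// mul1r -[leRHS]invrK invf_div.
  by rewrite lef_pV2 ?posrE ?divr_gt0.
have := le_trans H2 H3.
move: H1; set a := cRe _; set b := cRe _; set d := Rintegral _ _ _.
move=> h1 h2; have -> : a - d = (a - b) + (b - d) by ring.
apply: le_trans (ler_normD _ _) _; lra.
Unshelve. all: by end_near. Qed.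

End AiryDecay.

(** * Goursat and the identity theorem on the real line *)

Section ComplexDifferentiability.
Context {R : realType}.
Notation mu := (@lebesgue_measure R).
Implicit Types (x y s k e : R) (z w a b h l : R[i]) (F G : R[i] -> R[i]).

(** Complex differentiability at a point with real epsilons: easier to multiply
    and to feed to the bisection argument than the normed-module derivative. *)
Definition cdiff F z l := forall e, 0 < e -> exists2 d : R, 0 < d &
  forall h, nc h < d -> nc (F (z + h) - F z - h * l) <= e * nc h.

Lemma nc0 : nc 0 = 0 :> R. Proof. exact: ComplexField.Normc.normc0. Qed.
Lemma norm_nc z : `|z| = (nc z)%:C.
Proof. by rewrite normc_def; case: z. Qed.

Lemma pos_real (e : R[i]) : 0 < e -> exists2 e' : R, 0 < e' & e = e'%:C.
Proof.
case: e => a b; rewrite ltcE /= => /andP[/eqP -> a0]; by exists a.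
Qed.

Lemma ncBC z w : nc (z - w) = nc (w - z).
Proof. by rewrite -ncN opprB. Qed.

Lemma derivable_cdiff F z : derivable (F : R[i]^o -> R[i]^o) z 1 <-> exists l, cdiff F z l.
Proof.
split.
  move=> /cvg_ex[/= l Hl]; exists l => e e0.
  have e0C : 0 < (e%:C : R[i]) by rewrite ltcR.
  move/cvgrPdist_le: Hl => /(_ _ e0C)[/= d d0 Hd].
  have [d' d'0 dE] := pos_real d0.
  exists d' => // h hd.
  have [->|h0] := eqVneq h 0.
    by rewrite addr0 subrr mul0r subrr nc0 mulr0.
  have := Hd h; rewrite /ball_/= sub0r normrN norm_nc dE ltcR => /(_ hd h0).
  rewrite /GRing.scale/= mulr1 norm_nc lecR (addrC h) => H.
  have -> : F (z + h) - F z - h * l = - (h * (l - h^-1 * (F (z + h) - F z))).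
    by rewrite mulrBr mulVKf// opprB.
  by rewrite ncN ncM mulrC ler_wpM2r ?nc_ge0.
move=> [l Hl]; apply/cvg_ex; exists l; apply/cvgrPdist_le => e e0.
have [e' e'0 ->] := pos_real e0; have [d d0 Hd] := Hl _ e'0.
exists d%:C; first by rewrite /= ltcR.
move=> h; rewrite /ball_/= sub0r normrN norm_nc ltcR => hd h0.
rewrite /GRing.scale/= mulr1 norm_nc lecR (addrC h).
have -> : l - h^-1 * (F (z + h) - F z) = - (h^-1 * (F (z + h) - F z - h * l)).
  by rewrite [in RHS]mulrBr mulKf// opprB.
have hp : 0 < nc h.
  rewrite lt_neqAle nc_ge0 andbT eq_sym; apply: contra_neq h0.
  exact: ComplexField.Normc.eq0_normc.
rewrite ncN ncM ComplexField.Normc.normcV ler_pdivrMl// [leRHS]mulrC.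
exact: Hd.
Qed.

(** Quadratic error bounds, as produced by integrals along rays, give complex
    differentiability. *)
Lemma cdiff_quad F z l (C : R) :
  (forall h, nc h <= 1 -> nc (F (z + h) - F z - h * l) <= C * nc h ^+ 2) -> cdiff F z l.
Proof.
move=> H e e0; pose d := Num.min 1 (e / (`|C| + 1)).
have C1 : 0 < `|C| + 1 by rewrite ltr_wpDl.
exists d; first by rewrite /d lt_min ltr01 divr_gt0.
move=> h; rewrite lt_min => /andP[/ltW h1 /ltW h2].
apply: le_trans (H h h1) _; rewrite expr2 mulrA ler_wpM2r ?nc_ge0//.
move: h2; rewrite ler_pdivlMr// => h2; apply: le_trans h2; rewrite mulrC.
by apply: ler_wpM2l; rewrite ?nc_ge0//; have := ler_norm C; lra.
Qed.

Lemma cdiff_lip F z l : cdiff F z l -> exists2 d : R, 0 < d &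
  forall h, nc h < d -> nc (F (z + h) - F z) <= (nc l + 1) * nc h.
Proof.
move=> /(_ 1 ltr01)[d d0 Hd]; exists d => // h hd.
have -> : F (z + h) - F z = (F (z + h) - F z - h * l) + h * l by ring.
apply: le_trans (ncD _ _) _; rewrite ncM; have := Hd h hd; lra.
Qed.

Lemma cdiffM F G z l m : cdiff F z l -> cdiff G z m ->
  cdiff (fun z => F z * G z) z (l * G z + F z * m).
Proof.
move=> HF HG e e0.
pose K := nc (G z) + nc l + nc (F z) + nc m + 2.
have K1 : 1 <= K.
  by rewrite /K; have := nc_ge0 (G z); have := nc_ge0 l; have := nc_ge0 (F z);
     have := nc_ge0 m; lra.
have K0 : 0 < K by lra.
have e3 : 0 < e / (3 * K) by rewrite divr_gt0// mulr_gt0.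
have [d1 d10 H1] := HF _ e3; have [d2 d20 H2] := HG _ e3.
have [d3 d30 H3] := cdiff_lip HF; have [d4 d40 H4] := cdiff_lip HG.
pose d5 := e / (3 * K * K).
have d50 : 0 < d5 by rewrite divr_gt0// !mulr_gt0.
exists (Num.min (Num.min d1 d2) (Num.min (Num.min d3 d4) d5)).
  by rewrite !lt_min d10 d20 d30 d40 d50.
move=> h; rewrite !lt_min => /andP[/andP[h1 h2] /andP[/andP[h3 h4] h5]].
have -> : F (z + h) * G (z + h) - F z * G z - h * (l * G z + F z * m) =
  (F (z + h) - F z - h * l) * G z + F z * (G (z + h) - G z - h * m) +
  (F (z + h) - F z) * (G (z + h) - G z) by ring.
have nh := nc_ge0 h.
have t1 : nc ((F (z + h) - F z - h * l) * G z) <= e / 3 * nc h.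
  rewrite ncM; apply: le_trans (_ : e / (3 * K) * nc h * K <= _).
    apply: ler_pM; rewrite ?nc_ge0//; first exact: H1.
    by rewrite /K; have := nc_ge0 l; have := nc_ge0 (F z); have := nc_ge0 m; lra.
  have -> : e / (3 * K) * nc h * K = e / 3 * nc h by field; rewrite gt_eqF.
  by [].
have t2 : nc (F z * (G (z + h) - G z - h * m)) <= e / 3 * nc h.
  rewrite ncM; apply: le_trans (_ : K * (e / (3 * K) * nc h) <= _).
    apply: ler_pM; rewrite ?nc_ge0//; last exact: H2.
    by rewrite /K; have := nc_ge0 l; have := nc_ge0 (G z); have := nc_ge0 m; lra.
  have -> : K * (e / (3 * K) * nc h) = e / 3 * nc h by field; rewrite gt_eqF.
  by [].
have t3 : nc ((F (z + h) - F z) * (G (z + h) - G z)) <= e / 3 * nc h.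
  rewrite ncM; apply: le_trans (_ : (K * nc h) * (K * nc h) <= _).
    apply: ler_pM; rewrite ?nc_ge0//.
      apply: le_trans (H3 h h3) _; apply: ler_wpM2r => //.
      by rewrite /K; have := nc_ge0 (F z); have := nc_ge0 (G z); have := nc_ge0 m; lra.
    apply: le_trans (H4 h h4) _; apply: ler_wpM2r => //.
    by rewrite /K; have := nc_ge0 (F z); have := nc_ge0 (G z); have := nc_ge0 l; lra.
  rewrite mulrA; apply: ler_wpM2r => //.
  have -> : K * nc h * K = nc h * (3 * K * K) / 3 by field.
  by apply: ler_wpM2r => //; move: (ltW h5); rewrite ler_pdivlMr// !mulr_gt0.
apply: le_trans (ncD _ _) _; apply: le_trans (lerD (ncD _ _) (lexx _)) _.
have -> : e * nc h = e / 3 * nc h + e / 3 * nc h + e / 3 * nc h by field.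
lra.
Qed.

Lemma cdiff_gauss (c : R[i]) z : cdiff (fun z => cexp (c * z ^+ 2)) z
  (2 * c * z * cexp (c * z ^+ 2)).
Proof.
pose M := nc c * (2 * nc z + 1).
have M0 : 0 <= M by rewrite mulr_ge0 ?nc_ge0// addr_ge0// mulr_ge0 ?nc_ge0.
apply: (@cdiff_quad _ _ _ (expR (cRe (c * z ^+ 2)) * (2 * (M ^+ 2 * expR M) + nc c))) => h h1.
pose w := c * h * (2 * z + h).
have -> : cexp (c * (z + h) ^+ 2) = cexp (c * z ^+ 2) * cexp w.
  by rewrite -cexpD; congr cexp; rewrite /w; ring.
have -> : cexp (c * z ^+ 2) * cexp w - cexp (c * z ^+ 2) - h * (2 * c * z * cexp (c * z ^+ 2)) =
   cexp (c * z ^+ 2) * ((cexp w - 1 - w) + c * h ^+ 2) by rewrite /w; ring.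
rewrite ncM nc_cexp -mulrA; apply: ler_wpM2l; first exact: expR_ge0.
have nh := nc_ge0 h; have nz := nc_ge0 z; have ncc := nc_ge0 c.
have wM : nc w <= M * nc h.
  rewrite /w /M !ncM mulrAC; apply: ler_wpM2r => //; apply: ler_wpM2l => //.
  apply: le_trans (ncD _ _) _; rewrite ncM -[nc 2]/(nc (2%:R : R[i])).
  have -> : (2 : R[i]) = (2 : R)%:C by rewrite rmorph_nat.
  by rewrite nc_real ger0_norm//; lra.
have wM1 : nc w <= M by apply: le_trans wM _; rewrite ler_piMr.
apply: le_trans (ncD _ _) _; rewrite mulrDl; apply: lerD.
  apply: le_trans (cexp_quad w) _.
  have -> : 2 * (M ^+ 2 * expR M) * nc h ^+ 2 = 2 * ((M * nc h) ^+ 2 * expR M) by ring.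
  apply: ler_wpM2l => //; apply: ler_pM; rewrite ?sqr_ge0 ?expR_ge0 ?ler_expR//.
  by rewrite ler_pXn2r ?nnegrE ?nc_ge0// mulr_ge0.
by rewrite ncM ncX.
Qed.

Lemma cdiff_ccont F a b : (forall z, exists l, cdiff F z l) ->
  ccont (fun s => F (a + b * s%:C)).
Proof.
move=> HF.
have key x e : 0 < e -> \forall y \near x, nc (F (a + b * x%:C) - F (a + b * y%:C)) <= e.
  move=> e0; have [l Hl] := HF (a + b * x%:C); have [d d0 Hd] := cdiff_lip Hl.
  pose M := (nc l + 1) * (nc b + 1).
  have M0 : 0 < M by rewrite mulr_gt0 ?ltr_wpDl ?nc_ge0.
  have nb : 0 < nc b + 1 by rewrite ltr_wpDl ?nc_ge0.
  near=> y.
  have hy1 : `|x - y| <= e / M by near: y; apply: cvgr_dist_le; [exact: cvg_id|rewrite divr_gt0].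
  have hy2 : `|x - y| <= d / 2 / (nc b + 1).
    by near: y; apply: cvgr_dist_le; [exact: cvg_id|rewrite divr_gt0// divr_gt0].
  have E : a + b * y%:C = (a + b * x%:C) + b * (y - x)%:C by rewrite rmorphB/=; ring.
  have nE : nc (b * (y - x)%:C) = nc b * `|x - y| by rewrite ncM nc_real distrC.
  have n1 := normr_ge0 (x - y); have n2 := nc_ge0 b; have n3 := nc_ge0 l.
  rewrite ncBC E; apply: le_trans (Hd _ _) _.
    rewrite nE; move: hy2; rewrite ler_pdivlMr// => hy2.
    by apply: (@le_lt_trans _ _ (d / 2)); [nra|lra].
  rewrite nE; move: hy1; rewrite ler_pdivlMr// /M => hy1; nra.
split => x; apply/cvgrPdist_le => e e0; near=> y.
  rewrite -cReN -cReD; apply: le_trans (nc_Re _) _; near: y; exact: key.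
rewrite -cImN -cImD; apply: le_trans (nc_Im _) _; near: y; exact: key.
Unshelve. all: by end_near. Qed.

Lemma ccont_Cint f (p q : R) : ccont f -> cintegrable `[p, q] f.
Proof. by move=> [c1 c2]; split; exact: Lint_segment. Qed.

Lemma int_split (f : R -> R) (p q r : R) : p <= q <= r -> Lint `[p, r] f ->
  \int[mu]_(x in `[p, r]) f x = \int[mu]_(x in `[p, q]) f x + \int[mu]_(x in `[q, r]) f x.
Proof.
move=> /andP[pq qr] If; apply/eqP; rewrite addrC -subr_eq.
rewrite Rintegral_itvB ?bnd_simp//.
rewrite Rintegral_itv_obnd_cbnd//; apply: integrableS If => //.
by move=> x /=; rewrite !in_itv/= => /andP[h1 ->]; rewrite andbT (le_trans pq)// ltW.
Qed.

Lemma cint_split f (p q r : R) : p <= q <= r -> ccont f ->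
  cintegral `[p, r] f = cintegral `[p, q] f + cintegral `[q, r] f.
Proof.
move=> pqr [c1 c2]; apply: c_ext => /=.
  by apply: int_split => //; exact: Lint_segment.
by apply: int_split => //; exact: Lint_segment.
Qed.

Lemma int_cst (p q c : R) : p <= q -> \int[mu]_(x in `[p, q]) c = (q - p) * c.
Proof.
move=> pq; have H x : is_derive x (1 : R) (fun y => c * y) c.
  apply: (is_derive_eq (@is_deriveZ _ _ _ id c x 1 1 (is_derive_id _ _))).
  by rewrite /GRing.scale/= mulr1.
rewrite (@FTC_segment _ (fun y => c * y) (fun=> c))//; first by ring.
by move=> x; exact: cvg_cst.
Qed.

Lemma nc_cint_segment f (p q K : R) : p <= q -> ccont f ->
  (forall x, p <= x <= q -> nc (f x) <= K) ->
  nc (cintegral `[p, q] f) <= 2 * ((q - p) * K).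
Proof.
move=> pq cf H; rewrite -int_cst//; apply: nc_cint => //.
  exact: ccont_Cint.
by apply: Lint_segment => x; exact: cvg_cst.
Qed.

Section Goursat.
Variable F : R[i] -> R[i].
Hypothesis HF : forall z, exists l, cdiff F z l.

(** Integral of F along the boundary of the rectangle [p, q] x [r, t]. *)
Definition rect_int (G : R[i] -> R[i]) (p q r t : R) : R[i] :=
  cintegral `[p, q] (fun x => G (x +i* r) - G (x +i* t)) +
  ii * cintegral `[r, t] (fun y => G (q +i* y) - G (p +i* y)).

Lemma horizontal r : ccont (fun x => F (x +i* r)).
Proof.
have := cdiff_ccont (0 +i* r) 1 HF.
rewrite (_ : (fun s => F (0 +i* r + 1 * s%:C)) = (fun x => F (x +i* r)))//.
by apply/funext => x; congr F; apply: c_ext => /=; ring.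
Qed.

Lemma vertical p : ccont (fun y => F (p +i* y)).
Proof.
have := cdiff_ccont (p +i* 0) ii HF.
rewrite (_ : (fun s => F (p +i* 0 + ii * s%:C)) = (fun y => F (p +i* y)))//.
by apply/funext => x; congr F; apply: c_ext => /=; ring.
Qed.

Lemma ccontB (f g : R -> R[i]) : ccont f -> ccont g -> ccont (fun x => f x - g x).
Proof.
move=> [f1 f2] [g1 g2]; split => x.
  under eq_fun do rewrite cReD cReN.
  by apply: cvgB; [exact: f1|exact: g1].
under eq_fun do rewrite cImD cImN.
by apply: cvgB; [exact: f2|exact: g2].
Qed.

Lemma rect_intE p q r t : rect_int F p q r t =
  cintegral `[p, q] (fun x => F (x +i* r)) - cintegral `[p, q] (fun x => F (x +i* t)) +
  ii * (cintegral `[r, t] (fun y => F (q +i* y)) - cintegral `[r, t] (fun y => F (p +i* y))).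
Proof.
by rewrite /rect_int !cintB//; apply: ccont_Cint;
   first [exact: horizontal|exact: vertical].
Qed.

Lemma rect_int_h p q r t m : p <= m <= q -> r <= t ->
  rect_int F p q r t = rect_int F p m r t + rect_int F m q r t.
Proof.
move=> pmq rt; rewrite !rect_intE !(cint_split pmq); try exact: horizontal.
by ring.
Qed.

Lemma rect_int_v p q r t m : r <= m <= t ->
  rect_int F p q r t = rect_int F p q r m + rect_int F p q m t.
Proof.
move=> rmt; rewrite !rect_intE !(cint_split rmt); try exact: vertical.
by ring.
Qed.

Definition rect := (R * R * R * R)%type.
Definition rint (Q : rect) := let: (p, q, r, t) := Q in rect_int F p q r t.
Definition half_of (Q Q' : rect) : Prop :=
  let: (p, q, r, t) := Q in let: (p', q', r', t') := Q' in
  [/\ p <= p', q' <= q, r <= r', t' <= t &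
      [/\ q' - p' = (q - p) / 2, t' - r' = (t - r) / 2 & nc (rint Q) <= 4 * nc (rint Q')]].

Lemma quarter (Q : rect) : let: (p, q, r, t) := Q in p <= q -> r <= t ->
  exists Q', half_of Q Q'.
Proof.
case: Q => [[[p q] r] t] pq rt.
pose m := (p + q) / 2; pose n := (r + t) / 2.
have pmq : p <= m <= q by apply/andP; split; rewrite /m; lra.
have rnt : r <= n <= t by apply/andP; split; rewrite /n; lra.
have E : rect_int F p q r t = rect_int F p m r n + rect_int F p m n t +
    (rect_int F m q r n + rect_int F m q n t).
  by rewrite (rect_int_h pmq rt) (rect_int_v p m rnt) (rect_int_v m q rnt).
have H : nc (rect_int F p q r t) <= nc (rect_int F p m r n) + nc (rect_int F p m n t) +
   (nc (rect_int F m q r n) + nc (rect_int F m q n t)).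
  rewrite E; apply: le_trans (ncD _ _) _; apply: lerD; exact: ncD.
move: pmq rnt => /andP[pm mq] /andP[rn nt].
have hm : m - p = (q - p) / 2 /\ q - m = (q - p) / 2 by rewrite /m; split; field.
have hn : n - r = (t - r) / 2 /\ t - n = (t - r) / 2 by rewrite /n; split; field.
case: hm => hm1 hm2; case: hn => hn1 hn2.
pose T := nc (rect_int F p q r t).
have [h|h1] := leP T (4 * nc (rect_int F p m r n)).
  by exists (p, m, r, n); split => //; split.
have [h|h2] := leP T (4 * nc (rect_int F p m n t)).
  by exists (p, m, n, t); split => //; split.
have [h|h3] := leP T (4 * nc (rect_int F m q r n)).
  by exists (m, q, r, n); split => //; split.
have [h|h4] := leP T (4 * nc (rect_int F m q n t)).
  by exists (m, q, n, t); split => //; split.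
by exfalso; move: H; rewrite -/T; lra.
Qed.

Lemma affine_int (c0 c1 c : R[i]) p q r t : p <= q -> r <= t ->
  rect_int (fun z => c0 + (z - c) * c1) p q r t = 0.
Proof.
move=> pq rt; rewrite /rect_int.
have cst_int (d : R[i]) (u v : R) : u <= v -> cintegral `[u, v] (fun=> d) = (v - u)%:C * d.
  by case: d => d1 d2 uv; apply: c_ext; rewrite /cintegral /= int_cst//; ring.
rewrite (@cint_eq _ _ _ (fun=> ((0 +i* r) - (0 +i* t)) * c1)); last first.
  move=> x _; rewrite (_ : x +i* r = (0 +i* r) + x%:C); last by apply: c_ext => /=; ring.
  by rewrite (_ : x +i* t = (0 +i* t) + x%:C); [ring|apply: c_ext => /=; ring].
rewrite [X in _ + _ * X](@cint_eq _ _ _ (fun=> (q%:C - p%:C) * c1)); last first.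
  move=> y _; rewrite (_ : p +i* y = p%:C + 0 +i* y); last by apply: c_ext => /=; ring.
  by rewrite (_ : q +i* y = q%:C + 0 +i* y); [ring|apply: c_ext => /=; ring].
rewrite !cst_int// mulrA mulrA mulrA -mulrDl.
have -> : (q - p)%:C * (0 +i* r - 0 +i* t) + ii * (t - r)%:C * (q%:C - p%:C) = 0.
  by apply: c_ext => /=; ring.
by rewrite mul0r.
Qed.

(** On a small rectangle F is affine up to e times the diameter, and affine
    functions have zero boundary integral. *)
Lemma goursat_est (c l : R[i]) (e d p q r t : R) : p <= q -> r <= t ->
  p <= cRe c <= q -> r <= cIm c <= t -> 0 <= e ->
  d = (q - p) + (t - r) ->
  (forall h, nc h <= d -> nc (F (c + h) - F c - h * l) <= e * nc h) ->
  nc (rect_int F p q r t) <= 4 * e * d ^+ 2.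
Proof.
move=> pq rt /andP[c1 c2] /andP[c3 c4] e0 dE H.
pose A z := F c + (z - c) * l.
have HA z : exists l, cdiff A z l.
  exists l; apply: (@cdiff_quad _ _ _ 0) => h _.
  rewrite (_ : A (z + h) - A z - h * l = 0) ?nc0 ?mul0r//.
  by rewrite /A; ring.
have d0 : 0 <= d by lra.
have small x y : p <= x <= q -> r <= y <= t -> nc (F (x +i* y) - A (x +i* y)) <= e * d.
  move=> /andP[x1 x2] /andP[y1 y2].
  have hd : nc (x +i* y - c) <= d.
    apply: le_trans (nc_le _) _; rewrite cReD cImD cReN cImN /=.
    by rewrite dE; apply: lerD; rewrite ler_norml; apply/andP; split; lra.
  have := H _ hd; rewrite (addrC c) subrK => H'.
  have -> : F (x +i* y) - A (x +i* y) = F (x +i* y) - F c - (x +i* y - c) * l by rewrite /A; ring.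
  by apply: le_trans H' _; exact: ler_wpM2l.
have cA1 y : ccont (fun x => A (x +i* y)).
  have := cdiff_ccont (0 +i* y) 1 HA.
  rewrite (_ : (fun s => A (0 +i* y + 1 * s%:C)) = (fun x => A (x +i* y)))//.
  by apply/funext => x; congr A; apply: c_ext => /=; ring.
have cA2 x : ccont (fun y => A (x +i* y)).
  have := cdiff_ccont (x +i* 0) ii HA.
  rewrite (_ : (fun s => A (x +i* 0 + ii * s%:C)) = (fun y => A (x +i* y)))//.
  by apply/funext => y; congr A; apply: c_ext => /=; ring.
have fin1 y (u v : R) : cintegrable `[u, v] (fun x => F (x +i* y)) by apply: ccont_Cint; exact: horizontal.
have fin2 y (u v : R) : cintegrable `[u, v] (fun x => A (x +i* y)) by apply: ccont_Cint; exact: cA1.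
have fin3 y (u v : R) : cintegrable `[u, v] (fun x => F (y +i* x)) by apply: ccont_Cint; exact: vertical.
have fin4 y (u v : R) : cintegrable `[u, v] (fun x => A (y +i* x)) by apply: ccont_Cint; exact: cA2.
have -> : rect_int F p q r t =
  cintegral `[p, q] (fun x => (F (x +i* r) - F (x +i* t)) - (A (x +i* r) - A (x +i* t))) +
  ii * cintegral `[r, t] (fun y => (F (q +i* y) - F (p +i* y)) - (A (q +i* y) - A (p +i* y))).
  rewrite !cintB//; try (by apply: CintB).
  have := affine_int (F c) l c pq rt; rewrite -/A /rect_int.
  rewrite !cintB//; try (by apply: CintB).
  move=> E0; rewrite -[LHS]subr0 -E0; ring.
have qq : p <= q <= q by rewrite pq lexx.
have pp : p <= p <= q by rewrite pq lexx.
have rr : r <= r <= t by rewrite rt lexx.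
have tt' : r <= t <= t by rewrite rt lexx.
apply: le_trans (ncD _ _) _; rewrite ncM nc_ii mul1r.
have -> : 4 * e * d ^+ 2 = 2 * ((q - p) * (2 * (e * d))) + 2 * ((t - r) * (2 * (e * d))).
  by rewrite dE; ring.
apply: lerD; apply: nc_cint_segment => //.
- by apply: ccontB; apply: ccontB => //; exact: horizontal.
- move=> x hx; have -> : (F (x +i* r) - F (x +i* t)) - (A (x +i* r) - A (x +i* t)) =
    (F (x +i* r) - A (x +i* r)) - (F (x +i* t) - A (x +i* t)) by ring.
  apply: le_trans (ncB _ _) _; have := small _ _ hx rr; have := small _ _ hx tt'; lra.
- by apply: ccontB; apply: ccontB => //; exact: vertical.
- move=> x hx; have -> : (F (q +i* x) - F (p +i* x)) - (A (q +i* x) - A (p +i* x)) =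
    (F (q +i* x) - A (q +i* x)) - (F (p +i* x) - A (p +i* x)) by ring.
  apply: le_trans (ncB _ _) _; have := small _ _ qq hx; have := small _ _ pp hx; lra.
Qed.

(** The common point of nested intervals, obtained from the supremum of the left
    end points. *)
Lemma nested (a b : nat -> R) : (forall n, a n <= a n.+1) -> (forall n, b n.+1 <= b n) ->
  (forall n, a n <= b n) -> exists c, forall n, a n <= c <= b n.
Proof.
move=> ai bd ab.
have am (n k : nat) : a n <= a (n + k)%N.
  by elim: k => [|k IH]; rewrite ?addn0// addnS (le_trans IH).
have bm (n k : nat) : b (n + k)%N <= b n.
  by elim: k => [|k IH]; rewrite ?addn0// addnS (le_trans (bd _)).
have anb n m : a n <= b m.
  by apply: le_trans (am n m) _; apply: le_trans (ab _) _; rewrite addnC; exact: bm.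
have hs : has_sup (range a).
  by split; [exists (a 0%N), 0%N|exists (b 0%N) => _ [n _ <-]].
exists (sup (range a)) => n; apply/andP; split.
  by apply: ub_le_sup; [exact: hs.2|exists n].
by apply: sup_le_ub; [exact: hs.1|move=> _ [m _ <-]].
Qed.

(** Bisection: if the boundary integral were not 0, one of the four quarters
    would carry at least a quarter of it, at every scale; at the common point of
    the nested quarters this contradicts differentiability. *)
Theorem goursat p q r t : p <= q -> r <= t -> rect_int F p q r t = 0.
Proof.
move=> pq rt; apply: ComplexField.Normc.eq0_normc; apply/eqP.
rewrite eq_le nc_ge0 andbT leNgt; apply/negP => M0.
set M := nc _ in M0.
pose good (Q : rect) := let: (p, q, r, t) := Q in p <= q /\ r <= t.
have nextP (Q : rect) : exists Q', good Q -> half_of Q Q' /\ good Q'.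
  move: Q => [[[p1 q1] r1] t1].
  have [[h1 h2]|nQ] := pselect (p1 <= q1 /\ r1 <= t1); last by exists (p1, q1, r1, t1).
  have [Q' HQ'] := quarter (p1, q1, r1, t1) h1 h2.
  exists Q' => _; split => //; move: Q' HQ' => [[[p2 q2] r2] t2] [_ _ _ _ [e1 e2 _]].
  by split; lra.
have [next Hnext] := choice nextP.
pose Q n := iter n next (p, q, r, t).
have gQ n : good (Q n) by elim: n => [|n IH] //; exact: (Hnext _ IH).2.
have hQ n : half_of (Q n) (Q n.+1) by exact: (Hnext _ (gQ n)).1.
pose P n := (Q n).1.1.1; pose Qq n := (Q n).1.1.2; pose Rr n := (Q n).1.2; pose T n := (Q n).2.
have QE n : Q n = (P n, Qq n, Rr n, T n).
  by rewrite /P /Qq /Rr /T; case: (Q n) => [[[? ?] ?] ?].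
have h n : [/\ P n <= P n.+1, Qq n.+1 <= Qq n, Rr n <= Rr n.+1, T n.+1 <= T n &
      [/\ Qq n.+1 - P n.+1 = (Qq n - P n) / 2, T n.+1 - Rr n.+1 = (T n - Rr n) / 2 &
       nc (rint (Q n)) <= 4 * nc (rint (Q n.+1))]].
  by have := hQ n; rewrite (QE n) (QE n.+1).
have g n : P n <= Qq n /\ Rr n <= T n by have := gQ n; rewrite (QE n).
have [cx Hx] : exists c, forall n, P n <= c <= Qq n.
  by apply: nested => n; [case: (h n)|case: (h n)|case: (g n)].
have [cy Hy] : exists c, forall n, Rr n <= c <= T n.
  by apply: nested => n; [case: (h n)|case: (h n)|case: (g n)].
pose d := (q - p) + (t - r).
have dn n : (Qq n - P n) + (T n - Rr n) = d / 2 ^+ n.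
  elim: n => [|n IH]; first by rewrite expr0 divr1.
  case: (h n) => _ _ _ _ [e1 e2 _]; rewrite e1 e2 -mulrDl IH exprS.
  by field; rewrite expf_neq0.
have Mn n : M <= 4 ^+ n * nc (rint (Q n)).
  elim: n => [|n IH]; first by rewrite expr0 mul1r.
  case: (h n) => _ _ _ _ [_ _ e3]; apply: le_trans IH _; rewrite exprSr -mulrA.
  by apply: ler_wpM2l => //; exact: exprn_ge0.
have d0 : 0 <= d by rewrite /d; lra.
have [l Hl] := HF (cx +i* cy).
have D0 : 0 < 8 * (d ^+ 2 + 1) by rewrite mulr_gt0// ltr_wpDl ?sqr_ge0.
have e0 : 0 < M / (8 * (d ^+ 2 + 1)) by rewrite divr_gt0.
have [dl dl0 Hdl] := Hl _ e0.
have [n Hn] : exists n, d / 2 ^+ n < dl.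
  have [n Hn] : exists n : nat, d / dl < n%:R.
    by exists (Num.bound (d / dl)); apply: archi_boundP; rewrite divr_ge0// ltW.
  exists n; rewrite ltr_pdivrMr ?exprn_gt0// mulrC -ltr_pdivrMr//.
  apply: lt_trans Hn _; rewrite -natrX ltr_nat; exact: ltn_expl.
have := @goursat_est (cx +i* cy) l _ _ _ _ _ _ (g n).1 (g n).2 (Hx n) (Hy n) (ltW e0)
  (esym (dn n)).
have -> : rect_int F (P n) (Qq n) (Rr n) (T n) = rint (Q n) by rewrite (QE n).
move=> H; have {}H : nc (rint (Q n)) <= 4 * (M / (8 * (d ^+ 2 + 1))) * (d / 2 ^+ n) ^+ 2.
  by apply: H => h' hd; apply: Hdl; apply: le_lt_trans Hn.
have := Mn n; apply/negP; rewrite -ltNge.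
have p4 : 0 < 4 ^+ n :> R by rewrite exprn_gt0.
apply: le_lt_trans (ler_wpM2l (ltW p4) H) _.
have W0 : d ^+ 2 + 1 != 0 by rewrite gt_eqF// ltr_wpDl ?sqr_ge0.
have X0 : 2 ^+ n != 0 :> R by rewrite expf_neq0.
have -> : 4 ^+ n * (4 * (M / (8 * (d ^+ 2 + 1))) * (d / 2 ^+ n) ^+ 2) =
   M / 2 * (d ^+ 2 / (d ^+ 2 + 1)).
  have -> : 4 ^+ n = (2 ^+ n) ^+ 2 :> R by rewrite -!natrX -expnM mulnC expnM.
  by field; rewrite X0 W0.
have : d ^+ 2 / (d ^+ 2 + 1) <= 1.
  by rewrite ler_pdivrMr ?ltr_wpDl ?sqr_ge0//; lra.
have : 0 <= d ^+ 2 / (d ^+ 2 + 1).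
  by rewrite divr_ge0 ?addr_ge0 ?sqr_ge0.
move: (d ^+ 2 / (d ^+ 2 + 1)) => X; nra.
Qed.

End Goursat.

Lemma cont_bounded (f : R -> R[i]) (p q : R) : ccont f -> exists M : R, 0 <= M /\
  forall x, p <= x <= q -> nc (f x) <= M.
Proof.
move=> [c1 c2].
have [pq|qp] := leP p q; last first.
  by exists 0; split => // x /andP[h1 h2]; exfalso; lra.
have key (g : R -> R) : continuous g -> exists M : R, forall x, p <= x <= q -> g x <= M.
  move=> cg; have [c _ Hc] := @EVT_max R g p q pq (continuous_subspaceT cg).
  by exists (g c) => x hx; apply: Hc; rewrite in_itv.
have nk (g : R -> R) : continuous g -> exists M : R, forall x, p <= x <= q -> `|g x| <= M.
  move=> cg; have [M1 H1] := key _ cg.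
  have [M2 H2] : exists M : R, forall x, p <= x <= q -> - g x <= M.
    by apply: key => x; apply: cvgN; exact: cg.
  exists (Num.max M1 M2) => x hx; rewrite ler_norml le_max (H1 x hx) andbT.
  by rewrite lerNl le_max (H2 x hx) orbT.
have [M1 H1] := nk _ c1; have [M2 H2] := nk _ c2.
exists (`|M1| + `|M2|); split; first by rewrite addr_ge0.
move=> x hx; apply: le_trans (nc_le _) _; apply: lerD.
  by apply: le_trans (H1 x hx) (ler_norm _).
by apply: le_trans (H2 x hx) (ler_norm _).
Qed.

(** Against the narrow Gaussians e^{-N z^2}, which are entire and exponentially
    small on the other sides of the rectangle, the integral over the top side
    of a rectangle whose bottom side lies in the zero set must vanish. *)
Lemma zero_above (F : R[i] -> R[i]) (H : R) : 0 < H ->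
  (forall z, exists l, cdiff F z l) -> (forall x, F (x +i* (- H)) = 0) -> F 0 = 0.
Proof.
move=> H0 HF F0.
pose L := H + 1; have L0 : 0 < L by rewrite /L; lra.
pose G (N : R) (z : R[i]) := cexp (- N%:C * z ^+ 2).
pose FG N z := F z * G N z.
have HFG N z : exists l, cdiff (FG N) z l.
  by have [l Hl] := HF z; eexists; apply: cdiffM Hl (cdiff_gauss _ _).
have nG N x y : nc (G N (x +i* y)) = expR (- N * (x ^+ 2 - y ^+ 2)).
  by rewrite nc_cexp; congr expR; rewrite expr2 /=; ring.
have [M1 [M10 HM1]] := cont_bounded (- H) 0 (vertical HF L).
have [M2 [M20 HM2]] := cont_bounded (- H) 0 (vertical HF (- L)).
have [M3 [M30 HM3]] := cont_bounded (- L) L (horizontal HF 0).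
pose f x := F (x +i* 0).
pose g N x := expR (- N * x ^+ 2).
have FGtop N x : FG N (x +i* 0) = (g N x)%:C * f x.
  rewrite /FG /G cexpE mulrC; congr (_ * _).
  have -> : - N%:C * (x +i* 0) ^+ 2 = (- N * x ^+ 2)%:C.
    by apply: c_ext; rewrite !expr2 /=; ring.
  by rewrite /= cos0 sin0 mulr0 mulr1.
pose C := 2 * (H * (M1 + M2)).
have top N : 0 < N -> nc (cintegral `[- L, L] (fun x => FG N (x +i* 0))) <= C * expR (- N).
  move=> N0.
  have := goursat (HFG N) (p := - L) (q := L) (r := - H) (t := 0).
  rewrite (rect_intE (HFG N)) => gr.
  have {gr} := gr ltac:(lra) ltac:(lra).
  rewrite (@cint_eq _ _ (fun x => FG N (x +i* (- H))) (fun=> 0)); last first.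
    by move=> x _; rewrite /FG F0 mul0r.
  have -> : cintegral `[- L, L] (fun=> (0 : R[i])) = 0.
    by apply: c_ext; rewrite /cintegral /= int_cst ?mulr0//; lra.
  rewrite sub0r => /eqP; rewrite addrC subr_eq0 => /eqP <-.
  rewrite ncM nc_ii mul1r -cintB//; [|exact: ccont_Cint (vertical (HFG N) _)..].
  have -> : C * expR (- N) = 2 * ((0 - - H) * ((M1 + M2) * expR (- N))) by rewrite /C; ring.
  apply: nc_cint_segment; first lra.
    apply: ccontB; exact: vertical (HFG N) _.
  move=> y hy; apply: le_trans (ncB _ _) _; rewrite mulrDl.
  have Gb x : x ^+ 2 = L ^+ 2 -> nc (G N (x +i* y)) <= expR (- N).
    move=> xL; rewrite nG xL ler_expR.
    have yH : y ^+ 2 <= H ^+ 2.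
      apply: exprn_le_norm; rewrite ler_norml; move: hy => /andP[? ?].
      by apply/andP; split; lra.
    have : 1 <= L ^+ 2 - y ^+ 2 by rewrite /L sqrrD1; nra.
    by move: (L ^+ 2 - y ^+ 2) => X X1; nra.
  apply: lerD; rewrite ncM; apply: ler_pM; rewrite ?nc_ge0//.
  - exact: HM1.
  - exact: Gb.
  - exact: HM2.
  - by apply: Gb; rewrite sqrrN.
apply: ComplexField.Normc.eq0_normc; apply/eqP; rewrite eq_le nc_ge0 andbT leNgt.
apply/negP => eta0; set eta := nc (F 0) in eta0.
have [l Hl] := HF 0; have [d d0 Hd] := cdiff_lip Hl.
pose e := Num.min (d / 2) (eta / (4 * (nc l + 1))).
have l1 : 0 < nc l + 1 by rewrite ltr_wpDl ?nc_ge0.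
have e0 : 0 < e by rewrite lt_min !divr_gt0// mulr_gt0.
have close x : `|x| <= e -> nc (f x - F 0) <= eta / 4.
  rewrite le_min => /andP[h1 h2]; have := Hd x%:C; rewrite nc_real add0r => H1.
  apply: le_trans (H1 _) _; first lra.
  by move: h2; rewrite ler_pdivlMr ?mulr_gt0//; lra.
have gc N : continuous (g N).
  have h x : is_derive x (1 : R) (fun x => - N * x ^+ 2) (- N * (2 * x)).
    apply: (is_derive_eq (@is_deriveZ _ _ _ (fun x => x ^+ 2) (- N) x 1 _ _)).
    by rewrite /GRing.scale/=; ring.
  by apply: (@derive_contT _ _ (fun x => expR (- N * x ^+ 2) * (- N * (2 * x)))) => x;
     exact: (@is_derive1_comp R expR _ x _ _ (is_derive_expR _) (h x)).
pose A N := \int[mu]_(x in `[- L, L]) g N x.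
have g0 N x : 0 <= g N x by exact: expR_ge0.
have lower N : 0 < N -> eta / 2 * A N <= (C + 16 * L * M3) * expR (- (N * Num.min 1 (e ^+ 2))).
  move=> N0; set m := Num.min _ _.
  have e20 : 0 < e ^+ 2 by exact: exprn_gt0.
  have cgC : ccont (fun x => (g N x)%:C) by split => //= x; exact: cvg_cst.
  have cf : ccont f := horizontal HF 0.
  have I1 : cintegrable `[- L, L] (fun x => (g N x)%:C) by exact: ccont_Cint.
  have I2 : cintegrable `[- L, L] (fun x => (g N x)%:C * (f x - F 0)).
    apply: ccont_Cint; apply: ccontM => //; apply: ccontB => //.
    by split => x; exact: cvg_cst.
  have split : cintegral `[- L, L] (fun x => FG N (x +i* 0)) =
     F 0 * cintegral `[- L, L] (fun x => (g N x)%:C) +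
     cintegral `[- L, L] (fun x => (g N x)%:C * (f x - F 0)).
    rewrite -cintZ// -cintD//; last exact: CintZ.
    by apply: cint_eq => x _; rewrite FGtop; ring.
  have nA : nc (F 0 * cintegral `[- L, L] (fun x => (g N x)%:C)) = eta * A N.
    rewrite ncM; congr (_ * _).
    have -> : cintegral `[- L, L] (fun x => (g N x)%:C) = (A N)%:C.
      by apply: c_ext => //=; rewrite int_cst ?mulr0//; lra.
    by rewrite nc_real ger0_norm// /A; apply: Rintegral_ge0.
  have rem : nc (cintegral `[- L, L] (fun x => (g N x)%:C * (f x - F 0))) <=
      2 * (eta / 4 * A N + (L - - L) * (2 * M3 * 2 * expR (- (N * m)))).
    rewrite -int_cst; last lra.
    rewrite -RintegralZl//; last exact: Lint_segment.
    have LI : Lint `[- L, L] (fun x => eta / 4 * g N x).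
      by apply: LintZ => //; exact: Lint_segment.
    rewrite -RintegralD//; last by apply: Lint_segment => x; exact: cvg_cst.
    apply: nc_cint => //.
      by apply: LintD => //; apply: Lint_segment => x; exact: cvg_cst.
    move=> x; rewrite /= in_itv/= => hx; rewrite ncM nc_real ger0_norm//.
    have ex0 := expR_ge0 (- (N * m)).
    have [xe|xe] := leP `|x| e.
      have := close x xe; have := g0 N x; have : 0 <= 2 * M3 * 2 * expR (- (N * m)) by rewrite !mulr_ge0.
      by move: (nc _) (g N x) => X Y; nra.
    have gm : g N x <= expR (- (N * m)).
      rewrite ler_expR mulNr lerN2 ler_wpM2l ?(ltW N0)// /m ge_min.
      apply/orP; right; rewrite -(real_normK (num_real x)) ler_pXn2r ?nnegrE//; exact: ltW.
    have fb : nc (f x - F 0) <= 2 * M3.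
      apply: le_trans (ncB _ _) _.
      have := HM3 x hx; have : nc (F 0) <= M3 by apply: (HM3 0); apply/andP; split; lra.
      by rewrite -/(f x); lra.
    have : g N x * nc (f x - F 0) <= expR (- (N * m)) * (2 * M3).
      by apply: ler_pM => //; exact: nc_ge0.
    have : 0 <= eta / 4 * g N x by rewrite mulr_ge0// divr_ge0// ltW.
    have : 0 <= M3 * expR (- (N * m)) by rewrite mulr_ge0.
    lra.
  have tp := top N N0.
  have tri : eta * A N <= nc (cintegral `[- L, L] (fun x => FG N (x +i* 0))) +
     nc (cintegral `[- L, L] (fun x => (g N x)%:C * (f x - F 0))).
    rewrite -nA; have -> : F 0 * cintegral `[- L, L] (fun x => (g N x)%:C) =
      cintegral `[- L, L] (fun x => FG N (x +i* 0)) -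
      cintegral `[- L, L] (fun x => (g N x)%:C * (f x - F 0)) by rewrite split; ring.
    exact: ncB.
  have em : expR (- N) <= expR (- (N * m)).
    by rewrite ler_expR lerN2 ler_piMr ?(ltW N0)// /m ge_min lexx.
  have C0 : 0 <= C by rewrite /C !mulr_ge0 ?addr_ge0// ltW.
  have : C * expR (- N) <= C * expR (- (N * m)) by exact: ler_wpM2l.
  move: (A N) (expR (- (N * m))) (expR (- N)) tri rem tp => X Y Z; lra.
have lowA N : 1 <= N -> 2 * N^-1 * expR (- 1) <= A N.
  move=> N1; have N0 : 0 < N by lra.
  have L1 : 1 <= L by rewrite /L; lra.
  have NV : N^-1 <= 1 by rewrite invf_le1.
  have NV0 : 0 < N^-1 by rewrite invr_gt0.
  rewrite /A (@int_split _ (- L) (- N^-1) L); [|by apply/andP; split; lra|exact: Lint_segment].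
  rewrite (@int_split _ (- N^-1) (N^-1) L); [|by apply/andP; split; lra|exact: Lint_segment].
  rewrite addrCA; apply: ler_wpDr; first by apply: addr_ge0; apply: Rintegral_ge0.
  have -> : 2 * N^-1 * expR (- 1) = (N^-1 - - N^-1) * expR (- 1) by ring.
  rewrite -int_cst; last lra.
  apply: le_Rintegral => //; [by apply: Lint_segment => x; exact: cvg_cst|exact: Lint_segment|].
  move=> x; rewrite /= in_itv/= => hx; rewrite /g ler_expR mulNr lerN2.
  have : x ^+ 2 <= (N^-1) ^+ 2 by apply: exprn_le_norm; rewrite ler_norml.
  move=> hx2; apply: le_trans (ler_wpM2l (ltW N0) hx2) _.
  by rewrite expr2 mulrA mulfV ?gt_eqF// mul1r.
set m := Num.min 1 (e ^+ 2) in lower.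
have m0 : 0 < m by rewrite lt_min ltr01 exprn_gt0.
pose D := C + 16 * L * M3.
have D0 : 0 <= D.
  by rewrite /D addr_ge0 ?mulr_ge0 ?addr_ge0//; exact: ltW.
pose N := 1 + 4 * D * expR 1 / (eta * m ^+ 2).
have em : 0 < eta * m ^+ 2 by rewrite mulr_gt0// exprn_gt0.
have N1 : 1 <= N by rewrite lerDl divr_ge0 ?mulr_ge0 ?expR_ge0// ltW.
have N0 : 0 < N by lra.
have := lower N N0; have := lowA N N1; rewrite -/D.
rewrite expRN [expR (- (N * m))]expRN.
have E1 := expR_gt0 (1 : R); have E2 := expR_gt0 (N * m).
have big : (N * m) ^+ 2 / 2 < expR (N * m).
  have := @expR_ge1Dxn R (N * m) 1 (ltW (mulr_gt0 N0 m0)).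
  have -> : (2`! = 2)%N by [].
  by move=> ?; lra.
move=> h1 h2.
have h3 : eta / N / expR 1 <= D / expR (N * m).
  apply: le_trans h2; apply: le_trans (ler_wpM2l _ h1); last by rewrite divr_ge0// ltW.
  by rewrite le_eqVlt; apply/orP; left; apply/eqP; field; rewrite !gt_eqF.
move: h3; rewrite ler_pdivlMr// mulrAC ler_pdivrMr// mulrAC ler_pdivrMr// => h3.
have h4 : eta * ((N * m) ^+ 2 / 2) <= D * expR 1 * N.
  by apply: le_trans h3; rewrite ler_wpM2l// ltW.
have h5 : N * (eta * m ^+ 2) = eta * m ^+ 2 + 4 * D * expR 1.
  by rewrite /N mulrDl mul1r mulfVK// gt_eqF.
have : N * (N * (eta * m ^+ 2)) <= N * (2 * D * expR 1).
  have -> : N * (N * (eta * m ^+ 2)) = 2 * (eta * ((N * m) ^+ 2 / 2)) by field.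
  by move: h4; clearbody N D; clear; lra.
rewrite ler_pM2l// h5 => h6.
have : 0 <= D * expR 1 by rewrite mulr_ge0// ltW.
move: h6 em; clearbody N D; clear; lra.
Qed.

(** Translation reduces to a point above the real line, reflection to one below. *)
Theorem identity_theorem (F : R[i] -> R[i]) : (forall z, exists l, cdiff F z l) ->
  (forall x, F x%:C = 0) -> forall z, F z = 0.
Proof.
move=> HF F0 [p H].
have [H0|H0|->] := ltgtP H 0; last exact: F0.
  have := @zero_above (fun w => F ((p +i* H) - w)) (- H); rewrite subr0; apply; first lra.
    move=> z; have [l Hl] := HF ((p +i* H) - z); exists (- l) => e e0.
    have [d d0 Hd] := Hl e e0; exists d => // h hd.
    have := Hd (- h); rewrite ncN mulNr mulrN opprD addrA; exact.
  move=> x; rewrite opprK (_ : _ - _ = (p - x)%:C); first exact: F0.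
  by apply: c_ext => /=; ring.
have := @zero_above (fun w => F ((p +i* H) + w)) H; rewrite addr0; apply => //.
  move=> z; have [l Hl] := HF ((p +i* H) + z); exists l => e e0.
  have [d d0 Hd] := Hl e e0; exists d => // h hd.
  by rewrite addrA; exact: Hd.
move=> x; rewrite (_ : _ + _ = (p + x)%:C); first exact: F0.
by apply: c_ext => /=; ring.
Qed.

End ComplexDifferentiability.

(** * The Airy function and the kernel of the problem *)

Section AiryFunctionOnRays.
Context {R : realType}.
Notation mu := (@lebesgue_measure R).
Implicit Types (x y s k e : R) (z w a b h l : R[i]).

Lemma cRe_scale x w : cRe (x%:C * w) = x * cRe w.
Proof. by case: w => p q; rewrite /= mul0r subr0. Qed.

Lemma cIm_scale x w : cIm (x%:C * w) = x * cIm w.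
Proof. by case: w => p q; rewrite /= mul0r addr0. Qed.

Lemma ccontD (f g : R -> R[i]) : ccont f -> ccont g -> ccont (fun x => f x + g x).
Proof.
move=> [f1 f2] [g1 g2]; split => x.
  rewrite (_ : (fun y => cRe (f y + g y)) = (fun y => cRe (f y) + cRe (g y))).
    by apply: cvgD; [exact: f1|exact: g1].
  by apply/funext => y; rewrite cReD.
rewrite (_ : (fun y => cIm (f y + g y)) = (fun y => cIm (f y) + cIm (g y))).
  by apply: cvgD; [exact: f2|exact: g2].
by apply/funext => y; rewrite cImD.
Qed.

Lemma cder_quad (f : R -> R[i]) y l (K e : R) : 0 < e ->
  (forall h : R, `|h| < e -> nc (f (y + h) - f y - h%:C * l) <= K * h ^+ 2) ->
  cder f y l.
Proof.
move=> e0 key; split; apply: (@is_derive_quad _ _ _ _ K e) => // h hh.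
  have := le_trans (nc_Re _) (key h hh).
  by rewrite !cReD !cReN cRe_scale.
have := le_trans (nc_Im _) (key h hh).
by rewrite !cImD !cImN cIm_scale.
Qed.

(** The Airy function as a contour integral that comes in along the left ray and
    leaves along the right one, with m differentiations in z. *)
Definition airyD m z : R[i] :=
  ii ^+ m * ((2 * pi)^-1)%:C * (ray bR m z - ray bL m z).

Fact airyD_alg (i c p X1 X2 X3 Y1 Y2 Y3 h : R[i]) :
  p * c * (X1 - Y1) - p * c * (X2 - Y2) - h * (i * p * c * (X3 - Y3)) =
  p * c * ((X1 - X2 - h * (i * X3)) - (Y1 - Y2 - h * (i * Y3))).
Proof. ring. Qed.

(** Each differentiation brings down [i a], which is what raises m. *)
Lemma airyD_quad m z : exists C : R, forall h, nc h <= 1 ->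
  nc (airyD m (z + h) - airyD m z - h * airyD m.+1 z) <= C * nc h ^+ 2.
Proof.
have [C1 H1] := @ray_quad R bR (2 / 3) e23 bR_cubic m z.
have [C2 H2] := @ray_quad R bL (2 / 3) e23 bL_cubic m z.
exists (nc (ii ^+ m * ((2 * pi)^-1)%:C : R[i]) * (C1 + C2)) => h h1.
have -> : airyD m (z + h) - airyD m z - h * airyD m.+1 z =
  ii ^+ m * ((2 * pi)^-1)%:C *
   ((ray bR m (z + h) - ray bR m z - h * (ii * ray bR m.+1 z)) -
    (ray bL m (z + h) - ray bL m z - h * (ii * ray bL m.+1 z))).
  by rewrite /airyD (exprS ii m); exact: airyD_alg.
rewrite ncM -mulrA ler_wpM2l ?nc_ge0// mulrDl; apply: le_trans (ncB _ _) _.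
by apply: lerD; [exact: H1|exact: H2].
Qed.

Lemma airyD_cdiff m z : cdiff (airyD m) z (airyD m.+1 z).
Proof. have [C HC] := airyD_quad m z; exact: cdiff_quad HC. Qed.

(** Complex conjugation, written on components. *)
Definition cj z : R[i] := (cRe z) +i* (- cIm z).

Lemma cjD z w : cj (z + w) = cj z + cj w.
Proof. by case: z w => [? ?] [? ?]; rewrite /cj /= opprD. Qed.
Lemma cjM z w : cj (z * w) = cj z * cj w.
Proof. by case: z w => [? ?] [? ?]; apply: c_ext => /=; ring. Qed.
Lemma cjN z : cj (- z) = - cj z.
Proof. by case: z. Qed.
Lemma cjX z n : cj (z ^+ n) = cj z ^+ n.
Proof.
elim: n => [|n IH]; last by rewrite !exprS cjM IH.
by rewrite !expr0; apply: c_ext => //=; rewrite oppr0.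
Qed.
Lemma cjK z : cj (cj z) = z.
Proof. by case: z => a b; rewrite /cj /= opprK. Qed.
Lemma cj_real x : cj x%:C = x%:C.
Proof. by rewrite /cj /= oppr0. Qed.
Lemma addcj z : z + cj z = (2 * cRe z)%:C.
Proof. by case: z => a b; apply: c_ext => /=; ring. Qed.

Lemma cexp_cj z : cexp (cj z) = cj (cexp z).
Proof. by case: z => a b; rewrite !cexpE /cj /= cosN sinN mulrN. Qed.

Lemma Cint_cj (f : R -> R[i]) : cintegrable halfline f -> cintegrable halfline (fun x => cj (f x)).
Proof.
move=> [f1 f2]; split => //.
apply: (Lint_eq _ (f := fun x => -1 * cIm (f x))) => //.
  by move=> x _; rewrite mulN1r.
exact: LintZ.
Qed.

Lemma cint_cj (f : R -> R[i]) : cintegrable halfline f ->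
  cintegral halfline (fun x => cj (f x)) = cj (cintegral halfline f).
Proof.
move=> [f1 f2]; apply: c_ext => //.
rewrite -[RHS]mulN1r -RintegralZl//; apply: int_eq => x _.
by rewrite mulN1r.
Qed.

Lemma airyG_cj z s :
  bL * airyG 0 (cj z) (bL * s%:C) = - cj (bR * airyG 0 z (bR * s%:C)).
Proof.
have bLR : bL = - cj bR by rewrite /cj /=; apply: c_ext => /=; rewrite ?opprK.
have iiJ : cj ii = - ii by rewrite /cj /=; apply: c_ext => /=; rewrite ?oppr0.
rewrite cjM -mulNr -bLR; congr (_ * _); rewrite /airyG !expr0 !mul1r -cexp_cj; congr cexp.
have X : cj ((bR * s%:C) ^+ 3) = (cj bR * s%:C) ^+ 3 by rewrite cjX cjM cj_real.
rewrite c3V cjM iiJ cjD (cjM _ z) (cjM bR) (cjM _ (3^-1)%:C) X !cj_real bLR.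
move: (cj bR) (cj z) => p q; ring.
Qed.

(** Conjugation exchanges the two rays, so that their difference is real on the
    real line. *)
Lemma ray_cj z : ray bL 0 (cj z) = - cj (ray bR 0 z).
Proof.
have I := @ray_integrable R bR (2 / 3) e23 bR_cubic 0 z.
rewrite {2}/ray -(cint_cj I) -[RHS]mulN1r -cintZ//; last exact: Cint_cj.
by apply: cint_eq => s _; rewrite mulN1r airyG_cj.
Qed.

Lemma airyD_cj z : airyD 0 (cj z) = cj (airyD 0 z).
Proof.
have H1 := ray_cj z; have := ray_cj (cj z); rewrite cjK => H2.
have {}H2 : ray bR 0 (cj z) = - cj (ray bL 0 z) by rewrite H2 cjN cjK opprK.
rewrite /airyD H1 H2 !expr0 !mul1r cjM cj_real cjD cjN.
by congr (_ * _); rewrite opprK addrC.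
Qed.

(** The two rays contribute conjugate values, hence twice the real part of one. *)
Lemma airyD_real x : airyD 0 x%:C = (airy_real x)%:C.
Proof.
rewrite airy_real_ray /airyD expr0 mul1r.
have := ray_cj x%:C; rewrite cj_real => ->; rewrite opprK addcj -(rmorphM (@real_complex R)).
move: (cRe _) => X; congr (_%:C).
have : pi != 0 :> R by rewrite gt_eqF// pi_gt0.
by move: (pi : R) => q q0; field.
Qed.

Fact cdiffB_alg (F1 F2 G1 G2 h l k : R[i]) :
  F1 - G1 - (F2 - G2) - h * (l - k) = (F1 - F2 - h * l) - (G1 - G2 - h * k).
Proof. ring. Qed.

(** The set in the definition of Ai is not empty, as it contains the contour
    integral, and is a singleton by the identity theorem. *)
Theorem Ai_airyD z : Ai z = airyD 0 z.
Proof.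
rewrite /Ai (@xget_unique _ _ _ (airyD 0))//.
  split; last exact: airyD_real.
  by move=> w; apply/derivable_cdiff; exists (airyD 1 w); exact: airyD_cdiff.
move=> f [fe fx]; apply/funext => w; apply/eqP; rewrite -subr_eq0; apply/eqP.
apply: (@identity_theorem _ (fun w => f w - airyD 0 w)).
  move=> v; have /derivable_cdiff[l Hl] := fe v.
  exists (l - airyD 1 v) => e e0.
  have e2 : 0 < e / 2 by rewrite divr_gt0.
  have [d1 d10 H1] := Hl _ e2; have [d2 d20 H2] := airyD_cdiff 0 v e2.
  exists (Num.min d1 d2); first by rewrite lt_min d10.
  move=> h; rewrite lt_min => /andP[h1 h2].
  have -> : f (v + h) - airyD 0 (v + h) - (f v - airyD 0 v) - h * (l - airyD 1 v) =
    (f (v + h) - f v - h * l) - (airyD 0 (v + h) - airyD 0 v - h * airyD 1 v).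
    by exact: cdiffB_alg.
  apply: le_trans (ncB _ _) _; have := H1 h h1; have := H2 h h2; lra.
by move=> x; rewrite fx airyD_real subrr.
Qed.

(** V_m is the m-th derivative of y |-> w Ai(w y) with w = 1 + i. *)
Definition airyV m y : R[i] := bR ^+ m.+1 * airyD m (bR * y%:C).

Fact airyV_alg (p q X1 X2 X3 h : R[i]) :
  p * X1 - p * X2 - h * (q * p * X3) = p * (X1 - X2 - q * h * X3).
Proof. ring. Qed.

Lemma airyV_cder m y : cder (airyV m) y (airyV m.+1 y).
Proof.
have [C HC] := airyD_quad m (bR * y%:C).
have nb : nc bR <= 2 :> R by apply: le_trans (nc_le _) _; rewrite /= normr1.
pose K := nc (bR ^+ m.+1 : R[i]) * (`|C| * 4).
have key (h : R) : `|h| < 1 / 2 ->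
    nc (airyV m (y + h) - airyV m y - h%:C * airyV m.+1 y) <= K * h ^+ 2.
  move=> hh.
  have -> : airyV m (y + h) - airyV m y - h%:C * airyV m.+1 y =
    bR ^+ m.+1 * (airyD m (bR * y%:C + bR * h%:C) - airyD m (bR * y%:C) -
     (bR * h%:C) * airyD m.+1 (bR * y%:C)).
    rewrite /airyV rmorphD/= mulrDr (exprS bR m.+1).
    exact: airyV_alg.
  rewrite ncM /K -(mulrA (nc _)); apply: ler_wpM2l; first exact: nc_ge0.
  have nh : nc (bR * h%:C) <= 2 * `|h| by rewrite ncM nc_real ler_wpM2r.
  apply: le_trans (HC _ _) _; first lra.
  apply: le_trans (_ : `|C| * nc (bR * h%:C) ^+ 2 <= _).
    by apply: ler_wpM2r; rewrite ?sqr_ge0 ?ler_norm.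
  rewrite -mulrA ler_wpM2l// -(real_normK (num_real h)).
  have : nc (bR * h%:C) ^+ 2 <= (2 * `|h|) ^+ 2.
    by rewrite ler_pXn2r ?nnegrE ?nc_ge0// mulr_ge0.
  by rewrite exprMn; lra.
by apply: cder_quad key; lra.
Qed.

Fact ray_ode_alg (b a i E : R[i]) z : b * (i * (z + a ^+ 2)) * E = i * (z * (b * E) + b * (a ^+ 2 * E)).
Proof. ring. Qed.

(** The derivative of [e^{i(a z + a^3/3)}] in a is [i (z + a^2)] times it; the
    integral along a ray leaves the boundary value at 0. *)
Lemma ray_ode b e z : 0 < e -> cRe (ii * (b ^+ 3 / 3)) = - e ->
  ii * (z * ray b 0 z + ray b 2 z) = -1.
Proof.
move=> e0 be.
have I0 := @ray_integrable R b e e0 be 0 z; have I2 := @ray_integrable R b e e0 be 2 z.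
rewrite /ray -cintZ// -cintD//; last exact: CintZ.
rewrite -cintZ//; last by apply: CintD => //; exact: CintZ.
have d s : cder (fun s => airyG 0 z (b * s%:C)) s
  (ii * (z * (b * airyG 0 z (b * s%:C)) + b * airyG 2 z (b * s%:C))).
  have := hol_airyG 0 z (cder_linear 0 b s).
  under eq_fun do rewrite add0r.
  apply: cder_eq; rewrite add0r /airyG' /airyG expr0 !mul1r mul0r add0r.
  by rewrite mulrA; exact: ray_ode_alg.
rewrite (@cFTC_halfline R (fun s => airyG 0 z (b * s%:C))).
- by rewrite /airyG expr0 mul1r mulr0 mul0r expr0n/= mul0r addr0 mulr0 cexp0.
- by move=> s _; exact: d.
- apply: ccontM; first by split => x; exact: cvg_cst.
  have c0 := @ray_integrand_cont R b 0 z; have c2 := @ray_integrand_cont R b 2 z.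
  have c1 : ccont (fun s => z * (b * airyG 0 z (b * s%:C))).
    by apply: ccontM => //; split => x; exact: cvg_cst.
  exact: ccontD.
- by apply: CintZ => //; apply: CintD => //; exact: CintZ.
have [C [C0 HC]] := @ray_quad_pt R b e e0 be 0 z.
have b0 : 0 < nc b.
  rewrite lt_neqAle nc_ge0 andbT eq_sym; apply/eqP => /ComplexField.Normc.eq0_normc b0.
  move: be; rewrite b0 (_ : 0 ^+ 3 = 0 :> R[i]); last by rewrite expr0n.
  by rewrite mul0r mulr0 [cRe 0]/=; lra.
apply: (@expR_cvgy0 _ _ (C / nc b)) => s s0.
rewrite mulrAC ler_pdivlMr// mulrC -ncM.
by have := (HC 0 s _ s0).1; rewrite addr0; apply; rewrite nc0.
Qed.

(** The boundary terms of the two rays cancel. *)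
Lemma airy_ode z : airyD 2 z = z * airyD 0 z.
Proof.
have H1 := @ray_ode bR (2 / 3) z e23 bR_cubic.
have H2 := @ray_ode bL (2 / 3) z e23 bL_cubic.
rewrite /airyD expr0 expr2 ii2.
have : ii * ((z * ray bR 0 z + ray bR 2 z) - (z * ray bL 0 z + ray bL 2 z)) = 0.
  by rewrite mulrBr H1 H2 subrr.
move=> /eqP; rewrite mulf_eq0 => /orP[/eqP i0|/eqP H].
  by have := @ii2 R; rewrite i0 mul0r => /eqP; rewrite eq_sym oppr_eq0 oner_eq0.
have -> : ray bR 2 z = ray bL 2 z + z * ray bL 0 z - z * ray bR 0 z.
  move: H; move: (ray bR 0 z) (ray bR 2 z) (ray bL 0 z) (ray bL 2 z) => p q r t H.
  by apply/eqP; rewrite -subr_eq0 -[X in _ == X]H; apply/eqP; ring.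
move: (ray bR 0 z) (ray bL 0 z) (ray bL 2 z) ((2 * pi)^-1)%:C => p q r c; ring.
Qed.

Lemma airyV_ode y : airyV 2 y = bR ^+ 3 * (y%:C * airyV 0 y).
Proof.
rewrite /airyV airy_ode; set X := airyD 0 _; move: X (y%:C) => X q.
by congr (_ * _); rewrite expr1 [RHS]mulrCA mulrA.
Qed.

(** This decay, faster than every exponential, is the only asymptotic information
    on the Airy function that the proof uses. *)
Lemma airyV_decay m (eta : R) : exists C : R, 0 <= C /\ forall y, 0 <= y ->
  nc (airyV m y) <= C * expR (- eta * y).
Proof.
have [C HC] := @ray_diff_decay R m eta.
exists (nc (bR ^+ m.+1 * (ii ^+ m * ((2 * pi)^-1)%:C) : R[i]) * `|C|).
split; first by rewrite mulr_ge0 ?nc_ge0.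
move=> y y0; rewrite /airyV /airyD mulrA ncM -mulrA ler_wpM2l ?nc_ge0//.
by apply: le_trans (HC y y0) _; rewrite ler_wpM2r ?expR_ge0// ler_norm.
Qed.

(** The profile of the solution. *)
Definition kerA y : R := cRe (airyV 0 y).

Lemma cos_pi4 : cos (pi / 4) = (Num.sqrt 2)^-1 :> R.
Proof.
have p0 := pi_gt0 R.
have cs : cos (pi / 4) = sin (pi / 4) :> R.
  by rewrite -cosBpihalf -cosN; congr cos; field.
have c0 : 0 < cos (pi / 4) :> R by apply: cos_gt0_pihalf; apply/andP; split; lra.
have := cos2Dsin2 (pi / 4 : R); rewrite -cs => c2.
have {}c2 : cos (pi / 4) ^+ 2 = 2^-1 :> R by lra.
rewrite -sqrtrV// -c2 sqrtr_sqr ger0_norm//; exact: ltW.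
Qed.

Lemma sin_pi4 : sin (pi / 4) = (Num.sqrt 2)^-1 :> R.
Proof. by rewrite -cos_pi4 -cosBpihalf -cosN; congr cos; field. Qed.

Lemma pow32 : 2 `^ (3 / 2) = 2 * Num.sqrt 2 :> R.
Proof.
have -> : 3 / 2 = 1 + 2^-1 :> R by field.
by rewrite powRD ?powRr1 ?powR12_sqrt// implybE; apply/orP; right.
Qed.

(** The two Airy terms are conjugate to each other; [sqrt 2 e^{i pi/4} = 1 + i]
    turns their sum into the real profile. *)
Lemma u43E x (t : R) : 0 < t -> let r := (3 * t) `^ 3^-1 in
  u43 x t = (3 / 2 * (r^-1 * kerA (`|x| / r)))%:C.
Proof.
move=> t0 r; have r0 : 0 < r by rewrite powR_gt0// mulr_gt0.
have s0 : 0 < Num.sqrt 2 :> R by rewrite sqrtr_gt0.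
have s2 : Num.sqrt 2 * Num.sqrt 2 = 2 :> R by rewrite -expr2 sqr_sqrtr.
rewrite /u43 -/r !Ai_airyD.
have zE : (Num.sqrt 2)%:C * (`|x|%:C * cis (pi / 4)) / r%:C = bR * (`|x| / r)%:C.
  rewrite -(fmorphV (@real_complex R)) /cis cos_pi4 sin_pi4.
  apply: c_ext => /=; field; rewrite gt_eqF//= gt_eqF//.
have zJ : (Num.sqrt 2)%:C * (`|x|%:C * cis (- (pi / 4))) / r%:C = cj (bR * (`|x| / r)%:C).
  rewrite -zE -(fmorphV (@real_complex R)) !cjM !cj_real.
  by rewrite /cis cosN sinN.
rewrite zE zJ airyD_cj pow32 /kerA /airyV expr1.
have -> : cis (- (pi / 4)) = cj (cis (pi / 4)) :> R[i] by rewrite /cis cosN sinN.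
rewrite -cjM addcj -(rmorphM (@real_complex R)).
have -> : cis (pi / 4) = ((Num.sqrt 2)^-1)%:C * bR :> R[i].
  by rewrite /cis cos_pi4 sin_pi4; apply: c_ext => /=; ring.
rewrite -(mulrA _%:C) cRe_scale; set W := bR * airyD 0 _; move: W => W; congr (_%:C).
move: (cRe W) => X; rewrite -[in RHS]s2.
have : Num.sqrt 2 != 0 :> R by rewrite gt_eqF.
have : r != 0 by rewrite gt_eqF.
move: r (Num.sqrt 2) {r0 s0 s2 zE zJ} => r v r0 v0.
by field; rewrite r0 v0.
Qed.

End AiryFunctionOnRays.

(** * Change of variable on open intervals *)

Section ChangeOfVariable.
Context {R : realType}.
Notation mu := (@lebesgue_measure R).
Notation oline := (`]0, +oo[%classic : set R).
Implicit Types (F G f g : R -> R) (E D : set R).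

Lemma strict_incr (F F' : R -> R) (x y : R) : x < y ->
  (forall z : R, x <= z <= y -> is_derive z (1 : R) F (F' z)) ->
  (forall z : R, x <= z <= y -> 0 < F' z) -> F x < F y.
Proof.
move=> xy dF F0.
have c1 : {within `[x, y], continuous F}.
  by apply: (@derive_within _ F F') => z /=; rewrite in_itv/=; exact: dF.
have c2 : forall z, z \in `]x, y[ -> is_derive z (1 : R) F (F' z).
  by move=> z; rewrite in_itv/= => /andP[xz zy]; apply: dF; rewrite !ltW.
have [c] := MVT xy c2 c1.
rewrite in_itv/= => /andP[xc cy] E; rewrite -subr_gt0 E mulr_gt0 ?subr_gt0//.
by apply: F0; rewrite !ltW.
Qed.

Lemma subst_segment F F' G (a b : R) : 0 < a -> a <= b ->
  (forall x : R, 0 < x -> is_derive x (1 : R) F (F' x)) ->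
  (forall x : R, 0 < x -> {for x, continuous F'}) ->
  (forall x : R, 0 < x -> 0 < F' x) ->
  (forall y, F a <= y <= F b -> {for y, continuous G}) ->
  (\int[mu]_(y in `[F a, F b]) (G y)%:E =
   \int[mu]_(x in `[a, b]) (G (F x) * F' x)%:E)%E.
Proof.
move=> a0 ab dF cF' F'0 cG.
have dE x : 0 < x -> (F^`()%classic) x = F' x.
  by move=> x0; rewrite derive1E; have D := dF x x0; exact: (@derive_val _ _ _ _ _ _ _ D).
have cFd x : 0 < x -> {for x, continuous (F^`()%classic)}.
  move=> x0; rewrite /prop_for /continuous_at (dE x x0).
  apply: cvg_trans (cF' x x0); apply: near_eq_cvg.
  near=> y; rewrite dE//; near: y.
  by apply: lt_nbhsr.
rewrite (@integration_by_substitution_increasing _ F G a b)//.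
- apply: eq_integral => x /set_mem /=; rewrite in_itv/= => /andP[ax _].
  congr EFin; change (G (F x) * F^`()%classic x = G (F x) * F' x).
  by rewrite dE// (lt_le_trans a0 ax).
- move=> x y; rewrite !in_itv/= => /andP[ax _] _ xy.
  apply: (@strict_incr F F') => // z /andP[xz _].
    by apply: dF; apply: lt_le_trans xz; exact: lt_le_trans ax.
  by apply: F'0; apply: lt_le_trans xz; exact: lt_le_trans ax.
- by move=> x; rewrite in_itv/= => /andP[ax _]; apply: cFd; apply: lt_trans ax.
- by apply/cvg_ex; exists (F^`()%classic a); apply: cvg_at_right_filter; exact: cFd.
- by apply/cvg_ex; exists (F^`()%classic b); apply: cvg_at_left_filter; apply: cFd; exact: lt_le_trans ab.
- split.
  + move=> x; rewrite in_itv/= => /andP[ax _].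
    by apply: ex_derive; apply: dF; apply: lt_trans ax.
  + by apply: cvg_at_right_filter; exact: derive_cont (dF a a0).
  + by apply: cvg_at_left_filter; apply: derive_cont (dF b _); exact: lt_le_trans ab.
- by apply: continuous_in_subspaceT => y /set_mem /=; rewrite in_itv/=; exact: cG.
Unshelve. all: by end_near.
Qed.

(** An increasing change of variable from the open half line onto E. Both ends
    are excluded because the integrands below are singular there. *)
Record subst_data E F F' : Prop := SubstData {
  sub_der : forall x : R, 0 < x -> is_derive x (1 : R) F (F' x);
  sub_cont : forall x : R, 0 < x -> {for x, continuous F'};
  sub_pos : forall x : R, 0 < x -> 0 < F' x;
  sub_in : forall x : R, 0 < x -> E (F x);
  sub_itv : forall p q y, E p -> E q -> p <= y <= q -> E y;
  sub_exhaust : forall y, E y -> exists p q : R, [/\ 0 < p, p <= q & F p <= y <= F q] }.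

Lemma subst_mono E F F' (x y : R) : subst_data E F F' -> 0 < x -> x <= y -> F x <= F y.
Proof.
move=> [dF _ F'0 _ _ _] x0 xy.
have : `|(fun=> 0 : R) y - (fun=> 0 : R) x| <= F y - F x.
  apply: (@mvt_le R (fun=> 0) (fun=> 0) F F') => //.
  - by move=> z /andP[xz _]; apply: dF; exact: lt_le_trans xz.
  - by move=> z /andP[xz _]; rewrite normr0 ltW// F'0// (lt_le_trans x0 xz).
by rewrite subrr normr0 subr_ge0.
Qed.

Lemma oline_bigcup : oline = \bigcup_n `[n.+1%:R^-1, n.+1%:R]%classic.
Proof.
apply/seteqP; split => x /=; rewrite in_itv/= ?andbT.
  move=> x0; pose n := (Num.bound x + Num.bound x^-1)%N; exists n => //=.
  have h1 := archi_boundP (ltW x0); have := archi_boundP (_ : 0 <= x^-1).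
  rewrite invr_ge0 ltW// => /(_ isT) h2.
  have n1 : (Num.bound x)%:R <= n.+1%:R :> R by rewrite ler_nat leqW// leq_addr.
  have n2 : (Num.bound x^-1)%:R <= n.+1%:R :> R by rewrite ler_nat leqW// leq_addl.
  rewrite in_itv/=; apply/andP; split; last by apply: ltW; apply: lt_le_trans n1.
  rewrite -[leRHS]invrK lef_pV2 ?posrE ?invr_gt0//; apply: ltW; exact: lt_le_trans n2.
move=> [n _] /=; rewrite in_itv/= => /andP[h _]; apply: lt_le_trans h.
by rewrite invr_gt0.
Qed.

Lemma subst_bigcup E F F' : subst_data E F F' ->
  E = \bigcup_n `[F n.+1%:R^-1, F n.+1%:R]%classic.
Proof.
move=> S; apply/seteqP; split => y.
  move=> /(sub_exhaust S)[p [q [p0 pq /andP[py yq]]]].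
  have : oline p by rewrite /= in_itv/= p0.
  have : oline q by rewrite /= in_itv/= (lt_le_trans p0 pq).
  rewrite oline_bigcup => -[n _] /=; rewrite in_itv/= => /andP[_ qn].
  move=> [m _] /=; rewrite in_itv/= => /andP[mp _].
  exists (maxn n m) => //=; rewrite in_itv/=; apply/andP; split.
    apply: le_trans py; apply: (subst_mono S); first by rewrite invr_gt0.
    apply: le_trans mp; rewrite lef_pV2 ?posrE// ler_nat ltnS; exact: leq_maxr.
  apply: le_trans yq _; apply: (subst_mono S); first exact: lt_le_trans pq.
  by apply: le_trans qn _; rewrite ler_nat ltnS leq_maxl.
move=> [n _] /=; rewrite in_itv/= => h.
by apply: (sub_itv S) h; apply: (sub_in S); rewrite ?invr_gt0.
Qed.

Lemma subst_meas E F F' : subst_data E F F' -> Lmeas E.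
Proof. by move=> S; rewrite (subst_bigcup S); apply: bigcupT_measurable => n; exact: measurable_itv. Qed.

Lemma subst_measG E F F' G : subst_data E F F' ->
  (forall y, E y -> {for y, continuous G}) -> Lmfun E G.
Proof.
move=> S cG; rewrite (subst_bigcup S); apply/measurable_fun_bigcup => [n|n].
  exact: measurable_itv.
apply: subspace_continuous_measurable_fun; first exact: measurable_itv.
apply: continuous_in_subspaceT => y /set_mem /= h; apply: cG.
by rewrite (subst_bigcup S); exists n.
Qed.

Lemma subst_self : subst_data oline id (fun=> 1).
Proof.
split => //.
- by move=> x _; exact: is_derive_id.
- by move=> x _; exact: cvg_cst.
- by move=> x x0; rewrite /= in_itv/= x0.
- move=> p q y; rewrite /= !in_itv/= !andbT => p0 _ /andP[py _]; exact: lt_le_trans py.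
- by move=> y; rewrite /= in_itv/= andbT => y0; exists y, y; rewrite !lexx.
Qed.

Lemma subst_contG E F F' G : subst_data E F F' ->
  (forall y, E y -> {for y, continuous G}) ->
  forall x, oline x -> {for x, continuous (fun x => G (F x) * F' x)}.
Proof.
move=> S cG x; rewrite /= in_itv/= andbT => x0.
apply: cvgM; last exact: (sub_cont S).
apply: (@continuous_comp _ _ _ F G); first exact: derive_cont (sub_der S x0).
exact: cG (sub_in S x0).
Qed.

(** Monotone limit of the substitution on compact segments. *)
Lemma subst_ge0 E F F' G : subst_data E F F' ->
  (forall y, E y -> {for y, continuous G}) -> (forall y, E y -> 0 <= G y) ->
  (\int[mu]_(y in E) (G y)%:E = \int[mu]_(x in oline) (G (F x) * F' x)%:E)%E.
Proof.
move=> S cG G0.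
have inv_pos n : 0 < n.+1%:R^-1 :> R by rewrite invr_gt0.
have mE : Lmfun E (EFin \o G) by apply/measurable_EFinP; exact: subst_measG S cG.
have mO : Lmfun oline (EFin \o (fun x => G (F x) * F' x)).
  by apply/measurable_EFinP; apply: subst_measG subst_self _; exact: subst_contG S cG.
have H1 := @ge0_nondecreasing_set_cvg_integral _ (measurableTypeR R) R
  (fun n => `[F n.+1%:R^-1, F n.+1%:R]%classic) (EFin \o G) mu.
have H2 := @ge0_nondecreasing_set_cvg_integral _ (measurableTypeR R) R
  (fun n => `[n.+1%:R^-1, n.+1%:R]%classic : set R) (EFin \o (fun x => G (F x) * F' x)) mu.
move: H1 H2; rewrite -(subst_bigcup S) -oline_bigcup => H1 H2.
have sE n : `[F n.+1%:R^-1, F n.+1%:R]%classic `<=` E.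
  by move=> y h; rewrite (subst_bigcup S); exists n.
have sO n : `[n.+1%:R^-1, n.+1%:R]%classic `<=` oline.
  by move=> y h; rewrite oline_bigcup; exists n.
have A1 : {homo (fun n : nat => `[F n.+1%:R^-1, F n.+1%:R]%classic : set R) : n m / (n <= m)%N >-> (n <= m)%O}.
  apply/nondecreasing_seqP => n; rewrite subsetEset => y /=; rewrite !in_itv/= => /andP[h1 h2].
  apply/andP; split; [apply: le_trans h1|apply: le_trans h2 _]; apply: (subst_mono S) => //.
    by rewrite lef_pV2 ?posrE// ler_nat.
  by rewrite ler_nat.
have A2 : {homo (fun n : nat => `[n.+1%:R^-1, n.+1%:R]%classic : set R) : n m / (n <= m)%N >-> (n <= m)%O}.
  apply/nondecreasing_seqP => n; rewrite subsetEset => y /=; rewrite !in_itv/= => /andP[h1 h2].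
  apply/andP; split; [apply: le_trans h1|apply: le_trans h2 _].
    by rewrite lef_pV2 ?posrE// ler_nat.
  by rewrite ler_nat.
have C1 := H1 A1 (fun n => measurable_itv _) (fun n => measurable_funS (subst_meas S) (sE n) mE)
  (fun n x h => G0 x (sE n x h)).
have P0 x : oline x -> 0 <= G (F x) * F' x.
  rewrite /= in_itv/= andbT => x0.
  by apply: mulr_ge0; [by apply: G0; exact: (sub_in S)|by apply: ltW; exact: (sub_pos S)].
have C2 := H2 A2 (fun n => measurable_itv _) (fun n => measurable_funS (measurable_itv _) (sO n) mO)
  (fun n x h => P0 x (sO n x h)).
apply: cvg_unique C1 _ => //.
apply: cvg_trans C2.
apply: near_eq_cvg; apply: nearW => n.
apply/esym/subst_segment => //.
- by apply: le_trans (_ : 1 <= _); rewrite ?invf_le1 ?ler1n.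
- exact: sub_der S.
- exact: sub_cont S.
- exact: sub_pos S.
- by move=> y h; apply: cG; apply: (sE n); rewrite /= in_itv.
Qed.

Lemma subst_ge0_Lint E F F' G : subst_data E F F' ->
  (forall y, E y -> {for y, continuous G}) -> (forall y, E y -> 0 <= G y) ->
  Lint oline (fun x => G (F x) * F' x) -> Lint E G.
Proof.
move=> S cG G0 I; apply/integrableP; split.
  by apply/measurable_EFinP; exact: subst_measG S cG.
move/integrableP : I => [_]; congr (_ < _)%E.
rewrite (@eq_integral _ _ _ mu E (fun y => (G y)%:E)); last first.
  by move=> y /set_mem /G0 y0; rewrite /= ger0_norm.
rewrite (subst_ge0 S)//; apply: eq_integral => x /set_mem.
rewrite /= in_itv/= andbT => x0; rewrite ger0_norm//; apply: mulr_ge0; last by apply: ltW; exact: (sub_pos S).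
by apply: G0; exact: (sub_in S).
Qed.

Lemma subst_Lint E F F' G : subst_data E F F' ->
  (forall y, E y -> {for y, continuous G}) ->
  Lint oline (fun x => G (F x) * F' x) ->
  Lint E G /\ \int[mu]_(y in E) G y = \int[mu]_(x in oline) (G (F x) * F' x).
Proof.
move=> S cG I; have mE := subst_meas S.
have mO : Lmeas oline by exact: measurable_itv.
have cN y : E y -> {for y, continuous (fun y => `|G y|)} by move=> Ey; apply: cvg_norm; exact: cG.
have cB y : E y -> {for y, continuous (fun y => `|G y| - G y)}.
  by move=> Ey; apply: cvgB; [exact: cN|exact: cG].
have B0 y : 0 <= `|G y| - G y by rewrite subr_ge0 ler_norm.
have IN : Lint oline (fun x => `|G (F x)| * F' x).
  apply: Lint_eq (Lint_norm mO I) => // x; rewrite /= in_itv/= andbT => x0.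
  by rewrite normrM [`|F' _|]ger0_norm// ltW// (sub_pos S).
have IB : Lint oline (fun x => (`|G (F x)| - G (F x)) * F' x).
  apply: Lint_eq (LintB mO IN I) => // x _; by rewrite mulrBl.
have JN := subst_ge0_Lint S cN (fun _ _ => normr_ge0 _) IN.
have JB := subst_ge0_Lint S cB (fun y _ => B0 y) IB.
have JG : Lint E G.
  by apply: Lint_eq (LintB mE JN JB) => // x _; rewrite opprB addrC subrK.
split => //.
have EN : \int[mu]_(y in E) `|G y| = \int[mu]_(x in oline) (`|G (F x)| * F' x).
  by rewrite /Rintegral (subst_ge0 S cN).
have EB : \int[mu]_(y in E) (`|G y| - G y) = \int[mu]_(x in oline) ((`|G (F x)| - G (F x)) * F' x).
  by rewrite /Rintegral (subst_ge0 S cB).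
have e1 : \int[mu]_(y in E) G y = \int[mu]_(y in E) `|G y| - \int[mu]_(y in E) (`|G y| - G y).
  by rewrite -RintegralB//; apply: int_eq => y _; rewrite opprB addrC subrK.
rewrite e1 EN EB -RintegralB//; apply: int_eq => x _.
by rewrite mulrBl opprB addrC subrK.
Qed.

End ChangeOfVariable.

(** * Iterated integrals *)

Section IteratedIntegrals.
Context {R : realType}.
Notation mu := (@lebesgue_measure R).
Notation T := (measurableTypeR R).
Notation oline := (`]0, +oo[%classic : set R).
Implicit Types (f : R -> R -> R) (P Q N : R -> R) (E D : set R).

Lemma measurable_oline : Lmeas oline.
Proof. exact: measurable_itv. Qed.

Lemma meas_fst (h : R -> R) : Lmfun setT h ->
  measurable_fun [set: T * T] (fun z => h z.1).
Proof. by move=> mh; exact: (measurableT_comp mh (measurable_fst)). Qed.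

Lemma meas_snd (h : R -> R) : Lmfun setT h ->
  measurable_fun [set: T * T] (fun z => h z.2).
Proof. by move=> mh; exact: (measurableT_comp mh (measurable_snd)). Qed.

Lemma Rint_EFin D (h : R -> R) : Lmeas D -> Lint D h ->
  (\int[mu]_(x in D) (h x)%:E = (\int[mu]_(x in D) h x)%:E)%E.
Proof. by move=> mD Ih; rewrite /Rintegral fineK//; apply: integrable_fin_num. Qed.

Lemma int_cutoff D (h : R -> R) : Lmeas D -> Lint D h ->
  (\int[mu]_y (h y * \1_D y)%:E = (\int[mu]_(y in D) h y)%:E)%E.
Proof.
move=> mD Ih; rewrite -Rint_EFin// [RHS]integral_mkcond; apply: eq_integral => y _.
by rewrite patchE indicE; case: ifP => _; rewrite ?mulr1 ?mulr0.
Qed.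

(** Fubini for real integrals with separately known inner integrals: P and Q are
    the row and column integrals, N the rows of absolute values. *)
Lemma fubini_real D E f P Q N : Lmeas D -> Lmeas E ->
  measurable_fun [set: T * T] (fun z => f z.1 z.2) ->
  (forall x, D x -> [/\ Lint E (f x), \int[mu]_(y in E) f x y = P x
     & \int[mu]_(y in E) `|f x y| = N x]) ->
  Lint D N ->
  (forall y, E y -> Lint D (f^~ y) /\ \int[mu]_(x in D) f x y = Q y) ->
  Lint E Q /\ \int[mu]_(y in E) Q y = \int[mu]_(x in D) P x.
Proof.
move=> mD mE mf HD IN HE.
pose g (z : T * T) := (f z.1 z.2 * (\1_D z.1 * \1_E z.2))%:E.
have mg : measurable_fun setT g.
  apply/measurable_EFinP; apply: measurable_funM => //; apply: measurable_funM.
    by apply: meas_fst; exact: measurable_indic.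
  by apply: meas_snd; exact: measurable_indic.
have Frow (h : R -> R -> R) (x : R) : D x -> Lint E (h x) ->
    (\int[mu]_y (h x y * (\1_D x * \1_E y))%:E = (\int[mu]_(y in E) h x y)%:E)%E.
  by move=> Dx Ih; rewrite indicE mem_set//; under eq_integral do rewrite mul1r; exact: int_cutoff.
have Fcol (h : R -> R -> R) (y : R) : E y -> Lint D (h^~ y) ->
    (\int[mu]_x (h x y * (\1_D x * \1_E y))%:E = (\int[mu]_(x in D) h x y)%:E)%E.
  move=> Ey Ih; rewrite indicE (mem_set Ey); under eq_integral do rewrite mulr1.
  exact: int_cutoff.
have I0 : (\int[mu]_x \int[mu]_y `|g (x, y)| = \int[mu]_(x in D) (N x)%:E)%E.
  rewrite [RHS]integral_mkcond; apply: eq_integral => x _; rewrite patchE.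
  case: ifP => [/set_mem Dx|Dx].
    have [h1 _ <-] := HD x Dx; rewrite -(Frow (fun x y => `|f x y|))//; last exact: Lint_norm.
    apply: eq_integral => y _; rewrite /g /= normrM [X in _ * X]ger0_norm// mulr_ge0// indicE ler0n.
  by apply: integral0_eq => y _; rewrite /g /= indicE Dx mul0r mulr0 normr0.
have I1 : (\int[mu]_x \int[mu]_y `|g (x, y)| < +oo)%E.
  by rewrite I0 Rint_EFin// ltry.
have I : (mu \x mu)%E.-integrable setT g by apply/integrable12ltyP.
have GF : (\int[mu]_x \int[mu]_y g (x, y) = (\int[mu]_(x in D) P x)%:E)%E.
  have IP : Lint D P.
    apply: (Lint_le mD _ IN).
      have mF := measurable_fubini_F I.
      have : Lmfun setT (fun x => fine (fubini_F mu g x)) by exact: measurableT_comp mF.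
      move=> /(measurable_funS measurableT (@subsetT _ D)).
      apply: eq_measurable_fun => x /set_mem Dx.
      by have [h1 <- _] := HD x Dx; rewrite /fubini_F /g/= Frow.
    by move=> x Dx; have [h1 <- <-] := HD x Dx; exact: le_normr_Rintegral.
  rewrite -Rint_EFin// [RHS]integral_mkcond; apply: eq_integral => x _; rewrite patchE.
  case: ifP => [/set_mem Dx|Dx]; first by have [h1 <- _] := HD x Dx; rewrite /g/= Frow.
  by apply: integral0_eq => y _; rewrite /g /= indicE Dx mul0r mulr0.
have GQ y : (\int[mu]_x g (x, y) = ((Q \_ E) y)%:E)%E.
  rewrite patchE; case: ifP => [/set_mem Ey|Ey].
    by have [h1 <-] := HE y Ey; rewrite /g/= Fcol.
  by apply: integral0_eq => x _; rewrite /g /= !indicE Ey !mulr0.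
have IQ : Lint E Q.
  apply/(integrable_mkcond _ mE); apply/integrableP; split.
    have mG := measurable_fubini_G I.
    apply: eq_measurable_fun mG => y _.
    by rewrite /fubini_G GQ /= !patchE; case: ifP.
  have I21 : (\int[mu]_y \int[mu]_x `|g (x, y)| < +oo)%E by apply/integrable21ltyP.
  refine (@le_lt_trans _ (\bar R) _ _ _ _ I21).
  apply: ge0_le_integral => //.
  - apply: measurableT_comp => //.
    have mG := measurable_fubini_G I.
    apply: eq_measurable_fun mG => y _.
    by rewrite /fubini_G GQ /= !patchE; case: ifP.
  - apply: (@measurable_fun_fubini_tonelli_G _ _ _ _ _ mu (abse \o g)).
      exact: measurableT_comp.
    by move=> z; exact: abse_ge0.
  move=> y _.
  have -> : ((EFin \o Q) \_ E) y = ((Q \_ E) y)%:E by rewrite !patchE; case: ifP.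
  rewrite -GQ; apply: le_abse_integral => //.
  by apply: measurableT_comp => //; exact: pair2_measurable.
split => //; apply: EFin_inj; rewrite -GF (Fubini I) -Rint_EFin// [LHS]integral_mkcond.
by apply: eq_integral => y _; rewrite GQ !patchE; case: ifP.
Qed.

Lemma intZ D (c : R) (h : R -> R) : Lmeas D -> Lint D h ->
  \int[mu]_(x in D) (c * h x) = c * \int[mu]_(x in D) h x.
Proof. by move=> mD Ih; rewrite RintegralZl. Qed.

Lemma intD D (g h : R -> R) : Lmeas D -> Lint D g -> Lint D h ->
  \int[mu]_(x in D) (g x + h x) = \int[mu]_(x in D) g x + \int[mu]_(x in D) h x.
Proof. by move=> mD Ig Ih; rewrite (RintegralD mD Ig Ih). Qed.

Lemma intB D (g h : R -> R) : Lmeas D -> Lint D g -> Lint D h ->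
  \int[mu]_(x in D) (g x - h x) = \int[mu]_(x in D) g x - \int[mu]_(x in D) h x.
Proof. by move=> mD Ig Ih; rewrite (RintegralB mD Ig Ih). Qed.

Lemma Lint_oline (h : R -> R) : Lint oline h -> Lint halfline h.
Proof.
move=> Ih; have mh := Lint_meas Ih.
have mh' : Lmfun halfline h by apply/measurable_fun_itv_obnd_cbndP.
apply/integrableP; split; first exact/measurable_EFinP.
have /integrableP[_] := Ih; congr (_ < _)%E.
by rewrite integral_itv_obnd_cbnd//; apply: measurableT_comp => //; apply/measurable_EFinP.
Qed.

Lemma oline_Lint (h : R -> R) : Lint halfline h -> Lint oline h.
Proof.
move=> Ih; apply: (integrableS _ _ _ Ih) => //; try exact: measurable_itv.
by move=> x /=; rewrite !in_itv/= !andbT; exact: ltW.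
Qed.

Lemma int_oline (h : R -> R) : Lint oline h ->
  \int[mu]_(x in oline) h x = \int[mu]_(x in halfline) h x.
Proof. by move=> Ih; rewrite Rintegral_itv_obnd_cbnd. Qed.

(** Scaling by r is how the time variable enters the kernel. *)
Lemma int_scale (r : R) (f : R -> R) : 0 < r -> continuous f -> Lint halfline f ->
  Lint halfline (fun x => f (r * x)) /\
  \int[mu]_(x in halfline) f (r * x) = r^-1 * \int[mu]_(x in halfline) f x.
Proof.
move=> r0 cf If.
have S : subst_data oline (fun y => r^-1 * y) (fun=> r^-1).
  have ri : 0 < r^-1 by rewrite invr_gt0.
  split => //.
  - move=> x _; have := @is_deriveZ _ _ _ id r^-1 x 1 1 (is_derive_id _ _).
    by rewrite /GRing.scale/= mulr1.
  - by move=> x _; exact: cvg_cst.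
  - by move=> x x0; rewrite /= in_itv/= mulr_gt0.
  - move=> p q y; rewrite /= !in_itv/= !andbT => p0 _ /andP[py _]; exact: lt_le_trans py.
  - move=> y; rewrite /= in_itv/= andbT => y0; exists (r * y), (r * y).
    by rewrite mulKf ?gt_eqF// !lexx mulr_gt0.
have E x : f (r * (r^-1 * x)) * r^-1 = r^-1 * f x.
  by rewrite mulVKf ?gt_eqF// mulrC.
have [] := @subst_Lint R oline _ _ (fun x => f (r * x)) S.
- move=> y _; apply: (@continuous_comp _ _ _ (fun x => r * x) f); last exact: cf.
  by apply: cvgM; [exact: cvg_cst|exact: cvg_id].
- apply: (Lint_eq measurable_oline (f := fun x => r^-1 * f x)) => [x _|].
    by rewrite E.
  by apply: LintZ; [exact: measurable_oline|exact: oline_Lint].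
move=> I1 E1; split; first exact: Lint_oline.
rewrite -int_oline// E1 -[in RHS]int_oline; last exact: oline_Lint.
rewrite -RintegralZl//; [|exact: oline_Lint].
by apply: int_eq => x _; rewrite E.
Qed.

End IteratedIntegrals.

(** * Gamma integrals in cubic form *)

Section GammaIntegrals.
Context {R : realType}.
Notation mu := (@lebesgue_measure R).
Notation T := (measurableTypeR R).
Notation oline := (`]0, +oo[%classic : set R).
Implicit Types (x y z t r s : R).

Lemma is_derive_to (f : R -> R) x a b : is_derive x (1 : R) f a -> a = b ->
  is_derive x (1 : R) f b.
Proof. by move=> d <-. Qed.

(** Through the power function, to agree with the exponents of the statement. *)
Definition cbrt x : R := x `^ 3^-1.

Lemma cbrt_gt0 x : 0 < x -> 0 < cbrt x.
Proof. exact: powR_gt0. Qed.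

Lemma cbrt_ge0 x : 0 <= cbrt x.
Proof. exact: powR_ge0. Qed.

Lemma cbrt3 x : 0 <= x -> cbrt x ^+ 3 = x.
Proof.
move=> x0; rewrite -powR_mulrn ?cbrt_ge0// -powRrM mulVf ?powRr1//.
Qed.

Lemma cbrtK x y : 0 <= x -> 0 <= y -> y ^+ 3 = x -> cbrt x = y.
Proof.
move=> x0 y0 yx; apply/eqP; rewrite -(@eqrXn2 _ 3) ?cbrt_ge0//.
by rewrite cbrt3// yx.
Qed.

Lemma cbrtM x y : 0 <= x -> 0 <= y -> cbrt (x * y) = cbrt x * cbrt y.
Proof. by move=> x0 y0; rewrite /cbrt powRM. Qed.

Lemma is_derive_cbrt x : 0 < x ->
  is_derive x (1 : R) cbrt (3 * cbrt x ^+ 2)^-1.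
Proof.
move=> x0; have := is_derive1_powR (3^-1) x0; move/is_derive_to; apply.
have c0 := cbrt_gt0 x0.
rewrite powRD; last by rewrite (gt_eqF x0) implybT.
rewrite powRN powRr1 ?ltW// -/(cbrt x) -[X in _ / X](cbrt3 (ltW x0)).
by field; rewrite gt_eqF.
Qed.

Lemma cont_cbrt x : 0 < x -> {for x, continuous cbrt}.
Proof. by move=> x0; exact: derive_cont (is_derive_cbrt x0). Qed.

Lemma meas_cbrt (D : set R) : Lmeas D -> Lmfun D cbrt.
Proof. by move=> mD; exact: (measurable_funS measurableT (@subsetT _ D) (measurable_powR _)). Qed.

(** The weight [e^{-x^3/3}]; its moments are the Gamma values at multiples of 1/3
    in the variable [x^3/3], which avoids fractional powers. *)
Definition ecub x : R := expR (- (x ^+ 3 / 3)).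

Lemma is_derive_Xn (n : nat) x : is_derive x (1 : R) (fun y => y ^+ n) (n%:R * x ^+ n.-1).
Proof.
case: n => [|n]; first by rewrite mul0r; under eq_fun do rewrite expr0; exact: is_derive_cst.
elim: n => [|n IH]; first by rewrite mul1r expr0; under eq_fun do rewrite expr1; exact: is_derive_id.
under eq_fun do rewrite exprS.
have := @is_deriveM _ _ _ _ x 1 _ _ (is_derive_id x 1) IH.
move/is_derive_to; apply; rewrite /GRing.scale/= !(exprS x n) -[in RHS](addn1 n.+1) natrD.
move: (x ^+ n) (n.+1%:R : R) => p q; ring.
Qed.

Lemma is_derive_ecub x : is_derive x (1 : R) ecub (- (x ^+ 2 * ecub x)).
Proof.
have D1 : is_derive x (1 : R) (fun y => - (y ^+ 3 / 3)) (- x ^+ 2).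
  have D0 := is_derive_Xn 3 x.
  have D2 : is_derive x (1 : R) (fun y => - 3^-1 * y ^+ 3) (- 3^-1 * (3%:R * x ^+ 2)).
    by have := @is_deriveZ _ _ _ _ (- 3^-1) x 1 _ D0; rewrite /GRing.scale.
  rewrite (_ : (fun y => - (y ^+ 3 / 3)) = (fun y => - 3^-1 * y ^+ 3)).
    by move: D2 => /is_derive_to; apply; field.
  by apply/funext => y; rewrite mulNr mulrC.
have := @is_derive1_comp R expR _ x _ _ (is_derive_expR _) D1.
by move/is_derive_to; apply; rewrite /ecub; ring.
Qed.

Lemma is_derive_Xecub (n : nat) x :
  is_derive x (1 : R) (fun y => y ^+ n * ecub y) (n%:R * (x ^+ n.-1 * ecub x) - x ^+ n.+2 * ecub x).
Proof.
have := @is_deriveM _ _ _ _ x 1 _ _ (is_derive_Xn n x) (is_derive_ecub x).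
move/is_derive_to; apply; rewrite /GRing.scale/= !exprS.
move: (x ^+ n) (x ^+ n.-1) (n%:R : R) (ecub x) => a b c d; ring.
Qed.

Lemma cont_Xecub (n : nat) : continuous (fun y => y ^+ n * ecub y).
Proof. exact: (derive_contT (is_derive_Xecub n)). Qed.

Lemma Xecub_le (n : nat) : exists C : R, forall x, 0 <= x -> `|x ^+ n * ecub x| <= C * expR (- x).
Proof.
have e0 : 0 < 3^-1 :> R by [].
have [C [_ HC]] := @cubic_decay R 0 (3^-1) n e0; exists C => x x0.
rewrite ger0_norm ?mulr_ge0 ?exprn_ge0 ?expR_ge0//; apply: le_trans (HC x x0).
rewrite mul0r add0r mulrC /ecub mulrC (mulrC 3^-1); apply: ler_wpM2r; first exact: expR_ge0.
by apply: lerXn2r; rewrite ?nnegrE ?addr_ge0//; rewrite lerDr.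
Qed.

Lemma Lint_Xecub (n : nat) : Lint halfline (fun x => x ^+ n * ecub x).
Proof.
have [C HC] := Xecub_le n; apply: Lint_expR_dom HC.
by apply: cont_meas; [exact: measurable_halfline|exact: cont_Xecub].
Qed.

(** [Em n] is [3^((n-2)/3) Gamma((n+1)/3)]. *)
Definition Em (n : nat) : R := \int[mu]_(x in halfline) (x ^+ n * ecub x).

Lemma Xecub_cvg (n : nat) : (x ^+ n * ecub x) @[x --> +oo] --> (0 : R).
Proof.
have [C HC] := Xecub_le n.
have /cvgy0_real : @cvgy0 R (fun x => (x ^+ n * ecub x)%:C).
  by apply: (@expR_cvgy0 _ _ C) => x x0; rewrite nc_real; exact: HC.
by apply => x; rewrite nc_real.
Qed.

(** The functional equation of Gamma. *)
Lemma Em_rec (n : nat) : Em n.+3 = n.+1%:R * Em n.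
Proof.
have H := @FTC_halfline R _ _ (fun x _ => is_derive_Xecub n.+1 x).
move: H; rewrite expr0n/= mul0r oppr0 => H.
have I1 : Lint halfline (fun x => n.+1%:R * (x ^+ n * ecub x)).
  by apply: LintZ; [exact: measurable_halfline|exact: Lint_Xecub].
have : \int[mu]_(x in halfline) (n.+1%:R * (x ^+ n * ecub x) - x ^+ n.+3 * ecub x) = 0.
  apply: H; last exact: Xecub_cvg.
    move=> x; apply: cvgB; last exact: cont_Xecub.
    by apply: cvgM; [exact: cvg_cst|exact: cont_Xecub].
  by apply: LintB; [exact: measurable_halfline|exact: I1|exact: Lint_Xecub].
rewrite RintegralB//; [|exact: Lint_Xecub]; rewrite RintegralZl//; last exact: Lint_Xecub.
by rewrite -/(Em _) -/(Em _) => /eqP; rewrite subr_eq0 => /eqP.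
Qed.

Lemma Em2 : Em 2 = 1.
Proof.
have H := @FTC_halfline R _ _ (fun x _ => is_derive_Xecub 0 x).
have E x : 0%:R * (x ^+ 0.-1 * ecub x) - x ^+ 2 * ecub x = -1 * (x ^+ 2 * ecub x).
  by rewrite mul0r sub0r mulN1r.
have : \int[mu]_(x in halfline) (0%:R * (x ^+ 0.-1 * ecub x) - x ^+ 2 * ecub x) = - 1.
  rewrite H.
  - by rewrite expr0 mul1r /ecub expr0n/= mul0r oppr0 expR0.
  - under eq_fun do rewrite E.
    by move=> x; apply: cvgM; [exact: cvg_cst|exact: cont_Xecub].
  - apply: (Lint_eq _ (f := fun x => -1 * (x ^+ 2 * ecub x))); [exact: measurable_halfline|by move=> x _; rewrite E|].
    by apply: LintZ; [exact: measurable_halfline|exact: Lint_Xecub].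
  - exact: Xecub_cvg.
rewrite (@int_eq _ _ _ (fun x => -1 * (x ^+ 2 * ecub x))); last by move=> x _; exact: E.
rewrite RintegralZl//; last exact: Lint_Xecub.
by rewrite mulN1r => /eqP; rewrite eqr_opp => /eqP.
Qed.

Lemma Em_scale (l : R) (n : nat) : 0 < l ->
  Lint halfline (fun x => x ^+ n * ecub (l * x)) /\
  \int[mu]_(x in halfline) (x ^+ n * ecub (l * x)) = l ^- n.+1 * Em n.
Proof.
move=> l0; have [I E] := int_scale l0 (@cont_Xecub n) (Lint_Xecub n).
have F x : x ^+ n * ecub (l * x) = l ^- n * ((l * x) ^+ n * ecub (l * x)).
  have : l ^+ n != 0 by rewrite expf_neq0// gt_eqF.
  by rewrite exprMn; move: (l ^+ n) (x ^+ n) (ecub _) => p q r p0; rewrite -mulrA mulKf.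
have I' : Lint halfline (fun x => l ^- n * ((l * x) ^+ n * ecub (l * x))).
  by apply: LintZ => //; exact: measurable_halfline.
split; first by apply: Lint_eq I' => //; exact: measurable_halfline.
rewrite (int_eq (fun x _ => F x)) (intZ _ (@measurable_halfline R) I) E mulrA; congr (_ * _).
by rewrite exprSr invfM mulrC.
Qed.

(** The radius of the point [(1, x)] for the cubic norm. *)
Definition lam x : R := cbrt (1 + x ^+ 3).

Lemma lam_gt0 x : 0 <= x -> 0 < lam x.
Proof. by move=> x0; apply: cbrt_gt0; rewrite ltr_wpDr// exprn_ge0. Qed.

Lemma lam3 x : 0 <= x -> lam x ^+ 3 = 1 + x ^+ 3.
Proof. by move=> x0; rewrite cbrt3// addr_ge0 ?exprn_ge0. Qed.

(** The classical relation between Beta and Gamma integrals: polar-type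
    substitution v = u z in the double integral of u^a v^b e^{-(u^3+v^3)/3} *)
Lemma Em_mul (a b : nat) :
  Lint oline (fun z => z ^+ b * lam z ^- (a + b).+2 * Em (a + b).+1) /\
  \int[mu]_(z in oline) (z ^+ b * lam z ^- (a + b).+2 * Em (a + b).+1) = Em a * Em b.
Proof.
pose f u z : R := u ^+ (a + b).+1 * z ^+ b * (ecub u * ecub (u * z)).
have mX (n : nat) : Lmfun setT (fun x => x ^+ n) by apply: exprn_measurable.
have me : Lmfun setT ecub.
  by apply: cont_meas => //; apply: (derive_contT is_derive_ecub).
have row u : 0 < u -> Lint oline (f u) /\ \int[mu]_(z in oline) f u z = Em b * (u ^+ a * ecub u).
  move=> u0; have [I E] := Em_scale b u0.
  have F z : f u z = (u ^+ (a + b).+1 * ecub u) * (z ^+ b * ecub (u * z)).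
    rewrite /f; move: (u ^+ _) (z ^+ _) (ecub _) (ecub _) => p q r s; ring.
  have I' : Lint halfline (fun z => (u ^+ (a + b).+1 * ecub u) * (z ^+ b * ecub (u * z))).
    by apply: LintZ => //; exact: measurable_halfline.
  have J : Lint oline (f u).
    apply: oline_Lint; apply: Lint_eq I' => //; exact: measurable_halfline.
  split => //; rewrite (int_oline J) (int_eq (fun z _ => F z)) (intZ _ (@measurable_halfline R) I) E.
  rewrite -addnS exprD; have : u ^+ b.+1 != 0 by rewrite expf_neq0// gt_eqF.
  move: (u ^+ b.+1) (u ^+ a) (ecub u) (Em b) => p q r s p0; field.
  exact: p0.
have [||||] := @fubini_real R oline oline f (fun u => Em b * (u ^+ a * ecub u))
  (fun z => z ^+ b * lam z ^- (a + b).+2 * Em (a + b).+1)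
  (fun u => Em b * (u ^+ a * ecub u)) (measurable_oline) (measurable_oline).
- apply: measurable_funM.
    by apply: measurable_funM; [exact: (meas_fst (mX _))|exact: (meas_snd (mX _))].
  apply: measurable_funM; first exact: (meas_fst me).
  apply: (measurableT_comp me); apply: measurable_funM; first exact: measurable_fst.
  exact: measurable_snd.
- move=> u; rewrite /= in_itv/= andbT => u0; have [I E] := row u u0; split => //.
  rewrite -E; apply: int_eq => z; rewrite /= in_itv/= andbT => z0.
  by rewrite ger0_norm// /f !mulr_ge0 ?exprn_ge0 ?expR_ge0 ?ltW.
- apply: LintZ; [exact: measurable_oline|apply: oline_Lint; exact: Lint_Xecub].
- move=> z; rewrite /= in_itv/= andbT => z0; have l0 := lam_gt0 (ltW z0).
  have [I E] := Em_scale (a + b).+1 l0.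
  have F u : f u z = z ^+ b * (u ^+ (a + b).+1 * ecub (lam z * u)).
    have -> : ecub (lam z * u) = ecub u * ecub (u * z).
      by rewrite /ecub -expRD exprMn lam3 ?ltW// exprMn; congr expR; field.
    rewrite /f; move: (u ^+ _) (z ^+ _) (ecub _) (ecub _) => p q r s; ring.
  have I' : Lint halfline (fun u => z ^+ b * (u ^+ (a + b).+1 * ecub (lam z * u))).
    by apply: LintZ => //; exact: measurable_halfline.
  have J : Lint oline (f^~ z).
    apply: oline_Lint; apply: Lint_eq I' => //; exact: measurable_halfline.
  split => //; rewrite (int_oline J) (int_eq (fun u _ => F u)) (intZ _ (@measurable_halfline R) I) E.
  by rewrite mulrA.
have Ia := oline_Lint (Lint_Xecub a).
by move=> J E; split => //; rewrite E (intZ _ measurable_oline Ia) (int_oline Ia) -/(Em a) mulrC.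
Qed.

Lemma atan_third : atan (Num.sqrt 3)^-1 = pi / 6 :> R.
Proof.
set s : R := Num.sqrt 3; set h := atan s^-1.
have s0 : 0 < s by rewrite sqrtr_gt0.
have s3 : s ^+ 2 = 3 by rewrite sqr_sqrtr.
have h0 : 0 < h by rewrite -(@atan0 R); apply: lt_atan; rewrite invr_gt0.
have h1 : h < pi / 4.
  rewrite -(@atan1 R); apply: lt_atan; rewrite invf_lt1//.
  by rewrite -(@ltr_pXn2r _ 2) ?nnegrE ?ltW// s3 expr1n; lra.
have p0 := pi_gt0 R.
have c0 : 0 < cos h by apply: cos_gt0_pihalf; apply/andP; split; lra.
have th : sin h = cos h / s.
  have := @atanK R s^-1; rewrite /tan -/h => <-.
  by rewrite mulrC mulfVK ?gt_eqF.
have c2 : cos h ^+ 2 = 3 / 4.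
  have := cos2Dsin2 h; rewrite th expr_div_n s3; lra.
have : cos (3 * h) = cos (pi / 2).
  rewrite cos_pihalf (_ : 3 * h = h + h + h); last ring.
  rewrite !cosD sinD th.
  have -> : (cos h * cos h - cos h / s * (cos h / s)) * cos h -
    (cos h / s * cos h + cos h * (cos h / s)) * (cos h / s) =
    cos h * (cos h ^+ 2) * (1 - 3 / s ^+ 2).
    by field; rewrite gt_eqF.
  by rewrite s3 divff ?gt_eqF// subrr mulr0.
move=> /cos_inj; rewrite !in_itv/= => H.
suff : 3 * h = pi / 2 by lra.
by apply: H; apply/andP; split; lra.
Qed.

(** The reflection formula at 1/3, here an elementary arctangent integral. *)
Lemma Em01 : Em 0 * Em 1 = 2 * pi / (3 * Num.sqrt 3).
Proof.
set s : R := Num.sqrt 3.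
have s0 : 0 < s by rewrite sqrtr_gt0.
have s3 : s ^+ 2 = 3 by rewrite sqr_sqrtr.
have [I1 E1] := Em_mul 0 1; have [I2 E2] := Em_mul 1 0.
move: I1 E1 I2 E2; rewrite add0n addn0 Em2 => I1 E1 I2 E2.
pose q x : R := x ^+ 2 - x + 1.
have q0 x : 0 < q x.
  have -> : q x = (x - 2^-1) ^+ 2 + 3 / 4 by rewrite /q; field.
  by rewrite ltr_wpDl// sqr_ge0.
have EE : \int[mu]_(z in oline) (q z)^-1 = 2 * (Em 0 * Em 1) /\ Lint oline (fun z => (q z)^-1).
  have K z : oline z -> z ^+ 1 * lam z ^- 3 * 1 + z ^+ 0 * lam z ^- 3 * 1 = (q z)^-1.
    rewrite /= in_itv/= andbT => z0; rewrite lam3 ?ltW// expr1 expr0 !mul1r !mulr1.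
    have -> : 1 + z ^+ 3 = (z + 1) * q z by rewrite /q; ring.
    have : z + 1 != 0 by rewrite gt_eqF// addr_gt0.
    have := q0 z; move: (q z) => w w0 z1; field.
    by rewrite z1 gt_eqF.
  split; last by apply: Lint_eq (LintD measurable_oline I1 I2) => //; exact: measurable_oline.
  by rewrite -(int_eq K) RintegralD//; rewrite E1 E2; ring.
have [EE1 EE2] := EE.
pose A x : R := (2 / s) * (atan ((2 * x - 1) / s) - pi / 2).
have dA x : 0 <= x -> is_derive x (1 : R) A (q x)^-1.
  move=> _.
  have D1 : is_derive x (1 : R) (fun x => (2 * x - 1) / s) (2 / s).
    rewrite (_ : (fun x => _) = (fun x => (2 / s) * x + - s^-1)); last first.
      by apply/funext => y; field; rewrite gt_eqF.
    have D0 := @is_deriveZ _ _ _ id (2 / s) x 1 1 (is_derive_id _ _).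
    have := @is_deriveD _ _ _ _ _ x 1 _ _ D0 (is_derive_cst (- s^-1) x 1).
    by move/is_derive_to; apply; rewrite /GRing.scale/= mulr1 addr0.
  have D2 := @is_derive1_comp R atan _ x _ _ (is_derive1_atan _) D1.
  have D3 := @is_deriveB _ _ _ _ _ x 1 _ _ D2 (is_derive_cst (pi / 2) x 1).
  have := @is_deriveZ _ _ _ _ (2 / s) x 1 _ D3.
  move/is_derive_to; apply; rewrite /GRing.scale/= subr0 expr_div_n s3 /q.
  have := q0 x; rewrite /q => qx.
  have -> : 1 + (2 * x - 1) ^+ 2 / 3 = 4 / 3 * (x ^+ 2 - x + 1) by field.
  have -> : 2 / s * ((4 / 3 * (x ^+ 2 - x + 1))^-1 * (2 / s)) =
    3 / s ^+ 2 * (x ^+ 2 - x + 1)^-1 by field; rewrite ?gt_eqF.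
  by rewrite s3 divff ?mul1r ?gt_eqF.
have cq : continuous (fun x => (q x)^-1).
  move=> x; apply: cvgV; first by rewrite gt_eqF.
  apply: cvgD; last exact: cvg_cst.
  by apply: cvgB; [exact: (derive_contT (is_derive_Xn 2))|exact: cvg_id].
have Ao : A x @[x --> +oo] --> (0 : R).
  have L : (2 * x - 1) / s @[x --> +oo] --> +oo.
    apply/cvgryPge => M; near=> x; rewrite ler_pdivlMr//.
    have : (M * s + 1) / 2 <= x by near: x; apply: nbhs_pinfty_ge; rewrite num_real.
    lra.
  have C1 : atan ((2 * x - 1) / s) @[x --> +oo] --> (pi / 2 : R) by apply: cvg_comp L (@cvgy_atan R).
  have : (2 / s) * (atan ((2 * x - 1) / s) - pi / 2) @[x --> +oo] --> (2 / s) * (pi / 2 - pi / 2).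
    by apply: cvgM; [exact: cvg_cst|apply: cvgB => //; exact: cvg_cst].
  by rewrite subrr mulr0.
have := FTC_halfline dA cq (Lint_oline EE2) Ao.
rewrite -int_oline// EE1 /A mulr0 sub0r mulN1r atanN atan_third => E.
have -> : Em 0 * Em 1 = 2 * (Em 0 * Em 1) / 2 by field.
by rewrite E; field; rewrite gt_eqF.
Unshelve. all: by end_near.
Qed.

Lemma Em_gt0_neq0 (n : nat) : Em n != 0.
Proof.
have H : Em 0 * Em 1 != 0.
  by rewrite Em01 mulf_neq0// ?invr_eq0 ?mulf_neq0// gt_eqF// ?pi_gt0 ?sqrtr_gt0.
move: H; rewrite mulf_eq0 negb_or => /andP[h0 h1].
suff : (Em n != 0) /\ (Em n.+1 != 0) /\ (Em n.+2 != 0) by case.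
elim: n => [|n [a [b c]]]; first by rewrite h0 h1 Em2 oner_eq0.
by rewrite b c Em_rec mulf_neq0// pnatr_eq0.
Qed.

End GammaIntegrals.

(** * Beta integrals with Abel kernels *)

Section SingularIntegrals.
Context {R : realType}.
Notation mu := (@lebesgue_measure R).
Notation oline := (`]0, +oo[%classic : set R).
Implicit Types (x y z t s tau : R).

Lemma cont_chain (f : R -> R) (d x : R) : is_derive x (1 : R) f d -> 0 < f x ->
  {for x, continuous (fun y => (cbrt (f y))^-1)}.
Proof.
move=> df f0; apply: cvgV; first by rewrite gt_eqF// cbrt_gt0.
apply: (@continuous_comp _ _ _ f cbrt); first exact: derive_cont df.
exact: cont_cbrt.
Qed.

Lemma is_derive_affine (a b x : R) : is_derive x (1 : R) (fun y => a + b * y) b.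
Proof.
have D0 := @is_deriveZ _ _ _ id b x 1 1 (is_derive_id _ _).
have := @is_deriveD _ _ _ _ _ x 1 _ _ (is_derive_cst a x 1) D0.
by move/is_derive_to; apply; rewrite /GRing.scale/= mulr1 add0r.
Qed.

Lemma subst_cube : subst_data oline (fun u => u ^+ 3 / 3) (fun u => u ^+ 2).
Proof.
split.
- move=> x _; have := @is_deriveZ _ _ _ _ (3^-1) x 1 _ (is_derive_Xn 3 x).
  rewrite (_ : (3^-1 \*: _)%R = (fun u => u ^+ 3 / 3)); last first.
    by apply/funext => y; rewrite /= /GRing.scale/= mulrC.
  by move/is_derive_to; apply; rewrite /GRing.scale/=; field.
- by move=> x _; apply: (derive_contT (is_derive_Xn 2)).
- by move=> x x0; rewrite exprn_gt0.
- by move=> x x0; rewrite /= in_itv/= andbT divr_gt0// exprn_gt0.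
- by move=> p q y; rewrite /= !in_itv/= !andbT => p0 _ /andP[py _]; exact: lt_le_trans py.
- move=> y; rewrite /= in_itv/= andbT => y0; exists (cbrt (3 * y)), (cbrt (3 * y)).
  have y3 : 0 < 3 * y by rewrite mulr_gt0.
  rewrite lexx cbrt_gt0//; split => //.
  have -> : cbrt (3 * y) ^+ 3 / 3 = y by rewrite (cbrt3 (ltW y3)); field.
  by rewrite lexx.
Qed.

(** The Gamma value of the Caputo derivative of order 4/3. *)
Lemma Gamma_two_thirds : Gamma (2 - 4 / 3) = cbrt 3 * Em 1 :> R.
Proof.
pose G x : R := x `^ (2 - 4 / 3 - 1) * expR (- x).
have GE x : G x = (cbrt x)^-1 * expR (- x).
  by rewrite /G (_ : 2 - 4 / 3 - 1 = - 3^-1); [rewrite powRN|field].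
have K u : oline u -> G (u ^+ 3 / 3) * u ^+ 2 = cbrt 3 * (u ^+ 1 * ecub u).
  rewrite /= in_itv/= andbT => u0; rewrite GE expr1 -/(ecub u).
  have -> : cbrt (u ^+ 3 / 3) = u / cbrt 3.
    apply: cbrtK; rewrite ?divr_ge0 ?exprn_ge0 ?cbrt_ge0 ?ltW//.
    by rewrite expr_div_n cbrt3.
  have c0 : cbrt 3 != 0 :> R by rewrite gt_eqF// cbrt_gt0.
  move: (ecub u) (cbrt 3) c0 => p q q0; field.
  by rewrite q0 gt_eqF.
have I1 := oline_Lint (@Lint_Xecub R 1).
have [] := @subst_Lint R oline _ _ G subst_cube.
- move=> y; rewrite /= in_itv/= andbT => y0; rewrite (_ : G = (fun x => (cbrt x)^-1 * expR (- x))); last first.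
    by apply/funext => x; exact: GE.
  have c2 : {for y, continuous (fun x => expR (- x))}.
    rewrite (_ : (fun x => expR (- x)) = (fun x => expR (-1 * x))); last first.
      by apply/funext => x; rewrite mulN1r.
    exact: derive_cont (is_derive_expRZ (-1) y).
  by apply: cvgM => //; apply: (cont_chain (is_derive_id y 1)).
- apply: (Lint_eq measurable_oline (f := fun u => cbrt 3 * (u ^+ 1 * ecub u))).
    by move=> u /K.
  by apply: LintZ => //; exact: measurable_oline.
move=> _ E; rewrite /Gamma (_ : \int[mu]_(x in oline) _ = \int[mu]_(x in oline) G x)// E.
by rewrite (int_eq K) (intZ _ measurable_oline I1) (int_oline I1).
Qed.

(** The variable z with [z^3 = (s - tau) / (t - s)] sends the interval to the half
    line and removes both Abel singularities. *)
Lemma subst_beta tau t : tau < t ->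
  subst_data `]tau, t[%classic (fun z => t - (t - tau) * (1 + z ^+ 3)^-1)
    (fun z => (t - tau) * (3 * z ^+ 2 * (1 + z ^+ 3) ^- 2)).
Proof.
move=> tt; have T0 : 0 < t - tau by rewrite subr_gt0.
have p1 x : 0 < x -> 0 < 1 + x ^+ 3 by move=> x0; rewrite addr_gt0// exprn_gt0.
have d1 x : is_derive x (1 : R) (fun z => 1 + z ^+ 3) (3 * x ^+ 2).
  have := @is_deriveD _ _ _ _ _ x 1 _ _ (is_derive_cst (1 : R) x 1) (is_derive_Xn 3 x).
  by move/is_derive_to; apply; rewrite add0r.
have bnd x : 0 < x -> (tau < t - (t - tau) * (1 + x ^+ 3)^-1 < t).
  move=> x0; have q0 : 0 < (1 + x ^+ 3)^-1 by rewrite invr_gt0 p1.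
  have q1 : (1 + x ^+ 3)^-1 < 1 by rewrite invf_lt1 ?p1// ltrDl exprn_gt0.
  have h1 : (t - tau) * (1 + x ^+ 3)^-1 < t - tau by rewrite gtr_pMr.
  have h2 : 0 < (t - tau) * (1 + x ^+ 3)^-1 by rewrite mulr_gt0.
  move: ((t - tau) * _) h1 h2 => w h1 h2; apply/andP; split; lra.
split.
- move=> x x0; have n0 : 1 + x ^+ 3 != 0 by rewrite gt_eqF// p1.
  have D := @is_deriveV _ (fun z => 1 + z ^+ 3) x _ 1 n0 (d1 x).
  have D2 := @is_deriveZ _ _ _ _ (t - tau) x 1 _ D.
  have := @is_deriveB _ _ _ _ _ x 1 _ _ (is_derive_cst t x 1) D2.
  move/is_derive_to; apply; rewrite /GRing.scale/=.
  by move: ((1 + x ^+ 3) ^- 2) => p; ring.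
- move=> x x0; apply: cvgM; first exact: cvg_cst.
  apply: cvgM.
    by apply: cvgM; [exact: cvg_cst|exact: (derive_contT (is_derive_Xn 2))].
  apply: cvgV; first by rewrite gt_eqF// exprn_gt0// p1.
  apply: (@continuous_comp _ _ _ (fun z => 1 + z ^+ 3) (fun w => w ^+ 2)).
    exact: derive_cont (d1 x).
  exact: (derive_contT (is_derive_Xn 2)).
- move=> x x0; rewrite mulr_gt0// mulr_gt0 ?invr_gt0 ?exprn_gt0 ?p1//.
  by rewrite mulr_gt0 ?exprn_gt0.
- by move=> x x0; rewrite /= in_itv/= bnd.
- move=> p q y; rewrite /= !in_itv/= => /andP[p0 _] /andP[_ q0] /andP[py yq].
  by rewrite (lt_le_trans p0 py) (le_lt_trans yq q0).
- move=> y; rewrite /= in_itv/= => /andP[y0 y1].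
  have a0 : 0 < t - y by rewrite subr_gt0.
  have b0 : 0 < y - tau by rewrite subr_gt0.
  exists (cbrt ((y - tau) / (t - y))), (cbrt ((y - tau) / (t - y))).
  have c0 : 0 < (y - tau) / (t - y) by rewrite divr_gt0.
  rewrite lexx (cbrt_gt0 c0) (cbrt3 (ltW c0)).
  have -> : 1 + (y - tau) / (t - y) = (t - tau) / (t - y) by field; rewrite gt_eqF.
  have -> : t - (t - tau) * ((t - tau) / (t - y))^-1 = y; last by rewrite lexx; split.
  by field; rewrite !gt_eqF.
Qed.

Lemma beta_cbrt tau t z : tau < t -> 0 < z ->
  let s := t - (t - tau) * (1 + z ^+ 3)^-1 in
  cbrt (t - s) = cbrt (t - tau) / lam z /\ cbrt (s - tau) = cbrt (t - tau) * z / lam z.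
Proof.
move=> tt z0 s; have T0 : 0 < t - tau by rewrite subr_gt0.
have l0 := lam_gt0 (ltW z0); have l3 := lam3 (ltW z0).
have p0 : 0 < 1 + z ^+ 3 by rewrite addr_gt0// exprn_gt0.
have e1 : t - s = (t - tau) / (1 + z ^+ 3) by rewrite /s; ring.
have e2 : s - tau = (t - tau) * z ^+ 3 / (1 + z ^+ 3).
  by rewrite /s; move: (z ^+ 3) p0 => w p0; field; rewrite gt_eqF.
have c0 := cbrt_gt0 T0.
split; apply: cbrtK.
- by rewrite e1 divr_ge0 ?ltW.
- by rewrite divr_ge0 ?ltW.
- by rewrite expr_div_n cbrt3 ?ltW// l3 e1.
- by rewrite e2 divr_ge0 ?mulr_ge0 ?exprn_ge0 ?ltW.
- by rewrite divr_ge0 ?mulr_ge0 ?ltW.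
- by rewrite expr_div_n exprMn cbrt3 ?ltW// l3 e2.
Qed.

Lemma cont_beta (tau t : R) y : tau < y < t ->
  {for y, continuous (fun s => (cbrt (t - s))^-1)} /\ {for y, continuous (fun s => (cbrt (s - tau))^-1)}.
Proof.
move=> /andP[h1 h2]; split.
  have := is_derive_affine t (-1) y; under eq_fun do rewrite mulN1r.
  by move=> D; apply: (cont_chain D); rewrite subr_gt0.
have := is_derive_affine (- tau) 1 y; under eq_fun do rewrite mul1r addrC.
by move=> D; apply: (cont_chain D); rewrite subr_gt0.
Qed.

(** The Abel kernels of orders 1/3 and 2/3 are inverse to each other up to a
    constant that does not depend on the interval *)
Lemma abel_const tau t : tau < t ->
  Lint `]tau, t[ (fun s => (cbrt (t - s))^-1 ^+ 2 * (cbrt (s - tau))^-1) /\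
  \int[mu]_(s in `]tau, t[) ((cbrt (t - s))^-1 ^+ 2 * (cbrt (s - tau))^-1) = 3 * (Em 0 * Em 1).
Proof.
move=> tt; have T0 : 0 < t - tau by rewrite subr_gt0.
have [I E] := @Em_mul R 0 1.
have S := subst_beta tt.
pose G s : R := (cbrt (t - s))^-1 ^+ 2 * (cbrt (s - tau))^-1.
have K z : oline z -> 3 * (z ^+ 1 * lam z ^- (0 + 1).+2 * Em (0 + 1).+1) =
   G (t - (t - tau) * (1 + z ^+ 3)^-1) * ((t - tau) * (3 * z ^+ 2 * (1 + z ^+ 3) ^- 2)).
  rewrite /= in_itv/= andbT => z0; have [e1 e2] := beta_cbrt tt z0; rewrite /G e1 e2.
  have l0 := lam_gt0 (ltW z0); have c0 := cbrt_gt0 T0.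
  rewrite add0n Em2 -(lam3 (ltW z0)) expr1 -[X in _ = _ * (X * _)](cbrt3 (ltW T0)).
  move: (lam z) (cbrt (t - tau)) l0 c0 => l c l0 c0.
  by field; rewrite !gt_eqF.
have I' : Lint oline (fun z => 3 * (z ^+ 1 * lam z ^- (0 + 1).+2 * Em (0 + 1).+1)).
  by apply: LintZ => //; exact: measurable_oline.
have [] := @subst_Lint R _ _ _ G S.
- move=> y; rewrite /= in_itv/= => h; have [c1 c2] := cont_beta h.
  by apply: cvgM => //; rewrite expr2; apply: cvgM.
- by apply: Lint_eq I' => //; exact: measurable_oline.
move=> J F; split => //; rewrite F -(int_eq K) (intZ _ measurable_oline I) E //.
Qed.

(** The Caputo integral of a power of s, still a Beta integral; the factors are
    arranged as powers of [(3 s)^(1/3)], the scale of the kernel at time s. *)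
Lemma sing_moment t (k : nat) : 0 < t ->
  let G s := (cbrt (t - s))^-1 * ((cbrt (3 * s))^-1 ^+ 2 * cbrt (3 * s) ^+ k) in
  Lint `]0, t[ G /\
  (\int[mu]_(s in `]0, t[) G s) * Em k.+2 = cbrt 3 * Em 1 * (Em k * cbrt (3 * t) ^+ k).
Proof.
move=> t0 G; have [I E] := @Em_mul R 1 k.
have S := subst_beta t0; have c30 : 0 < cbrt 3 :> R by rewrite cbrt_gt0.
have e0 := @Em_gt0_neq0 R (1 + k).+1.
pose C : R := cbrt 3 * cbrt (3 * t) ^+ k * (Em (1 + k).+1)^-1.
have K z : oline z -> C * (z ^+ k * lam z ^- (1 + k).+2 * Em (1 + k).+1) =
   G (t - (t - 0) * (1 + z ^+ 3)^-1) * ((t - 0) * (3 * z ^+ 2 * (1 + z ^+ 3) ^- 2)).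
  rewrite /= in_itv/= andbT => z0; have [e1 e2] := beta_cbrt t0 z0; move: e1 e2.
  rewrite !subr0 /G; set s := t - t * (1 + z ^+ 3)^-1 => e1 e2.
  have l0 := lam_gt0 (ltW z0); have c0 := cbrt_gt0 t0.
  have s0 : 0 <= s.
    have q1 : (1 + z ^+ 3)^-1 <= 1.
      by rewrite invf_le1 ?lerDl ?exprn_ge0 ?ltW// addr_gt0// exprn_gt0.
    by rewrite /s subr_ge0 ler_piMr// ltW.
  rewrite (cbrtM _ s0)// e1 e2 -(lam3 (ltW z0)).
  rewrite /C (cbrtM _ (ltW t0))// -[X in _ = _ * (X * _)](cbrt3 (ltW t0)).
  rewrite !exprMn !exprVn (_ : (1 + k).+2 = (k + 3)%N) ?exprD; last by rewrite addnC addn1 addn3.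
  move: e0; have zk : 0 < z ^+ k by rewrite exprn_gt0.
  have lk : 0 < lam z ^+ k by rewrite exprn_gt0.
  have ck : 0 < cbrt t ^+ k by rewrite exprn_gt0.
  have tk : 0 < cbrt 3 ^+ k :> R by rewrite exprn_gt0.
  have c33 : cbrt 3 ^+ 3 = 3 :> R by rewrite cbrt3.
  have -> : (3 : R) * z ^+ 2 = cbrt 3 ^+ 3 * z ^+ 2 by rewrite c33.
  move: (cbrt 3) (Em _) (lam z) (cbrt t) (z ^+ k) (lam z ^+ k) (cbrt t ^+ k) (cbrt 3 ^+ k) zk lk ck tk c30 l0 c0.
  move=> {S I E C G c33} c3 e l c zk lk ck tk zk0 lk0 ck0 tk0 c30 l0 c0 e0.
  by field; rewrite e0 !gt_eqF.
have I' : Lint oline (fun z => C * (z ^+ k * lam z ^- (1 + k).+2 * Em (1 + k).+1)).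
  by apply: LintZ => //; exact: measurable_oline.
have [] := @subst_Lint R _ _ _ G S.
- move=> y; rewrite /= in_itv/= => /andP[y0 yt].
  have [c1 _] : _ /\ _ := cont_beta (introT andP (conj y0 yt)).
  have D : is_derive y (1 : R) (fun s => 3 * s) 3.
    by have := is_derive_affine 0 3 y; under eq_fun do rewrite add0r.
  have y3 : 0 < 3 * y by rewrite mulr_gt0.
  have c2 := cont_chain D y3.
  have c3 : {for y, continuous (fun s => cbrt (3 * s))}.
    by apply: (@continuous_comp _ _ _ (fun s => 3 * s) cbrt); [exact: derive_cont D|exact: cont_cbrt].
  apply: cvgM => //; apply: cvgM; first by rewrite expr2; apply: cvgM.
  apply: (@continuous_comp _ _ _ (fun s => cbrt (3 * s)) (fun w => w ^+ k)) => //.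
  exact: (derive_contT (is_derive_Xn k)).
- by apply: Lint_eq I' => //; exact: measurable_oline.
move=> J F; split => //; rewrite F -(int_eq K) (intZ _ measurable_oline I) E.
have k2 : (1 + k).+1 = k.+2 by rewrite add1n.
rewrite /C k2 in e0 *; move: (Em k.+2) (Em k) (Em 1) (cbrt 3) (cbrt (3 * t) ^+ k) e0 => e a b c d e0.
by field.
Qed.

End SingularIntegrals.

(** * Moments of the kernel and Airy values at the origin *)

Section Moments.
Context {R : realType}.
Notation mu := (@lebesgue_measure R).
Implicit Types (x y s t : R) (z w : R[i]).

Lemma rcM x y : (x * y)%:C = x%:C * y%:C :> R[i].
Proof. exact: (rmorphM (@real_complex R)). Qed.

Lemma rcX x (n : nat) : (x ^+ n)%:C = x%:C ^+ n :> R[i].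
Proof. exact: (rmorphXn (@real_complex R)). Qed.

Lemma rcN x : (- x)%:C = - x%:C :> R[i].
Proof. exact: (rmorphN (@real_complex R)). Qed.

(** One term of the exponential series. *)
Lemma expR_ge_pow (n : nat) x : 0 <= x -> x ^+ n <= n`!%:R * expR x.
Proof.
elim: n x => [|n IH] x x0; first by rewrite expr0 mul1r -expR0 ler_expR.
have D1 y : is_derive y (1 : R) (fun y => y ^+ n.+1) (n.+1%:R * y ^+ n) := is_derive_Xn n.+1 y.
have D2 y : is_derive y (1 : R) (fun y => n.+1`!%:R * expR y) (n.+1`!%:R * expR y).
  have := @is_deriveZ _ _ _ _ (n.+1`!%:R : R) y 1 _ (is_derive_expR y).
  by rewrite /GRing.scale/=.
have := @mvt_le R _ _ _ _ 0 x x0 (fun y _ => D1 y) (fun y _ => D2 y).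
rewrite expr0n/= subr0 => H.
have {}H : `|x ^+ n.+1| <= n.+1`!%:R * expR x - n.+1`!%:R * expR 0.
  apply: H => y /andP[y0 _].
  rewrite ger0_norm ?mulr_ge0 ?exprn_ge0// factS natrM -mulrA ler_wpM2l//.
  exact: IH.
have : 0 <= n.+1`!%:R * expR 0 :> R by rewrite mulr_ge0 ?expR_ge0.
by have := ler_norm (x ^+ n.+1); lra.
Qed.

(** The moment integrands. *)
Definition mul_pow (k : nat) (f : R -> R[i]) y : R[i] := (y ^+ k)%:C * f y.

Lemma airyV_pow_decay (m k : nat) (eta : R) : exists C : R, 0 <= C /\ forall y, 0 <= y ->
  nc (mul_pow k (airyV m) y) <= C * expR (- eta * y).
Proof.
have [C [C0 HC]] := @airyV_decay R m (eta + 1).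
exists (k`!%:R * C); split; first by rewrite mulr_ge0.
move=> y y0; rewrite /mul_pow ncM nc_real ger0_norm ?exprn_ge0//.
apply: le_trans (ler_pM _ (nc_ge0 _) (expR_ge_pow k y0) (HC y y0)) _; first exact: exprn_ge0.
rewrite mulrACA; apply: ler_wpM2l; first by rewrite mulr_ge0.
by rewrite -expRD ler_expR; lra.
Qed.

Lemma airyV_ccont m : ccont (@airyV R m).
Proof. by apply: (cder_cont (f' := airyV m.+1)) => y; exact: airyV_cder. Qed.

Lemma cder_pow (k : nat) y : cder (fun y => (y ^+ k)%:C) y (k%:R * y ^+ k.-1)%:C.
Proof. exact: cder_real (is_derive_Xn k y). Qed.

Lemma mul_pow_ccont (k m : nat) : ccont (mul_pow k (airyV m)).
Proof.
apply: ccontM; last exact: airyV_ccont.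
by apply: cder_cont => y; exact: cder_pow.
Qed.

Lemma mul_pow_Cint (k m : nat) : cintegrable halfline (mul_pow k (airyV m)).
Proof.
have [C [C0 HC]] := airyV_pow_decay m k 1.
apply: (Cint_dom (G := fun y => C * expR (- 1 * y)) (@measurable_halfline R) (mul_pow_ccont k m)).
  by apply: LintZ; [exact: measurable_halfline|exact: Lint_expR].
by move=> y; rewrite /= in_itv/= andbT; exact: HC.
Qed.

Lemma mul_pow_cvg (k m : nat) : cvgy0 (mul_pow k (airyV m)).
Proof.
have [C [C0 HC]] := airyV_pow_decay m k 1; apply: (@expR_cvgy0 _ _ C) => y /HC.
by rewrite mulN1r.
Qed.

(** Moments of V; their real parts are those of the profile. *)
Definition mom (k : nat) : R[i] := cintegral halfline (mul_pow k (airyV 0)).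

Lemma mom_V2 (k : nat) y : mul_pow k (airyV 2) y = bR ^+ 3 * mul_pow k.+1 (airyV 0) y.
Proof.
rewrite /mul_pow airyV_ode; set X := airyV 0 y; move: X => X.
have -> : (y ^+ k.+1)%:C = (y ^+ k)%:C * y%:C by rewrite -rcM -exprSr.
move: (bR ^+ 3) ((y ^+ k)%:C) (y%:C) => p q r; ring.
Qed.

Lemma mom_int_V2 (k : nat) :
  cintegral halfline (mul_pow k (airyV 2)) = bR ^+ 3 * mom k.+1.
Proof.
rewrite -(cintZ _ (@measurable_halfline R) (mul_pow_Cint k.+1 0)).
by apply: cint_eq => y _; exact: mom_V2.
Qed.

Lemma mom1 : bR ^+ 3 * mom 1 = - airyV 1 0.
Proof.
rewrite -mom_int_V2.
have E m y : mul_pow 0 (airyV m) y = airyV m y by rewrite /mul_pow expr0 mul1r.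
rewrite (cint_eq (g := airyV 2)); last by move=> y _; exact: E.
have E2 m : mul_pow 0 (airyV m) = airyV m by apply/funext => y; exact: E.
apply: cFTC_halfline.
- by move=> y _; exact: airyV_cder.
- exact: airyV_ccont.
- by rewrite -E2; exact: mul_pow_Cint.
- by rewrite -E2; exact: mul_pow_cvg.
Qed.

Lemma cvgy0Z c (f : R -> R[i]) : cvgy0 f -> cvgy0 (fun y => c * f y).
Proof.
move=> f0 e e0; have c1 : 0 < nc c + 1 by rewrite ltr_wpDl ?nc_ge0.
have [A HA] := f0 _ (divr_gt0 e0 c1); exists A => x /HA.
rewrite ler_pdivlMr// ncM => H; apply: le_trans H.
by rewrite mulrC ler_wpM2l ?nc_ge0// lerDl.
Qed.

Lemma mul_pow0 (k : nat) (f : R -> R[i]) : mul_pow k.+1 f 0 = 0.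
Proof. by rewrite /mul_pow expr0n mul0r. Qed.

(** Integration by parts; the powers kill the boundary term at 0. *)
Lemma mom_parts (m j : nat) :
  cintegral halfline (mul_pow j.+1 (airyV m.+1)) =
  - ((j.+1%:R)%:C * cintegral halfline (mul_pow j (airyV m))).
Proof.
have d y : cder (mul_pow j.+1 (airyV m)) y
    ((j.+1%:R)%:C * mul_pow j (airyV m) y + mul_pow j.+1 (airyV m.+1) y).
  apply: cder_eq (cderM (cder_pow j.+1 y) (airyV_cder m y)).
  by rewrite /mul_pow rcM mulrA.
have mH := @measurable_halfline R.
have I1 := CintZ (j.+1%:R)%:C mH (mul_pow_Cint j m).
have I2 := mul_pow_Cint j.+1 m.+1.
have C1 : ccont (fun y => (j.+1%:R)%:C * mul_pow j (airyV m) y + mul_pow j.+1 (airyV m.+1) y).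
  apply: ccontD; last exact: mul_pow_ccont.
  apply: ccontM; last exact: mul_pow_ccont.
  by split => x; exact: cvg_cst.
have := cFTC_halfline (fun y _ => d y) C1 (CintD mH I1 I2) (mul_pow_cvg j.+1 m).
rewrite (cintD mH I1 I2) (cintZ _ mH (mul_pow_Cint j m)) mul_pow0 oppr0 addrC.
by move=> /eqP; rewrite addr_eq0 => /eqP.
Qed.

Lemma mom2 : bR ^+ 3 * mom 2 = airyV 0 0.
Proof.
rewrite -mom_int_V2 mom_parts mul1r.
have E2 m : mul_pow 0 (airyV m) = airyV m.
  by apply/funext => y; rewrite /mul_pow expr0 mul1r.
have -> : cintegral halfline (mul_pow 0 (airyV 1)) = - airyV 0 0.
  rewrite E2; apply: cFTC_halfline.
  - by move=> y _; exact: airyV_cder.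
  - exact: airyV_ccont.
  - by rewrite -E2; exact: mul_pow_Cint.
  - by rewrite -E2; exact: mul_pow_cvg.
exact: opprK.
Qed.

(** Two integrations by parts and [V'' = w^3 y V]. *)
Lemma mom_rec (k : nat) : bR ^+ 3 * mom k.+3 = (k.+2%:R)%:C * ((k.+1%:R)%:C * mom k).
Proof. by rewrite -mom_int_V2 !mom_parts mulrN opprK. Qed.

Lemma ray_cj1 : ray bL 1 (0 : R[i]) = cj (ray bR 1 0).
Proof.
have I := @ray_integrable R bR (2 / 3) e23 bR_cubic 1 0.
rewrite {2}/ray -(cint_cj I); apply: cint_eq => s _.
have G0 (b : R[i]) : airyG 1 0 (b * s%:C) = b * s%:C * airyG 0 0 (b * s%:C).
  by rewrite /airyG expr1 expr0 mul1r.
have cj0 : cj (0 : R[i]) = 0 by rewrite /cj /= oppr0.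
have := @airyG_cj R 0 s; rewrite cj0 => H.
have bLR : bL = - cj bR :> R[i] by rewrite /cj /=; apply: c_ext => /=; rewrite ?opprK.
have R1 : bR * airyG 1 0 (bR * s%:C) = (bR * s%:C) * (bR * airyG 0 0 (bR * s%:C)).
  by rewrite G0 mulrCA.
have R2 : cj (bR * s%:C) = - (bL * s%:C) by rewrite cjM cj_real bLR mulNr opprK.
by rewrite R1 G0 mulrCA H [in RHS]cjM R2 mulrN mulNr.
Qed.

(** A primitive twelfth root of unity, direction of the ray on which the exponent
    [i a^3/3] is real. *)
Definition om : R[i] := (Num.sqrt 3 / 2) +i* (1 / 2).

(** On the ray rotated to [om] the integrand is the real weight [e^{-s^3/3}]. *)
Lemma ray_value (m : nat) : ray bR m (0 : R[i]) = om ^+ m.+1 * (Em m)%:C.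
Proof.
set s : R := Num.sqrt 3.
have s0 : 0 < s by rewrite sqrtr_gt0.
have s3 : s ^+ 2 = 3 by rewrite sqr_sqrtr.
have sV : s^-1 = s / 3 by rewrite -s3; field; rewrite gt_eqF.
have j1 : 1 / 2 < s^-1 <= 1.
  rewrite invf_le1//; apply/andP; split.
    have h : 3 / 2 < s by rewrite -(@ltr_pXn2r _ 2) ?nnegrE ?ltW// s3; lra.
    rewrite sV; lra.
  by rewrite -(@ler_pXn2r _ 2) ?nnegrE ?ltW// s3; lra.
rewrite (ray_rotate m j1) /ray.
pose l : R := 2 / s; have l0 : 0 < l by rewrite divr_gt0.
have [I E] := Em_scale m l0.
have wl : (1 +i* s^-1 : R[i]) = om * l%:C.
  by rewrite /om /l; apply: c_ext => /=; rewrite -/s; field; rewrite gt_eqF.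
clearbody l.
have K x : (1 +i* s^-1) * airyG m 0 ((1 +i* s^-1) * x%:C) =
   (om ^+ m.+1 * (l ^+ m.+1)%:C) * (x ^+ m * ecub (l * x))%:C.
  have -> : airyG m 0 ((1 +i* s^-1) * x%:C) = ((1 +i* s^-1) * x%:C) ^+ m * (ecub (l * x))%:C.
    rewrite /airyG mulr0 add0r; congr (_ * _).
    have -> : ii * (((1 +i* s^-1) * x%:C) ^+ 3 / 3) = (- ((l * x) ^+ 3 / 3))%:C.
      rewrite wl c3V.
      have : om ^+ 3 = ii.
        rewrite /om -/s !exprS expr0; apply: c_ext => /=.
          have -> : s / 2 * (s / 2 * (s / 2 * 1 - 1 / 2 * 0) - 1 / 2 * (s / 2 * 0 + 1 / 2 * 1)) -
            1 / 2 * (s / 2 * (s / 2 * 0 + 1 / 2 * 1) + 1 / 2 * (s / 2 * 1 - 1 / 2 * 0)) =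
            s * (s ^+ 2 - 3) / 8 by field.
          by rewrite s3 subrr mulr0 mul0r.
        have -> : s / 2 * (s / 2 * (s / 2 * 0 + 1 / 2 * 1) + 1 / 2 * (s / 2 * 1 - 1 / 2 * 0)) +
            1 / 2 * (s / 2 * (s / 2 * 1 - 1 / 2 * 0) - 1 / 2 * (s / 2 * 0 + 1 / 2 * 1)) =
            (3 * s ^+ 2 - 1) / 8 by field.
        by rewrite s3; field.
      move=> o3; have -> : (om * l%:C * x%:C) ^+ 3 = ii * ((l * x) ^+ 3)%:C.
        by rewrite -mulrA -rcM exprMn o3 rcX.
      rewrite mulrA (mulrA ii) ii2 mulN1r mulNr -rcM.
      by rewrite rcN.
    by rewrite cexpE /= cos0 sin0 mulr1 mulr0.
  rewrite wl rcM !rcX.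
  move: (om : R[i]) (l%:C) (x%:C) ((ecub _)%:C) => o p q r.
  rewrite !exprMn !exprS; move: (o ^+ m) (p ^+ m) (q ^+ m) => a b c; ring.
rewrite (cint_eq (fun x _ => K x)).
have C1 : cintegrable halfline (fun x => (x ^+ m * ecub (l * x))%:C).
  split => //=; have := LintZ 0 (@measurable_halfline R) I.
  by apply: Lint_eq => [|x _]; [exact: measurable_halfline|rewrite mul0r].
rewrite (cintZ _ (@measurable_halfline R) C1).
have -> : cintegral halfline (fun x => (x ^+ m * ecub (l * x))%:C) = (l ^- m.+1 * Em m)%:C.
  apply: c_ext => /=; first exact: E.
  by rewrite (Rintegral_cst _ (@measurable_halfline R)) mul0r.
rewrite -mulrA -rcM mulVKf// expf_neq0// gt_eqF//.
Qed.

(** A normalization constant shared by the values of Ai and of its derivative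
    at the origin. *)
Definition airyK : R := Num.sqrt 3 / (2 * pi).

Lemma airy_at0 : airyD 0 (0 : R[i]) = (airyK * Em 0)%:C.
Proof.
have c0 : cj (0 : R[i]) = 0 by rewrite /cj /= oppr0.
have := @ray_cj R 0; rewrite c0 => H.
rewrite /airyD expr0 mul1r H opprK addcj ray_value expr1 -rcM.
rewrite mulrC -(mulrC (Em 0)%:C) in |- *.
congr (_%:C); rewrite cRe_scale /om /airyK [cRe _]/=.
have p0 : pi != 0 :> R by rewrite gt_eqF// pi_gt0.
by move: (Num.sqrt 3 : R) (Em 0 : R) (pi : R) p0 => s e p p0; field.
Qed.

Lemma airy1_at0 : airyD 1 (0 : R[i]) = (- (airyK * Em 1))%:C.
Proof.
rewrite /airyD expr1 ray_cj1 ray_value.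
have -> : om ^+ 2 * (Em 1)%:C - cj (om ^+ 2 * (Em 1)%:C) = ii * (Num.sqrt 3 * Em 1)%:C.
  by rewrite expr2 /om; apply: c_ext => /=; field.
have p0 : pi != 0 :> R by rewrite gt_eqF// pi_gt0.
have -> : ii * ((2 * pi)^-1)%:C * (ii * (Num.sqrt 3 * Em 1)%:C) =
  (ii * ii) * (((2 * pi)^-1)%:C * (Num.sqrt 3 * Em 1)%:C) :> R[i].
  by move: (ii : R[i]) (((2 * pi)^-1)%:C) ((Num.sqrt 3 * Em 1)%:C) => p q r; ring.
rewrite ii2 mulN1r -rcM -rcN; congr (_%:C).
rewrite /airyK; move: (Num.sqrt 3 : R) (Em 1 : R) (pi : R) p0 => s e p p0; field.
exact: p0.
Qed.

End Moments.

(** * The zeroth moment through the Laplace transform *)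

Section LaplaceTransform.
Context {R : realType}.
Notation mu := (@lebesgue_measure R).
Implicit Types (x y s t : R) (z w : R[i]).
Let mH := @measurable_halfline R.

Lemma halfline_ge0 y : (halfline : set R) y -> 0 <= y.
Proof. by rewrite /= in_itv/= andbT. Qed.

Definition ex s y : R := expR (- (2 * s) * y).

Lemma cder_ex_y s y : cder (fun y => (ex s y)%:C) y (- (2 * s) * ex s y)%:C.
Proof. exact: cder_real (is_derive_expRZ (- (2 * s)) y). Qed.

Lemma cder_ex_s s y : cder (fun s => (ex s y)%:C) s (- (2 * y) * ex s y)%:C.
Proof.
apply: cder_real; have := is_derive_expRZ (- (2 * y)) s.
have E t : expR (- (2 * y) * t) = ex t y by rewrite /ex; congr expR; ring.
by under eq_fun do rewrite E; rewrite E.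
Qed.

Lemma ex_le s y : -1 <= s -> 0 <= y -> `|ex s y| <= expR (2 * y).
Proof. by move=> s1 y0; rewrite ger0_norm ?expR_ge0// ler_expR; nra. Qed.

Lemma ex_Cint (k m : nat) s : -1 <= s ->
  cintegrable halfline (fun y => (ex s y)%:C * mul_pow k (airyV m) y).
Proof.
move=> s1; have [C [C0 HC]] := @airyV_pow_decay R m k 3.
apply: (Cint_dom (G := fun y => C * expR (- 1 * y)) mH).
- apply: ccontM; last exact: mul_pow_ccont.
  by apply: cder_cont => y; exact: cder_ex_y.
- by apply: LintZ => //; exact: Lint_expR.
move=> y /halfline_ge0 y0; rewrite ncM nc_real.
apply: le_trans (ler_pM (normr_ge0 _) (nc_ge0 _) (ex_le s1 y0) (HC y y0)) _.
by rewrite mulrCA ler_wpM2l// -expRD ler_expR; lra.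
Qed.

(** Laplace transform of [y^k V^(m)] at [2 s]; the factor 2 simplifies the
    integrating factor of the equation below. *)
Definition lapl (k m : nat) s : R[i] :=
  cintegral halfline (fun y => (ex s y)%:C * mul_pow k (airyV m) y).

Lemma lapl_cder s : -1 < s -> cder (lapl 0 0) s (- (2%:C * lapl 1 0 s)).
Proof.
move=> s1; have [C [C0 HC]] := @airyV_pow_decay R 0 1 3.
have D : cder (lapl 0 0) s
   (cintegral halfline (fun y => (- (2 * y) * ex s y)%:C * mul_pow 0 (airyV 0) y)).
  apply: (@cder_int R halfline (fun s y => (ex s y)%:C * mul_pow 0 (airyV 0) y)
    (fun s y => (- (2 * y) * ex s y)%:C * mul_pow 0 (airyV 0) y)
    (-1) (s + 1) s (fun y => 2 * C * expR (- 1 * y)) mH).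
  - by rewrite s1 /= ltrDl.
  - by move=> x /andP[x1 _]; apply: ex_Cint; exact: ltW.
  - move=> x y _ _; apply: cder_eq (cderM (cder_ex_s x y) (cder_cst _ _)).
    by rewrite mulr0 addr0.
  - by apply: LintZ => //; exact: Lint_expR.
  move=> x y /andP[x1 _] /halfline_ge0 y0.
  have -> : (- (2 * y) * ex x y)%:C * mul_pow 0 (airyV 0) y =
     (- 2 * ex x y)%:C * mul_pow 1 (airyV 0) y.
    rewrite /mul_pow expr0 expr1 mul1r mulrA -rcM; congr (_%:C * _); ring.
  have n2 : `|- 2 * ex x y| = 2 * `|ex x y| by rewrite normrM normrN (@ger0_norm _ 2).
  rewrite ncM nc_real n2.
  have h := ler_pM (normr_ge0 _) (nc_ge0 _) (ex_le (ltW x1) y0) (HC y y0).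
  rewrite -[leLHS]mulrA -[leRHS]mulrA; apply: ler_wpM2l => //; apply: le_trans h _.
  by rewrite mulrCA ler_wpM2l// -expRD ler_expR; lra.
apply: cder_eq D.
have I := ex_Cint 1 0 (ltW s1).
rewrite /lapl -mulNr -(cintZ _ mH I); apply: cint_eq => y _.
rewrite /mul_pow expr0 expr1 mul1r.
have -> : (- (2 * y) * ex s y)%:C = - 2%:C * ((ex s y)%:C * y%:C) :> R[i].
  by rewrite -rcN -!rcM; congr (_%:C); ring.
by rewrite -(mulrA (- _)) -(mulrA (ex s y)%:C).
Qed.

(** The Laplace transform turns [V'' = w^3 y V] into a first order equation. *)
Lemma lapl_ode s : 0 <= s -> bR ^+ 3 * lapl 1 0 s =
  (4 * s ^+ 2)%:C * lapl 0 0 s - (airyV 1 0 + (2 * s)%:C * airyV 0 0).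
Proof.
move=> s0; have s1 : -1 <= s by lra.
have E2 m y : mul_pow 0 (airyV m) y = airyV m y by rewrite /mul_pow expr0 mul1r.
pose F y := (ex s y)%:C * (airyV 1 y + (2 * s)%:C * airyV 0 y).
pose F' y := bR ^+ 3 * ((ex s y)%:C * mul_pow 1 (airyV 0) y) -
   (4 * s ^+ 2)%:C * ((ex s y)%:C * mul_pow 0 (airyV 0) y).
have I1 := CintZ (bR ^+ 3) mH (ex_Cint 1 0 s1).
have I2 := CintZ (4 * s ^+ 2)%:C mH (ex_Cint 0 0 s1).
have cex : ccont (fun y => (ex s y)%:C) by apply: cder_cont => y; exact: cder_ex_y.
have ccst c : ccont (fun=> c : R[i]) by split => x; exact: cvg_cst.
have dF y : cder F y (F' y).
  have := cderM (cder_ex_y s y) (cderD (airyV_cder 1 y) (cderZ (2 * s)%:C (airyV_cder 0 y))).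
  apply: cder_eq; rewrite /F' E2 airyV_ode /mul_pow expr1.
  set V0 := airyV 0 y; set V1 := airyV 1 y.
  rewrite (_ : (4 * s ^+ 2)%:C = (2 * s)%:C * (2 * s)%:C :> R[i]); last first.
    by rewrite -rcM; congr (_%:C); ring.
  have -> : (- (2 * s) * ex s y)%:C = - ((2 * s)%:C * (ex s y)%:C) by rewrite -rcM -rcN mulNr.
  move: V0 V1 (bR ^+ 3) (y%:C) ((ex s y)%:C) ((2 * s)%:C) => a b c d e f; ring.
have C1 : ccont F'.
  have c1 : ccont (fun y => bR ^+ 3 * ((ex s y)%:C * mul_pow 1 (airyV 0) y)).
    by apply: ccontM => //; apply: ccontM => //; exact: mul_pow_ccont.
  have c2 : ccont (fun y => - (4 * s ^+ 2)%:C * ((ex s y)%:C * mul_pow 0 (airyV 0) y)).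
    by apply: ccontM => //; apply: ccontM => //; exact: mul_pow_ccont.
  have -> : F' = (fun y => bR ^+ 3 * ((ex s y)%:C * mul_pow 1 (airyV 0) y) +
     - (4 * s ^+ 2)%:C * ((ex s y)%:C * mul_pow 0 (airyV 0) y)).
    by apply/funext => y; rewrite mulNr.
  exact: ccontD.
have L : cvgy0 F.
  have [A0 [A00 HA0]] := @airyV_decay R 0 1; have [A1 [A10 HA1]] := @airyV_decay R 1 1.
  apply: (@expR_cvgy0 _ _ (A1 + 2 * s * A0)) => y y0.
  rewrite /F ncM nc_real ger0_norm ?expR_ge0//.
  have e1 : ex s y <= 1 by rewrite -[leRHS]expR0 ler_expR; nra.
  apply: le_trans (_ : 1 * nc (airyV 1 y + (2 * s)%:C * airyV 0 y) <= _).
    by apply: ler_wpM2r; rewrite ?nc_ge0.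
  rewrite mul1r; apply: le_trans (ncD _ _) _; rewrite ncM nc_real ger0_norm ?mulr_ge0//.
  rewrite [leRHS]mulrDl; apply: lerD; first by have := HA1 y y0; rewrite mulN1r.
  by rewrite -mulrA ler_wpM2l ?mulr_ge0//; have := HA0 y y0; rewrite mulN1r.
have := cFTC_halfline (fun y _ => dF y) C1 (CintB mH I1 I2) L.
rewrite (cintB mH I1 I2) (cintZ _ mH (ex_Cint 1 0 s1)) (cintZ _ mH (ex_Cint 0 0 s1)).
rewrite -/(lapl 1 0 s) -/(lapl 0 0 s) /F /ex mulr0 expR0 mul1r.
move: (lapl 1 0 s) (lapl 0 0 s) (airyV 1 0) (airyV 0 0) => a b c d H.
by apply/eqP; rewrite -subr_eq0; apply/eqP; rewrite opprB addrCA addrC H; ring.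
Qed.

Lemma lapl0 : lapl 0 0 0 = mom 0.
Proof.
by apply: cint_eq => y _; rewrite /ex mulr0 oppr0 mul0r expR0 mul1r.
Qed.

Lemma lapl_le : exists C : R, forall s, 0 <= s -> nc (lapl 0 0 s) <= C.
Proof.
have [C [C0 HC]] := @airyV_pow_decay R 0 0 1.
have I : Lint halfline (fun y => C * expR (- 1 * y)) by apply: LintZ => //; exact: Lint_expR.
exists (2 * \int[mu]_(y in halfline) (C * expR (- 1 * y))) => s s0.
apply: nc_cint => //; first by apply: ex_Cint; lra.
move=> y /halfline_ge0 y0.
have e0 : 0 <= ex s y by exact: expR_ge0.
rewrite ncM nc_real (ger0_norm e0); apply: le_trans (HC y y0).
apply: ler_piMl; first exact: nc_ge0.
by rewrite -[leRHS]expR0 ler_expR; nra.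
Qed.

(** Integrating factor of that equation, which is itself an Airy integrand along
    the right ray. *)
Definition ee s : R[i] := airyG 0 0 (bR * s%:C).

Lemma cder_ee s : cder ee s (ii * bR ^+ 3 * (s ^+ 2)%:C * ee s).
Proof.
have := hol_airyG 0 0 (cder_linear 0 bR s).
under eq_fun do rewrite add0r.
apply: cder_eq; rewrite add0r /ee /airyG' /airyG expr0 mul1r mul0r add0r add0r mul1r rcX.
set E := cexp _; move: E (ii : R[i]) (bR : R[i]) (s%:C) => E i b c; ring.
Qed.

Lemma ee_le : exists C : R, 0 <= C /\ forall s, 0 <= s -> nc (ee s) <= C * expR (- s).
Proof.
have [C [C0 HC]] := @ray_quad_pt R bR (2 / 3) e23 bR_cubic 0 0; exists C; split => // s s0.
have := (HC 0 s _ s0).1; rewrite addr0 nc0 => /(_ ler01).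
apply: le_trans; rewrite ncM ler_peMl ?nc_ge0//.
by rewrite -[X in X <= _](normr1 R) -[X in `|X|]/(cRe bR); exact: nc_Re.
Qed.

Lemma ii_bR3 : ii * bR ^+ 3 * bR ^+ 3 = 8%:C :> R[i].
Proof. by rewrite !exprS expr0; apply: c_ext => /=; ring. Qed.

Fact mom0_alg (V L1 L0 e b i x p q : R[i]) : i * b * b = p * q ->
  b * L1 = q * x ^+ 2 * L0 - V ->
  b * (i * b * x ^+ 2 * e * L0 + e * - (p * L1)) = p * (e * V).
Proof.
move=> H1 H2.
have -> : b * (i * b * x ^+ 2 * e * L0 + e * - (p * L1)) =
  (i * b * b) * x ^+ 2 * e * L0 - e * p * (b * L1) by ring.
by rewrite H1 H2; ring.
Qed.

(** The product of the integrating factor and the Laplace transform vanishes at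
    +oo, and its value at 0 is the moment; its derivative integrates to values
    of the ray at the origin, that is to Gamma values. *)
Lemma mom0 : mom 0 = (airyK * (Em 0 * Em 1))%:C :> R[i].
Proof.
pose F s := bR ^+ 3 * (ee s * lapl 0 0 s).
pose F' s := 2%:C * (ee s * (airyV 1 0 + (2 * s)%:C * airyV 0 0)).
have b0 : bR != 0 :> R[i] by rewrite eq_complex /= oner_eq0.
have dF s : 0 <= s -> cder F s (F' s).
  move=> s0; have s1 : -1 < s by lra.
  apply: cder_eq (cderZ (bR ^+ 3) (cderM (cder_ee s) (lapl_cder s1))).
  have := lapl_ode s0; rewrite /F' (rcM 4) !rcX !(rcM 2 s).
  have := ii_bR3; rewrite (_ : (8%:C : R[i]) = 2%:C * 4%:C); last by rewrite -rcM; congr (_%:C); ring.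
  exact: mom0_alg.
have I0 := @ray_integrable R bR (2 / 3) e23 bR_cubic 0 0.
have I1 := @ray_integrable R bR (2 / 3) e23 bR_cubic 1 0.
have K s : F' s = (2%:C * airyV 1 0 * bR^-1) * (bR * airyG 0 0 (bR * s%:C)) +
   (4%:C * airyV 0 0 * bR ^- 2) * (bR * airyG 1 0 (bR * s%:C)).
  have G0 (b : R[i]) : airyG 1 0 (b * s%:C) = b * s%:C * airyG 0 0 (b * s%:C).
    by rewrite /airyG expr1 expr0 mul1r.
  rewrite /F' G0 -/(ee s) rcM (_ : (4%:C : R[i]) = 2%:C * 2%:C); last by rewrite -rcM; congr (_%:C); ring.
  move: b0; set V1 := airyV 1 0; set V0 := airyV 0 0.
  move: V1 V0 (ee s) (bR : R[i]) (s%:C) (2%:C) => V1 V0 e b x p b0; field.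
  exact: b0.
have C0 := CintZ (2%:C * airyV 1 0 * bR^-1) mH I0.
have C1 := CintZ (4%:C * airyV 0 0 * bR ^- 2) mH I1.
have C2 : cintegrable halfline F'.
  by apply: Cint_eq (CintD mH C0 C1) => // s _; rewrite K.
have L : cvgy0 F.
  have [A [A0 HA]] := ee_le; have [B HB] := lapl_le.
  apply: cvgy0Z; apply: (@expR_cvgy0 _ _ (A * B)) => s s0; rewrite ncM.
  apply: le_trans (ler_pM (nc_ge0 _) (nc_ge0 _) (HA s s0) (HB s s0)) _.
  by rewrite mulrAC.
have cF : ccont F'.
  have ccst c : ccont (fun=> c : R[i]) by split => x; exact: cvg_cst.
  apply: ccontM => //; apply: ccontM.
    by apply: cder_cont => s; exact: cder_ee.
  apply: ccontD => //; apply: ccontM => //.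
  apply: cder_cont => s; have D := is_derive_affine 0 2 s.
  apply: cder_real; move: D; under eq_fun do rewrite add0r; exact.
have := cFTC_halfline dF cF C2 L.
rewrite (cint_eq (fun s _ => K s)) (cintD mH C0 C1) (cintZ _ mH I0) (cintZ _ mH I1).
have F0 : F 0 = bR ^+ 3 * mom 0.
  have e0 : ee 0 = 1.
    rewrite /ee mulr0 /airyG expr0 mul1r mul0r add0r (_ : (0 : R[i]) ^+ 3 = 0); last by rewrite expr0n.
    by rewrite mul0r mulr0 cexp0.
  by rewrite /F e0 lapl0 mul1r.
rewrite -!/(ray _ _ _) !ray_value F0 /airyV mulr0 airy_at0 airy1_at0 expr1 => H.
have b4 : bR ^+ 4 = - 4%:C :> R[i] by rewrite !exprS expr0; apply: c_ext => /=; ring.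
move: (airyK : R) (Em 0 : R) (Em 1 : R) H => K' E0 E1 H.
have : bR ^+ 4 * mom 0 = - 4%:C * (K' * (E0 * E1))%:C :> R[i].
  rewrite exprSr mulrAC -[LHS]opprK -mulNr -H !rcM !rcN !rcM.
  have b2 : bR ^+ 2 = 2%:C * ii :> R[i] by rewrite expr2; apply: c_ext => /=; ring.
  have oo : ii * om - om ^+ 2 = -1 :> R[i].
    have s3 : Num.sqrt 3 ^+ 2 = 3 :> R by rewrite sqr_sqrtr.
    rewrite /om expr2; apply: c_ext => /=; last by field.
    have -> : 0 * (Num.sqrt 3 / 2) - 1 * (1 / 2) - (Num.sqrt 3 / 2 * (Num.sqrt 3 / 2) - 1 / 2 * (1 / 2)) =
      - (1 / 4) - Num.sqrt 3 ^+ 2 / 4 :> R by field.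
    by rewrite s3; field.
  have e4 : 4%:C = 2%:C * 2%:C :> R[i] by rewrite -rcM; congr (_%:C); ring.
  rewrite e4.
  move: b0 b2 oo {H b4 e4}; move: (K'%:C) (E0%:C) (E1%:C) (om : R[i]) (ii : R[i]) (2%:C) (bR : R[i]) => {}K' {}E0 {}E1.
  move=> o i p b b0 b2 oo.
  have -> : (p * (b ^+ 2 * - (K' * E1)) / b * (o ^+ 1 * E0) +
    p * p * (b * (K' * E0)) / b ^+ 2 * (o ^+ 2 * E1)) * b =
   - (p * K' * E1 * E0) * (b ^+ 2 * o - p * o ^+ 2).
    by field; exact: b0.
  have -> : b ^+ 2 * o - p * o ^+ 2 = p * (i * o - o ^+ 2) by rewrite b2; ring.
  by rewrite oo; ring.
rewrite b4 => /mulfI; apply.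
by rewrite oppr_eq0 eq_complex /= pnatr_eq0.
Qed.

Fact mom_rel_alg (b n e p q r N E : R[i]) : b * n * e = N * E ->
  b * (p * (q * n)) * (r * e) = q * (r * N) * (p * E).
Proof.
move=> H; have -> : b * (p * (q * n)) * (r * e) = p * q * r * (b * n * e) by ring.
by rewrite H; ring.
Qed.

(** Both sides satisfy the same three-step recursion, so that the cases 0, 1, 2
    suffice. This is what makes the Caputo equation hold on monomials. *)
Lemma mom_rel (k : nat) : bR * mom k.+1 * (Em k)%:C = mom k * (Em k.+2)%:C :> R[i].
Proof.
have b0 : bR != 0 :> R[i] by rewrite eq_complex /= oner_eq0.
have m1 : bR * mom 1 = (airyK * Em 1)%:C :> R[i].
  have := @mom1 R; rewrite /airyV mulr0 airy1_at0 => H.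
  apply: (mulfI (expf_neq0 2 b0)); rewrite mulrA -exprSr H rcN mulrN opprK.
  by [].
have m2 : bR ^+ 2 * mom 2 = (airyK * Em 0)%:C :> R[i].
  have := @mom2 R; rewrite /airyV mulr0 airy_at0 => H.
  by apply: (mulfI b0); rewrite mulrA -exprS H expr1.
suff : [/\ bR * mom k.+1 * (Em k)%:C = mom k * (Em k.+2)%:C :> R[i],
   bR * mom k.+2 * (Em k.+1)%:C = mom k.+1 * (Em k.+3)%:C :> R[i]
   & bR * mom k.+3 * (Em k.+2)%:C = mom k.+2 * (Em k.+4)%:C :> R[i]] by move=> [h _ _].
elim: k => [|k [h0 h1 h2]]; split => //.
- rewrite m1 Em2 mulr1 mom0 -rcM; congr (_%:C); ring.
- apply: (mulfI b0); rewrite (Em_rec 0) mul1r !mulrA -expr2 m2 m1 -!rcM; congr (_%:C); ring.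
- apply: (mulfI (expf_neq0 2 b0)); rewrite Em2 mulr1 !mulrA m2 -exprSr mom_rec mom0 (Em_rec 1).
  rewrite -!rcM; congr (_%:C); ring.
apply: (mulfI (expf_neq0 3 b0)).
have -> : bR ^+ 3 * (bR * mom k.+4 * (Em k.+3)%:C) = bR * (bR ^+ 3 * mom k.+4) * (Em k.+3)%:C :> R[i].
  by move: (mom k.+4) (bR : R[i]) ((Em k.+3)%:C) => p q r; ring.
rewrite [RHS]mulrA !mom_rec (Em_rec k) (Em_rec k.+2) !rcM.
exact: mom_rel_alg h0.
Qed.

Lemma mom0_value : mom 0 = (3^-1)%:C :> R[i].
Proof.
rewrite mom0 Em01 /airyK; congr (_%:C).
have p0 : pi != 0 :> R by rewrite gt_eqF// pi_gt0.
have s0 : Num.sqrt 3 != 0 :> R by rewrite gt_eqF// sqrtr_gt0.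
by move: (Num.sqrt 3 : R) (pi : R) s0 p0 => s p s0 p0; field; rewrite s0 p0.
Qed.

End LaplaceTransform.

(** * Time derivatives of the pairing with the kernel *)

Section RealKernels.
Context {R : realType}.
Notation mu := (@lebesgue_measure R).
Notation oline := (`]0, +oo[%classic : set R).
Implicit Types (x y s t r eta : R) (F : nat -> R -> R) (psi k : R -> R).
Let mH := @measurable_halfline R.

(** With [V = A + i b] and [d = b - A], the equation [V'' = w^3 y V] gives
    [d'' = 4 y A]: d is the profile of the velocity. *)
Definition kerD (m : nat) y : R := cIm (airyV m y) - cRe (airyV m y).

Lemma kerD_der m y : is_derive y (1 : R) (kerD m) (kerD m.+1 y).
Proof.
have [d1 d2] := @airyV_cder R m y.
exact: (@is_deriveB _ _ _ _ _ y 1 _ _ d2 d1).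
Qed.

Lemma kerA_der y : is_derive y (1 : R) kerA (cRe (airyV 1 y)).
Proof. by have [d1 _] := @airyV_cder R 0 y. Qed.

Lemma kerD2 y : kerD 2 y = 4 * (y * kerA y).
Proof.
rewrite /kerD /kerA airyV_ode; set V := airyV 0 y; move: V => [a b].
have -> : bR ^+ 3 = (- 2) +i* 2 :> R[i] by rewrite !exprS expr0; apply: c_ext => /=; ring.
rewrite cReM cImM cRe_scale cIm_scale /=; ring.
Qed.

Lemma kerD_at0 : kerD 0 0 = 0.
Proof.
rewrite /kerD /airyV mulr0 expr1 airy_at0; set X := airyK * Em 0; move: X => X.
by rewrite cImM cReM /=; ring.
Qed.

(** The class of kernels for which every test function of exponential growth can
    be integrated. *)
Definition superexp k : Prop := continuous k /\
  forall eta : R, exists C : R, 0 <= C /\ forall y, 0 <= y -> `|k y| <= C * expR (- eta * y).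

Lemma superexp_A : superexp kerA.
Proof.
split; first exact: (derive_contT kerA_der).
move=> eta; have [C [C0 HC]] := @airyV_decay R 0 eta; exists C; split => // y y0.
exact: le_trans (nc_Re _) (HC y y0).
Qed.

Lemma superexp_D m : superexp (kerD m).
Proof.
split; first exact: (derive_contT (kerD_der m)).
move=> eta; have [C [C0 HC]] := @airyV_decay R m eta; exists (C + C).
split => [|y y0]; first by rewrite addr_ge0.
apply: le_trans (ler_normB _ _) _; rewrite mulrDl; apply: lerD.
  exact: le_trans (nc_Im _) (HC y y0).
exact: le_trans (nc_Re _) (HC y y0).
Qed.

Lemma superexp_X k n : superexp k -> superexp (fun y => y ^+ n * k y).
Proof.
move=> [ck dk]; split.
  by move=> y; apply: cvgM; [exact: (derive_contT (is_derive_Xn n))|exact: ck].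
move=> eta; have [C [C0 HC]] := dk (eta + 1); exists (n`!%:R * C).
split => [|y y0]; first by rewrite mulr_ge0.
rewrite normrM ger0_norm ?exprn_ge0//.
apply: le_trans (ler_pM _ (normr_ge0 _) (expR_ge_pow n y0) (HC y y0)) _; first exact: exprn_ge0.
by rewrite mulrACA ler_wpM2l ?mulr_ge0// -expRD ler_expR; lra.
Qed.

Lemma superexp_Lint k eta (f : R -> R) (C : R) : superexp k -> Lmfun halfline f ->
  (forall y, 0 <= y -> `|f y| <= C * expR (eta * y)) ->
  Lint halfline (fun y => k y * f y).
Proof.
move=> [ck dk] mf Hf; have [A [A0 HA]] := dk (eta + 1).
apply: (@Lint_expR_dom _ _ (A * C)).
  by apply: measurable_funM => //; exact: cont_meas.
move=> y y0; rewrite normrM.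
apply: le_trans (ler_pM (normr_ge0 _) (normr_ge0 _) (HA y y0) (Hf y y0)) _.
rewrite mulrACA -expRD (_ : - (eta + 1) * y + eta * y = - y)//; ring.
Qed.

Lemma superexp_int k eta : superexp k -> Lint halfline (fun y => `|k y| * expR (eta * y)).
Proof.
move=> sk; have [ck dk] := sk.
have I : Lint halfline (fun y => k y * expR (eta * y)).
  apply: (superexp_Lint (eta := eta) (C := 1) sk).
    apply: cont_meas => // y; exact: derive_cont (is_derive_expRZ eta y).
  by move=> y y0; rewrite mul1r ger0_norm ?expR_ge0.
by apply: Lint_eq (Lint_norm mH I) => // y _; rewrite normrM [X in _ * X]ger0_norm ?expR_ge0.
Qed.

(** The even ([sg = 1]) or odd ([sg = -1]) part of the test function, up to a
    factor 2, at scale r. *)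
Definition sym (sg : R) psi r y : R := psi (r * y) + sg * psi (- (r * y)).

Definition kpair k (g : R -> R -> R) r : R := \int[mu]_(y in halfline) (k y * g r y).

Lemma is_derive_comp1 (f g : R -> R) x df dg : is_derive x (1 : R) g dg ->
  is_derive (g x) (1 : R) f df -> is_derive x (1 : R) (fun x => f (g x)) (df * dg).
Proof.
move=> Dg Df; have := @is_derive1_comp R f g x _ _ Df Dg.
by move/is_derive_to; apply; rewrite /GRing.scale/=.
Qed.

(** A function together with all its derivatives. *)
Definition dseq F : Prop := forall n x, is_derive x (1 : R) (F n) (F n.+1 x).
Definition bseq F : Prop := forall n, exists C : R, forall x, `|F n x| <= C.

Lemma is_derive_lin (c x : R) : is_derive x (1 : R) (fun y => c * y) c.
Proof. by have := is_derive_affine 0 c x; under eq_fun do rewrite add0r. Qed.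

Lemma sym_der_r F n sg r y : dseq F ->
  is_derive r (1 : R) (fun r => sym sg (F n) r y) (y * sym (- sg) (F n.+1) r y).
Proof.
move=> dF.
have D0 : is_derive r (1 : R) (fun r => r * y) y.
  by have := is_derive_lin y r; under eq_fun do rewrite mulrC.
have D1 := is_derive_comp1 D0 (dF n (r * y)).
have D2 := is_derive_comp1 (@is_deriveN _ _ _ _ r 1 _ D0) (dF n (- (r * y))).
have D3 := @is_deriveZ _ _ _ _ sg r 1 _ D2.
have := @is_deriveD _ _ _ _ _ r 1 _ _ D1 D3.
by move/is_derive_to; apply; rewrite /sym /GRing.scale/=; ring.
Qed.

Lemma sym_der_y F n sg r y : dseq F ->
  is_derive y (1 : R) (fun y => sym sg (F n) r y) (r * sym (- sg) (F n.+1) r y).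
Proof.
move=> dF.
have D0 := is_derive_lin r y.
have D1 := is_derive_comp1 D0 (dF n (r * y)).
have D2 := is_derive_comp1 (@is_deriveN _ _ _ _ y 1 _ D0) (dF n (- (r * y))).
have D3 := @is_deriveZ _ _ _ _ sg y 1 _ D2.
have := @is_deriveD _ _ _ _ _ y 1 _ _ D1 D3.
by move/is_derive_to; apply; rewrite /sym /GRing.scale/=; ring.
Qed.

Lemma sym_le F n sg C r y : `|sg| <= 1 -> (forall x, `|F n x| <= C) ->
  `|sym sg (F n) r y| <= 2 * C.
Proof.
move=> s1 HC; apply: le_trans (ler_normD _ _) _; rewrite normrM.
have h1 := HC (r * y); have h2 := HC (- (r * y)).
have h3 : `|sg| * `|F n (- (r * y))| <= 1 * C by apply: ler_pM.
lra.
Qed.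

Lemma sym_cont psi sg r : continuous psi -> continuous (sym sg psi r).
Proof.
move=> cp y; have L : {for y, continuous (fun y => r * y)} by exact: derive_cont (is_derive_lin r y).
apply: cvgD; first by apply: (@continuous_comp _ _ _ (fun y => r * y) psi) => //; exact: cp.
apply: cvgM; first exact: cvg_cst.
apply: (@continuous_comp _ _ _ (fun y => - (r * y)) psi); last exact: cp.
exact: cvgN.
Qed.

Lemma kpair_Lint k F n sg r : superexp k -> dseq F -> bseq F -> `|sg| <= 1 ->
  Lint halfline (fun y => k y * sym sg (F n) r y).
Proof.
move=> sk dF bF s1; have [C HC] := bF n.
apply: (superexp_Lint (eta := 0) (C := 2 * C) sk).
  by apply: cont_meas => //; apply: sym_cont; exact: (derive_contT (dF n)).
by move=> y y0; rewrite mul0r expR0 mulr1; exact: sym_le.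
Qed.

(** Differentiating in the scale costs a factor y and one derivative, and swaps
    parity. *)
Lemma kpair_der k F n sg r : superexp k -> dseq F -> bseq F -> `|sg| <= 1 ->
  is_derive r (1 : R) (kpair k (sym sg (F n)))
    (kpair (fun y => y ^+ 1 * k y) (sym (- sg) (F n.+1)) r).
Proof.
move=> sk dF bF s1; have [C HC] := bF n.+1.
have := @derive_int R halfline (fun r y => k y * sym sg (F n) r y)
  (fun r y => (y ^+ 1 * k y) * sym (- sg) (F n.+1) r y) (r - 1) (r + 1) r
  (fun y => (2 * C) * (`|y ^+ 1 * k y| * expR (0 * y))) mH.
apply.
- by apply/andP; split; lra.
- by move=> x _; exact: kpair_Lint.
- move=> x y _ _; have := @is_deriveZ _ _ _ _ (k y) x 1 _ (sym_der_r n sg x y dF).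
  by move/is_derive_to; apply; rewrite /GRing.scale/= expr1; ring.
- by apply: LintZ => //; exact: superexp_int (superexp_X 1 sk).
- move=> x y _ _; rewrite normrM mul0r expR0 mulr1 mulrC ler_wpM2r//.
  by apply: sym_le; rewrite ?normrN.
Qed.

(** Two integrations by parts trade [y A = d''/4] for d and two derivatives of
    the test function: the velocity then carries three derivatives. *)
Lemma kpair_parts F n r : dseq F -> bseq F ->
  kpair (fun y => y ^+ 1 * kerA y) (sym (-1) (F n)) r =
  r ^+ 2 / 4 * kpair (kerD 0) (sym (-1) (F n.+2)) r.
Proof.
move=> dF bF.
have s1 : `|-1 : R| <= 1 by rewrite normrN normr1.
have s2 : `|1 : R| <= 1 by rewrite normr1.
have sA := superexp_X 1 superexp_A; have sD := superexp_D.
have I1 := kpair_Lint n r sA dF bF s1.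
have I2 := kpair_Lint n.+2 r (sD 0) dF bF s1.
pose G y := kerD 1 y * sym (-1) (F n) r y - r * (kerD 0 y * sym 1 (F n.+1) r y).
have dG y : is_derive y (1 : R) G (4 * (y ^+ 1 * kerA y * sym (-1) (F n) r y) -
    r ^+ 2 * (kerD 0 y * sym (-1) (F n.+2) r y)).
  have D1 := @is_deriveM _ _ _ _ y 1 _ _ (kerD_der 1 y) (sym_der_y n (-1) r y dF).
  have D2 := @is_deriveM _ _ _ _ y 1 _ _ (kerD_der 0 y) (sym_der_y n.+1 1 r y dF).
  have D3 := @is_deriveZ _ _ _ _ r y 1 _ D2.
  have := @is_deriveB _ _ _ _ _ y 1 _ _ D1 D3.
  move/is_derive_to; apply; rewrite /GRing.scale/= kerD2 opprK expr1.
  move: (kerA y) (kerD 0 y) (kerD 1 y) (sym (-1) (F n) r y) (sym 1 (F n.+1) r y) (sym (-1) (F n.+2) r y) => a b c d e f.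
  ring.
have cG : continuous (fun y => 4 * (y ^+ 1 * kerA y * sym (-1) (F n) r y) -
    r ^+ 2 * (kerD 0 y * sym (-1) (F n.+2) r y)).
  have cs m : continuous (sym (-1) (F m) r) by apply: sym_cont; exact: (derive_contT (dF m)).
  have [c1 _] := sA; have [c2 _] := sD 0%N.
  move=> y; apply: cvgB; apply: cvgM; try exact: cvg_cst; apply: cvgM;
    [exact: c1|exact: cs|exact: c2|exact: cs].
have IG := LintB mH (LintZ 4 mH I1) (LintZ (r ^+ 2) mH I2).
have [C1 H1] := bF n; have [C2 H2] := bF n.+1.
have [_ /(_ 1)[A1 [A10 HA1]]] := sD 1%N; have [_ /(_ 1)[A0 [A00 HA0]]] := sD 0%N.
have LG : G y @[y --> +oo] --> (0 : R).
  apply: (@cvgy0_real R G (fun y => (G y)%:C)); last by move=> y; rewrite nc_real.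
  apply: (@expR_cvgy0 _ _ (A1 * (2 * C1) + `|r| * (A0 * (2 * C2)))) => y y0.
  rewrite nc_real; apply: le_trans (ler_normB _ _) _; rewrite !normrM mulrDl.
  have h1 := sym_le r y s1 H1; have h2 := sym_le r y s2 H2.
  have := HA1 y y0; have := HA0 y y0; rewrite !mulN1r => k0 k1.
  have p1 := ler_pM (normr_ge0 _) (normr_ge0 _) k1 h1.
  have p2 := ler_pM (normr_ge0 _) (normr_ge0 _) k0 h2.
  apply: lerD; first by apply: le_trans p1 _; rewrite mulrAC.
  rewrite -mulrA; apply: ler_wpM2l => //.
  by apply: le_trans p2 _; rewrite mulrAC.
have := FTC_halfline (fun y _ => dG y) cG IG LG.
rewrite (intB mH (LintZ 4 mH I1) (LintZ (r ^+ 2) mH I2)) (intZ _ mH I1) (intZ _ mH I2).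
have -> : G 0 = 0 by rewrite /G kerD_at0 /sym mulr0 oppr0; ring.
rewrite oppr0 -/(kpair _ _ r) -/(kpair _ _ r) => H.
by move: H; set X := kpair _ _ _; set Y := kpair _ _ _ => H; lra.
Qed.

(** The spatial scale of the solution at time t. *)
Definition rt t : R := cbrt (3 * t).

Lemma rt_gt0 t : 0 < t -> 0 < rt t.
Proof. by move=> t0; apply: cbrt_gt0; rewrite mulr_gt0. Qed.

Lemma rt_der t : 0 < t -> is_derive t (1 : R) rt ((rt t)^-1 ^+ 2).
Proof.
move=> t0; have t3 : 0 < 3 * t by rewrite mulr_gt0.
have := is_derive_comp1 (is_derive_lin 3 t) (is_derive_cbrt t3).
move/is_derive_to; apply; rewrite -/(rt t); have := rt_gt0 t0.
by move: (rt t) => r r0; field; rewrite gt_eqF.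
Qed.

(** The pairing of the solution with a real test function, and its candidate
    first and second time derivatives [sol1] and [sol2]. *)
Definition sol F t : R := 3 / 2 * kpair kerA (sym 1 (F 0%N)) (rt t).
Definition sol1 F t : R := 3 / 8 * kpair (kerD 0) (sym (-1) (F 3%N)) (rt t).
Definition sol2 F t : R :=
  3 / 8 * ((rt t)^-1 ^+ 2 * kpair (fun y => y ^+ 1 * kerD 0 y) (sym 1 (F 4%N)) (rt t)).

Lemma sol_der F t : dseq F -> bseq F -> 0 < t -> is_derive t (1 : R) (sol F) (sol1 F t).
Proof.
move=> dF bF t0.
have s2 : `|1 : R| <= 1 by rewrite normr1.
have D := is_derive_comp1 (rt_der t0) (kpair_der 0 (rt t) superexp_A dF bF s2).
have := @is_deriveZ _ _ _ _ (3 / 2) t 1 _ D.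
move/is_derive_to; apply; rewrite /GRing.scale/= kpair_parts// /sol1.
have := rt_gt0 t0; set X := kpair _ _ _; move: (rt t) X => r X r0; field.
by rewrite gt_eqF.
Qed.

Lemma sol1_der F t : dseq F -> bseq F -> 0 < t -> is_derive t (1 : R) (sol1 F) (sol2 F t).
Proof.
move=> dF bF t0.
have s1 : `|-1 : R| <= 1 by rewrite normrN normr1.
have D := is_derive_comp1 (rt_der t0) (kpair_der 3 (rt t) (superexp_D 0) dF bF s1).
have := @is_deriveZ _ _ _ _ (3 / 8) t 1 _ D.
move/is_derive_to; apply; rewrite /GRing.scale/= /sol2 opprK; congr (_ * _).
exact: mulrC.
Qed.

Lemma sol2_cont F t : dseq F -> bseq F -> 0 < t -> {for t, continuous (sol2 F)}.
Proof.
move=> dF bF t0.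
have s2 : `|1 : R| <= 1 by rewrite normr1.
have D := is_derive_comp1 (rt_der t0) (kpair_der 4 (rt t) (superexp_X 1 (superexp_D 0)) dF bF s2).
apply: cvgM; first exact: cvg_cst.
apply: cvgM; last exact: derive_cont D.
have cr := derive_cont (rt_der t0).
by rewrite expr2; apply: cvgM; apply: cvgV => //; rewrite gt_eqF// rt_gt0.
Qed.

End RealKernels.

(** * The Caputo equation on functions of exponential type *)

Section CaputoIdentity.
Context {R : realType}.
Notation mu := (@lebesgue_measure R).
Implicit Types (x y s t r eta : R) (F : nat -> R -> R) (psi k : R -> R).
Let mH := @measurable_halfline R.

Definition kD y : R := y ^+ 1 * kerD 0 y.

Lemma superexp_kD : superexp kD.
Proof. exact: superexp_X (superexp_D 0). Qed.

(** Weight of the Caputo integral at time t once the time derivatives of the scale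
    have been expressed. *)
Definition wt t s : R := (cbrt (t - s))^-1 * (rt s)^-1 ^+ 2.

Lemma meas_tline t : Lmeas (`]0, t[%classic : set R).
Proof. exact: measurable_itv. Qed.

Lemma wt_ge0 t s : 0 <= wt t s.
Proof. by rewrite mulr_ge0 ?exprn_ge0 ?invr_ge0 ?cbrt_ge0. Qed.

(** The Caputo integral of the n-th power of the scale, from [sing_moment]. *)
Lemma wt_moment t n : 0 < t -> Lint `]0, t[ (fun s => wt t s * rt s ^+ n) /\
  (\int[mu]_(s in `]0, t[) (wt t s * rt s ^+ n)) * Em n.+2 = cbrt 3 * Em 1 * (Em n * rt t ^+ n).
Proof.
move=> t0; have [I E] := sing_moment n t0.
have K s : (cbrt (t - s))^-1 * ((cbrt (3 * s))^-1 ^+ 2 * cbrt (3 * s) ^+ n) = wt t s * rt s ^+ n.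
  by rewrite mulrA.
split; last by rewrite -E; congr (_ * _); apply: int_eq => s _; rewrite K.
by apply: Lint_eq I => [|s _]; [exact: meas_tline|rewrite K].
Qed.

Lemma wt_Lint t : 0 < t -> Lint `]0, t[ (wt t).
Proof.
move=> t0; have [I _] := wt_moment 0 t0.
by apply: Lint_eq I => [|s _]; [exact: meas_tline|rewrite expr0 mulr1].
Qed.

(** A class that contains the monomials as well as the bounded functions. *)
Definition expb psi : Prop := continuous psi /\
  exists C eta : R, [/\ 0 <= C, 0 <= eta & forall x, `|psi x| <= C * expR (eta * `|x|)].

Lemma sym_expb (psi : R -> R) (C eta r y : R) : 0 <= r -> 0 <= y ->
  (forall x, `|psi x| <= C * expR (eta * `|x|)) ->
  `|sym 1 psi r y| <= 2 * C * expR (eta * r * y).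
Proof.
move=> r0 y0 H; apply: le_trans (ler_normD _ _) _; rewrite mul1r.
have h1 := H (r * y); have h2 := H (- (r * y)); rewrite normrN in h2.
have e : `|r * y| = r * y by rewrite ger0_norm// mulr_ge0.
by rewrite e mulrA in h1 h2; lra.
Qed.

Lemma expb_Lint k psi r : superexp k -> expb psi -> 0 <= r ->
  Lint halfline (fun y => k y * sym 1 psi r y).
Proof.
move=> sk [cp [C [eta [C0 e0 H]]]] r0.
apply: (superexp_Lint (eta := eta * r) (C := 2 * C) sk).
  by apply: cont_meas => //; exact: sym_cont.
by move=> y y0; exact: sym_expb.
Qed.

Lemma kpair_le k psi (C eta r rr : R) : superexp k -> continuous psi -> 0 <= C -> 0 <= eta ->
  (forall x, `|psi x| <= C * expR (eta * `|x|)) -> 0 <= r <= rr ->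
  `|kpair k (sym 1 psi) r| <= 2 * C * \int[mu]_(y in halfline) (`|k y| * expR (eta * rr * y)).
Proof.
move=> sk cp C0 e0 H /andP[r0 rr0].
have I := superexp_int (eta * rr) sk.
rewrite -(intZ _ mH I); apply: norm_int_le => //.
- by apply: expb_Lint => //; split => //; exists C, eta.
- exact: LintZ.
move=> y /halfline_ge0 y0; rewrite normrM mulrCA; apply: ler_wpM2l => //.
apply: le_trans (sym_expb r0 y0 H) _; apply: ler_wpM2l; first by rewrite mulr_ge0.
by rewrite ler_expR ler_wpM2r// ler_wpM2l.
Qed.

(** Test functions for which both terms of the defect below make sense. *)
Definition adm t psi : Prop :=
  expb psi /\ Lmfun (`]0, t[%classic : set R) (fun s => kpair kD (sym 1 psi) (rt s)).

Lemma adm_bound t psi : 0 < t -> adm t psi -> exists K : R, forall s, 0 < s < t ->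
  `|kpair kD (sym 1 psi) (rt s)| <= K.
Proof.
move=> t0 [[cp [C [eta [C0 e0 H]]]] mp].
exists (2 * C * \int[mu]_(y in halfline) (`|kD y| * expR (eta * rt t * y))) => s /andP[s0 st].
apply: (kpair_le superexp_kD cp C0 e0 H).
rewrite cbrt_ge0 /= /rt /cbrt; apply: ge0_ler_powR; rewrite ?nnegrE ?invr_ge0 ?mulr_ge0 ?ltW//.
by rewrite ltr_pM2l.
Qed.

Lemma adm_Lint t psi : 0 < t -> adm t psi ->
  Lint `]0, t[ (fun s => wt t s * kpair kD (sym 1 psi) (rt s)).
Proof.
move=> t0 ap; have [K HK] := adm_bound t0 ap; have [_ mp] := ap.
have Iw := wt_Lint t0.
apply: (Lint_le (meas_tline t) _ (g := fun s => K * wt t s)).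
- by apply: measurable_funM => //; exact: Lint_meas Iw.
- by apply: LintZ => //; exact: meas_tline.
move=> s; rewrite /= in_itv/= => h; rewrite normrM (ger0_norm (wt_ge0 _ _)) mulrC.
by apply: ler_wpM2r; [exact: wt_ge0|exact: HK].
Qed.

(** Up to a factor, the Caputo equation for a solution tested against a function
    whose fourth derivative is psi. *)
Definition defect t psi : R :=
  \int[mu]_(s in `]0, t[) (wt t s * kpair kD (sym 1 psi) (rt s)) +
  cbrt 3 * Em 1 * kpair kerA (sym 1 psi) (rt t).

Lemma kpair_lin k (p q : R -> R) (c r : R) : superexp k -> expb p -> expb q -> 0 <= r ->
  kpair k (sym 1 (fun x => p x + c * q x)) r =
  kpair k (sym 1 p) r + c * kpair k (sym 1 q) r.
Proof.
move=> sk ep eq r0; have I1 := expb_Lint sk ep r0; have I2 := expb_Lint sk eq r0.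
rewrite /kpair -(intZ _ mH I2) -(intD mH I1 (LintZ c mH I2)); apply: int_eq => y _.
rewrite /sym; ring.
Qed.

Lemma expb_lin (p q : R -> R) (c : R) : expb p -> expb q -> expb (fun x => p x + c * q x).
Proof.
move=> [cp [C1 [e1 [C10 e10 H1]]]] [cq [C2 [e2 [C20 e20 H2]]]]; split.
  by move=> x; apply: cvgD; [exact: cp|apply: cvgM; [exact: cvg_cst|exact: cq]].
exists (C1 + `|c| * C2), (e1 + e2); split; rewrite ?addr_ge0 ?mulr_ge0// => x.
apply: le_trans (ler_normD _ _) _; rewrite normrM mulrDl; apply: lerD.
  apply: le_trans (H1 x) _; apply: ler_wpM2l => //; rewrite ler_expR.
  by apply: ler_wpM2r => //; rewrite lerDl.
rewrite -mulrA; apply: ler_wpM2l => //; apply: le_trans (H2 x) _.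
by apply: ler_wpM2l => //; rewrite ler_expR; apply: ler_wpM2r => //; rewrite lerDr.
Qed.

Lemma adm_lin t (p q : R -> R) (c : R) : adm t p -> adm t q -> adm t (fun x => p x + c * q x).
Proof.
move=> [ep mp] [eq mq]; split; first exact: expb_lin.
rewrite (_ : (fun s => _) = (fun s => kpair kD (sym 1 p) (rt s) + c * kpair kD (sym 1 q) (rt s))).
  by apply: measurable_funD => //; apply: measurable_funM.
apply/funext => s; apply: kpair_lin => //; first exact: superexp_kD.
exact: cbrt_ge0.
Qed.

Lemma defect_lin t (p q : R -> R) (c : R) : 0 < t -> adm t p -> adm t q ->
  defect t (fun x => p x + c * q x) = defect t p + c * defect t q.
Proof.
move=> t0 ap aq; have I1 := adm_Lint t0 ap; have I2 := adm_Lint t0 aq.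
have [ep _] := ap; have [eq _] := aq; have mT := meas_tline t.
rewrite /defect (kpair_lin c superexp_A ep eq (cbrt_ge0 _)).
rewrite (@int_eq _ _ _ (fun s => wt t s * kpair kD (sym 1 p) (rt s) +
   c * (wt t s * kpair kD (sym 1 q) (rt s)))); last first.
  move=> s _; rewrite (kpair_lin c superexp_kD ep eq (cbrt_ge0 _)).
  by move: (wt t s) (kpair _ _ _) (kpair _ _ _) => a b d; ring.
rewrite (intD mT I1 (LintZ c mT I2)) (intZ _ mT I2).
move: (\int[mu]_(s in _) _) (\int[mu]_(s in _) _) (kpair _ _ _) (kpair _ _ _) (cbrt 3 * _) => a b d e f; ring.
Qed.

Lemma expb_X n : expb (fun x => x ^+ n).
Proof.
split; first exact: (derive_contT (is_derive_Xn n)).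
exists n`!%:R, 1; split => // x; rewrite mul1r normrX; exact: expR_ge_pow.
Qed.

Lemma kpair_X k n r : superexp k ->
  kpair k (sym 1 (fun x => x ^+ n)) r =
  (1 + (-1) ^+ n) * r ^+ n * \int[mu]_(y in halfline) (y ^+ n * k y).
Proof.
move=> sk; have I : Lint halfline (fun y => y ^+ n * k y).
  have := superexp_int 0 (superexp_X n sk).
  move=> I0; apply: (Lint_le mH _ I0).
    by apply: cont_meas => //; have [] := superexp_X n sk.
  by move=> y _; rewrite mul0r expR0 mulr1.
rewrite -(intZ _ mH I); apply: int_eq => y _.
have -> : sym 1 (fun x => x ^+ n) r y = (1 + (-1) ^+ n) * r ^+ n * y ^+ n.
  rewrite /sym /= mul1r [in LHS]exprNn !exprMn; move: ((-1) ^+ n) (r ^+ n) (y ^+ n) => b c d; ring.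
by rewrite [LHS]mulrC -[LHS]mulrA.
Qed.

Lemma adm_X t n : adm t (fun x => x ^+ n).
Proof.
split; first exact: expb_X.
rewrite (_ : (fun s => _) = (fun s => (1 + (-1) ^+ n) * rt s ^+ n *
   \int[mu]_(y in halfline) (y ^+ n * kD y))); last first.
  by apply/funext => s; exact: kpair_X superexp_kD.
apply: measurable_funM => //; apply: measurable_funM => //.
rewrite /rt; apply: (measurableT_comp (exprn_measurable n)).
apply: (measurableT_comp (meas_cbrt measurableT)); exact: mulrl_measurable.
Qed.

Lemma moment_A n : \int[mu]_(y in halfline) (y ^+ n * kerA y) = cRe (@mom R n).
Proof. by apply: int_eq => y _; rewrite /mul_pow cRe_scale. Qed.

Lemma moment_D n : \int[mu]_(y in halfline) (y ^+ n * kD y) =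
  cIm (@mom R n.+1) - cRe (@mom R n.+1).
Proof.
have [i1 i2] := @mul_pow_Cint R n.+1 0.
rewrite -(intB mH i2 i1); apply: int_eq => y _.
rewrite /mul_pow cIm_scale cRe_scale /kD /kerD expr1 exprS.
set X := airyV 0 y; move: (cRe X) (cIm X) => a b; ring.
Qed.

(** Odd powers vanish by parity; for even ones the two terms cancel by the
    relation between moments of V and Gamma integrals. *)
Lemma defect_X t n : 0 < t -> defect t (fun x => x ^+ n) = 0.
Proof.
move=> t0; have [I E] := wt_moment n t0; have mT := meas_tline t.
rewrite /defect (kpair_X _ _ superexp_A) moment_A.
have K s : wt t s * kpair kD (sym 1 (fun x => x ^+ n)) (rt s) =
  (1 + (-1) ^+ n) * (cIm (@mom R n.+1) - cRe (@mom R n.+1)) * (wt t s * rt s ^+ n).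
  by rewrite (kpair_X _ _ superexp_kD) moment_D; ring.
rewrite (int_eq (fun s _ => K s)) (intZ _ mT I).
have e0 := @Em_gt0_neq0 R n.+2.
have := @mom_rel R n; move=> /(congr1 (@complex.Re R)).
rewrite [in LHS]mulrC [in RHS]mulrC !cRe_scale cReM.
rewrite [cRe bR]/= [cIm bR]/= !mul1r => M.
apply: (mulIf e0); rewrite mul0r.
move: E M; move: (\int[mu]_(s in _) _) (cRe (mom n.+1)) (cIm (mom n.+1)) (cRe (mom n)) (rt t ^+ n).
move: (Em n) (Em n.+2) (Em 1) (cbrt 3) ((-1) ^+ n) => e e2 e1 c sg J p q m rr E M.
have -> : ((1 + sg) * (q - p) * J + c * e1 * ((1 + sg) * rr * m)) * e2 =
  (1 + sg) * ((q - p) * (J * e2) + c * e1 * rr * (e2 * m)) by ring.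
rewrite E -M; ring.
Qed.

Definition taylor F n x : R := \sum_(k < n) (F k 0 / k`!%:R) * x ^+ k.

Lemma taylor_S F n x : is_derive x (1 : R) (taylor F n.+1) (taylor (fun (k : nat) => F k.+1) n x).
Proof.
have -> : taylor F n.+1 = (fun x => F 0%N 0 + \sum_(k < n) (F k.+1 0 / k.+1`!%:R) * x ^+ k.+1).
  apply/funext => y; rewrite /taylor big_ord_recl /= expr0 mulr1 fact0 divr1.
  by congr (_ + _); apply: eq_bigr.
have D : is_derive x (1 : R) (fun x => \sum_(k < n) (F k.+1 0 / k.+1`!%:R) * x ^+ k.+1)
   (taylor (fun (k : nat) => F k.+1) n x).
  rewrite /taylor; elim: n => [|n IH].
    by rewrite big_ord0; under eq_fun do rewrite big_ord0; exact: is_derive_cst.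
  rewrite big_ord_recr/=; under eq_fun do rewrite big_ord_recr/=.
  have D1 := @is_deriveZ _ _ _ _ (F n.+1 0 / n.+1`!%:R) x 1 _ (is_derive_Xn n.+1 x).
  have := @is_deriveD _ _ _ _ _ x 1 _ _ IH D1.
  move/is_derive_to; apply; rewrite /GRing.scale/=; congr (_ + _).
  rewrite factS natrM; have f0 : n`!%:R != 0 :> R by rewrite pnatr_eq0 -lt0n fact_gt0.
  have n0 : n.+1%:R != 0 :> R by rewrite pnatr_eq0.
  move: (F n.+1 0) (n`!%:R : R) (n.+1%:R : R) (x ^+ n) f0 n0 => a b c e f0 n0.
  by field; rewrite f0 n0.
have := @is_deriveD _ _ _ _ _ x 1 _ _ (is_derive_cst (F 0%N 0) x 1) D.
by move/is_derive_to; apply; rewrite add0r.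
Qed.

Lemma taylor_bound_pos F n (C B : R) : dseq F -> 0 <= B ->
  (forall (k : nat) x, `|F k x| <= C * B ^+ k) ->
  forall x, 0 <= x -> `|F 0%N x - taylor F n x| <= C * (B ^+ n * x ^+ n / n`!%:R).
Proof.
move=> + B0; elim: n F C => [|n IH] F C dF HF x x0.
  by rewrite /taylor big_ord0 subr0; have := HF 0%N x; rewrite !expr0 fact0 divr1 !mulr1.
have IHF : forall y, 0 <= y -> `|F 1%N y - taylor (fun (k : nat) => F k.+1) n y| <=
    (C * B) * (B ^+ n * y ^+ n / n`!%:R).
  apply: IH => [m y|k y]; first exact: dF.
  by have := HF k.+1 y; rewrite exprS mulrA.
have D1 y : is_derive y (1 : R) (fun y => F 0%N y - taylor F n.+1 y)
   (F 1%N y - taylor (fun (k : nat) => F k.+1) n y).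
  exact: (@is_deriveB _ _ _ _ _ y 1 _ _ (dF 0%N y) (taylor_S F n y)).
have D2 y : is_derive y (1 : R) (fun y => (C * (B ^+ n.+1 / n.+1`!%:R)) * y ^+ n.+1)
   ((C * (B ^+ n.+1 / n.+1`!%:R)) * (n.+1%:R * y ^+ n)).
  exact: (@is_deriveZ _ _ _ _ (C * (B ^+ n.+1 / n.+1`!%:R)) y 1 _ (is_derive_Xn n.+1 y)).
have H := @mvt_le R _ _ _ _ 0 x x0 (fun y _ => D1 y) (fun y _ => D2 y).
have E0 : F 0%N 0 - taylor F n.+1 0 = 0.
  rewrite /taylor big_ord_recl big1 => [|i _]; last by rewrite /= expr0n mulr0.
  by rewrite /= expr0 fact0 divr1 mulr1 addr0 subrr.
move: H; rewrite E0 !subr0 expr0n/= mulr0 subr0 => H.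
apply: le_trans (H _) _; last by rewrite !mulrA (mulrAC _ (x ^+ _)).
move=> y /andP[y0 _]; apply: le_trans (IHF y y0) _.
rewrite factS natrM exprS; have f0 : n`!%:R != 0 :> R by rewrite pnatr_eq0 -lt0n fact_gt0.
have n0 : n.+1%:R != 0 :> R by rewrite pnatr_eq0.
rewrite le_eqVlt; apply/orP; left; apply/eqP.
move: (n`!%:R : R) (n.+1%:R : R) (y ^+ n) (B ^+ n) f0 n0 => a b c e f0 n0.
by field; rewrite f0 n0.
Qed.

Lemma dseq_reflect F : dseq F -> dseq (fun (k : nat) x => (-1) ^+ k * F k (- x)).
Proof.
move=> dF n x; have D0 := @is_deriveN _ _ _ _ x 1 _ (is_derive_id x (1 : R)).
have D1 := is_derive_comp1 D0 (dF n (- x)).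
have := @is_deriveZ _ _ _ _ ((-1) ^+ n) x 1 _ D1.
by move/is_derive_to; apply; rewrite /GRing.scale/= exprS; ring.
Qed.

Lemma taylor_bound F n (C B : R) : dseq F -> 0 <= B ->
  (forall (k : nat) x, `|F k x| <= C * B ^+ k) ->
  forall x, `|F 0%N x - taylor F n x| <= C * (B ^+ n * `|x| ^+ n / n`!%:R).
Proof.
move=> dF B0 HF x; have [x0|x0] := leP 0 x.
  by have := taylor_bound_pos n dF B0 HF x0; rewrite (ger0_norm x0).
have := @taylor_bound_pos _ n C B (dseq_reflect dF) B0 _ (- x).
rewrite (ltr0_norm x0) expr0 mul1r opprK oppr_ge0 (_ : taylor _ n (- x) = taylor F n x).
  apply; last exact: ltW.
  by move=> k y; rewrite normrM normrX normrN normr1 expr1n mul1r.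
apply: eq_bigr => i _; rewrite oppr0 [X in _ * X]exprNn.
have s : (-1) ^+ i * (-1) ^+ i = 1 :> R by rewrite -expr2 sqrr_sign.
move: ((-1) ^+ i) s (F i 0) (i`!%:R^-1) (x ^+ i) => e s f g z.
have -> : e * f * g * (e * z) = e * e * (f * g * z) by ring.
by rewrite s mul1r.
Qed.

Lemma adm_taylor t F n : 0 < t -> adm t (taylor F n) /\ defect t (taylor F n) = 0.
Proof.
move=> t0; elim: n => [|n [IH1 IH2]].
  have A0 := adm_lin (-1) (adm_X t 0) (adm_X t 0).
  have -> : taylor F 0 = (fun x => x ^+ 0 + (-1) * x ^+ 0).
    by apply/funext => x; rewrite /taylor big_ord0 mulN1r subrr.
  by split => //; rewrite (defect_lin _ t0 (adm_X t 0) (adm_X t 0)) defect_X// mulr0 addr0.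
have -> : taylor F n.+1 = (fun x => taylor F n x + (F n 0 / n`!%:R) * x ^+ n).
  by apply/funext => x; rewrite /taylor big_ord_recr.
split; first exact: adm_lin (adm_X t n).
by rewrite (defect_lin _ t0 IH1 (adm_X t n)) IH2 defect_X// mulr0 addr0.
Qed.

Lemma adm_seq t F n : 0 < t -> dseq F -> bseq F -> adm t (F n).
Proof.
move=> t0 dF bF; split.
  split; first exact: (derive_contT (dF n)).
  have [C HC] := bF n; exists C, 0; split => //.
    exact: le_trans (normr_ge0 _) (HC 0).
  by move=> x; rewrite mul0r expR0 mulr1.
apply: open_continuous_measurable_fun; first exact: interval_open.
move=> s; rewrite inE/= in_itv/= => /andP[s0 _].
have s2 : `|1 : R| <= 1 by rewrite normr1.
exact: derive_cont (is_derive_comp1 (rt_der s0) (kpair_der n (rt s) superexp_kD dF bF s2)).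
Qed.

(** The functional is continuous for the exponential weight, because the kernels
    decay faster than every exponential. *)
Lemma defect_le t psi (C eta : R) : 0 < t -> adm t psi -> 0 <= C -> 0 <= eta ->
  (forall x, `|psi x| <= C * expR (eta * `|x|)) ->
  `|defect t psi| <= C * (2 * (\int[mu]_(y in halfline) (`|kD y| * expR (eta * rt t * y)))
     * \int[mu]_(s in `]0, t[) wt t s +
    `|cbrt 3 * Em 1| * (2 * \int[mu]_(y in halfline) (`|kerA y| * expR (eta * rt t * y)))).
Proof.
move=> t0 ap C0 e0 H; have [[cp _] _] := ap; have mT := meas_tline t.
set ID := \int[mu]_(y in halfline) (`|kD y| * _).
set IA := \int[mu]_(y in halfline) (`|kerA y| * _).
apply: le_trans (ler_normD _ _) _; rewrite mulrDr; apply: lerD; last first.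
  rewrite normrM mulrCA; apply: ler_wpM2l => //.
  rewrite mulrA (mulrC C); apply: (kpair_le superexp_A cp C0 e0 H).
  by rewrite cbrt_ge0 lexx.
have Iw := wt_Lint t0.
rewrite mulrA (mulrC _ (\int[mu]_(s in _) _)) -mulrC -(intZ _ mT Iw).
apply: norm_int_le => //; first exact: adm_Lint.
  exact: LintZ.
move=> s; rewrite /= in_itv/= => /andP[s0 st]; rewrite normrM (ger0_norm (wt_ge0 _ _)) mulrC.
apply: ler_wpM2r; first exact: wt_ge0.
rewrite mulrA (mulrC C); apply: (kpair_le superexp_kD cp C0 e0 H).
rewrite cbrt_ge0 /= /rt /cbrt; apply: ge0_ler_powR; rewrite ?nnegrE ?invr_ge0 ?mulr_ge0 ?ltW//.
by rewrite ltr_pM2l.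
Qed.

(** For such functions the Taylor series converges in the exponential weight. *)
Definition exptype F : Prop := exists C B : R, [/\ 0 <= C, 0 <= B & forall (k : nat) x, `|F k x| <= C * B ^+ k].

(** The defect vanishes on Taylor polynomials and is continuous for the norm in
    which they converge. *)
Lemma defect_exptype t F : 0 < t -> dseq F -> exptype F -> defect t (F 0%N) = 0.
Proof.
move=> t0 dF [C [B [C0 B0 HF]]].
have bF : bseq F by move=> n; exists (C * B ^+ n) => x; exact: HF.
pose eta := 2 * B; have e0 : 0 <= eta by rewrite mulr_ge0.
set K := 2 * (\int[mu]_(y in halfline) (`|kD y| * expR (eta * rt t * y)))
     * \int[mu]_(s in `]0, t[) wt t s +
    `|cbrt 3 * Em 1| * (2 * \int[mu]_(y in halfline) (`|kerA y| * expR (eta * rt t * y))).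
have key n : `|defect t (F 0%N)| <= (C * 2^-1 ^+ n) * K.
  have [aT dT] := adm_taylor F n t0; have a0 := adm_seq 0 t0 dF bF.
  have aR := adm_lin (-1) a0 aT.
  have -> : defect t (F 0%N) = defect t (fun x => F 0%N x + (-1) * taylor F n x).
    by rewrite (defect_lin _ t0 a0 aT) dT mulr0 addr0.
  apply: (defect_le t0 aR) => //; first by rewrite mulr_ge0// exprn_ge0.
  move=> x; rewrite mulN1r; apply: le_trans (taylor_bound n dF B0 HF x) _.
  rewrite -[leRHS]mulrA; apply: ler_wpM2l => //.
  have := expR_ge_pow n (mulr_ge0 e0 (normr_ge0 x)).
  have f0 : 0 < n`!%:R :> R by rewrite ltr0n fact_gt0.
  have -> : (eta * `|x|) ^+ n = 2 ^+ n * (B ^+ n * `|x| ^+ n) by rewrite /eta !exprMn mulrA.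
  have p0 : 0 < 2 ^+ n :> R by rewrite exprn_gt0.
  move=> h; rewrite ler_pdivrMr// exprVn -(ler_pM2l p0).
  move: (2 ^+ n) (B ^+ n * _) (expR _) p0 h => p a E p0 h.
  have -> : p * (p^-1 * E * n`!%:R) = n`!%:R * E by field; rewrite gt_eqF.
  exact: h.
have : `|defect t (F 0%N)| <= 0; last by rewrite normr_le0 => /eqP.
apply/ler_addgt0Pr => e e_gt0; rewrite add0r.
pose n := Num.bound (C * `|K| / e); have q0 : 0 <= C * `|K| / e by rewrite divr_ge0 ?mulr_ge0 ?normr_ge0// ltW.
have hn : C * `|K| / e < n%:R := archi_boundP q0.
apply: le_trans (key n) _; rewrite -mulrA mulrCA exprVn ler_pdivrMl ?exprn_gt0//.
have h1 : n%:R <= 2 ^+ n :> R by rewrite -natrX ler_nat ltnW// ltn_expl.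
have h2 : C * K <= C * `|K| by rewrite ler_wpM2l// ler_norm.
move: hn; rewrite ltr_pdivrMr// => hn; apply: le_trans h2 _; apply: ltW; apply: lt_le_trans hn _.
by rewrite ler_wpM2r// ltW.
Qed.

End CaputoIdentity.

(** * A bump function with its derivatives *)

Section BumpFunction.
Context {R : realType}.
Notation mu := (@lebesgue_measure R).
Implicit Types (x y u : R) (F G H : nat -> R -> R).

(** flat k u = u^-k e^(-1/u) for u > 0, and 0 otherwise *)
Definition flat (k : nat) u : R := if u <= 0 then 0 else u^-1 ^+ k * expR (- u^-1).

Lemma flat_le (k : nat) u : `|flat k u| <= k.+2`!%:R * u ^+ 2.
Proof.
rewrite /flat; case: (leP u 0) => u0; first by rewrite normr0 mulr_ge0 ?sqr_ge0.
have v0 : 0 <= u^-1 by rewrite invr_ge0 ltW.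
have := expR_ge_pow k.+2 v0; rewrite ger0_norm ?mulr_ge0 ?exprn_ge0 ?expR_ge0//.
rewrite expRN ler_pdivrMr ?expR_gt0// exprSr exprSr => H.
have -> : u^-1 ^+ k = u^-1 ^+ k * u^-1 * u^-1 * u ^+ 2.
  by move: (u^-1 ^+ k) => p; field; rewrite gt_eqF.
by rewrite [leRHS]mulrAC ler_wpM2r ?sqr_ge0.
Qed.

Lemma is_derive_near (f g : R -> R) x l : is_derive x (1 : R) f l ->
  (\forall y \near x, f y = g y) -> is_derive x (1 : R) g l.
Proof. by move=> D N; apply: near_eq_is_derive D => //; exact: oner_neq0. Qed.

(** At 0 all these functions are flat, which a quadratic bound shows. *)
Lemma flat_der (k : nat) u : is_derive u (1 : R) (flat k)
  (- k%:R * flat k.+1 u + flat k.+2 u).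
Proof.
have [u0|u0|u0] := ltgtP u 0.
- rewrite /flat ltW// mulr0 addr0; apply: (is_derive_near (is_derive_cst (0 : R) u 1)).
  near=> y; rewrite ifT//; apply: ltW; near: y; exact: lt_nbhsl.
- rewrite {2 3}/flat !leNgt u0 /=.
  have D0 := is_derive_Xn k u^-1.
  have DV : is_derive u (1 : R) (fun u => u^-1) (- (u^-1 ^+ 2)).
    have := @is_deriveV _ id u 1 1 _ (is_derive_id u (1 : R)); rewrite gt_eqF// => /(_ isT).
    by move/is_derive_to; apply; rewrite /GRing.scale/= mulr1 exprVn.
  have D1 := is_derive_comp1 DV D0.
  have D2 := is_derive_comp1 (@is_deriveN _ _ _ _ u 1 _ DV) (is_derive_expR (- u^-1)).
  have D3 := @is_deriveM _ _ _ _ u 1 _ _ D1 D2.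
  apply: (@is_derive_near (fun u => u^-1 ^+ k * expR (- u^-1))); last first.
    near=> y; rewrite /flat ifF//; apply/negbTE; rewrite -ltNge; near: y; exact: lt_nbhsr.
  move: D3 => /is_derive_to; apply; rewrite /GRing.scale/= opprK.
  case: k {D0 D1} => [|k]; first by rewrite !expr0 !mul0r !mulr0 oppr0 mul0r !add0r expr2; ring.
  rewrite /= !exprS; move: (u^-1 ^+ k) (expR _) (k.+1%:R : R) => p q r; ring.
- rewrite u0; have E n : flat n 0 = 0 by rewrite /flat lexx.
  rewrite !E mulr0 addr0; apply: (@is_derive_quad _ _ _ _ k.+2`!%:R 1) => // h _.
  by rewrite E add0r mulr0 !subr0; exact: flat_le.
Unshelve. all: by end_near.
Qed.

(** The n-th derivative of [flat k], by its recursion in the family. *)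
Fixpoint flatD (n k : nat) u : R :=
  if n is n'.+1 then - k%:R * flatD n' k.+1 u + flatD n' k.+2 u else flat k u.

Lemma flatD_der n k u : is_derive u (1 : R) (flatD n k) (flatD n.+1 k u).
Proof.
elim: n k => [|n IH] k; first exact: flat_der.
have D1 := @is_deriveZ _ _ _ _ (- k%:R : R) u 1 _ (IH k.+1).
exact: (@is_deriveD _ _ _ _ _ u 1 _ _ D1 (IH k.+2)).
Qed.

Lemma flatD0 n k u : u <= 0 -> flatD n k u = 0.
Proof.
move=> u0; elim: n k => [|n IH] k /=; first by rewrite /flat u0.
by rewrite !IH mulr0 addr0.
Qed.

(** The n-th derivative of a product, by recursion instead of binomial sums. *)
Fixpoint prodseq n F G x : R :=
  if n is n'.+1 then prodseq n' (fun i => F i.+1) G x + prodseq n' F (fun i => G i.+1) x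
  else F 0%N x * G 0%N x.

Lemma prodseq_der n F G : dseq F -> dseq G -> forall x,
  is_derive x (1 : R) (prodseq n F G) (prodseq n.+1 F G x).
Proof.
elim: n F G => [|n IH] F G dF dG x.
  have := @is_deriveM _ _ _ _ x 1 _ _ (dF 0%N x) (dG 0%N x).
  by move/is_derive_to; apply; rewrite /GRing.scale/=; ring.
have D1 := IH _ G (fun m => dF m.+1) dG x.
exact: (@is_deriveD _ _ _ _ _ x 1 _ _ D1 (IH F _ dF (fun m => dG m.+1) x)).
Qed.

Lemma prodseq_0l n F G x : (forall i, F i x = 0) -> prodseq n F G x = 0.
Proof.
elim: n F G => [|n IH] F G F0 /=; first by rewrite F0 mul0r.
by rewrite IH// IH// addr0.
Qed.

Lemma prodseq_0r n F G x : (forall i, G i x = 0) -> prodseq n F G x = 0.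
Proof.
elim: n F G => [|n IH] F G G0 /=; first by rewrite G0 mulr0.
by rewrite IH// IH// addr0.
Qed.

Lemma prodseq_le n F G x (w C1 B1 C2 B2 : R) : 0 <= w ->
  0 <= C1 -> 0 <= C2 -> 0 <= B1 -> 0 <= B2 ->
  (forall i, w * `|F i x| <= C1 * B1 ^+ i) -> (forall i, `|G i x| <= C2 * B2 ^+ i) ->
  w * `|prodseq n F G x| <= C1 * C2 * (B1 + B2) ^+ n.
Proof.
move=> w0 + + b1 b2; elim: n F G C1 C2 => [|n IH] F G C1 C2 c1 c2 HF HG /=.
  rewrite normrM mulrA expr0 mulr1; have := HF 0%N; have := HG 0%N.
  rewrite !expr0 !mulr1 => h2 h1; apply: ler_pM => //; exact: mulr_ge0.
apply: le_trans (_ : w * (`|prodseq n (fun i => F i.+1) G x| + `|prodseq n F (fun i => G i.+1) x|) <= _).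
  by apply: ler_wpM2l => //; exact: ler_normD.
have h1 : w * `|prodseq n (fun i => F i.+1) G x| <= (C1 * B1) * C2 * (B1 + B2) ^+ n.
  apply: IH => //; first by rewrite mulr_ge0.
  by move=> i; have := HF i.+1; rewrite exprS mulrA.
have h2 : w * `|prodseq n F (fun i => G i.+1) x| <= C1 * (C2 * B2) * (B1 + B2) ^+ n.
  apply: IH => //; first by rewrite mulr_ge0.
  by move=> i; have := HG i.+1; rewrite exprS mulrA.
rewrite mulrDr; apply: le_trans (lerD h1 h2) _; rewrite exprS.
by move: ((B1 + B2) ^+ n) => p; rewrite le_eqVlt; apply/orP; left; apply/eqP; ring.
Qed.

(** The n-th derivative of a smooth function supported in [-1, 1]. *)
Definition bump n x : R :=
  prodseq n (fun i x => flatD i 0 (1 + x)) (fun i x => (-1) ^+ i * flatD i 0 (1 - x)) x.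

Lemma bump_der : dseq bump.
Proof.
move=> n x; apply: prodseq_der => i y.
  have D := is_derive_affine 1 1 y; have := is_derive_comp1 D (flatD_der i 0 (1 + 1 * y)).
  under eq_fun do rewrite mul1r; rewrite mulr1 mul1r; exact.
have D := is_derive_affine 1 (-1) y; have D1 := is_derive_comp1 D (flatD_der i 0 (1 + -1 * y)).
move: D1; under eq_fun do rewrite mulN1r; rewrite mulN1r => D1.
have := @is_deriveZ _ _ _ _ ((-1) ^+ i : R) y 1 _ D1.
by move/is_derive_to; apply; rewrite /GRing.scale/= exprS; ring.
Qed.

Lemma bump_left n : bump n (-1) = 0.
Proof. by apply: prodseq_0l => i; rewrite subrr flatD0. Qed.

Lemma bump_right n : bump n 1 = 0.
Proof. by apply: prodseq_0r => i; rewrite subrr flatD0// mulr0. Qed.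

Lemma flat_ge0 k u : 0 <= flat k u.
Proof.
rewrite /flat; case: (leP u 0) => // u0.
by rewrite mulr_ge0 ?expR_ge0// exprn_ge0// invr_ge0 ltW.
Qed.

Lemma bump_ge0 x : 0 <= bump 0 x.
Proof. by rewrite /bump /= expr0 mul1r mulr_ge0 ?flat_ge0. Qed.

Lemma bump_gt0 : 0 < bump 0 0.
Proof.
rewrite /bump /= expr0 mul1r addr0 subr0 /flat ler10 /= expr0 mul1r.
by rewrite mulr_gt0 ?expR_gt0.
Qed.

(** Multiplication by the variable, on sequences of derivatives. *)
Definition xseq G n x : R := x * G n x + n%:R * G n.-1 x.

Lemma xseq_der G : dseq G -> dseq (xseq G).
Proof.
move=> dG n x; have D1 := @is_deriveM _ _ _ _ x 1 _ _ (is_derive_id x (1 : R)) (dG n x).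
case: n D1 => [|n] D1.
  have D2 : is_derive x (1 : R) (fun x => 0%:R * G 0.-1 x) 0.
    by under eq_fun do rewrite mul0r; exact: is_derive_cst.
  have := @is_deriveD _ _ _ _ _ x 1 _ _ D1 D2.
  by move/is_derive_to; apply; rewrite /xseq /GRing.scale/=; ring.
have D2 := @is_deriveZ _ _ _ _ (n.+1%:R : R) x 1 _ (dG n x).
have := @is_deriveD _ _ _ _ _ x 1 _ _ D1 D2.
move/is_derive_to; apply; rewrite /xseq /GRing.scale/= -(natr1 n.+1); ring.
Qed.

(** Derivatives of [y^j] times the bump, needed as the cosine transform is
    differentiated j times. *)
Definition ybump j : nat -> R -> R := iter j xseq bump.

Lemma ybump_der j : dseq (ybump j).
Proof. by elim: j => [|j IH]; [exact: bump_der|exact: xseq_der]. Qed.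

Lemma ybump0S j x : ybump j.+1 0%N x = x * ybump j 0%N x.
Proof. by rewrite /ybump /= /xseq mul0r addr0. Qed.

Lemma ybump_end j n : ybump j n (-1) = 0 /\ ybump j n 1 = 0.
Proof.
elim: j n => [|j IH] n; first by rewrite /ybump /= bump_left bump_right.
have [h1 h2] := IH n; have [h3 h4] := IH n.-1.
by rewrite /ybump /= /xseq -/(ybump j) h1 h2 h3 h4 !mulr0 addr0.
Qed.

Lemma bump_bound (m : nat) : exists M : R, 0 <= M /\ forall i x, (i <= m)%N -> -1 <= x <= 1 ->
  `|bump i x| <= M.
Proof.
have one i : exists M : R, 0 <= M /\ forall x, -1 <= x <= 1 -> `|bump i x| <= M.
  have c : ccont (fun x => (bump i x)%:C).
    by split => x; [exact: (derive_contT (bump_der i))|exact: cvg_cst].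
  have [M [M0 HM]] := cont_bounded (-1) 1 c; exists M; split => // x /HM.
  by rewrite nc_real.
elim: m => [|m [M [M0 HM]]].
  have [M [M0 HM]] := one 0%N; exists M; split => // i x; rewrite leqn0 => /eqP ->; exact: HM.
have [M' [M'0 HM']] := one m.+1; exists (M + M'); split => [|i x]; first by rewrite addr_ge0.
rewrite leq_eqVlt => /predU1P[->|]; first by move=> /HM'; lra.
by rewrite ltnS => im h; have := HM i x im h; lra.
Qed.

Lemma ybump_bound (m : nat) : exists M : R, 0 <= M /\ forall j i x, (i <= m)%N -> -1 <= x <= 1 ->
  `|ybump j i x| <= M * (1 + m%:R) ^+ j.
Proof.
have [M [M0 HM]] := bump_bound m; exists M; split => // j.
elim: j => [|j IH] i x im h; first by rewrite expr0 mulr1; exact: HM.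
rewrite /ybump /= /xseq -/(ybump j); apply: le_trans (ler_normD _ _) _.
rewrite !normrM exprS.
have h1 := IH i x im h; have h2 := IH i.-1 x (leq_trans (leq_pred i) im) h.
have x1 : `|x| <= 1 by rewrite ler_norml.
have i1 : `|i%:R : R| <= m%:R by rewrite ger0_norm// ler_nat.
have p1 := ler_pM (normr_ge0 _) (normr_ge0 _) x1 h1.
have p2 := ler_pM (normr_ge0 _) (normr_ge0 _) i1 h2.
apply: le_trans (lerD p1 p2) _; move: (m%:R : R) ((1 + m%:R) ^+ j) => q p.
by rewrite le_eqVlt; apply/orP; left; apply/eqP; ring.
Qed.

End BumpFunction.

(** * A nonnegative rapidly decreasing function of exponential type *)

Section BandLimited.
Context {R : realType}.
Notation mu := (@lebesgue_measure R).
Implicit Types (x y z c : R) (F G H : nat -> R -> R) (m n j : nat).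
Let mH := @measurable_halfline R.

(** Schwartz functions and rapidly decreasing functions of exponential type,
    given together with all their derivatives *)
Definition sch F : Prop := dseq F /\
  forall m n, exists C : R, forall x, (1 + `|x|) ^+ m * `|F n x| <= C.

Definition bandl F : Prop := dseq F /\
  forall m, exists C B : R, [/\ 0 <= C, 0 <= B & forall n x, (1 + `|x|) ^+ m * `|F n x| <= C * B ^+ n].

Lemma bandl_sch F : bandl F -> sch F.
Proof.
by move=> [dF HF]; split => // m n; have [C [B [_ _ H]]] := HF m; exists (C * B ^+ n) => x.
Qed.

Lemma bandl_exptype F : bandl F -> exptype F.
Proof.
move=> [dF HF]; have [C [B [C0 B0 H]]] := HF 0%N; exists C, B; split => // n x.
by have := H n x; rewrite expr0 mul1r.
Qed.

Lemma sch_bseq F : sch F -> bseq F.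
Proof. by move=> [_ HF] n; have [C H] := HF 0%N n; exists C => x; have := H x; rewrite expr0 mul1r. Qed.

Lemma sch_shift F j : sch F -> sch (fun n => F (n + j)%N).
Proof.
move=> [dF HF]; split => [n x|m n]; last exact: HF.
by have := dF (n + j)%N x; rewrite addSn.
Qed.

Lemma pow_1x (a : R) m : 0 <= a -> (1 + a) ^+ m <= 2 ^+ m * (1 + a ^+ m).
Proof.
move=> a0; have [a1|a1] := leP a 1.
  apply: le_trans (_ : 2 ^+ m * 1 <= _).
    by rewrite mulr1; apply: lerXn2r; rewrite ?nnegrE ?addr_ge0//; lra.
  by apply: ler_wpM2l; rewrite ?exprn_ge0// lerDl exprn_ge0.
apply: le_trans (_ : 2 ^+ m * a ^+ m <= _).
  rewrite -exprMn; apply: lerXn2r; rewrite ?nnegrE ?addr_ge0 ?mulr_ge0//; lra.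
by apply: ler_wpM2l; rewrite ?exprn_ge0// lerDr.
Qed.

Lemma Lint_inv3 : Lint halfline (fun y : R => (1 + y) ^- 3).
Proof.
have [I _] := @Em_mul R 1 0; apply: Lint_oline.
have mO := @measurable_oline R.
apply: (Lint_le mO _ I).
  apply: open_continuous_measurable_fun; first exact: interval_open.
  move=> y; rewrite inE/= in_itv/= andbT => y0.
  apply: cvgV; first by rewrite expf_neq0// gt_eqF// addr_gt0.
  apply: (@continuous_comp _ _ _ (fun y => 1 + y) (fun w => w ^+ 3)); last exact: (derive_contT (is_derive_Xn 3)).
  by apply: cvgD; [exact: cvg_cst|exact: cvg_id].
move=> z; rewrite /= in_itv/= andbT => z0; rewrite addn0 Em2 expr0 mul1r mulr1 (lam3 (ltW z0)).
have p0 : 0 < 1 + z by rewrite addr_gt0.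
have p1 : 0 < 1 + z ^+ 3 by rewrite addr_gt0// exprn_gt0.
have p3 : 0 < (1 + z) ^- 3 by rewrite invr_gt0 exprn_gt0.
rewrite (ger0_norm (ltW p3)) lef_pV2 ?posrE ?exprn_gt0//.
have -> : (1 + z) ^+ 3 = 1 + z ^+ 3 + 3 * z * (1 + z) by ring.
by rewrite lerDl mulr_ge0 ?mulr_ge0 ?ltW.
Qed.

(** Cubic decay is more than enough for integrability, and avoids computing with
    optimal exponents. *)
Lemma decay_Lint (f : R -> R) C : Lmfun halfline f ->
  (forall y, 0 <= y -> (1 + y) ^+ 3 * `|f y| <= C) -> Lint halfline f.
Proof.
move=> mf Hf; apply: (Lint_le mH mf (LintZ C mH Lint_inv3)) => y /halfline_ge0 y0.
have p0 : 0 < 1 + y by rewrite ltr_wpDr.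
by rewrite ler_pdivlMr ?exprn_gt0// mulrC; exact: Hf.
Qed.

Definition inv3 : R := \int[mu]_(y in halfline) ((1 + y) ^- 3).

Lemma decay_int (f : R -> R) C : Lint halfline f ->
  (forall y, 0 <= y -> (1 + y) ^+ 3 * `|f y| <= C) ->
  `|\int[mu]_(y in halfline) f y| <= C * inv3.
Proof.
move=> If Hf; rewrite -(intZ _ mH Lint_inv3).
apply: norm_int_le => // [|y /halfline_ge0 y0]; first exact: LintZ Lint_inv3.
have p0 : 0 < 1 + y by rewrite ltr_wpDr.
by rewrite ler_pdivlMr ?exprn_gt0// mulrC; exact: Hf.
Qed.

Lemma int_gt0 (D : set R) (f : R -> R) (p q : R) : Lmeas D -> Lint D f ->
  (forall x, D x -> 0 <= f x) -> p < q -> (forall x, p <= x <= q -> D x) ->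
  (forall x, p <= x <= q -> {for x, continuous f}) -> 0 < f p ->
  0 < \int[mu]_(x in D) f x.
Proof.
move=> mD If f0 pq Dpq cf fp.
have [d d0 Hd] : exists2 d, 0 < d & forall x, p <= x <= p + d -> f p / 2 <= f x.
  have := cf p; rewrite lexx ltW// => /(_ isT) /cvgrPdist_le /(_ (f p / 2)).
  rewrite divr_gt0// => /(_ isT) [e /= e0 He]; exists (e / 2); first by rewrite divr_gt0.
  move=> x /andP[px xp]; have := He x; rewrite /ball_ /= => /(_ _) H.
  have {}H : `|f p - f x| <= f p / 2.
    apply: H; rewrite distrC ger0_norm ?subr_ge0//; lra.
  by have := ler_norm (f p - f x); lra.
pose q' := Num.min q (p + d).
have pq' : p < q' by rewrite /q' lt_min pq ltrDl.
have sub : `[p, q']%classic `<=` D.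
  by move=> x /=; rewrite in_itv/= le_min => /and3P[h1 h2 h3]; apply: Dpq; rewrite h1.
have mI : Lmeas (`[p, q']%classic : set R) by exact: measurable_itv.
have II : Lint `[p, q'] f by apply: integrableS If => //.
have -> : \int[mu]_(x in D) f x = \int[mu]_(x in `[p, q'] `|` (D `\` `[p, q'])) f x.
  by rewrite setDUK.
rewrite Rintegral_setU//; last 3 first.
- exact: measurableD.
- by rewrite setDUK.
- by apply/disj_setPS => x [h1 [_ h2]].
apply: ltr_pwDl; last first.
  apply: Rintegral_ge0 => x [Dx _]; exact: f0.
have : \int[mu]_(x in `[p, q']) (f p / 2) <= \int[mu]_(x in `[p, q']) f x.
  apply: le_Rintegral => //.
    by apply: Lint_segment => x; exact: cvg_cst.
  by move=> x /=; rewrite in_itv/= le_min => /and3P[h1 h2 h3]; apply: Hd; rewrite h1.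
by apply: lt_le_trans; rewrite (int_cst _ (ltW pq')) mulr_gt0 ?divr_gt0// subr_gt0.
Qed.

(** The phase encodes the derivatives of the cosine: each adds a quarter period. *)
Definition cosx c x : R := cos (x + c).

Lemma cosx_le c x : `|cosx c x| <= 1.
Proof. by rewrite ler_norml cos_geN1 cos_le1. Qed.

Lemma cosx_der c x : is_derive x (1 : R) (cosx c) (cosx (c + pi / 2) x).
Proof.
have D0 := @is_deriveD _ _ _ _ _ x 1 _ _ (is_derive_id x (1 : R)) (is_derive_cst c x 1).
have := is_derive_comp1 D0 (is_derive_cos (x + c)).
move/is_derive_to; apply; rewrite addr0 mulr1 /cosx addrA [RHS]cosD cos_pihalf sin_pihalf.
by rewrite mulr0 mulr1 sub0r.
Qed.

Definition seg : set R := `[-1, 1]%classic.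

Lemma meas_seg : Lmeas seg.
Proof. exact: measurable_itv. Qed.

(** The j-th derivative of the cosine transform of the bump. *)
Definition kap j x : R := \int[mu]_(u in seg) (ybump j 0%N u * cosx (j%:R * (pi / 2)) (x * u)).

Lemma cosx_cont c x : continuous (fun u => cosx c (x * u)).
Proof.
move=> u; apply: (@continuous_comp _ _ _ (fun u => x * u) (cosx c)).
  exact: derive_cont (is_derive_lin x u).
exact: (derive_contT (cosx_der c)).
Qed.

Lemma seg_Lint (f : R -> R) c x : continuous f -> Lint seg (fun u => f u * cosx c (x * u)).
Proof. by move=> cf; apply: Lint_segment => u; apply: cvgM; [exact: cf|exact: cosx_cont]. Qed.

Lemma kap_der : dseq kap.
Proof.
move=> j x; have [M [M0 HM]] := @ybump_bound R 0.
have cb i : continuous (ybump i 0%N : R -> R) by exact: (derive_contT (ybump_der i 0)).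
apply: (@derive_int R seg (fun x u => ybump j 0%N u * cosx (j%:R * (pi / 2)) (x * u))
  (fun x u => ybump j.+1 0%N u * cosx (j.+1%:R * (pi / 2)) (x * u)) (x - 1) (x + 1) x
  (fun=> M * (1 + 0%:R) ^+ j.+1) meas_seg).
- by apply/andP; split; lra.
- by move=> y _; exact: seg_Lint.
- move=> y u _ _.
  have D0 : is_derive y (1 : R) (fun y => y * u) u.
    by have := is_derive_lin u y; under eq_fun do rewrite mulrC.
  have D1 := is_derive_comp1 D0 (cosx_der (j%:R * (pi / 2)) (y * u)).
  have := @is_deriveZ _ _ _ _ (ybump j 0%N u) y 1 _ D1.
  move/is_derive_to; apply; rewrite ybump0S /GRing.scale /=.
  have -> : j.+1%:R * (pi / 2) = j%:R * (pi / 2) + pi / 2 :> R by rewrite -(natr1 j); ring.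
  ring.
- by apply: Lint_segment => u; exact: cvg_cst.
move=> y u _; rewrite /seg /= in_itv/= => h; rewrite normrM.
have h1 := HM j.+1 0%N u (leqnn _) h; have h2 := cosx_le (j.+1%:R * (pi / 2)) (y * u).
by have := ler_pM (normr_ge0 _) (normr_ge0 _) h1 h2; rewrite mulr1.
Qed.

Lemma seg_parts H c x : dseq H -> (forall n, H n (-1) = 0 /\ H n 1 = 0) ->
  x * \int[mu]_(u in seg) (H 0%N u * cosx (c + pi / 2) (x * u)) =
  - \int[mu]_(u in seg) (H 1%N u * cosx c (x * u)).
Proof.
move=> dH H0; have cH n := derive_contT (dH n).
have I1 := seg_Lint (c + pi / 2) x (cH 0%N); have I2 := seg_Lint c x (cH 1%N).
have D u : is_derive u (1 : R) (fun u => H 0%N u * cosx c (x * u))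
   (H 1%N u * cosx c (x * u) + x * (H 0%N u * cosx (c + pi / 2) (x * u))).
  have D1 := is_derive_comp1 (is_derive_lin x u) (cosx_der c (x * u)).
  have := @is_deriveM _ _ _ _ u 1 _ _ (dH 0%N u) D1.
  by move/is_derive_to; apply; rewrite /GRing.scale/=; ring.
have N11 : (-1 : R) <= 1 by lra.
have C : continuous (fun u => H 1%N u * cosx c (x * u) + x * (H 0%N u * cosx (c + pi / 2) (x * u))).
  move=> u; apply: cvgD; first by apply: cvgM; [exact: cH|exact: cosx_cont].
  by apply: cvgM; [exact: cvg_cst|apply: cvgM; [exact: cH|exact: cosx_cont]].
have := FTC_segment N11 (fun u _ => D u) C.
have [-> ->] := H0 0%N; rewrite !mul0r subrr.
rewrite (intD meas_seg I2 (LintZ x meas_seg I1)) (intZ _ meas_seg I1) addrC => /eqP.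
by rewrite addr_eq0 => /eqP.
Qed.

(** Each integration by parts exchanges a factor x for a derivative of the bump,
    whose derivatives vanish at both ends. *)
Lemma seg_bound m H c x (M : R) : dseq H -> (forall n, H n (-1) = 0 /\ H n 1 = 0) ->
  (forall u, -1 <= u <= 1 -> `|H m u| <= M) ->
  `|x| ^+ m * `|\int[mu]_(u in seg) (H 0%N u * cosx c (x * u))| <= 2 * M.
Proof.
elim: m H c => [|m IH] H c dH H0 HM.
  rewrite expr0 mul1r; have I := seg_Lint c x (derive_contT (dH 0%N)).
  have IM : Lint seg (fun=> M) by apply: Lint_segment => u; exact: cvg_cst.
  apply: le_trans (norm_int_le meas_seg I IM _) _.
    move=> u; rewrite /seg /= in_itv/= => h; rewrite normrM.
    by have := ler_pM (normr_ge0 _) (normr_ge0 _) (HM u h) (cosx_le c (x * u)); rewrite mulr1.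
  by rewrite int_cst; [lra|lra].
have := seg_parts (c - pi / 2) x dH H0; rewrite subrK => E.
rewrite exprSr -mulrA -normrM E normrN.
by apply: (IH (fun n => H n.+1)) => // n x'; exact: dH.
Qed.

(** Compact support gives the geometric growth in n, smoothness the decay in x. *)
Lemma kap_bound m : exists C B : R, [/\ 0 <= C, 0 <= B & forall n x, (1 + `|x|) ^+ m * `|kap n x| <= C * B ^+ n].
Proof.
have [M [M0 HM]] := @ybump_bound R m.
have b0 : 0 <= 1 + m%:R :> R by rewrite addr_ge0.
exists (2 ^+ m * (4 * M)), (1 + m%:R); split => //.
  by rewrite mulr_ge0 ?exprn_ge0 ?mulr_ge0.
move=> n x; have := ybump_end; set P := M * (1 + m%:R) ^+ n => En.
have h i : (i <= m)%N -> `|x| ^+ i * `|kap n x| <= 2 * P.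
  move=> im; apply: (seg_bound _ _ (ybump_der n)) => [k|u hu]; first exact: ybump_end.
  exact: HM.
have h0 := h 0%N isT; have hm := h m (leqnn _); rewrite expr0 mul1r in h0.
apply: le_trans (ler_wpM2r (normr_ge0 _) (pow_1x m (normr_ge0 x))) _.
rewrite -[leLHS]mulrA -[leRHS]mulrA; apply: ler_wpM2l; first by rewrite exprn_ge0.
rewrite -[leRHS]mulrA -/P; lra.
Qed.

(** The square of the cosine transform: nonnegative, so that its integral does
    not vanish, and still rapidly decreasing with geometric derivatives. *)
Definition mol n x : R := prodseq n kap kap x.

Lemma mol_bandl : bandl mol.
Proof.
split=> [n x|m]; first by apply: prodseq_der; exact: kap_der.
have [C1 [B1 [C10 B10 H1]]] := kap_bound m; have [C2 [B2 [C20 B20 H2]]] := kap_bound 0.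
exists (C1 * C2), (B1 + B2); split; rewrite ?mulr_ge0 ?addr_ge0// => n x.
apply: prodseq_le => // i.
by have := H2 i x; rewrite expr0 mul1r.
Qed.

Lemma mol_ge0 x : 0 <= mol 0 x.
Proof. by rewrite /mol /= -expr2 sqr_ge0. Qed.

Lemma mol_gt0 : 0 < mol 0 0.
Proof.
rewrite /mol /= -expr2 exprn_even_gt0//= gt_eqF//.
have E u : seg u -> ybump 0 0%N u * cosx (0%:R * (pi / 2)) (0 * u) = bump 0 u.
  by move=> _; rewrite mul0r mul0r /cosx addr0 cos0 mulr1.
rewrite /kap (int_eq E).
have c : continuous (bump 0 : R -> R) by exact: (derive_contT (bump_der 0)).
apply: (@int_gt0 seg _ 0 1 meas_seg (Lint_segment (-1) 1 c)) => //.
- by move=> u _; exact: bump_ge0.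
- by move=> u; rewrite /seg /= in_itv/= => /andP[h1 h2]; apply/andP; split; lra.
- by move=> u _; exact: c.
exact: bump_gt0.
Qed.

End BandLimited.

(** * Approximation by functions of exponential type *)

Section Mollification.
Context {R : realType}.
Notation mu := (@lebesgue_measure R).
Implicit Types (x y z e : R) (F G : nat -> R -> R) (m n j : nat).
Let mH := @measurable_halfline R.

(** The weight is submultiplicative, hence moderate under translations. *)
Lemma weight_shift x h m : (1 + `|x|) ^+ m <= (1 + `|x + h|) ^+ m * (1 + `|h|) ^+ m.
Proof.
rewrite -exprMn; apply: lerXn2r; rewrite ?nnegrE ?mulr_ge0 ?addr_ge0//.
have h1 : `|x| <= `|x + h| + `|h|.
  by have := ler_normB (x + h) h; rewrite addrK.
by have := mulr_ge0 (normr_ge0 (x + h)) (normr_ge0 h); lra.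
Qed.

Lemma sch_shift_le F m n : sch F -> exists C : R, 0 <= C /\ forall x h,
  (1 + `|x|) ^+ m * `|F n (x + h)| <= C * (1 + `|h|) ^+ m.
Proof.
move=> [dF HF]; have [C HC] := HF m n.
have C0 : 0 <= C by apply: le_trans (HC 0); rewrite mulr_ge0// exprn_ge0// addr_ge0.
exists C; split => // x h.
apply: le_trans (ler_wpM2r (normr_ge0 _) (weight_shift x h m)) _.
rewrite mulrAC; apply: ler_wpM2r; last exact: HC.
by rewrite exprn_ge0// addr_ge0.
Qed.

Lemma sch_diff_le F m n : sch F -> exists C : R, 0 <= C /\ forall x h,
  (1 + `|x|) ^+ m * `|F n (x + h) - F n x| <= C * `|h| * (1 + `|h|) ^+ m.
Proof.
move=> sF; have [dF _] := sF; have [C [C0 HC]] := sch_shift_le m n.+1 sF.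
exists C; split => // x h.
have w0 : 0 < (1 + `|x|) ^+ m by rewrite exprn_gt0// ltr_wpDr.
rewrite mulrC -ler_pdivlMr//.
have := @lipschitz_le R (F n) (F n.+1) x (x + h) (C * (1 + `|h|) ^+ m / (1 + `|x|) ^+ m).
have -> : x + h - x = h by ring.
move=> H; apply: le_trans (H _ _) _.
- by move=> y _; exact: dF.
- move=> y hy; rewrite ler_pdivlMr// mulrC.
  have := HC x (y - x); rewrite (_ : x + (y - x) = y); last by ring.
  move=> h1.
  apply: le_trans h1 _; apply: ler_wpM2l => //.
  apply: lerXn2r; rewrite ?nnegrE ?addr_ge0// lerD2l.
  move: hy; rewrite ge_min le_max => /andP[/orP a /orP b].
  rewrite ler_norml; have := ler_norm h; have := ler_norm (- h); rewrite normrN => n1 n2.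
  by apply/andP; split; case: a => a; case: b => b; lra.
rewrite le_eqVlt; apply/orP; left; apply/eqP.
by move: ((1 + `|h|) ^+ m) ((1 + `|x|) ^- m) (`|h|) => a b c; ring.
Qed.

(** The integral over the line, folded on the half line, where the integration
    lemmas are available. *)
Definition lint (f : R -> R) : R := \int[mu]_(z in halfline) (f z + f (- z)).

Definition decays (f : R -> R) (C : R) := forall z, (1 + `|z|) ^+ 3 * `|f z| <= C.

Lemma decays_Lint (f : R -> R) C : continuous f -> decays f C ->
  Lint halfline f /\ Lint halfline (fun z => f (- z)).
Proof.
move=> cf Hf; split; apply: (@decay_Lint _ _ C).
- exact: cont_meas.
- by move=> y y0; have := Hf y; rewrite (ger0_norm y0).
- by apply: cont_meas => // y; apply: (@continuous_comp _ _ _ (fun y => - y) f);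
    [exact: cvgN (cvg_id)|exact: cf].
- by move=> y y0; have := Hf (- y); rewrite normrN (ger0_norm y0).
Qed.

Lemma lint_Lint (f : R -> R) C : continuous f -> decays f C ->
  Lint halfline (fun z => f z + f (- z)).
Proof. by move=> cf Hf; have [I1 I2] := decays_Lint cf Hf; exact: LintD. Qed.

Lemma lint_le (f : R -> R) C : continuous f -> decays f C -> `|lint f| <= 2 * C * inv3.
Proof.
move=> cf Hf; apply: decay_int; first exact: lint_Lint cf Hf.
move=> y y0; have h1 := Hf y; have h2 := Hf (- y); rewrite normrN (ger0_norm y0) in h1 h2.
have w0 : 0 <= (1 + y) ^+ 3 by rewrite exprn_ge0// addr_ge0.
apply: le_trans (ler_wpM2l w0 (ler_normD _ _)) _; rewrite mulrDr; lra.
Qed.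

Lemma lint_lin (f g : R -> R) (a b C1 C2 : R) : continuous f -> continuous g ->
  decays f C1 -> decays g C2 -> lint (fun z => a * f z + b * g z) = a * lint f + b * lint g.
Proof.
move=> cf cg Hf Hg; have I1 := lint_Lint cf Hf; have I2 := lint_Lint cg Hg.
rewrite /lint -(intZ _ mH I1) -(intZ _ mH I2) -(intD mH (LintZ a mH I1) (LintZ b mH I2)).
by apply: int_eq => z _; ring.
Qed.

(** A derivative of a decaying function has integral 0. *)
Lemma lint_der (g g' : R -> R) (C C' : R) : (forall z, is_derive z (1 : R) g (g' z)) ->
  continuous g' -> decays g' C' -> decays g C -> lint g' = 0.
Proof.
move=> dg cg' Hg' Hg.
have D z : is_derive z (1 : R) (fun z => g z - g (- z)) (g' z + g' (- z)).
  have D0 := @is_deriveN _ _ _ _ z 1 _ (is_derive_id z (1 : R)).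
  have D1 := is_derive_comp1 D0 (dg (- z)).
  have := @is_deriveB _ _ _ _ _ z 1 _ _ (dg z) D1.
  by move/is_derive_to; apply; rewrite mulrN1 opprK.
have cF : continuous (fun z => g' z + g' (- z)).
  move=> z; apply: cvgD; first exact: cg'.
  by apply: (@continuous_comp _ _ _ (fun y => - y) g'); [exact: cvgN (cvg_id)|exact: cg'].
have C0 : 0 <= C by apply: le_trans (Hg 0); rewrite mulr_ge0// exprn_ge0// addr_ge0.
have L : (fun z => g z - g (- z)) z @[z --> +oo] --> (0 : R).
  apply: (@cvgy0_real R (fun z => g z - g (- z)) (fun z => (g z - g (- z))%:C)); last by move=> z; rewrite nc_real.
  move=> e e0; exists (2 * C / e) => z zA.
  have z0 : 0 <= z by apply: le_trans zA; rewrite divr_ge0 ?mulr_ge0// ltW.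
  rewrite nc_real; apply: le_trans (ler_normB _ _) _.
  have h1 := Hg z; have h2 := Hg (- z); rewrite normrN (ger0_norm z0) in h1 h2.
  have w1 : 1 + z <= (1 + z) ^+ 3 by rewrite ler_eXnr// lerDl.
  have k1 : (1 + z) * `|g z| <= C by apply: le_trans h1; exact: ler_wpM2r.
  have k2 : (1 + z) * `|g (- z)| <= C by apply: le_trans h2; exact: ler_wpM2r.
  move: zA; rewrite ler_pdivrMr// => zA.
  have p0 : 0 < 1 + z by rewrite ltr_wpDr.
  rewrite -(ler_pM2l p0) mulrDr; apply: le_trans (lerD k1 k2) _; nra.
rewrite /lint (FTC_halfline (fun z _ => D z) cF (lint_Lint cg' Hg') L).
by rewrite oppr0 subrr oppr0.
Qed.

Lemma mol_cont j : continuous (mol j : R -> R).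
Proof. by have [d _] := @mol_bandl R; exact: (derive_contT (d j)). Qed.

Definition conv F n j e x : R := lint (fun z => F n (x + e * z) * mol j z).

Lemma conv_cont F n j e x : dseq F -> continuous (fun z => F n (x + e * z) * mol j z).
Proof.
move=> dF z; apply: cvgM; last exact: mol_cont.
apply: (@continuous_comp _ _ _ (fun z => x + e * z) (F n)).
  exact: derive_cont (is_derive_affine x e z).
exact: (derive_contT (dF n)).
Qed.

Lemma conv_decay F n m : sch F -> exists C B : R, [/\ 0 <= C, 0 <= B & forall j e x, 0 < e <= 1 ->
  decays (fun z => (1 + `|x|) ^+ m * (F n (x + e * z) * mol j z)) (C * B ^+ j)].
Proof.
move=> sF; have [C [C0 HC]] := sch_shift_le m n sF.
have [_ HM] := @mol_bandl R; have [D [B [D0 B0 HD]]] := HM (m + 3)%N.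
exists (C * D), B; split; rewrite ?mulr_ge0// => j e x /andP[e0 e1] z.
have h1 := HC x (e * z); have h2 := HD j z.
have w0 : 0 <= (1 + `|x|) ^+ m by rewrite exprn_ge0// addr_ge0.
have ez : `|e * z| <= `|z| by rewrite normrM (ger0_norm (ltW e0)) ler_piMl.
have h3 : (1 + `|e * z|) ^+ m <= (1 + `|z|) ^+ m.
  by apply: lerXn2r; rewrite ?nnegrE ?addr_ge0// lerD2l.
have h4 : (1 + `|x|) ^+ m * `|F n (x + e * z)| <= C * (1 + `|z|) ^+ m.
  by apply: le_trans h1 _; exact: ler_wpM2l.
rewrite !normrM (ger0_norm w0); move: h2; rewrite exprD => h2.
have a0 : 0 <= (1 + `|z|) ^+ 3 by rewrite exprn_ge0// addr_ge0.
have k0 := normr_ge0 (mol j z).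
move: h4 h2 a0 k0 (normr_ge0 (F n (x + e * z))) {h1 h3}.
move: ((1 + `|z|) ^+ 3) ((1 + `|x|) ^+ m) ((1 + `|z|) ^+ m) (`|F n _|) (`|mol j z|) (B ^+ j) w0.
move=> a X w f k b w0 h4 h2 a0 k0 f0.
apply: le_trans (_ : (C * w) * (a * k) <= _).
  have -> : a * (X * (f * k)) = (X * f) * (a * k) by ring.
  by apply: ler_wpM2r => //; exact: mulr_ge0.
have -> : C * w * (a * k) = C * (w * a * k) by ring.
by rewrite -[leRHS]mulrA; exact: ler_wpM2l.
Qed.

(** A derivative may be moved from the test function to the mollifier. *)
Lemma conv_rec F n j e x : sch F -> 0 < e <= 1 ->
  e * conv F n.+1 j e x = - conv F n j.+1 e x.
Proof.
move=> sF he; have [dF _] := sF.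
have [C1 [B1 [_ _ H1]]] := conv_decay n.+1 0 sF; have [C2 [B2 [_ _ H2]]] := conv_decay n 0 sF.
have E n' j' : decays (fun z => (1 + `|x|) ^+ 0 * (F n' (x + e * z) * mol j' z)) =
  decays (fun z => F n' (x + e * z) * mol j' z).
  by congr decays; apply/funext => z; rewrite expr0 mul1r.
have {}H1 := H1 j e x he; have H3 := H2 j.+1 e x he; have {}H2 := H2 j e x he.
rewrite !E in H1 H2 H3.
have c1 := @conv_cont F n.+1 j e x dF; have c3 := @conv_cont F n j.+1 e x dF.
have D z : is_derive z (1 : R) (fun z => F n (x + e * z) * mol j z)
   (e * (F n.+1 (x + e * z) * mol j z) + 1 * (F n (x + e * z) * mol j.+1 z)).
  have D1 := is_derive_comp1 (is_derive_affine x e z) (dF n (x + e * z)).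
  have [dM _] := @mol_bandl R.
  have := @is_deriveM _ _ _ _ z 1 _ _ D1 (dM j z).
  by move/is_derive_to; apply; rewrite /GRing.scale/=; ring.
have c4 : continuous (fun z => e * (F n.+1 (x + e * z) * mol j z) + 1 * (F n (x + e * z) * mol j.+1 z)).
  move=> z; apply: cvgD; apply: cvgM; try exact: cvg_cst; [exact: c1|exact: c3].
have H4 : decays (fun z => e * (F n.+1 (x + e * z) * mol j z) + 1 * (F n (x + e * z) * mol j.+1 z))
   (C1 * B1 ^+ j + C2 * B2 ^+ j.+1).
  move=> z; have := H1 z; have := H3 z; case/andP: he => e0 e1.
  have w0 : 0 <= (1 + `|z|) ^+ 3 by rewrite exprn_ge0// addr_ge0.
  move=> h3 h1; rewrite mul1r.
  apply: le_trans (ler_wpM2l w0 (ler_normD _ _)) _; rewrite mulrDr; apply: lerD => //.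
  rewrite (normrM e) (ger0_norm (ltW e0)) mulrCA; apply: le_trans h1.
  by rewrite ler_piMl// mulr_ge0.
have := lint_der D c4 H4 H2; rewrite (lint_lin e 1 c1 c3 H1 H3) mul1r => /eqP.
by rewrite addr_eq0 => /eqP.
Qed.

(** All derivatives on the mollifier: the growth becomes geometric, whatever the
    test function. *)
Lemma conv_iter F n e x : sch F -> 0 < e <= 1 ->
  conv F n 0 e x = (- e^-1) ^+ n * conv F 0 n e x.
Proof.
move=> sF he; have e0 : e != 0 by case/andP: he => e0 _; rewrite gt_eqF.
suff : forall j, conv F n j e x = (- e^-1) ^+ n * conv F 0 (n + j) e x by move=> /(_ 0%N); rewrite addn0.
elim: n => [|n IH] j; first by rewrite expr0 mul1r.
have := conv_rec n j x sF he; rewrite IH => H.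
apply: (mulfI e0); rewrite H addSnnS exprS.
by move: (conv _ _ _ _ _) ((- e^-1) ^+ n) => a b; field.
Qed.

Definition mass : R := lint (fun z => mol 0 z).

Lemma mol_decay j m : exists C : R, decays (fun z => (1 + `|z|) ^+ m * mol j z) C.
Proof.
have [_ HM] := @mol_bandl R; have [D [B [D0 B0 HD]]] := HM (3 + m)%N.
exists (D * B ^+ j) => z; have := HD j z; rewrite exprD normrM ger0_norm ?mulrA//.
Qed.

Lemma mol_decay0 j : exists C : R, decays (mol j) C.
Proof.
have [C HC] := mol_decay j 0; exists C => z; have := HC z; by rewrite expr0 mul1r.
Qed.

Lemma mass_gt0 : 0 < mass.
Proof.
have [C HC] := mol_decay0 0; have c := @mol_cont 0.
have I := lint_Lint c HC.
apply: (@int_gt0 _ halfline _ 0 1 mH I) => //.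
- by move=> z _; rewrite addr_ge0 ?mol_ge0.
- by move=> z /andP[z0 _]; rewrite /= in_itv/= andbT.
- move=> z _; apply: cvgD; first exact: c.
  by apply: (@continuous_comp _ _ _ (fun y => - y) (mol 0)); [exact: cvgN (cvg_id)|exact: c].
by rewrite oppr0 addr_gt0 ?mol_gt0.
Qed.

(** The mollification of F at scale e, with its derivatives. *)
Definition molly F e n x : R := mass^-1 * conv F n 0 e x.

Lemma molly_der F e : sch F -> 0 < e <= 1 -> dseq (molly F e).
Proof.
move=> sF he n x; have [dF HF] := sF.
have [C HC] := HF 0%N n.+1; have [D HD] := mol_decay0 0.
have C0 : 0 <= C by apply: le_trans (HC 0); rewrite mulr_ge0// exprn_ge0// addr_ge0.
have {}HC y : `|F n.+1 y| <= C by have := HC y; rewrite expr0 mul1r.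
have [I1 I2] := decays_Lint (@mol_cont 0) HD.
suff D0 : is_derive x (1 : R) (conv F n 0 e) (conv F n.+1 0 e x).
  by have := @is_deriveZ _ _ _ _ (mass^-1) x 1 _ D0.
have [A [B [_ _ HA]]] := conv_decay n 0 sF.
apply: (@derive_int R halfline
  (fun x z => F n (x + e * z) * mol 0 z + F n (x + e * - z) * mol 0 (- z))
  (fun x z => F n.+1 (x + e * z) * mol 0 z + F n.+1 (x + e * - z) * mol 0 (- z))
  (x - 1) (x + 1) x (fun z => C * (mol 0 z + mol 0 (- z))) mH).
- by apply/andP; split; lra.
- move=> y _; apply: (@lint_Lint (fun z => F n (y + e * z) * mol 0 z) (A * B ^+ 0)).
    exact: conv_cont.
  by move=> z; have := HA 0%N e y he z; rewrite expr0 mul1r.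
- move=> y z _ _.
  have D1 w : is_derive y (1 : R) (fun y => F n (y + w)) (F n.+1 (y + w)).
    have D2 := @is_deriveD _ _ _ _ _ y 1 _ _ (is_derive_id y (1 : R)) (is_derive_cst w y 1).
    have := is_derive_comp1 D2 (dF n (y + w)).
    by move/is_derive_to; apply; rewrite addr0 mulr1.
  have D3 w c : is_derive y (1 : R) (fun y => F n (y + w) * c) (F n.+1 (y + w) * c).
    have := @is_deriveM _ _ _ _ y 1 _ _ (D1 w) (is_derive_cst c y 1).
    by move/is_derive_to; apply; rewrite /GRing.scale/= mulr0 add0r mulrC.
  exact: (@is_deriveD _ _ _ _ _ y 1 _ _ (D3 _ _) (D3 _ _)).
- by apply: LintZ => //; exact: LintD.
move=> y z _ _; have m1 := mol_ge0 z; have m2 := mol_ge0 (- z).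
move: (mol 0 z) (mol 0 (- z)) m1 m2 => a b m1 m2.
apply: le_trans (ler_normD _ _) _; rewrite !normrM mulrDr.
by rewrite (ger0_norm m1) (ger0_norm m2); apply: lerD; apply: ler_wpM2r.
Qed.

Lemma molly_bandl F e : sch F -> 0 < e <= 1 -> bandl (molly F e).
Proof.
move=> sF he; split; first exact: molly_der.
move=> m; have [C [B [C0 B0 HC]]] := conv_decay 0 m sF; have [dF _] := sF.
have e0 : 0 < e by case/andP: he.
have i0 : 0 <= inv3 :> R.
  apply: Rintegral_ge0 => y /halfline_ge0 y0.
  by rewrite invr_ge0 exprn_ge0// addr_ge0.
have Z0 : 0 <= mass^-1 by rewrite invr_ge0 ltW// mass_gt0.
exists (mass^-1 * (2 * C * inv3)), (e^-1 * B); split.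
- by rewrite mulr_ge0// mulr_ge0// mulr_ge0.
- by rewrite mulr_ge0// invr_ge0 ltW.
move=> n x; rewrite /molly (conv_iter n x sF he).
have w0 : 0 <= (1 + `|x|) ^+ m by rewrite exprn_ge0// addr_ge0.
have Hd := HC n e x he.
have cd : continuous (fun z => (1 + `|x|) ^+ m * (F 0%N (x + e * z) * mol n z)).
  by move=> z; apply: cvgM; [exact: cvg_cst|exact: conv_cont].
have := lint_le cd Hd.
have -> : lint (fun z => (1 + `|x|) ^+ m * (F 0%N (x + e * z) * mol n z)) = (1 + `|x|) ^+ m * conv F 0 n e x.
  have Hd0 := HC n e x he; have [C' [B' [_ _ H0]]] := conv_decay 0 0 sF.
  have {}H0 : decays (fun z => F 0%N (x + e * z) * mol n z) (C' * B' ^+ n).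
    by move=> z; have := H0 n e x he z; rewrite expr0 mul1r.
  have c0 := @conv_cont F 0 n e x dF.
  have := lint_lin ((1 + `|x|) ^+ m) 0 c0 c0 H0 H0; rewrite mul0r addr0 => L.
  transitivity ((1 + `|x|) ^+ m * lint (fun z => F 0%N (x + e * z) * mol n z)) => //.
  by rewrite -L; congr lint; apply/funext => z; rewrite mul0r addr0.
have ne : `|(- e^-1) ^+ n| = e^-1 ^+ n by rewrite normrX normrN normfV (ger0_norm (ltW e0)).
rewrite !normrM ne (ger0_norm w0) (ger0_norm Z0) => H.
rewrite exprMn.
move: H w0 Z0; move: ((1 + `|x|) ^+ m) (`|conv F 0 n e x|) (B ^+ n) (inv3) (mass^-1) => w c b i M H w0 Z0.
have p0 : 0 <= e^-1 ^+ n by rewrite exprn_ge0// invr_ge0 ltW.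
have -> : w * (M * (e^-1 ^+ n * c)) = M * e^-1 ^+ n * (w * c) by ring.
have -> : M * (2 * C * i) * (e^-1 ^+ n * b) = M * e^-1 ^+ n * (2 * (C * b) * i) by ring.
by apply: ler_wpM2l => //; exact: mulr_ge0.
Qed.

(** First order approximation in every seminorm. *)
Lemma molly_close F m n : sch F -> exists K : R, 0 <= K /\ forall e x, 0 < e <= 1 ->
  (1 + `|x|) ^+ m * `|molly F e n x - F n x| <= K * e.
Proof.
move=> sF; have [dF _] := sF; have [C [C0 HC]] := sch_diff_le m n sF.
have [D HD] := mol_decay 0 m.+1.
have Z0 : 0 <= mass^-1 by rewrite invr_ge0 ltW// mass_gt0.
have i0 : 0 <= inv3 :> R.
  by apply: Rintegral_ge0 => y /halfline_ge0 y0; rewrite invr_ge0 exprn_ge0// addr_ge0.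
have D0 : 0 <= D by apply: le_trans (HD 0); rewrite mulr_ge0// exprn_ge0// addr_ge0.
exists (mass^-1 * (2 * (C * D) * inv3)); split; first by rewrite !mulr_ge0.
move=> e x he; have e0 : 0 < e by case/andP: he.
have w0 : 0 <= (1 + `|x|) ^+ m by rewrite exprn_ge0// addr_ge0.
have [A [B [_ _ HA]]] := conv_decay n 0 sF.
have {}HA : decays (fun z => F n (x + e * z) * mol 0 z) (A * B ^+ 0).
  by move=> z; have := HA 0%N e x he z; rewrite expr0 mul1r.
have [M HM] := mol_decay0 0.
have cc := @conv_cont F n 0 e x dF; have cm := @mol_cont 0.
pose g z := (1 + `|x|) ^+ m * (F n (x + e * z) * mol 0 z) + (- ((1 + `|x|) ^+ m * F n x)) * mol 0 z.
have E : (1 + `|x|) ^+ m * (molly F e n x - F n x) = mass^-1 * lint g.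
  rewrite /g (lint_lin _ _ cc cm HA HM) -/(conv F n 0 e x) -/mass /molly.
  have Z1 : mass != 0 by rewrite gt_eqF// mass_gt0.
  by move: mass (conv _ _ _ _ _) (F n x) Z1 => Z c f Z1; field.
have cg : continuous g.
  move=> z; apply: cvgD; (apply: cvgM; first exact: cvg_cst); [exact: cc|exact: cm].
have dg : decays g (C * e * D).
  move=> z; have -> : g z = (1 + `|x|) ^+ m * (F n (x + e * z) - F n x) * mol 0 z by rewrite /g; ring.
  have h1 := HC x (e * z); have h2 := HD z.
  move: (mol 0 z) h2 => kk h2.
  have ez : `|e * z| = e * `|z| by rewrite normrM (ger0_norm (ltW e0)).
  have h3 : (1 + `|e * z|) ^+ m <= (1 + `|z|) ^+ m.
    apply: lerXn2r; rewrite ?nnegrE ?addr_ge0// lerD2l ez ler_piMl//.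
    by case/andP: he.
  rewrite !normrM (ger0_norm w0).
  move: h2; rewrite normrM ger0_norm ?exprn_ge0 ?addr_ge0// (exprS (1 + `|z|) m) => h2.
  have a0 : 0 <= (1 + `|z|) ^+ 3 by rewrite exprn_ge0// addr_ge0.
  have v0 : 0 <= (1 + `|z|) ^+ m by rewrite exprn_ge0// addr_ge0.
  rewrite ez in h1.
  have h4 : (1 + `|x|) ^+ m * `|F n (x + e * z) - F n x| <= C * e * ((1 + `|z|) * (1 + `|z|) ^+ m).
    apply: le_trans h1 _; rewrite -ez.
    apply: le_trans (_ : C * `|e * z| * (1 + `|z|) ^+ m <= _).
      by apply: ler_wpM2l => //; rewrite mulr_ge0.
    rewrite ez; move: ((1 + `|z|) ^+ m) v0 => v v0.
    have -> : C * (e * `|z|) * v = C * e * (`|z| * v) by ring.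
    apply: ler_wpM2l; first by rewrite mulr_ge0// ltW.
    by apply: ler_wpM2r => //; rewrite lerDr.
  move: h4 h2 a0 v0 (normr_ge0 kk) {h1 h3}.
  move: (1 + `|z|) ((1 + `|x|) ^+ m * `|_ - _|) ((1 + `|z|) ^+ m) ((1 + `|z|) ^+ 3) (`|kk|).
  move=> p f v a k h4 h2 a0 v0 k0.
  apply: le_trans (_ : C * e * (p * v) * (a * k) <= _).
    have -> : a * (f * k) = f * (a * k) by ring.
    by apply: ler_wpM2r => //; exact: mulr_ge0.
  have -> : C * e * (p * v) * (a * k) = C * e * (a * (p * v * k)) by ring.
  by apply: ler_wpM2l => //; rewrite mulr_ge0// ltW.
have := lint_le cg dg => H.
rewrite -[X in X * _ <= _](ger0_norm w0) -normrM E normrM (ger0_norm Z0).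
have -> : mass^-1 * (2 * (C * D) * inv3) * e = mass^-1 * (2 * (C * e * D) * inv3).
  by move: mass^-1 inv3 => a b; ring.
by apply: ler_wpM2l.
Qed.

End Mollification.

(** * The Caputo equation and the initial data *)

Section Existence.
Context {R : realType}.
Notation mu := (@lebesgue_measure R).
Implicit Types (x y s t r e : R) (F : nat -> R -> R).
Let mH := @measurable_halfline R.

Lemma le0_of_small (a K : R) : 0 <= K -> (forall e, 0 < e <= 1 -> a <= K * e) -> a <= 0.
Proof.
move=> K0 H; apply/ler_addgt0Pr => d d0; rewrite add0r.
have K1 : 0 < K + 1 by rewrite ltr_wpDl.
have e1 : 0 < Num.min 1 (d / (K + 1)) <= 1.
  by rewrite lt_min ltr01 divr_gt0//= ge_min lexx.
apply: le_trans (H _ e1) _.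
have h : Num.min 1 (d / (K + 1)) <= d / (K + 1) by rewrite ge_min lexx orbT.
apply: le_trans (ler_wpM2l K0 h) _.
rewrite mulrA ler_pdivrMr//; have := ltW d0; nra.
Qed.

(** Density of the functions of exponential type and continuity of the defect. *)
Lemma defect_sch t F : 0 < t -> sch F -> defect t (F 0%N) = 0.
Proof.
move=> t0 sF; have [dF _] := sF; have bF := sch_bseq sF.
have [K [K0 HK]] := molly_close 0 0 sF.
set A := 2 * (\int[mu]_(y in halfline) (`|kD y| * expR (0 * rt t * y)))
     * \int[mu]_(s in `]0, t[) wt t s +
    `|cbrt 3 * Em 1| * (2 * \int[mu]_(y in halfline) (`|kerA y| * expR (0 * rt t * y))).
have : `|defect t (F 0%N)| <= 0; last by rewrite normr_le0 => /eqP.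
apply: (@le0_of_small _ (K * `|A|)) => [|e he]; first by rewrite mulr_ge0.
have bl := molly_bandl sF he; have [dG _] := bl.
have bG := sch_bseq (bandl_sch bl).
have a0 := adm_seq 0 t0 dF bF; have a1 := adm_seq 0 t0 dG bG.
have E : defect t (F 0%N) = defect t (fun x => F 0%N x + (-1) * molly F e 0 x).
  by rewrite (defect_lin _ t0 a0 a1) (defect_exptype t0 dG (bandl_exptype bl)) mulr0 addr0.
have e0 : 0 <= e by case/andP: he => /ltW.
rewrite E; apply: le_trans (defect_le (C := K * e) (eta := 0) t0 (adm_lin (-1) a0 a1) _ _ _) _ => //.
- by rewrite mulr_ge0.
- move=> x; rewrite mul0r expR0 mulr1 mulN1r distrC.
  by have := HK e x he; rewrite expr0 mul1r.
rewrite -/A [leRHS]mulrAC; apply: ler_wpM2l; last exact: ler_norm.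
exact: mulr_ge0.
Qed.

Definition shiftn (j : nat) F : nat -> R -> R := fun n => F (n + j)%N.

(** The vanishing of the defect at the fourth derivative, rewritten. *)
Lemma sol_caputo t F : 0 < t -> sch F ->
  Lint `]0, t[ (fun s => sol2 F s * (cbrt (t - s))^-1) /\
  \int[mu]_(s in `]0, t[) (sol2 F s * (cbrt (t - s))^-1) =
  - (cbrt 3 * Em 1) / 4 * sol (shiftn 4 F) t.
Proof.
move=> t0 sF; have sF4 := sch_shift 4 sF; have mT := meas_tline t.
have [dF4 _] := sF4; have := defect_sch t0 sF4; rewrite /defect add0n => H.
have I := adm_Lint t0 (adm_seq 0 t0 dF4 (sch_bseq sF4)); rewrite add0n in I.
have K s : 3 / 8 * (wt t s * kpair kD (sym 1 (F 4%N)) (rt s)) = sol2 F s * (cbrt (t - s))^-1.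
  rewrite /sol2 /wt -/kD.
  move: (kpair _ _ _) ((rt s)^-1 ^+ 2) ((cbrt (t - s))^-1) => a b c; ring.
split; first by apply: Lint_eq (LintZ (3 / 8) mT I) => // s _.
rewrite -(int_eq (fun s _ => K s)) (intZ _ mT I) /sol /shiftn add0n.
move: H; move: (\int[mu]_(s in _) _) (kpair _ _ _) (cbrt 3 * Em 1) => a b c H; lra.
Qed.

Lemma rt_cvg0 : rt t @[t --> 0^'+] --> (0 : R).
Proof.
apply/cvgrPdist_le => e e0; near=> t.
have t0 : 0 < t by near: t; exact: nbhs_right_gt.
rewrite sub0r normrN (ger0_norm (ltW (rt_gt0 t0))).
have te : t <= e ^+ 3 / 3.
  by near: t; apply: nbhs_right_le; rewrite divr_gt0// exprn_gt0.
rewrite -(@cbrtK _ (e ^+ 3) e (exprn_ge0 _ (ltW e0)) (ltW e0) erefl).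
have t3 : 0 <= 3 * t by rewrite mulr_ge0// ltW.
have te3 : 3 * t <= e ^+ 3 by move: te; rewrite ler_pdivlMr// mulrC.
by apply: ge0_ler_powR; rewrite ?nnegrE ?invr_ge0//; apply: exprn_ge0; apply: ltW.
Unshelve. all: by end_near. Qed.

Lemma kpair_cvg0 k F n sg : superexp k -> dseq F -> bseq F -> `|sg| <= 1 ->
  kpair k (sym sg (F n)) (rt t) @[t --> 0^'+] --> kpair k (sym sg (F n)) 0.
Proof.
move=> sk dF bF s1; have c := derive_cont (kpair_der n 0 sk dF bF s1).
exact: (cvg_comp _ _ rt_cvg0 c).
Qed.

(** At scale 0 only the integral of the profile remains, and it equals 1/3. *)
Lemma sol_init F : sch F -> sol F t @[t --> 0^'+] --> F 0%N 0.
Proof.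
move=> sF; have [dF _] := sF; have bF := sch_bseq sF.
have s2 : `|1 : R| <= 1 by rewrite normr1.
have c := @kpair_cvg0 _ F 0%N 1 superexp_A dF bF s2.
have -> : F 0%N 0 = 3 / 2 * kpair kerA (sym 1 (F 0%N)) 0.
  have K y : kerA y * sym 1 (F 0%N) 0 y = (2 * F 0%N 0) * (y ^+ 0 * kerA y).
    by rewrite /sym mul0r oppr0 expr0; ring.
  rewrite /kpair (int_eq (fun y _ => K y)) (intZ _ mH); last first.
    have := kpair_Lint 0 0 superexp_A dF bF s2.
    have I0 := superexp_int 0 (superexp_X 0 (@superexp_A R)).
    move=> _; apply: (Lint_le mH _ I0).
      by apply: cont_meas => //; have [] := superexp_X 0 (@superexp_A R).
    by move=> y _; rewrite mul0r expR0 mulr1.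
  by rewrite moment_A mom0_value [cRe _]/=; field.
by apply: cvgM => //; exact: cvg_cst.
Qed.

(** At scale 0 the odd part of a function vanishes. *)
Lemma sol1_init F : sch F -> sol1 F t @[t --> 0^'+] --> (0 : R).
Proof.
move=> sF; have [dF _] := sF; have bF := sch_bseq sF.
have s1 : `|-1 : R| <= 1 by rewrite normrN normr1.
have c := @kpair_cvg0 _ F 3%N (-1) (superexp_D 0) dF bF s1.
have E : 3 / 8 * kpair (kerD 0) (sym (-1) (F 3%N)) 0 = 0 :> R.
  have K y : kerD 0 y * sym (-1) (F 3%N) 0 y = 0.
    by rewrite /sym mul0r oppr0 mulN1r subrr mulr0.
  by rewrite /kpair (int_eq (fun y _ => K y)) (Rintegral_cst _ mH) mul0r mulr0.
have : sol1 F t @[t --> 0^'+] --> 3 / 8 * kpair (kerD 0) (sym (-1) (F 3%N)) 0.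
  by apply: cvgM => //; exact: cvg_cst.
by rewrite E.
Qed.

Lemma sol_le t F (C : R) : 0 < t -> dseq F -> bseq F -> 0 <= C -> (forall x, `|F 0%N x| <= C) ->
  `|sol F t| <= 3 / 2 * (2 * \int[mu]_(y in halfline) (`|kerA y| * expR (0 * rt t * y))) * C.
Proof.
move=> t0 dF bF C0 H; rewrite /sol normrM ger0_norm//.
rewrite -mulrA; apply: ler_wpM2l => //; rewrite mulrAC.
apply: (kpair_le superexp_A (derive_contT (dF 0%N)) C0 (lexx _)) => [x|].
  by rewrite mul0r expR0 mulr1.
by rewrite cbrt_ge0 lexx.
Qed.

End Existence.

(** * Inversion of the Abel integral *)

Section AbelInversion.
Context {R : realType}.
Notation mu := (@lebesgue_measure R).
Notation T2 := (measurableTypeR R).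
Implicit Types (x y s t tau : R).

Lemma Lint_ind D (h : R -> R) (A : set R) : Lmeas D -> Lmeas A ->
  Lint (D `&` A) h -> Lint D (fun x => h x * \1_A x) /\
  \int[mu]_(x in D) (h x * \1_A x) = \int[mu]_(x in D `&` A) h x.
Proof.
move=> mD mA I.
have E : (fun x => h x * \1_A x) = h \_ A.
  by apply/funext => x; rewrite patchE indicE; case: ifP => _; rewrite ?mulr1 ?mulr0.
rewrite E; split; last by rewrite Rintegral_mkcondr.
apply/(integrable_mkcond _ mD).
have mI : Lmeas (D `&` A) by exact: measurableI.
move/(integrable_mkcond _ mI) : I; congr (_.-integrable _ _).
apply/funext => x; rewrite !patchE in_setI /=.
by rewrite patchE; case: (x \in D); case: (x \in A).
Qed.

(** A function w with integrable Abel integrals is recovered by a second Abel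
    integration: the two kernels compose to a constant *)
Lemma abel_inversion (w g : R -> R) t : 0 < t -> (forall s, 0 < s -> {for s, continuous w}) ->
  (forall s, 0 < s <= t -> Lint `]0, s[ (fun tau => w tau * (cbrt (s - tau))^-1) /\
     \int[mu]_(tau in `]0, s[) (w tau * (cbrt (s - tau))^-1) = g s) ->
  Lint `]0, t[ w /\
  Lint `]0, t[ (fun s => (cbrt (t - s))^-1 ^+ 2 * g s) /\
  \int[mu]_(s in `]0, t[) ((cbrt (t - s))^-1 ^+ 2 * g s) =
  3 * (Em 0 * Em 1) * \int[mu]_(s in `]0, t[) w s.
Proof.
move=> t0 cw Hg; have mT := meas_tline t.
have mO := @measurable_oline R.
have mw : Lmfun (`]0, +oo[%classic : set R) w.
  apply: open_continuous_measurable_fun; first exact: interval_open.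
  by move=> y; rewrite inE/= in_itv/= andbT; exact: cw.
have sT : `]0, t[%classic `<=` (`]0, +oo[%classic : set R).
  by move=> x /=; rewrite !in_itv/= andbT => /andP[].
have mwt : Lmfun (`]0, t[%classic : set R) w by apply: measurable_funS mw.
have tl : 0 < t <= t by rewrite t0 lexx.
have [It _] := Hg t tl.
have Iw : Lint `]0, t[ w.
  apply: (Lint_le mT mwt (LintZ (cbrt t) mT (Lint_norm mT It))) => s.
  rewrite /= in_itv/= => /andP[s0 st].
  have ts : 0 < t - s by rewrite subr_gt0.
  have c0 := cbrt_gt0 ts; have c1 := cbrt_gt0 t0.
  have ct : cbrt (t - s) <= cbrt t.
    have tsl : t - s <= t by lra.
    by apply: ge0_ler_powR; rewrite ?nnegrE ?invr_ge0// ltW.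
  rewrite normrM normfV (ger0_norm (ltW c0)) mulrCA ler_peMr//.
  by rewrite ler_pdivlMr// mul1r.
split => //.
pose w0 x : R := (w \_ (`]0, +oo[%classic : set R)) x.
have w0E x : 0 < x -> w0 x = w x.
  by move=> x0; rewrite /w0 patchE mem_set//= in_itv/= x0.
have mw0 : Lmfun setT w0.
  by apply/(measurable_restrictT _ mO).
have mc : Lmfun setT (fun x : R => (cbrt x)^-1).
  rewrite (_ : (fun x => (cbrt x)^-1) = (fun x => x `^ (- 3^-1))).
    exact: measurable_powR.
  by apply/funext => x; rewrite powRN.
pose f tau s := w0 tau * ((cbrt (t - s))^-1 ^+ 2 * (cbrt (s - tau))^-1) * \1_(`]0, +oo[%classic : set R) (s - tau).
have msub : measurable_fun [set: T2 * T2] (fun z => z.2 - z.1).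
  apply: measurable_funB; [exact: measurable_snd|exact: measurable_fst].
have mf : measurable_fun [set: T2 * T2] (fun z => f z.1 z.2).
  have mi : measurable_fun [set: T2] (\1_(`]0, +oo[%classic : set T2) : T2 -> R) by exact: measurable_indic.
  rewrite /f; apply: measurable_funM; last exact: (measurableT_comp mi msub).
  apply: measurable_funM; first exact: (@meas_fst _ w0).
  apply: measurable_funM; last exact: (measurableT_comp mc msub).
  apply: (@meas_snd _ (fun s => (cbrt (t - s))^-1 ^+ 2)).
  apply: (measurableT_comp (exprn_measurable 2)).
  apply: (measurableT_comp mc); apply: measurable_funB => //.
pose B : R := 3 * (Em 0 * Em 1).
have B0 : 0 <= B.
  by rewrite /B Em01 mulr_ge0// divr_ge0// ?mulr_ge0 ?sqrtr_ge0// ltW// pi_gt0.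
have indE tau s : \1_(`]0, +oo[%classic : set R) (s - tau) = \1_(`]tau, +oo[%classic : set R) s :> R.
  by rewrite !indicE; congr (_%:R); congr nat_of_bool; apply/idP/idP;
     rewrite !inE/= !in_itv/= !andbT subr_gt0.
have indE2 tau s : \1_(`]0, +oo[%classic : set R) (s - tau) = \1_(`]-oo, s[%classic : set R) tau :> R.
  by rewrite !indicE; congr (_%:R); congr nat_of_bool; apply/idP/idP;
     rewrite !inE/= !in_itv/= ?andbT subr_gt0.
have row tau : 0 < tau < t -> Lint `]0, t[ (f tau) /\ \int[mu]_(s in `]0, t[) f tau s = w tau * B.
  move=> /andP[ta0 tat]; have [I E] := abel_const tat.
  have sI : `]0, t[%classic `&` `]tau, +oo[%classic = (`]tau, t[%classic : set R).
    apply/seteqP; split => x /=; rewrite !in_itv/= ?andbT; first by move=> [/andP[_ ->] ->].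
    by move=> /andP[h ->]; rewrite h (lt_trans ta0 h).
  have mA : Lmeas (`]tau, +oo[%classic : set R) by exact: measurable_itv.
  have I' := LintZ (w tau) (measurable_itv _) I.
  have := @Lint_ind `]0, t[%classic (fun s => w tau * ((cbrt (t - s))^-1 ^+ 2 * (cbrt (s - tau))^-1)) _ mT mA.
  rewrite sI => /(_ I') [J F].
  have K s : f tau s = w tau * ((cbrt (t - s))^-1 ^+ 2 * (cbrt (s - tau))^-1) * \1_(`]tau, +oo[%classic : set R) s.
    by rewrite /f w0E// indE.
  split; first by apply: Lint_eq J => // s _; rewrite K.
  by rewrite (int_eq (fun s _ => K s)) F (intZ _ (measurable_itv _) I) E.
have [|||] := @fubini_real R `]0, t[%classic `]0, t[%classic f (fun tau => w tau * B)
  (fun s => (cbrt (t - s))^-1 ^+ 2 * g s) (fun tau => `|w tau| * B) mT mT mf.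
- move=> tau; rewrite /= in_itv/= => h; have [I E] := row tau h; split => //.
  have ta0 : 0 < tau by case/andP: h.
  have [J E'] := row tau h.
  have : \int[mu]_(s in `]0, t[) `|f tau s| = \int[mu]_(s in `]0, t[) (Num.sg (w tau) * f tau s).
    apply: int_eq => s _; rewrite /f w0E// -mulrA.
    have nn : 0 <= (cbrt (t - s))^-1 ^+ 2 * (cbrt (s - tau))^-1 * \1_(`]0, +oo[%classic : set R) (s - tau) :> R.
      by rewrite mulr_ge0 ?indicE ?ler0n// mulr_ge0 ?exprn_ge0 ?invr_ge0 ?cbrt_ge0.
    move: nn; move: (_ * \1_(_) _) => X nn.
    by rewrite normrM (ger0_norm nn) mulrA -normrEsg.
  by move=> ->; rewrite (intZ _ mT J) E' mulrA -normrEsg.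
- apply: Lint_eq (LintZ B mT (Lint_norm mT Iw)) => // s _; exact: mulrC.
- move=> s; rewrite /= in_itv/= => /andP[s0 st].
  have sl : 0 < s <= t by rewrite s0 ltW.
  have [I E] := Hg s sl.
  have sI : `]0, t[%classic `&` `]-oo, s[%classic = (`]0, s[%classic : set R).
    apply/seteqP; split => x /=; rewrite !in_itv/=; first by move=> [/andP[-> _] ->].
    by move=> /andP[-> h]; rewrite h (lt_trans h st).
  have mA : Lmeas (`]-oo, s[%classic : set R) by exact: measurable_itv.
  have I' := LintZ ((cbrt (t - s))^-1 ^+ 2) (measurable_itv _) I.
  have := @Lint_ind `]0, t[%classic (fun tau => (cbrt (t - s))^-1 ^+ 2 * (w tau * (cbrt (s - tau))^-1)) _ mT mA.
  rewrite sI => /(_ I') [J F].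
  have K tau : `]0, t[%classic tau -> f tau s = (cbrt (t - s))^-1 ^+ 2 * (w tau * (cbrt (s - tau))^-1) * \1_(`]-oo, s[%classic : set R) tau.
    rewrite /= in_itv/= => /andP[ta0 _]; rewrite /f w0E// indE2; congr (_ * _); ring.
  split; first by apply: Lint_eq J => // tau /K ->.
  by rewrite (int_eq K) F (intZ _ (measurable_itv _) I) E.
move=> J E; split => //; rewrite E -/B -(intZ _ mT Iw); apply: int_eq => s _; exact: mulrC.
Qed.

End AbelInversion.

(** * Fundamental theorem of calculus up to a singular endpoint *)

Section FTCOpen.
Context {R : realType}.
Notation mu := (@lebesgue_measure R).
Implicit Types (s t e : R).

(** The derivative is only integrable near 0; both sides have the same derivative
    and the same limit at 0. *)
Lemma FTC_open (f f' : R -> R) t (T : R) : 0 < t < T ->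
  (forall s, 0 < s -> is_derive s (1 : R) f (f' s)) ->
  (forall s, 0 < s -> {for s, continuous f'}) ->
  Lint `]0, T[ f' -> f s @[s --> 0^'+] --> (0 : R) ->
  \int[mu]_(s in `]0, t[) f' s = f t.
Proof.
move=> /andP[t0 tT] df cf I f0; have mT := meas_tline T.
pose g := f' \_ (`]0, T[%classic : set R).
have gE s : 0 < s < T -> g s = f' s.
  by move=> h; rewrite /g patchE mem_set//= in_itv.
have Ig : Lint setT g.
  move/(integrable_mkcond _ mT) : I; congr (_.-integrable _ _).
  by apply/funext => x; rewrite /g /= !patchE; case: ifP.
have IgD (D : set R) : Lmeas D -> Lint D g.
  by move=> mD; exact: (integrableS measurableT mD (@subsetT _ D) Ig).
pose F y := \int[mu]_(s in `[0, y]) g s.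
have dF s : 0 < s < T -> is_derive s (1 : R) F (g s).
  move=> sT; have /andP[s0 sT1] := sT.
  have N : \forall y \near s, 0 < y < T.
    have := @near_in_itvoo _ 0 T s; rewrite in_itv/= => /(_ sT).
    by apply: filterS => y; rewrite in_itv.
  have cg : {for s, continuous g}.
    have E : g s = f' s := gE s sT.
    rewrite /prop_for /continuous_at E; apply: cvg_trans (cf s s0).
    by apply: near_eq_cvg; apply: filterS N => y hy; rewrite gE.
  have [d e] := @continuous_FTC1_closed R g 0 s T sT1 (IgD _ (measurable_itv _)) s0 cg.
  have e' : 'D_1 F s = g s by rewrite -derive1E; exact: e.
  exact: (DeriveDef d e').
have D0 e : 0 < e <= t -> F t - f t = F e - f e.
  move=> /andP[e0 et]; apply/eqP; rewrite -subr_eq0 -normr_le0.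
  have := @lipschitz_le R (fun s => F s - f s) (fun=> 0) e t 0.
  rewrite mul0r; apply => [x|x _]; last by rewrite normr0.
  rewrite min_l// max_r// => /andP[ex xt].
  have x0 : 0 < x := lt_le_trans e0 ex.
  have h : 0 < x < T by rewrite x0 (le_lt_trans xt tT).
  by have := is_deriveB (dF x h) (df x x0); move/is_derive_to; apply; rewrite gE// subrr.
have Z : `|F t - f t| <= 0.
  apply/ler_addgt0Pr => e e0; rewrite add0r.
  have e2 : 0 < e / 2 by rewrite divr_gt0.
  have n1 : \forall c \near 0^'+, 0 <= c -> `|F c| < e / 2.
    apply: cvg_within.
    exact: (@parameterized_integral_near_left R 0 T (e / 2) g (lt_trans t0 tT) e2 (IgD _ (measurable_itv _))).
  have n2 : \forall s \near 0^'+, `|f s| < e / 2.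
    by move/cvgrPdist_lt : f0 => /(_ _ e2); apply: filterS => s; rewrite sub0r normrN.
  near (0 : R)^'+ => s.
  have s0 : 0 < s by near: s; exact: nbhs_right_gt.
  have st : s <= t by near: s; exact: nbhs_right_le.
  have a : `|F s| < e / 2.
    have a' : 0 <= s -> `|F s| < e / 2 by near: s; exact: n1.
    by apply: a'; apply: ltW.
  have b : `|f s| < e / 2 by near: s; exact: n2.
  by rewrite (D0 s) ?s0//; have := ler_normB (F s) (f s); lra.
have E : F t = f t by apply/eqP; rewrite -subr_eq0 -normr_le0.
rewrite -E /F -(Rintegral_itv_obnd_cbnd (IgD _ (measurable_itv _))).
rewrite -(Rintegral_itv_bndo_bndc (IgD _ (measurable_itv _))).
by apply: int_eq => s /=; rewrite in_itv/= => /andP[s0 st]; rewrite gE// s0 (lt_trans st tT).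
Unshelve. all: by end_near. Qed.

End FTCOpen.

(** * Sequences with geometric increments *)

Section Geometric.
Context {R : realType}.
Implicit Types (a : nat -> R) (l C K x : R).
Local Notation q k := ((3^-1 : R) ^+ k).

Lemma pow3V_gt0 k : 0 < q k. Proof. by rewrite exprn_gt0// invr_gt0. Qed.

Lemma pow3VS k : q k.+1 = q k / 3. Proof. by rewrite exprSr. Qed.

Lemma pow3V_le1 k : q k <= 1.
Proof. by apply: exprn_ile1; rewrite ?invr_ge0// invf_le1//; lra. Qed.

(** The geometric form of an arbitrarily small bound. *)
Lemma pow3_small (b K : R) : (forall i, b <= K * q i) -> b <= 0.
Proof.
move=> H; have K0 := le_trans (H 0%N) (ler_wpM2r (ltW (pow3V_gt0 0)) (ler_norm K)).
apply: (@le0_of_small _ _ `|K|) => // e /andP[e0 e1].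
pose i := (Num.truncn e^-1).+1.
have hi : e^-1 <= 3 ^+ i.
  have h1 : e^-1 < i%:R by apply: truncnS_gt.
  apply: (le_trans (ltW h1)); rewrite -natrX ler_nat; apply: ltnW; exact: ltn_expl.
apply: le_trans (H i) _; apply: le_trans (ler_wpM2r (ltW (pow3V_gt0 i)) (ler_norm K)) _.
apply: ler_wpM2l => //; rewrite exprVn -[leRHS]invrK lef_pV2// posrE ?exprn_gt0// invr_gt0//.
Qed.

Lemma geom_diff a C : (forall k, `|a k.+1 - a k| <= C * q k) ->
  forall k i, `|a (k + i)%N - a k| <= 3 / 2 * C * (q k - q (k + i)).
Proof.
move=> H k; elim => [|i IH]; first by rewrite addn0 !subrr normr0 mulr0.
rewrite addnS pow3VS; have := H (k + i)%N; have := ler_normD (a (k + i).+1 - a (k + i)%N) (a (k + i)%N - a k).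
rewrite [X in `|X| <= _ -> _](_ : _ = a (k + i).+1 - a k); last by ring.
by move: IH; move: (q k) (q (k + i)%N) => u v; lra.
Qed.

(** The rough bound K only serves to identify l as the limit; the increments then
    give the sharp one. *)
Lemma geom_close a l C K : (forall k, `|a k.+1 - a k| <= C * q k) ->
  (forall k, `|l - a k| <= K * q k) -> forall k, `|l - a k| <= 3 / 2 * C * q k.
Proof.
move=> H HK k; rewrite -subr_le0; apply: (@pow3_small _ K) => i.
have C0 : 0 <= C by have := le_trans (normr_ge0 _) (H 0%N); rewrite expr0 mulr1.
have K0 : 0 <= K by have := le_trans (normr_ge0 _) (HK 0%N); rewrite expr0 mulr1.
have := geom_diff H k i; have := HK (k + i)%N.
have := ler_normD (l - a (k + i)%N) (a (k + i)%N - a k).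
rewrite [X in `|X| <= _ -> _](_ : _ = l - a k); last by ring.
have h1 : q (k + i) <= q i by rewrite exprD ler_piMl ?pow3V_le1// ltW// pow3V_gt0.
have h2 : K * q (k + i) <= K * q i by exact: ler_wpM2l.
have h3 : 0 <= C * q (k + i) by rewrite mulr_ge0// ltW// pow3V_gt0.
by move: h2 h3; move: (q k) (q (k + i)%N) (q i) => u v w; lra.
Qed.

Lemma geom_lim a C : (forall k, `|a k.+1 - a k| <= C * q k) ->
  exists l, forall k, `|l - a k| <= 3 / 2 * C * q k.
Proof.
move=> H; have C0 : 0 <= C by have := le_trans (normr_ge0 _) (H 0%N); rewrite expr0 mulr1.
pose S : set R := range (fun k => a k - 3 / 2 * C * q k).
have lu i k : a i - 3 / 2 * C * q i <= a k + 3 / 2 * C * q k.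
  have cq j : 0 <= C * q j by rewrite mulr_ge0// ltW// pow3V_gt0.
  have := cq i; have := cq k; case: (leqP i k) => ik.
    have := geom_diff H i (k - i); rewrite subnKC// ler_norml.
    by move=> /andP[]; move: (q i) (q k) => u v; lra.
  have := geom_diff H k (i - k); rewrite subnKC; last exact: ltnW.
  by rewrite ler_norml => /andP[]; move: (q i) (q k) => u v; lra.
have ub : has_ubound S by exists (a 0%N + 3 / 2 * C * q 0) => _ [i _ <-]; exact: lu.
exists (sup S) => k; rewrite ler_norml; apply/andP; split.
  have : a k - 3 / 2 * C * q k <= sup S by apply: ub_le_sup => //; exists k.
  lra.
have : sup S <= a k + 3 / 2 * C * q k.
  by apply: ge_sup; [exists (a 0%N - 3 / 2 * C * q 0), 0%N|move=> _ [i _ <-]; exact: lu].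
lra.
Qed.

(** An almost maximal term which is moreover larger than a given bound. *)
Lemma near_max (v : nat -> R) (M B : R) : 0 <= M -> (exists j, M < v j) -> (forall j, v j <= B) ->
  exists j, M < v j /\ forall i, v i <= 3 / 2 * v j.
Proof.
move=> M0 [j0 Mj] vB; pose S : set R := range v.
have hs : has_sup S by split; [exists (v j0), j0|exists B => _ [i _ <-]].
have sM : M < sup S by apply: (lt_le_trans Mj); apply: ub_le_sup; [case: hs|exists j0].
have e0 : 0 < Num.min (sup S - M) (sup S / 3).
  by rewrite lt_min subr_gt0 sM/= divr_gt0// (le_lt_trans M0 sM).
have [_ [j _ <-] hj] := sup_adherent e0 hs.
have h1 : Num.min (sup S - M) (sup S / 3) <= sup S - M by rewrite ge_min lexx.
have h2 : Num.min (sup S - M) (sup S / 3) <= sup S / 3 by rewrite ge_min lexx orbT.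
exists j; split; first by lra.
move=> i; have : v i <= sup S by apply: ub_le_sup; [case: hs|exists i].
lra.
Qed.

(** Finitely many seminorms can be bounded by one constant. *)
Lemma box_bound (Q : nat -> nat -> R -> Prop) N :
  (forall m n C C', C <= C' -> Q m n C -> Q m n C') -> (forall m n, exists C, Q m n C) ->
  exists C, 0 <= C /\ forall m n, (m <= N)%N -> (n <= N)%N -> Q m n C.
Proof.
move=> mono H.
have [f Hf] := @choice _ _ (fun (p : nat * nat) C => Q p.1 p.2 C) (fun p => H p.1 p.2).
pose G (p : 'I_N.+1 * 'I_N.+1) := f (p.1 : nat, p.2 : nat).
exists (\big[Order.max/0]_p G p); split; first exact: bigmax_ge_id.
move=> m n mN nN; apply: mono (Hf (m, n)).
have mN' : (m < N.+1)%N by [].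
have nN' : (n < N.+1)%N by [].
exact: (le_bigmax 0 G (Ordinal mN', Ordinal nN')).
Qed.

End Geometric.

(** * Solutions with zero initial data vanish *)

Section Uniqueness.
Context {R : realType}.
Notation mu := (@lebesgue_measure R).
Implicit Types (F G : nat -> R -> R) (s t x C M T : R).
Local Notation q k := ((3^-1 : R) ^+ k).

(** What is used of the difference of two solutions, tested against real
    functions: W is the pairing, W1 and W2 its time derivatives. Only the fourth
    derivative of the test function enters the equation. *)
Record null_solution (W W1 W2 : (nat -> R -> R) -> R -> R) : Prop := NullSolution {
  ns_lin : forall c F G t, 0 < t -> sch F -> sch G ->
    W (fun n x => F n x + c * G n x) t = W F t + c * W G t;
  ns_temp : forall t, 0 < t -> exists (K : R) (N : nat), forall F C, sch F -> 0 <= C ->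
    (forall m n x, (m <= N)%N -> (n <= N)%N -> (1 + `|x|) ^+ m * `|F n x| <= C) ->
    `|W F t| <= K * C;
  ns_der1 : forall F t, sch F -> 0 < t -> is_derive t (1 : R) (W F) (W1 F t);
  ns_der2 : forall F t, sch F -> 0 < t -> is_derive t (1 : R) (W1 F) (W2 F t);
  ns_cont : forall F t, sch F -> 0 < t -> {for t, continuous (W2 F)};
  ns_int : forall F t, sch F -> 0 < t -> Lint `]0, t[ (fun s => W2 F s * (cbrt (t - s))^-1);
  ns_eq : forall F t, sch F -> 0 < t -> \int[mu]_(s in `]0, t[) (W2 F s * (cbrt (t - s))^-1) =
    - (cbrt 3 * Em 1) / 4 * W (shiftn 4 F) t;
  ns_init : forall F, sch F -> W F t @[t --> 0^'+] --> (0 : R);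
  ns_init1 : forall F, sch F -> W1 F t @[t --> 0^'+] --> (0 : R) }.

Context {W W1 W2 : (nat -> R -> R) -> R -> R} (ns : null_solution W W1 W2).

Let B : R := 3 * (Em 0 * Em 1).
Let ga : R := cbrt 3 * Em 1 / 4.

Let B0 : 0 < B.
Proof. by rewrite /B Em01 mulr_gt0// divr_gt0// mulr_gt0// ?pi_gt0// sqrtr_gt0. Qed.

Let ga0 : 0 <= ga.
Proof.
rewrite /ga divr_ge0// mulr_ge0 ?cbrt_ge0// /Em; apply: Rintegral_ge0 => x /halfline_ge0 x0.
by rewrite mulr_ge0 ?exprn_ge0// ltW// expR_gt0.
Qed.

(** The Abel integral of the acceleration is known, so a second Abel integral
    gives the velocity. *)
Lemma velocity_volterra F t : sch F -> 0 < t ->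
  Lint `]0, t[ (fun s => (cbrt (t - s))^-1 ^+ 2 * (- ga * W (shiftn 4 F) s)) /\
  \int[mu]_(s in `]0, t[) ((cbrt (t - s))^-1 ^+ 2 * (- ga * W (shiftn 4 F) s)) = B * W1 F t.
Proof.
move=> sF t0.
have H s : 0 < s -> Lint `]0, s[ (fun tau => W2 F tau * (cbrt (s - tau))^-1) /\
    \int[mu]_(tau in `]0, s[) (W2 F tau * (cbrt (s - tau))^-1) = - ga * W (shiftn 4 F) s.
  move=> s0; split; first exact: (ns_int ns).
  by rewrite (ns_eq ns)// /ga mulNr.
have c2 s (s0 : 0 < s) := ns_cont ns sF s0.
have [I [J E]] := abel_inversion t0 c2 (fun s h => H s (proj1 (andP h))).
split => //; rewrite E; congr (_ * _).
have t2 : 0 < 2 * t by rewrite mulr_gt0.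
have [I2 _] := abel_inversion t2 c2 (fun s h => H s (proj1 (andP h))).
have tt : 0 < t < 2 * t by rewrite t0/=; lra.
by apply: (@FTC_open R (W1 F) (W2 F) t (2 * t)) => // [s|];
  [exact: (ns_der2 ns sF)|exact: (ns_init1 ns sF)].
Qed.

(** On (0, t) the kernel [(t - s)^(-2/3)] is at most [t^(1/3)] times the Beta kernel
    of the Abel inversion, whose integral is known. *)
Lemma velocity_le F T M j : sch F -> 0 <= M ->
  (forall s, 0 < s <= T -> `|W (shiftn 4 F) s| <= M * s ^+ j) ->
  forall t, 0 < t <= T -> `|W1 F t| <= ga * cbrt T * M * t ^+ j.
Proof.
move=> sF M0 H t /andP[t0 tT]; have [J E] := velocity_volterra sF t0.
have mT := meas_tline t; have [I1 E1] := abel_const t0.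
have ct0 := cbrt_gt0 t0.
have ctT : cbrt t <= cbrt T.
  by apply: ge0_ler_powR; rewrite ?nnegrE ?invr_ge0//; [apply: ltW|apply: le_trans tT; apply: ltW].
have tj : 0 <= t ^+ j by rewrite exprn_ge0// ltW.
have : `|B * W1 F t| <= B * (ga * cbrt t * M * t ^+ j).
  have -> : B * (ga * cbrt t * M * t ^+ j) = \int[mu]_(s in `]0, t[)
     ((ga * cbrt t * M * t ^+ j) * ((cbrt (t - s))^-1 ^+ 2 * (cbrt (s - 0))^-1)).
    by rewrite (intZ _ mT I1) E1 mulrC.
  rewrite -E; apply: (norm_int_le mT J (LintZ _ mT I1)) => s.
  rewrite /= in_itv/= => /andP[s0 st]; rewrite subr0.
  have hs : 0 < s <= T by rewrite s0 (le_trans (ltW st) tT).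
  have h1 := H s hs.
  have h2 : M * s ^+ j <= M * t ^+ j.
    by apply: ler_wpM2l => //; apply: lerXn2r; rewrite ?nnegrE; apply: ltW.
  have h3 : 1 <= cbrt t * (cbrt s)^-1.
    rewrite ler_pdivlMr ?cbrt_gt0// mul1r.
    by apply: ge0_ler_powR; rewrite ?nnegrE ?invr_ge0//; apply: ltW.
  have h4 : 0 <= (cbrt (t - s))^-1 ^+ 2 by rewrite exprn_ge0// invr_ge0 cbrt_ge0.
  rewrite normrM (ger0_norm h4) normrM normrN (ger0_norm ga0).
  have h5 : ga * `|W (shiftn 4 F) s| <= ga * (M * t ^+ j) by apply: ler_wpM2l => //; apply: le_trans h2.
  have h6 : 0 <= ga * (M * t ^+ j) by apply: mulr_ge0; [exact: ga0|exact: mulr_ge0].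
  have h7 : ga * (M * t ^+ j) <= ga * (M * t ^+ j) * (cbrt t * (cbrt s)^-1) by rewrite ler_peMr.
  have h8 := le_trans h5 h7.
  rewrite [leRHS](_ : _ = (cbrt (t - s))^-1 ^+ 2 * (ga * (M * t ^+ j) * (cbrt t * (cbrt s)^-1))); last by ring.
  exact: ler_wpM2l.
rewrite normrM (gtr0_norm B0) ler_pM2l// => h; apply: le_trans h _.
by apply: ler_wpM2r => //; apply: ler_wpM2r => //; apply: ler_wpM2l.
Qed.

Lemma pairing_le F T M j : sch F -> 0 <= M ->
  (forall s, 0 < s <= T -> `|W (shiftn 4 F) s| <= M * s ^+ j) ->
  forall t, 0 < t <= T -> `|W F t| <= ga * cbrt T * M / j.+1%:R * t ^+ j.+1.
Proof.
move=> sF M0 H t /andP[t0 tT]; have HV := velocity_le sF M0 H.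
set L := ga * cbrt T * M in HV *.
have L0 : 0 <= L.
  by rewrite /L; apply: mulr_ge0 => //; apply: mulr_ge0; [exact: ga0|exact: cbrt_ge0].
apply/ler_addgt0Pr => e e0.
have n2 : \forall s \near 0^'+, `|W F s| < e.
  by move/cvgrPdist_lt : (ns_init ns sF) => /(_ _ e0); apply: filterS => s; rewrite sub0r normrN.
near (0 : R)^'+ => s.
have s0 : 0 < s by near: s; exact: nbhs_right_gt.
have st : s <= t by near: s; exact: nbhs_right_le.
have a : `|W F s| < e by near: s; exact: n2.
have : `|W F t - W F s| <= L / j.+1%:R * t ^+ j.+1 - L / j.+1%:R * s ^+ j.+1.
  apply: (@mvt_le R (W F) (W1 F) (fun x => L / j.+1%:R * x ^+ j.+1) (fun x => L * x ^+ j) s t st) => x /andP[sx xt].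
  - exact: (ns_der1 ns sF (lt_le_trans s0 sx)).
  - have := is_deriveZ (L / j.+1%:R) (is_derive_Xn j.+1 x).
    move/is_derive_to; apply; rewrite /GRing.scale/= mulrA -(mulrA L) mulVf ?mulr1//.
  - by apply: HV; rewrite (lt_le_trans s0 sx) (le_trans xt tT).
have h : 0 <= L / j.+1%:R * s ^+ j.+1.
  by apply: mulr_ge0; [exact: divr_ge0|apply: exprn_ge0; exact: ltW].
have := ler_normD (W F t - W F s) (W F s); rewrite subrK.
move: h; move: (_ * s ^+ _) (_ * t ^+ _) => u v; lra.
Unshelve. all: by end_near. Qed.

(** Each step integrates a power of t once, hence the factorial, and consumes
    four derivatives of the test function. *)
Lemma pairing_iter n F T M : sch F -> 0 <= M ->
  (forall s, 0 < s <= T -> `|W (shiftn (4 * n) F) s| <= M) ->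
  forall t, 0 < t <= T -> `|W F t| <= (ga * cbrt T) ^+ n * M / n`!%:R * t ^+ n.
Proof.
elim: n F => [|n IH] F sF M0 H t ht.
  rewrite !expr0 mul1r mulr1 divr1.
  by have := H t ht; rewrite (_ : shiftn _ F = F)//; apply/funext => k; rewrite /shiftn addn0.
have E : shiftn (4 * n) (shiftn 4 F) = shiftn (4 * n.+1) F.
  by apply/funext => k; rewrite /shiftn -addnA -mulnSr.
have H' s : 0 < s <= T -> `|W (shiftn (4 * n) (shiftn 4 F)) s| <= M by rewrite E; exact: H.
have K0 : 0 <= (ga * cbrt T) ^+ n * M / n`!%:R.
  by rewrite divr_ge0 ?ler0n// mulr_ge0// exprn_ge0// mulr_ge0// cbrt_ge0.
have := pairing_le sF K0 (IH _ (sch_shift 4 sF) M0 H') ht.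
rewrite (_ : ga * cbrt T * _ / _ = (ga * cbrt T) ^+ n.+1 * M / n.+1`!%:R)//.
by rewrite factS natrM invfM exprS; ring.
Qed.

Lemma pairing_scale c F t : 0 < t -> sch F -> W (fun n x => c * F n x) t = c * W F t.
Proof.
move=> t0 sF.
pose Z : nat -> R -> R := fun _ _ => 0.
have sZ : sch Z.
  split => [n x|m n]; first exact: is_derive_cst.
  by exists 0 => x; rewrite normr0 mulr0.
have Z0 : W Z t = 0.
  have := ns_lin ns 1 t0 sZ sZ; rewrite (_ : (fun n x => _) = Z); last first.
    by apply/funext => n; apply/funext => x; rewrite /Z mulr0 addr0.
  lra.
have := ns_lin ns c t0 sZ sF; rewrite Z0 add0r => <-; congr (W _ t).
by apply/funext => n; apply/funext => x; rewrite /Z add0r.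
Qed.

Lemma pairing_temp F t : 0 < t -> exists (K : R) (N : nat), 0 <= K /\ forall F C, sch F -> 0 <= C ->
    (forall m n x, (m <= N)%N -> (n <= N)%N -> (1 + `|x|) ^+ m * `|F n x| <= C) ->
    `|W F t| <= K * C.
Proof.
move=> t0; have [K [N H]] := ns_temp ns t0; exists `|K|, N; split => // G C sG C0 HC.
by apply: le_trans (H G C sG C0 HC) _; apply: ler_wpM2r => //; exact: ler_norm.
Qed.

(** Continuity on compact intervals and the limit at 0. *)
Lemma pairing_bounded F T : 0 < T -> sch F -> exists M, forall s, 0 < s <= T -> `|W F s| <= M.
Proof.
move=> T0 sF.
have n2 : \forall s \near 0^'+, `|W F s| < 1.
  have := ns_init ns sF; move/cvgrPdist_lt => /(_ 1 ltr01).
  by apply: filterS => s; rewrite sub0r normrN.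
have [e [e0 eT He]] : exists e, [/\ 0 < e, e <= T & forall s, 0 < s < e -> `|W F s| < 1].
  have [d d0 Hd] := n2; exists (Num.min d T); split.
  - by rewrite lt_min d0 T0.
  - by rewrite ge_min lexx orbT.
  move=> s /andP[s0]; rewrite lt_min => /andP[sd _]; apply: Hd => //=.
  by rewrite sub0r normrN gtr0_norm.
have ct : {within `[e, T], continuous (fun s => `|W F s|)}.
  apply: continuous_in_subspaceT => s; rewrite inE/= in_itv/= => /andP[es _].
  apply: cvg_norm; exact: (derive_cont (ns_der1 ns sF (lt_le_trans e0 es))).
have [c _ Hc] := EVT_max eT ct.
exists (1 + `|W F c|) => s /andP[s0 sT].
case: (ltP s e) => se.
  by have := He s; rewrite s0 se => /(_ isT) h; have := normr_ge0 (W F c); lra.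
have := Hc s; rewrite in_itv/= se sT => /(_ isT) h; lra.
Qed.

(** A uniform boundedness principle by the sliding hump, without completeness of
    a space of test functions: if the bound failed, times s_k and indices j_k
    could be chosen so that a signed sum of the [3^-k chi (j_k)] has unbounded
    pairings at the times s_k. The signs are chosen so that each new term does
    not decrease the pairing at s_k, and the ratio 1/3 makes the tail smaller
    than the k-th term. *)
Lemma pairing_equibounded (chi : nat -> nat -> R -> R) T : 0 < T -> (forall j, sch (chi j)) ->
  (forall m n, exists C, forall j x, (1 + `|x|) ^+ m * `|chi j n x| <= C) ->
  exists M, forall j s, 0 < s <= T -> `|W (chi j) s| <= M.
Proof.
move=> T0 sc HC; apply: contrapT => unb.
have unb1 M : exists j s, 0 < s <= T /\ M < `|W (chi j) s|.
  apply: contrapT => h; apply: unb; exists M => j s hs; rewrite leNgt; apply/negP => h'.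
  by apply: h; exists j, s.
have bnd s : 0 < s -> exists Bs, forall j, `|W (chi j) s| <= Bs.
  move=> s0; have [K [N [K0 HK]]] := pairing_temp (chi 0%N) s0.
  have [|C [C0 H]] := @box_bound R (fun m n C => forall j x, (1 + `|x|) ^+ m * `|chi j n x| <= C) N _ HC.
    by move=> m n C C' CC h j x; apply: le_trans (h j x) CC.
  exists (K * C) => j; apply: HK => // m n x mN nN; exact: H.
have pick k : exists p : R * nat, [/\ 0 < p.1 <= T, 3 ^+ k * k%:R < `|W (chi p.2) p.1| &
    forall i, `|W (chi i) p.1| <= 3 / 2 * `|W (chi p.2) p.1|].
  have [j0 [s [hs Hs]]] := unb1 (3 ^+ k * k%:R).
  have s0 : 0 < s by case/andP: hs.
  have [Bs HB] := bnd s s0.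
  have M0 : 0 <= 3 ^+ k * k%:R :> R by rewrite mulr_ge0// exprn_ge0.
  have [j [h1 h2]] := @near_max R (fun j => `|W (chi j) s|) _ Bs M0 (ex_intro _ j0 Hs) HB.
  by exists (s, j); split.
have [f Hf] := @choice _ _ (fun k (p : R * nat) => [/\ 0 < p.1 <= T, 3 ^+ k * k%:R < `|W (chi p.2) p.1| &
    forall i, `|W (chi i) p.1| <= 3 / 2 * `|W (chi p.2) p.1|]) pick.
pose add (G : nat -> R -> R) c k : nat -> R -> R := fun n x => G n x + c * chi (f k).2 n x.
(* The partial sums, with the sign of each term chosen by comparison at s_k. *)
pose P := fix P k : nat -> R -> R := if k is k'.+1 then
   (if `|W (add (P k') (- q k') k') (f k').1| <= `|W (add (P k') (q k') k') (f k').1|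
    then add (P k') (q k') k' else add (P k') (- q k') k') else fun _ _ => 0.
have PS k : exists c, [/\ c = q k \/ c = - q k, P k.+1 = add (P k) c k &
    forall c', c' = q k \/ c' = - q k -> `|W (add (P k) c' k) (f k).1| <= `|W (P k.+1) (f k).1|].
  case: (leP `|W (add (P k) (- q k) k) (f k).1| `|W (add (P k) (q k) k) (f k).1|) => h.
    have E : P k.+1 = add (P k) (q k) k by rewrite /= h.
    by exists (q k); split => //; [left|move=> c' [->|->]; rewrite E].
  have E : P k.+1 = add (P k) (- q k) k by rewrite /= leNgt h.
  by exists (- q k); split => //; [right|move=> c' [->|->]; rewrite E// ltW].
have sadd G c k : sch G -> sch (add G c k).
  move=> [dG HG]; have [dc _] := sc (f k).2; split => [n x|m n].
    have := is_deriveD (dG n x) (is_deriveZ c (dc n x)).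
    by move/is_derive_to; apply; rewrite /GRing.scale.
  have [C1 h1] := HG m n; have [C2 h2] := HC m n; exists (C1 + `|c| * C2) => x.
  rewrite /add; have w0 : 0 <= (1 + `|x|) ^+ m by rewrite exprn_ge0// addr_ge0.
  apply: le_trans (ler_wpM2l w0 (ler_normD _ _)) _; rewrite mulrDr lerD//.
  by rewrite normrM mulrCA; apply: ler_wpM2l.
have sP k : sch (P k).
  elim: k => [|k IH]; last by have [c [_ -> _]] := PS k; exact: sadd.
  split => [n x|m n]; first exact: is_derive_cst.
  by exists 0 => x; rewrite normr0 mulr0.
have stepP m n C : (forall j x, (1 + `|x|) ^+ m * `|chi j n x| <= C) ->
    forall x k, `|(1 + `|x|) ^+ m * P k.+1 n x - (1 + `|x|) ^+ m * P k n x| <= C * q k.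
  move=> h x k; have [c [hc -> _]] := PS k.
  have w0 : 0 <= (1 + `|x|) ^+ m by rewrite exprn_ge0// addr_ge0.
  have -> : (1 + `|x|) ^+ m * add (P k) c k n x - (1 + `|x|) ^+ m * P k n x =
      c * ((1 + `|x|) ^+ m * chi (f k).2 n x) by rewrite /add; ring.
  rewrite normrM (_ : `|c| = q k); last first.
    by case: hc => ->; rewrite ?normrN gtr0_norm ?pow3V_gt0.
  by rewrite mulrC ler_pM2r ?pow3V_gt0// normrM (ger0_norm w0).
have [S HS] : exists S : nat -> R -> R, forall n x, exists K, forall k, `|S n x - P k n x| <= K * q k.
  have h (p : nat * R) : exists l, exists K, forall k, `|l - P k p.1 p.2| <= K * q k.
    have [C hC] := HC 0%N p.1.
    have [|l hl] := @geom_lim R (fun k => P k p.1 p.2) C.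
      by move=> k; have := stepP _ _ _ hC p.2 k; rewrite expr0 !mul1r.
    by exists l, (3 / 2 * C).
  have [g Hg] := choice h; exists (fun n x => g (n, x)) => n x; exact: (Hg (n, x)).
have closeS m n C : (forall j x, (1 + `|x|) ^+ m * `|chi j n x| <= C) ->
    forall x k, (1 + `|x|) ^+ m * `|S n x - P k n x| <= 3 / 2 * C * q k.
  move=> h x k; have w0 : 0 <= (1 + `|x|) ^+ m by rewrite exprn_ge0// addr_ge0.
  have [K HK] := HS n x.
  rewrite -{1}(ger0_norm w0) -normrM mulrBr.
  apply: (@geom_close R (fun k => (1 + `|x|) ^+ m * P k n x) _ C ((1 + `|x|) ^+ m * K)).
    exact: stepP.
  by move=> i; rewrite -mulrBr normrM (ger0_norm w0) -mulrA; apply: ler_wpM2l.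
have dS : dseq S.
  move=> n x; have [C2 h2] := HC 0%N n.+2.
  apply: (@is_derive_quad R _ _ _ (3 / 2 * C2) 1) => // h _.
  have [K0 H0] := HS n (x + h); have [K1 H1] := HS n x; have [K2 H2] := HS n.+1 x.
  rewrite -subr_le0; apply: (@pow3_small R _ (K0 + K1 + `|h| * K2)) => i.
  have [dP _] := sP i.
  have := @taylor2 R (P i n) (P i n.+1) (P i n.+2) x (x + h) (3 / 2 * C2).
  have -> : x + h - x = h by ring.
  have hb y : `|P i n.+2 y| <= 3 / 2 * C2.
    have h0 k : `|P k.+1 n.+2 y - P k n.+2 y| <= C2 * q k.
      by have := stepP _ _ _ h2 y k; rewrite expr0 !mul1r.
    have := geom_diff h0 0 i; rewrite add0n [X in `|X|](_ : _ = P i n.+2 y); last by rewrite /= subr0.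
    have C0 : 0 <= C2 by have := le_trans (normr_ge0 _) (h0 0%N); rewrite expr0 mulr1.
    have : 0 <= 3 / 2 * C2 * q i by rewrite !mulr_ge0// ltW// pow3V_gt0.
    by rewrite expr0; move: (q i) => u; lra.
  move=> /(_ (fun y _ => dP n y) (fun y _ => dP n.+1 y) (fun y _ => hb y)).
  have a0 := H0 i; have a1 := H1 i; have a2 := ler_wpM2l (normr_ge0 h) (H2 i).
  rewrite -normrM in a2.
  have := ler_normD (S n (x + h) - P i n (x + h) - (S n x - P i n x) - h * (S n.+1 x - P i n.+1 x))
     (P i n (x + h) - P i n x - h * P i n.+1 x).
  rewrite [X in `|X| <= _ -> _](_ : _ = S n (x + h) - S n x - h * S n.+1 x); last by ring.
  have := ler_normB (S n (x + h) - P i n (x + h) - (S n x - P i n x)) (h * (S n.+1 x - P i n.+1 x)).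
  have := ler_normB (S n (x + h) - P i n (x + h)) (S n x - P i n x).
  move: a0 a1 a2; move: (q i) (h ^+ 2) => u v; lra.
have sS : sch S.
  split => // m n; have [C hC] := HC m n; exists (3 / 2 * C * q 0) => x.
  by have := closeS m n C hC x 0%N; rewrite /= subr0.
have [M HM] := pairing_bounded T0 sS.
(* At time s_k the k-th term has size w / 3^k >= k and the tail at most 3/4 of it. *)
have key k : k%:R <= 4 * M.
  have [hs h1 h2] := Hf k; set s := (f k).1 in hs h1 h2; set w := `|W (chi (f k).2) s| in h1 h2.
  have s0 : 0 < s by case/andP: hs.
  have HMs := HM s hs.
  (* All chi j have pairing at most (3/2) w at s_k, by the choice of j_k. *)
have stepW i : `|W (P i.+1) s - W (P i) s| <= 3 / 2 * w * q i.
    have [c [hc -> _]] := PS i; rewrite (ns_lin ns c s0 (sP i) (sc _)) addrC addKr normrM.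
    rewrite (_ : `|c| = q i); last by case: hc => ->; rewrite ?normrN gtr0_norm ?pow3V_gt0.
    by rewrite mulrC ler_pM2r ?pow3V_gt0.
  have [K [N [K0 HK]]] := pairing_temp S s0.
  have [|C [C0 HCN]] := @box_bound R (fun m n C => forall j x, (1 + `|x|) ^+ m * `|chi j n x| <= C) N _ HC.
    by move=> m n C C' CC h j x; apply: le_trans (h j x) CC.
  have limW i : `|W S s - W (P i) s| <= K * (3 / 2 * C) * q i.
    have e1 : W S s - W (P i) s = W (fun n x => S n x + (-1) * P i n x) s.
      by rewrite (ns_lin ns (-1) s0 sS (sP i)) mulN1r.
    rewrite e1 -mulrA; apply: HK.
    - have [dP bP] := sP i; split => [n x|m n].
        have := is_deriveD (dS n x) (is_deriveZ (-1) (dP n x)).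
        by move/is_derive_to; apply; rewrite /GRing.scale.
      have [D hD] := HC m n; exists (3 / 2 * D * q i) => x; rewrite mulN1r; exact: closeS.
    - by rewrite !mulr_ge0// ltW// pow3V_gt0.
    - by move=> m n x mN nN; rewrite mulN1r; apply: closeS; exact: HCN.
  have g := geom_close stepW limW k.+1; rewrite pow3VS in g.
  have [c [hc _ Hc]] := PS k.
  have big : q k * w <= `|W (P k.+1) s|.
    have a1 := Hc (q k) (or_introl erefl); have a2 := Hc (- q k) (or_intror erefl).
    rewrite -/s in a1 a2; rewrite /add !(ns_lin ns _ s0 (sP k) (sc _)) in a1 a2.
    have := ler_normB (W (P k) s + q k * W (chi (f k).2) s) (W (P k) s + - q k * W (chi (f k).2) s).
    have -> : W (P k) s + q k * W (chi (f k).2) s - (W (P k) s + - q k * W (chi (f k).2) s) =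
      2 * (q k * W (chi (f k).2) s) by ring.
    rewrite !normrM (gtr0_norm (@pow3V_gt0 R k)) normr_nat -/w => a3; lra.
  have fin : k%:R <= q k * w.
    have e3 : q k * 3 ^+ k = 1 :> R by rewrite -exprMn mulVf ?expr1n.
    have := ler_wpM2l (ltW (@pow3V_gt0 R k)) (ltW h1); rewrite mulrA e3 mul1r//.
  have := ler_normB (W S s) (W S s - W (P k.+1) s); rewrite subKr.
  move: fin big g HMs; move: (q k) => u; nra.
have := key (Num.truncn (4 * M)).+1; have := truncnS_gt (4 * M); lra.
Qed.

(** For geometric growth of the derivatives, the sequence F^(8j)/j! is bounded in
    every seminorm; 2j steps of the iteration gain (2j)! >= (j!)^2 against the j!
    lost. *)
Lemma pairing_bandl F t : 0 < t -> bandl F -> W F t = 0.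
Proof.
move=> t0 bF; have sF := bandl_sch bF.
pose chi j : nat -> R -> R := fun n x => j`!%:R^-1 * F (n + 8 * j)%N x.
have sc j : sch (chi j).
  have [dF HF] := sch_shift (8 * j) sF; split => [n x|m n].
    by have := is_deriveZ (j`!%:R^-1) (dF n x); move/is_derive_to; apply.
  have [C h] := HF m n; exists (`|j`!%:R^-1| * C) => x; rewrite normrM mulrCA.
  by apply: ler_wpM2l.
have HC m n : exists C, forall j x, (1 + `|x|) ^+ m * `|chi j n x| <= C.
  have [C [D [C0 D0 H]]] := bF.2 m; exists (C * D ^+ n * expR (D ^+ 8)) => j x.
  have f0 : 0 < j`!%:R :> R by rewrite ltr0n fact_gt0.
  rewrite /chi normrM normfV (gtr0_norm f0) mulrCA ler_pdivrMl//.
  apply: le_trans (H _ _) _; rewrite exprD mulrA exprM [leRHS]mulrCA; apply: ler_wpM2l.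
    by rewrite mulr_ge0// exprn_ge0.
  by apply: expR_ge_pow; rewrite exprn_ge0.
have [M HM] := pairing_equibounded t0 sc HC.
have M0 : 0 <= M by apply: le_trans (HM 0%N t _); rewrite ?t0 ?lexx.
have [L [L0 LE]] : exists L : R, 0 <= L /\ L = ga * cbrt t.
  by exists (ga * cbrt t); split => //; apply: mulr_ge0; [exact: ga0|exact: cbrt_ge0].
pose Z := (L * t) ^+ 2.
have Z0 : 0 <= Z by rewrite exprn_ge0// mulr_ge0// ltW.
apply/eqP; rewrite -normr_le0; apply: (@pow3_small R _ (M * expR (3 * Z))) => j.
have f0 : 0 < j`!%:R :> R by rewrite ltr0n fact_gt0.
have H s : 0 < s <= t -> `|W (shiftn (4 * (2 * j)) F) s| <= M * j`!%:R.
  move=> hs; have s0 : 0 < s by case/andP: hs.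
  have := HM j s hs; rewrite /chi (pairing_scale _ s0 (sch_shift (8 * j) sF)) normrM normfV (gtr0_norm f0).
  by rewrite ler_pdivrMl// mulrC /shiftn mulnA.
have Mj : 0 <= M * j`!%:R by rewrite mulr_ge0// ltW.
have tt : 0 < t <= t by rewrite t0 lexx.
apply: le_trans (pairing_iter sF Mj H tt) _; rewrite -LE.
have f2 : j`!%:R * j`!%:R <= (2 * j)`!%:R :> R.
  rewrite -natrM ler_nat mul2n -addnn -(bin_fact (leq_addr j j)) addnK leq_pmull// bin_gt0.
  exact: leq_addr.
have f2p : 0 < (2 * j)`!%:R :> R by rewrite ltr0n fact_gt0.
have p := expR_ge_pow j (mulr_ge0 (ler0n R 3) Z0); rewrite exprMn in p.
have e1 : L ^+ (2 * j) * (M * j`!%:R) / (2 * j)`!%:R * t ^+ (2 * j) =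
   M * (Z ^+ j * (j`!%:R / (2 * j)`!%:R)).
  rewrite -[Z ^+ j]exprM exprMn.
  by move: (L ^+ _) (t ^+ _) ((2 * j)`!%:R^-1 : R) (j`!%:R : R) => a b c d; ring.
rewrite e1 -mulrA; apply: ler_wpM2l => //.
have h1 : j`!%:R / (2 * j)`!%:R <= j`!%:R^-1 :> R.
  by rewrite ler_pdivrMr// ler_pdivlMl.
apply: le_trans (ler_wpM2l (exprn_ge0 _ Z0) h1) _.
rewrite ler_pdivrMr// exprVn mulrAC ler_pdivlMr ?exprn_gt0//.
by rewrite mulrC [leRHS]mulrC.
Qed.

(** Mollification and continuity of the pairing. *)
Lemma null_solution_eq0 F t : 0 < t -> sch F -> W F t = 0.
Proof.
move=> t0 sF; have [K [N [K0 HK]]] := pairing_temp F t0.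
pose Q m n C := forall e x, 0 < e <= 1 ->
    (1 + `|x|) ^+ m * `|molly F e n x - F n x| <= C * e.
have monoQ m n C C' : C <= C' -> Q m n C -> Q m n C'.
  move=> CC h e x he; apply: le_trans (h e x he) _.
  by apply: ler_wpM2r => //; case/andP: he => /ltW.
have exQ m n : exists C, Q m n C by have [D [_ hD]] := molly_close m n sF; exists D.
have [C [C0 H]] := box_bound N monoQ exQ.
apply/eqP; rewrite -normr_le0; apply: (@le0_of_small _ _ (K * C)) => [|e he]; first exact: mulr_ge0.
have bG := molly_bandl sF he; have sG := bandl_sch bG; have [dG hG] := sG; have [dF hF] := sF.
have e0 : 0 <= e by case/andP: he => /ltW.
have E : W F t = - W (fun n x => molly F e n x + (-1) * F n x) t.
  by rewrite (ns_lin ns (-1) t0 sG sF) (pairing_bandl t0 bG); ring.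
rewrite E normrN -mulrA; apply: HK.
- split => [n x|m n].
    have := is_deriveD (dG n x) (is_deriveZ (-1) (dF n x)).
    by move/is_derive_to; apply; rewrite /GRing.scale.
  have [D [_ hD]] := molly_close m n sF; exists (D * e) => x; rewrite mulN1r; exact: hD.
- exact: mulr_ge0.
- by move=> m n x mN nN; rewrite mulN1r; exact: H.
Qed.

End Uniqueness.

(** * Complex test functions and their real components *)

Section RealParts.
Context {R : realType}.
Notation mu := (@lebesgue_measure R).
Implicit Types (F G : nat -> R -> R) (phi psi : R -> R[i]) (x y s t r : R).
Let mH := @measurable_halfline R.

(** The complex function with given real and imaginary sequences. *)
Definition cs F G : R -> R[i] := fun x => F 0%N x +i* G 0%N x.
Definition Fre phi : nat -> R -> R := fun n x => cRe (cderiven n phi x).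
Definition Fim phi : nat -> R -> R := fun n x => cIm (cderiven n phi x).
Definition zseq : nat -> R -> R := fun _ _ => 0.

Lemma cs_parts phi : cs (Fre phi) (Fim phi) = phi.
Proof. by apply/funext => x; rewrite /cs /Fre /Fim /=; case: (phi x). Qed.

Lemma cderiven_cs F G n : dseq F -> dseq G -> cderiven n (cs F G) = fun x => F n x +i* G n x.
Proof.
move=> dF dG; elim: n => [//|n IH]; rewrite /cderiven iterS -/(cderiven n _) IH.
apply/funext => x; rewrite /cderive /= !derive1E.
by have a := dF n x; have b := dG n x; rewrite !derive_val.
Qed.

Lemma cderiven_add m n phi : cderiven m (cderiven n phi) = cderiven (m + n) phi.
Proof. by rewrite /cderiven iterD. Qed.

Lemma sch_lin c F G : sch F -> sch G -> sch (fun n x => F n x + c * G n x).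
Proof.
move=> [dF HF] [dG HG]; split => [n x|m n].
  have := is_deriveD (dF n x) (is_deriveZ c (dG n x)).
  by move/is_derive_to; apply; rewrite /GRing.scale.
have [C h] := HF m n; have [D k] := HG m n; exists (C + `|c| * D) => x.
have w0 : 0 <= (1 + `|x|) ^+ m by rewrite exprn_ge0// addr_ge0.
apply: le_trans (ler_wpM2l w0 (ler_normD _ _)) _; rewrite mulrDr lerD//.
by rewrite normrM mulrCA; apply: ler_wpM2l.
Qed.

Lemma sch_zseq : sch zseq.
Proof.
split => [n x|m n]; first exact: is_derive_cst.
by exists 0 => x; rewrite normr0 mulr0.
Qed.

Lemma schwartz_cs F G : sch F -> sch G -> schwartz (cs F G).
Proof.
move=> [dF HF] [dG HG]; split => [n x|m n].
  rewrite (cderiven_cs n dF dG); split => /=.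
    by have a := dF n x; exact: (@ex_derive _ _ _ _ _ _ _ a).
  by have a := dG n x; exact: (@ex_derive _ _ _ _ _ _ _ a).
have [C h] := HF m n; have [D k] := HG m n; exists (C + D) => x.
rewrite /schwartz_term (cderiven_cs n dF dG).
have w0 : 0 <= `|x| ^+ m by rewrite exprn_ge0.
have w1 : `|x| ^+ m <= (1 + `|x|) ^+ m.
  by apply: lerXn2r; rewrite ?nnegrE ?addr_ge0// lerDr.
apply: le_trans (ler_wpM2l w0 (nc_le _)) _; rewrite /= mulrDr lerD//.
  by apply: le_trans (h x); apply: ler_wpM2r.
by apply: le_trans (k x); apply: ler_wpM2r.
Qed.

(** Powers of [|x|] and of [1 + |x|] define the same decay conditions. *)
Lemma sch_part phi (p : R[i] -> R) : schwartz phi -> (forall z, `|p z| <= nc z) ->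
  (forall n x, is_derive x (1 : R) (fun y => p (cderiven n phi y)) (p (cderiven n.+1 phi x))) ->
  sch (fun n x => p (cderiven n phi x)).
Proof.
move=> [_ HS] pn dp; split => // m n.
have [M0 h0] := HS 0%N n; have [M1 h1] := HS m n.
exists (2 ^+ m * (M0 + M1)) => x.
have b0 : `|p (cderiven n phi x)| <= M0.
  by apply: le_trans (pn _) _; have := h0 x; rewrite /schwartz_term expr0 mul1r.
have b1 : `|x| ^+ m * `|p (cderiven n phi x)| <= M1.
  by apply: le_trans (h1 x); apply: ler_wpM2l => //; apply: exprn_ge0.
apply: le_trans (ler_wpM2r (normr_ge0 _) (pow_1x m (normr_ge0 x))) _.
rewrite -mulrA mulrDl mul1r; apply: ler_wpM2l; first exact: exprn_ge0.
exact: lerD.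
Qed.

Lemma cderivable_parts phi x : cderivable phi x ->
  is_derive x (1 : R) (fun y => cRe (phi y)) (cRe (cderive phi x)) /\
  is_derive x (1 : R) (fun y => cIm (phi y)) (cIm (cderive phi x)).
Proof.
by move=> [a b]; split; [apply: (DeriveDef a)|apply: (DeriveDef b)]; rewrite /cderive /= derive1E.
Qed.

Lemma sch_Fre phi : schwartz phi -> sch (Fre phi).
Proof.
move=> sp; apply: (@sch_part phi (fun z => cRe z) sp (fun z => nc_Re z)) => n x.
by have [a _] := cderivable_parts (sp.1 n x).
Qed.

Lemma sch_Fim phi : schwartz phi -> sch (Fim phi).
Proof.
move=> sp; apply: (@sch_part phi (fun z => cIm z) sp (fun z => nc_Im z)) => n x.
by have [_ a] := cderivable_parts (sp.1 n x).
Qed.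

Lemma Fre_deriven j phi : Fre (cderiven j phi) = shiftn j (Fre phi).
Proof. by apply/funext => n; apply/funext => x; rewrite /Fre /shiftn cderiven_add. Qed.

Lemma Fim_deriven j phi : Fim (cderiven j phi) = shiftn j (Fim phi).
Proof. by apply/funext => n; apply/funext => x; rewrite /Fim /shiftn cderiven_add. Qed.

Lemma Fre_cs F G : dseq F -> dseq G -> Fre (cs F G) = F.
Proof. by move=> dF dG; apply/funext => n; apply/funext => x; rewrite /Fre cderiven_cs. Qed.

Lemma Fim_cs F G : dseq F -> dseq G -> Fim (cs F G) = G.
Proof. by move=> dF dG; apply/funext => n; apply/funext => x; rewrite /Fim cderiven_cs. Qed.

Lemma schwartz_deriven j phi : schwartz phi -> schwartz (cderiven j phi).
Proof.
move=> sp; rewrite -(cs_parts (cderiven j phi)) Fre_deriven Fim_deriven.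
by apply: schwartz_cs; apply: sch_shift; [exact: sch_Fre|exact: sch_Fim].
Qed.

Lemma scale_add_cs (a : R[i]) phi psi : (fun x => a * phi x + psi x) =
  cs (fun n x => (Fre psi n x + cRe a * Fre phi n x) + - cIm a * Fim phi n x)
     (fun n x => (Fim psi n x + cRe a * Fim phi n x) + cIm a * Fre phi n x).
Proof.
apply/funext => x; rewrite /cs /Fre /Fim /=.
by apply: c_ext; rewrite ?cReD ?cImD ?cReM ?cImM /=; ring.
Qed.

Lemma schwartz_scale_add (a : R[i]) phi psi : schwartz phi -> schwartz psi ->
  schwartz (fun x => a * phi x + psi x).
Proof.
move=> s1 s2; rewrite scale_add_cs.
have a1 := sch_Fre s1; have a2 := sch_Fim s1; have b1 := sch_Fre s2; have b2 := sch_Fim s2.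
by apply: schwartz_cs; apply: sch_lin => //; exact: sch_lin.
Qed.

Lemma sol_lin c F G t : sch F -> sch G ->
  sol (fun n x => F n x + c * G n x) t = sol F t + c * sol G t.
Proof.
move=> sF sG; have [dF _] := sF; have [dG _] := sG.
have s1 : `|1 : R| <= 1 by rewrite normr1.
have I1 := kpair_Lint 0 (rt t) superexp_A dF (sch_bseq sF) s1.
have I2 := kpair_Lint 0 (rt t) superexp_A dG (sch_bseq sG) s1.
have K y : kerA y * sym 1 (fun x => F 0%N x + c * G 0%N x) (rt t) y =
   kerA y * sym 1 (F 0%N) (rt t) y + c * (kerA y * sym 1 (G 0%N) (rt t) y).
  by rewrite /sym; move: (kerA y) => k; ring.
rewrite /sol /kpair (int_eq (fun y _ => K y)) (intD mH I1 (LintZ c mH I2)) (intZ c mH I2).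
move: (\int[mu]_(_ in _) _) (\int[mu]_(_ in _) _) => u v; ring.
Qed.

(** The reflection formula holds for nonnegative functions; it is applied to
    [|f|] and to [f + |f|]. *)
Lemma fold_line (f : R -> R) : continuous f -> Lint halfline f -> Lint halfline (fun x => f (- x)) ->
  Lint setT f /\ \int[mu]_(x in setT) f x = \int[mu]_(x in halfline) (f x + f (- x)).
Proof.
move=> cf I1 I2.
pose N0 : set R := `]-oo, 0]%classic; pose N : set R := `]-oo, 0[%classic.
have mN0 : Lmeas N0 by exact: measurable_itv.
have mN : Lmeas N by exact: measurable_itv.
have subst (h : R -> R) : continuous h -> (forall x, 0 <= h x) ->
    (\int[mu]_(x in N0) (h x)%:E = \int[mu]_(x in halfline) (h (- x))%:E)%E.
  move=> ch h0; rewrite /N0 -[in LHS]oppr0.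
  apply: ge0_integration_by_substitutionNy; last by move=> x _; exact: h0.
  by apply: continuous_subspaceT.
have cn : continuous (fun x => `|f x|) by move=> x; apply: cvg_norm; exact: cf.
have In : Lint N0 (fun x => `|f x|).
  apply/integrableP; split; first by apply/measurable_EFinP; exact: cont_meas.
  have := integrableP _ _ _ (Lint_norm mH I2) => -[_]; apply: le_lt_trans.
  under eq_integral do rewrite /= normr_id.
  by rewrite (subst _ cn)//; under [leRHS]eq_integral do rewrite /= normr_id.
have I0 : Lint N0 f.
  by apply: (Lint_le mN0 _ In) => //; exact: cont_meas.
have c2 : continuous (fun x => f x + `|f x|).
  by move=> x; apply: cvgD; [exact: cf|exact: cn].
have E0 : \int[mu]_(x in N0) f x = \int[mu]_(x in halfline) f (- x).
  have e1 : \int[mu]_(x in N0) (f x + `|f x|) = \int[mu]_(x in halfline) (f (- x) + `|f (- x)|).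
    congr fine; apply: (subst _ c2) => x.
    by have := ler_norm (- f x); rewrite normrN; lra.
  have e2 : \int[mu]_(x in N0) `|f x| = \int[mu]_(x in halfline) `|f (- x)|.
    by congr fine; exact: (subst _ cn).
  move: e1; rewrite (intD mN0 I0 In) (intD mH I2 (Lint_norm mH I2)) e2; exact: addIr.
have IN : Lint N f.
  apply: (integrableS mN0 mN _ I0) => x; rewrite /N /N0 /= !in_itv/=; exact: ltW.
have EN : \int[mu]_(x in N) f x = \int[mu]_(x in N0) f x by exact: Rintegral_itv_bndo_bndc.
have ext D : Lmeas D -> Lint D f -> Lint setT (f \_ D).
  move=> mD /(integrable_mkcond _ mD); congr (_.-integrable _ _).
  by apply/funext => x; rewrite /= !patchE; case: ifP.
have K x : f x = (f \_ N) x + (f \_ halfline) x.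
  rewrite !patchE; case: (ltP x 0) => x0.
    rewrite mem_set; last by rewrite /N /= in_itv.
    rewrite memNset ?addr0//= in_itv/= andbT; apply/negP; by rewrite -ltNge.
  rewrite memNset; last by rewrite /N /= in_itv/=; apply/negP; rewrite -leNgt.
  by rewrite mem_set ?add0r//= in_itv/= andbT.
have J1 := ext _ mN IN; have J2 := ext _ mH I1.
split; first by apply: Lint_eq (LintD measurableT J1 J2) => // x _; rewrite K.
rewrite (int_eq (fun x _ => K x)) (intD measurableT J1 J2) (intD mH I1 I2).
by rewrite -!Rintegral_mkcond EN E0 addrC.
Qed.

Lemma u43_pairing F t : 0 < t -> sch F ->
  Lint setT (fun x => cRe (u43 x t) * F 0%N x) /\
  \int[mu]_(x in setT) (cRe (u43 x t) * F 0%N x) = sol F t.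
Proof.
move=> t0 sF; have [dF _] := sF; have bF := sch_bseq sF.
have r0 := rt_gt0 t0; have rV0 : 0 < (rt t)^-1 by rewrite invr_gt0.
set f := fun x => cRe (u43 x t) * F 0%N x.
have fE x : f x = 3 / 2 * (rt t)^-1 * (kerA ((rt t)^-1 * `|x|) * F 0%N x).
  rewrite /f (u43E x t0) -/(cbrt _) -/(rt t) [cRe _]/= (mulrC `|x|).
  by move: (kerA _) => k; ring.
have [cA _] := @superexp_A R.
have cf : continuous f.
  have -> : f = (fun x => 3 / 2 * (rt t)^-1 * (kerA ((rt t)^-1 * `|x|) * F 0%N x)).
    exact/funext.
  move=> x; apply: cvgM; first exact: cvg_cst.
  apply: cvgM; last exact: (derive_contT (dF 0%N)).
  apply: (@cvg_comp _ _ _ (fun y => (rt t)^-1 * `|y|) kerA); last exact: cA.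
  by apply: cvgM; [exact: cvg_cst|exact: norm_continuous].
have scal (g : R -> R) : continuous g -> Lint halfline (fun y => kerA y * g y) ->
   Lint halfline (fun x => 3 / 2 * (rt t)^-1 * (kerA ((rt t)^-1 * x) * g ((rt t)^-1 * x))) /\
   \int[mu]_(x in halfline) (3 / 2 * (rt t)^-1 * (kerA ((rt t)^-1 * x) * g ((rt t)^-1 * x))) =
     3 / 2 * \int[mu]_(y in halfline) (kerA y * g y).
  move=> cg Ig.
  have ck : continuous (fun y => kerA y * g y) by move=> y; apply: cvgM; [exact: cA|exact: cg].
  have [J E] := int_scale rV0 ck Ig.
  split; first exact: LintZ.
  by rewrite (intZ _ mH J) E invrK -(mulrA (3 / 2)) mulKf ?gt_eqF.
have s1 : `|1 : R| <= 1 by rewrite normr1.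
have s0 : `|0 : R| <= 1 by rewrite normr0.
have c1 := derive_contT (dF 0%N).
have [J1 E1] := scal _ (sym_cont (sg := 1) (r := rt t) c1) (kpair_Lint 0 (rt t) superexp_A dF bF s1).
have [J0 _] := scal _ (sym_cont (sg := 0) (r := rt t) c1) (kpair_Lint 0 (rt t) superexp_A dF bF s0).
have rK x : rt t * ((rt t)^-1 * x) = x by rewrite mulVKf ?gt_eqF.
have e0 x : halfline x -> 3 / 2 * (rt t)^-1 * (kerA ((rt t)^-1 * x) * sym 0 (F 0%N) (rt t) ((rt t)^-1 * x)) = f x.
  by move=> /halfline_ge0 x0; rewrite fE /sym rK mul0r addr0 (ger0_norm x0).
have e1 x : halfline x -> 3 / 2 * (rt t)^-1 * (kerA ((rt t)^-1 * x) * sym 1 (F 0%N) (rt t) ((rt t)^-1 * x)) = f x + f (- x).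
  by move=> /halfline_ge0 x0; rewrite !fE normrN /sym rK mul1r (ger0_norm x0) !mulrDr.
have I1 : Lint halfline f by apply: Lint_eq J0.
have I2 : Lint halfline (fun x => f (- x)).
  apply: Lint_eq (LintB mH (Lint_eq mH e1 J1) I1) => // x _; ring.
have [L E] := fold_line cf I1 I2.
by split => //; rewrite E -(int_eq e1) E1.
Qed.

End RealParts.

(** * The explicit kernel is the unique solution *)

Section Assembly.
Context {R : realType}.
Notation mu := (@lebesgue_measure R).
Implicit Types (F G : nat -> R -> R) (phi psi : R -> R[i]) (x y s t r : R).
Let mH := @measurable_halfline R.

Lemma ccvg (T : Type) (D : set_system T) (a b : T -> R) (la lb : R) : Filter D ->
  a z @[z --> D] --> la -> b z @[z --> D] --> lb ->
  ((fun z => a z +i* b z) : T -> R[i]^o) z @[z --> D] --> (la +i* lb : R[i]^o).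
Proof.
move=> FD ca cb; apply/cvgrPdist_le => e e0; have [e' e'0 ->] := pos_real e0.
have e2 : 0 < e' / 2 by rewrite divr_gt0.
move/cvgrPdist_le : ca => /(_ _ e2) ca; move/cvgrPdist_le : cb => /(_ _ e2) cb.
near=> z; rewrite norm_nc lecR; apply: le_trans (nc_le _) _ => /=.
have h1 : `|la - a z| <= e' / 2 by near: z; exact: ca.
have h2 : `|lb - b z| <= e' / 2 by near: z; exact: cb.
lra.
Unshelve. all: by end_near. Qed.

Lemma part_cvg (T : Type) (D : set_system T) (p : R[i] -> R) (f : T -> R[i]) (l : R[i]) : Filter D ->
  (forall z w, p (z - w) = p z - p w) -> (forall z, `|p z| <= nc z) ->
  (f : T -> R[i]^o) z @[z --> D] --> (l : R[i]^o) -> p (f z) @[z --> D] --> p l.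
Proof.
move=> FD pB pn cf; apply/cvgrPdist_le => e e0.
have e0C : 0 < (e%:C : R[i]) by rewrite ltcR.
move/cvgrPdist_le : cf => /(_ _ e0C); apply: filterS => z.
by rewrite norm_nc lecR -pB; apply: le_trans; exact: pn.
Qed.

Lemma near_pos t : 0 < t -> \forall y \near t, 0 < y.
Proof.
move=> t0; have := @near_in_itvoo _ 0 (t + 1) t; rewrite in_itv/= t0 ltrDl ltr01 => /(_ isT).
by apply: filterS => y; rewrite in_itv/= => /andP[].
Qed.

Lemma cderive_pos (f : R -> R[i]) (a b a' b' : R -> R) :
  (forall t, 0 < t -> f t = a t +i* b t) ->
  (forall t, 0 < t -> is_derive t (1 : R) a (a' t)) ->
  (forall t, 0 < t -> is_derive t (1 : R) b (b' t)) ->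
  forall t, 0 < t -> cderivable f t /\ cderive f t = a' t +i* b' t.
Proof.
move=> fE da db t t0.
have d1 : is_derive t (1 : R) (fun y => cRe (f y)) (a' t).
  by apply: (is_derive_near (da t t0)); apply: filterS (near_pos t0) => y y0; rewrite fE.
have d2 : is_derive t (1 : R) (fun y => cIm (f y)) (b' t).
  by apply: (is_derive_near (db t t0)); apply: filterS (near_pos t0) => y y0; rewrite fE.
split; first by split; [exact: (@ex_derive _ _ _ _ _ _ _ d1)|exact: (@ex_derive _ _ _ _ _ _ _ d2)].
by rewrite /cderive !derive1E !derive_val.
Qed.

(** Being represented by the kernel is a statement about real pairings only. *)
Lemma rep_sol t (T : (R -> R[i]) -> R[i]) : 0 < t ->
  represented_by T (fun x => u43 x t) <->
  (forall phi, schwartz phi -> T phi = sol (Fre phi) t +i* sol (Fim phi) t).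
Proof.
move=> t0.
have key phi : schwartz phi -> cintegrable [set: R] (fun x => u43 x t * phi x) /\
   cintegral [set: R] (fun x => u43 x t * phi x) = sol (Fre phi) t +i* sol (Fim phi) t.
  move=> sp; have [I1 E1] := u43_pairing t0 (sch_Fre sp); have [I2 E2] := u43_pairing t0 (sch_Fim sp).
  have u0 x : u43 x t = (cRe (u43 x t))%:C by rewrite (u43E x t0).
  have e1 x : cRe (u43 x t) * Fre phi 0%N x = cRe (u43 x t * phi x).
    by rewrite [in RHS]u0 cRe_scale.
  have e2 x : cRe (u43 x t) * Fim phi 0%N x = cIm (u43 x t * phi x).
    by rewrite [in RHS]u0 cIm_scale.
  split; first split.
  - by apply: Lint_eq I1 => // x _; exact: e1.
  - by apply: Lint_eq I2 => // x _; exact: e2.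
  by rewrite /cintegral -(int_eq (fun x _ => e1 x)) -(int_eq (fun x _ => e2 x)) E1 E2.
split=> [H phi sp|H phi sp]; first by have [_ ->] := H phi sp; have [_ ->] := key phi sp.
by have [I E] := key phi sp; split => //; rewrite H// E.
Qed.

Lemma exponent_third s : s `^ (4 / 3 - 1) = cbrt s.
Proof. by rewrite /cbrt; congr (_ `^ _); field. Qed.

Lemma cRe_div (z : R[i]) s : cRe (z / s%:C) = cRe z * s^-1.
Proof. by rewrite -(fmorphV (@real_complex R)) mulrC cRe_scale mulrC. Qed.

Lemma cIm_div (z : R[i]) s : cIm (z / s%:C) = cIm z * s^-1.
Proof. by rewrite -(fmorphV (@real_complex R)) mulrC cIm_scale mulrC. Qed.

Lemma Gamma_neq0 : cbrt 3 * Em 1 != 0 :> R.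
Proof. by rewrite mulf_neq0 ?Em_gt0_neq0// gt_eqF// cbrt_gt0. Qed.

Lemma seminorm_ge m n phi x : schwartz phi -> schwartz_term m n phi x <= schwartz_seminorm m n phi.
Proof.
move=> [_ HS]; apply: ub_le_sup; last by exists x.
by have [M HM] := HS m n; exists M => _ [y _ <-]; exact: HM.
Qed.

Lemma rhs_scale (z : R[i]) : - (1 / 2 ^+ 2) * ((-1) ^+ 4 * z) = (- (4^-1))%:C * z.
Proof.
have -> : 2 ^+ 2 = 4 :> R[i] by rewrite -natrX.
have -> : (-1) ^+ 4 = 1 :> R[i] by rewrite -signr_odd expr0.
by rewrite !mul1r rcN (fmorphV (@real_complex R)) rmorph_nat.
Qed.

Lemma scale_cancel (g p q : R) : g != 0 ->
  (g^-1)%:C * ((- g / 4 * q) +i* (- g / 4 * p)) = (- (4^-1))%:C * (q +i* p).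
Proof. by move=> g0; apply: c_ext; rewrite ?cRe_scale ?cIm_scale /=; field. Qed.

(** Existence, component by component. *)
Lemma kernel_solution (u : R -> (R -> R[i]) -> R[i]) :
  (forall t, 0 < t -> represented_by (u t) (fun x => u43 x t)) -> fractional_rod_solution (4 / 3) u.
Proof.
move=> Hu.
have uE t phi : 0 < t -> schwartz phi -> u t phi = sol (Fre phi) t +i* sol (Fim phi) t.
  by move=> t0; have [h _] := rep_sol (u t) t0; exact: (h (Hu t t0)).
split=> [t t0|phi sp f].
  split=> [a phi psi s1 s2|].
    have a1 := sch_Fre s1; have a2 := sch_Fim s1; have b1 := sch_Fre s2; have b2 := sch_Fim s2.
    rewrite (uE t _ t0 (schwartz_scale_add a s1 s2)) (uE t _ t0 s1) (uE t _ t0 s2) scale_add_cs.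
    have c1 := sch_lin (- cIm a) (sch_lin (cRe a) b1 a1) a2.
    have c2 := sch_lin (cIm a) (sch_lin (cRe a) b2 a2) a1.
    rewrite (Fre_cs c1.1 c2.1) (Fim_cs c1.1 c2.1).
    rewrite (sol_lin _ _ (sch_lin _ b1 a1) a2) (sol_lin _ _ b1 a1).
    rewrite (sol_lin _ _ (sch_lin _ b2 a2) a1) (sol_lin _ _ b2 a2).
    by apply: c_ext; rewrite ?cReD ?cImD ?cReM ?cImM /=; ring.
  set K := 3 / 2 * (2 * \int[mu]_(y in halfline) (`|kerA y| * expR (0 * rt t * y))).
  exists (2 * K), 0%N => phi sp; rewrite !big_ord1.
  set C := schwartz_seminorm _ _ phi.
  have HC x : nc (phi x) <= C.
    by have := seminorm_ge 0 0 x sp; rewrite /schwartz_term expr0 mul1r.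
  have C0 : 0 <= C := le_trans (nc_ge0 _) (HC 0).
  have f1 := sch_Fre sp; have f2 := sch_Fim sp.
  have h1 := sol_le t0 f1.1 (sch_bseq f1) C0 (fun x => le_trans (nc_Re _) (HC x)).
  have h2 := sol_le t0 f2.1 (sch_bseq f2) C0 (fun x => le_trans (nc_Im _) (HC x)).
  rewrite (uE t _ t0 sp); apply: le_trans (nc_le _) _ => /=.
  by move: h1 h2; rewrite -/K; move: (sol _ _) (sol _ _) => p q h1 h2; lra.
have f1 := sch_Fre sp; have f2 := sch_Fim sp.
have B1 := sch_bseq f1; have B2 := sch_bseq f2.
have fE t : 0 < t -> f t = sol (Fre phi) t +i* sol (Fim phi) t by move=> t0; exact: uE.
have D1 := cderive_pos fE (fun t h => sol_der f1.1 B1 h) (fun t h => sol_der f2.1 B2 h).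
have D2 := cderive_pos (fun t h => (D1 t h).2)
  (fun t h => sol1_der f1.1 B1 h) (fun t h => sol1_der f2.1 B2 h).
have E2 t : 0 < t -> cderiven 2 f t = sol2 (Fre phi) t +i* sol2 (Fim phi) t.
  by move=> t0; exact: (D2 t t0).2.
have eR t s : 0 < s -> cRe (caputo_integrand (4 / 3) f t s) = sol2 (Fre phi) s * (cbrt (t - s))^-1.
  by move=> s0; rewrite /caputo_integrand exponent_third cRe_div E2.
have eI t s : 0 < s -> cIm (caputo_integrand (4 / 3) f t s) = sol2 (Fim phi) s * (cbrt (t - s))^-1.
  by move=> s0; rewrite /caputo_integrand exponent_third cIm_div E2.
have pos t s : `]0, t[%classic s -> 0 < s by rewrite /= in_itv/= => /andP[].
split.
- move=> t t0; split; [exact: (D1 t t0).1|exact: (D2 t t0).1|].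
  rewrite /prop_for /continuous_at (E2 t t0).
  have c : ((fun z => sol2 (Fre phi) z +i* sol2 (Fim phi) z) : R -> R[i]^o) z @[z --> t] -->
      (sol2 (Fre phi) t +i* sol2 (Fim phi) t : R[i]^o).
    by apply: ccvg; [exact: (sol2_cont f1.1 B1 t0)|exact: (sol2_cont f2.1 B2 t0)].
  apply: cvg_trans c; apply: near_eq_cvg.
  by apply: filterS (near_pos t0) => y y0; rewrite E2.
- move=> t t0; have [I1 _] := sol_caputo t0 f1; have [I2 _] := sol_caputo t0 f2.
  split; [apply: Lint_eq I1|apply: Lint_eq I2]; rewrite //; try exact: meas_tline.
    by move=> s /pos s0; rewrite eR.
  by move=> s /pos s0; rewrite eI.
- move=> t t0; have [_ I1] := sol_caputo t0 f1; have [_ I2] := sol_caputo t0 f2.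
  have i1 : \int[mu]_(s in `]0, t[) cRe (caputo_integrand (4 / 3) f t s) =
      \int[mu]_(s in `]0, t[) (sol2 (Fre phi) s * (cbrt (t - s))^-1).
    by apply: int_eq => s /pos s0; rewrite eR.
  have i2 : \int[mu]_(s in `]0, t[) cIm (caputo_integrand (4 / 3) f t s) =
      \int[mu]_(s in `]0, t[) (sol2 (Fim phi) s * (cbrt (t - s))^-1).
    by apply: int_eq => s /pos s0; rewrite eI.
  have cE : cintegral `]0, t[ (caputo_integrand (4 / 3) f t) =
      (- (cbrt 3 * Em 1) / 4 * sol (shiftn 4 (Fre phi)) t) +i* (- (cbrt 3 * Em 1) / 4 * sol (shiftn 4 (Fim phi)) t).
    by apply: c_ext; [exact: (etrans i1 I1)|exact: (etrans i2 I2)].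
  have kE : caputo (4 / 3) f t = ((cbrt 3 * Em 1)^-1)%:C * cintegral `]0, t[ (caputo_integrand (4 / 3) f t).
    by rewrite /caputo Gamma_two_thirds.
  rewrite {}kE {}cE /distribution_derive.
  rewrite (uE t _ t0 (schwartz_deriven 4 sp)) Fre_deriven Fim_deriven.
  have g0 := Gamma_neq0.
  have -> : - (1 / 2 ^+ 2) * ((-1) ^+ 4 * (sol (shiftn 4 (Fre phi)) t +i* sol (shiftn 4 (Fim phi)) t))
     = (- (4^-1))%:C * (sol (shiftn 4 (Fre phi)) t +i* sol (shiftn 4 (Fim phi)) t) :> R[i].
    exact: rhs_scale.
  move: (sol _ _) (sol _ _) (cbrt 3 * Em 1) g0 => p q g g0.
  exact: scale_cancel.
- have c : ((fun z => sol (Fre phi) z +i* sol (Fim phi) z) : R -> R[i]^o) z @[z --> 0^'+] -->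
      (Fre phi 0%N 0 +i* Fim phi 0%N 0 : R[i]^o).
    by apply: ccvg; [exact: (sol_init f1)|exact: (sol_init f2)].
  have -> : dirac_distribution phi = Fre phi 0%N 0 +i* Fim phi 0%N 0.
    by rewrite /dirac_distribution /Fre /Fim /=; case: (phi 0).
  apply: cvg_trans c; apply: near_eq_cvg; near=> y.
  have y0 : 0 < y by near: y; exact: nbhs_right_gt.
  by rewrite fE.
- have c : ((fun z => sol1 (Fre phi) z +i* sol1 (Fim phi) z) : R -> R[i]^o) z @[z --> 0^'+] -->
      (0 +i* 0 : R[i]^o).
    by apply: ccvg; [exact: (sol1_init f1)|exact: (sol1_init f2)].
  apply: cvg_trans c; apply: near_eq_cvg; near=> y.
  have y0 : 0 < y by near: y; exact: nbhs_right_gt.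
  by rewrite (D1 y y0).2.
Unshelve. all: by end_near. Qed.

(** The two real components of a complex number, indexed so that the real and
    imaginary parts of a solution are treated at once *)
(** The real part for [true] and the imaginary part for [false], so that the two
    components of a solution are treated at once. *)
Definition part (b : bool) (z : R[i]) : R := if b then cRe z else cIm z.

Lemma partD b z w : part b (z + w) = part b z + part b w.
Proof. by case: b; rewrite /part ?cReD ?cImD. Qed.

Lemma partN b z : part b (- z) = - part b z.
Proof. by case: b; rewrite /part ?cReN ?cImN. Qed.

Lemma partZ b x z : part b (x%:C * z) = x * part b z.
Proof. by case: b; rewrite /part ?cRe_scale ?cIm_scale. Qed.

Lemma part_div b z x : part b (z / x%:C) = part b z * x^-1.
Proof. by case: b; rewrite /part ?cRe_div ?cIm_div. Qed.

Lemma part_le b z : `|part b z| <= nc z.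
Proof. by case: b; [exact: nc_Re|exact: nc_Im]. Qed.

Lemma part_derive b (f : R -> R[i]) t : cderivable f t ->
  is_derive t (1 : R) (fun y => part b (f y)) (part b (cderive f t)).
Proof. by move=> d; have [h k] := cderivable_parts d; case: b. Qed.

Lemma part_int b (D : set R) (f : R -> R[i]) : cintegrable D f ->
  Lint D (fun x => part b (f x)) /\
  \int[mu]_(x in D) part b (f x) = part b (cintegral D f).
Proof. by move=> [h k]; case: b. Qed.

Section Null.
Context {u : R -> (R -> R[i]) -> R[i]} (hu : fractional_rod_solution (4 / 3) u) (b : bool).

Let tst F : R -> R[i] := cs F zseq.
Let W F t : R := part b (u t (tst F)) - b%:R * sol F t.
Let W1 F t : R := part b (cderive (fun s => u s (tst F)) t) - b%:R * sol1 F t.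
Let W2 F t : R := part b (cderiven 2 (fun s => u s (tst F)) t) - b%:R * sol2 F t.

(** Against a real test function the real part of the solution is compared with
    the explicit pairing, and the imaginary part with 0: this is the coefficient
    [b%:R]. *)
Lemma component_null : null_solution W W1 W2.
Proof.
have [ht hp] := hu.
have st F : sch F -> schwartz (tst F) by move=> sF; exact: schwartz_cs sF sch_zseq.
have bR0 : 0 <= b%:R :> R by [].
have bR1 : b%:R <= 1 :> R by case: b.
have pos t s : `]0, t[%classic s -> 0 < s by rewrite /= in_itv/= => /andP[].
have pB z w : part b (z - w) = part b z - part b w by rewrite partD partN.
split.
- move=> c F G t t0 sF sG; have [hl _] := ht t t0.
  have e : tst (fun n x => F n x + c * G n x) = (fun x => c%:C * tst G x + tst F x).
    apply/funext => x; rewrite /tst /cs /zseq; apply: c_ext.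
      by rewrite cReD cRe_scale /= addrC.
    by rewrite cImD cIm_scale /= mulr0 addr0.
  rewrite /W e hl ?partD ?partZ; [|exact: st|exact: st].
  by rewrite (sol_lin _ _ sF sG); ring.
- move=> t t0; have [_ [K [N HK]]] := ht t t0.
  set K1 := 3 / 2 * (2 * \int[mu]_(y in halfline) (`|kerA y| * expR (0 * rt t * y))).
  exists (`|K| * (N.+1 * N.+1)%:R + `|K1|), N => F C sF C0 HF.
  have sT := st F sF.
  have h1 : nc (u t (tst F)) <= `|K| * (N.+1 * N.+1)%:R * C.
    apply: le_trans (HK _ sT) _; rewrite -mulrA.
    have S0 : \sum_(m < N.+1) \sum_(n < N.+1) schwartz_seminorm m n (tst F) <= (N.+1 * N.+1)%:R * C.
      have -> : (N.+1 * N.+1)%:R * C = \sum_(m < N.+1) \sum_(n < N.+1) C :> R.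
        by rewrite !sumr_const !card_ord -mulrnA mulr_natl.
      apply: ler_sum => m _; apply: ler_sum => n _.
      apply: ge_sup; first by exists (schwartz_term m n (tst F) 0), 0.
      move=> _ [x _ <-]; have := HF m n x (ltn_ord m) (ltn_ord n); apply: le_trans.
      rewrite /schwartz_term /tst (cderiven_cs n sF.1 sch_zseq.1).
      have -> : F n x +i* zseq n x = (F n x)%:C by [].
      rewrite nc_real; apply: ler_wpM2r => //.
      by apply: lerXn2r; rewrite ?nnegrE ?addr_ge0// lerDr.
    have P0 : 0 <= \sum_(m < N.+1) \sum_(n < N.+1) schwartz_seminorm m n (tst F).
      apply: sumr_ge0 => m _; apply: sumr_ge0 => n _.
      apply: le_trans (seminorm_ge m n 0 sT); rewrite mulr_ge0 ?exprn_ge0//; exact: nc_ge0.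
    apply: le_trans (ler_wpM2r P0 (ler_norm K)) _; exact: ler_wpM2l.
  have h2 : `|sol F t| <= `|K1| * C.
    have hF x : `|F 0%N x| <= C by have := HF 0%N 0%N x isT isT; rewrite expr0 mul1r.
    apply: le_trans (sol_le t0 sF.1 (sch_bseq sF) C0 hF) _.
    by apply: ler_wpM2r => //; exact: ler_norm.
  apply: le_trans (ler_normB _ _) _; rewrite mulrDl; apply: lerD.
    exact: le_trans (part_le _ _) h1.
  rewrite normrM (ger0_norm bR0); apply: le_trans h2; exact: ler_piMl.
- move=> F t sF t0; have [/(_ t t0)[d _ _] _ _ _ _] := hp _ (st F sF).
  have := is_deriveB (part_derive b d) (is_deriveZ b%:R (sol_der sF.1 (sch_bseq sF) t0)).
  by move/is_derive_to; apply; rewrite /GRing.scale.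
- move=> F t sF t0; have [/(_ t t0)[_ d _] _ _ _ _] := hp _ (st F sF).
  have := is_deriveB (part_derive b d) (is_deriveZ b%:R (sol1_der sF.1 (sch_bseq sF) t0)).
  by move/is_derive_to; apply; rewrite /GRing.scale.
- move=> F t sF t0; have [/(_ t t0)[_ _ c] _ _ _ _] := hp _ (st F sF).
  apply: cvgB; first exact: (part_cvg _ pB (part_le b) c).
  by apply: cvgM; [exact: cvg_cst|exact: (sol2_cont sF.1 (sch_bseq sF) t0)].
- move=> F t sF t0; have [_ /(_ t t0) c _ _ _] := hp _ (st F sF).
  have [I _] := part_int b c; have [J _] := sol_caputo t0 sF; have mT := meas_tline t.
  apply: Lint_eq (LintB mT I (LintZ b%:R mT J)) => // s _.
  by rewrite /caputo_integrand exponent_third part_div /W2 mulrBl mulrA.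
- move=> F t sF t0; have [_ /(_ t t0) c /(_ t t0) e _ _] := hp _ (st F sF).
  have [I E] := part_int b c; have [J E'] := sol_caputo t0 sF; have mT := meas_tline t.
  have K s : W2 F s * (cbrt (t - s))^-1 = part b (caputo_integrand (4 / 3) (fun s => u s (tst F)) t s)
      - b%:R * (sol2 F s * (cbrt (t - s))^-1).
    by rewrite /caputo_integrand exponent_third part_div /W2 mulrBl mulrA.
  rewrite (int_eq (fun s _ => K s)) (intB mT I (LintZ b%:R mT J)) (intZ _ mT J) E E'.
  have g0 := Gamma_neq0.
  have e4 : cderiven 4 (tst F) = tst (shiftn 4 F).
    by apply/funext => x; rewrite /tst (cderiven_cs 4 sF.1 sch_zseq.1).
  have := congr1 (fun z => part b ((cbrt 3 * Em 1)%:C * z)) e.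
  rewrite /caputo Gamma_two_thirds /distribution_derive e4 mulrA -rcM mulfV// -[1%:C]/(1 : R[i]) mul1r => ->.
  have -> : - (1 / 2 ^+ 2) * ((-1) ^+ 4 * u t (tst (shiftn 4 F))) = (- (4^-1))%:C * u t (tst (shiftn 4 F)) :> R[i].
    exact: rhs_scale.
  rewrite !partZ /W; move: (part _ _) (sol _ _) (cbrt 3 * Em 1) (b%:R : R) => p q g c0; ring.
- move=> F sF; have [_ _ _ c _] := hp _ (st F sF).
  have E : part b (dirac_distribution (tst F)) - b%:R * F 0%N 0 = 0.
    by rewrite /dirac_distribution /tst /cs /part; case: b => /=; rewrite ?mul1r ?mul0r subrr.
  suff : W F t @[t --> 0^'+] --> part b (dirac_distribution (tst F)) - b%:R * F 0%N 0 by rewrite E.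
  apply: cvgB; first exact: (part_cvg _ pB (part_le b) c).
  by apply: cvgM; [exact: cvg_cst|exact: sol_init].
- move=> F sF; have [_ _ _ _ c] := hp _ (st F sF).
  have E : part b 0 - b%:R * 0 = 0 :> R by rewrite mulr0 subr0; case: b.
  suff : W1 F t @[t --> 0^'+] --> part b 0 - b%:R * 0 by rewrite E.
  apply: cvgB; first exact: (part_cvg _ pB (part_le b) c).
  by apply: cvgM; [exact: cvg_cst|exact: sol1_init].
Qed.

Lemma component_eq F t : 0 < t -> sch F -> part b (u t (tst F)) = b%:R * sol F t.
Proof.
by move=> t0 sF; apply/eqP; rewrite -subr_eq0; apply/eqP; exact: (null_solution_eq0 component_null).
Qed.

End Null.

(** A real test function has a real pairing, known by uniqueness; a complex one
    is [phi = Re phi + i Im phi]. *)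
Lemma solution_kernel (u : R -> (R -> R[i]) -> R[i]) : fractional_rod_solution (4 / 3) u ->
  forall t, 0 < t -> represented_by (u t) (fun x => u43 x t).
Proof.
move=> hu t t0; have [_ h] := rep_sol (u t) t0; apply: h => phi sp.
have f1 := sch_Fre sp; have f2 := sch_Fim sp; have sz := @sch_zseq R.
have uE F : sch F -> u t (cs F zseq) = (sol F t)%:C.
  move=> sF; apply: c_ext.
    by have := component_eq hu true t0 sF; rewrite /part mul1r.
  by have := component_eq hu false t0 sF; rewrite /part mul0r.
have e : phi = (fun x => (0 +i* 1) * cs (Fim phi) zseq x + cs (Fre phi) zseq x).
  rewrite -[LHS]cs_parts; apply/funext => x; rewrite /cs /zseq.
  by apply: c_ext; rewrite ?cReD ?cImD ?cReM ?cImM /=; ring.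
have [[hl _] _] := (hu.1 t t0, tt).
rewrite {1}e hl; [|exact: schwartz_cs|exact: schwartz_cs].
rewrite !uE//; apply: c_ext; rewrite ?cReD ?cImD ?cReM ?cImM /=; ring.
Qed.

End Assembly.

Theorem theorem3p4 (R : realType) (u : R -> (R -> R[i]) -> R[i]) :
  fractional_rod_solution (4 / 3) u <->
  (forall t : R, 0 < t -> represented_by (u t) (fun x => u43 x t)).
Proof. by split; [exact: solution_kernel|exact: kernel_solution]. Qed.
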